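(* Let $\hat{\mathfrak g}$ be the universal central extension of $\mathfrak g=\mathfrak{psl}(2|2)$ with center $Z$, let $J=M_{1,1}^+$, and let $\chi\in Z^*$ be semisimple atypical. Then $\hat{\mathfrak g}\text{-mod}_1^{\,\chi}$ (and $J\text{-mod}_1^{\,\chi}$) has two blocks, and each of them is equivalent to the category of finite-dimensional nilpotent representations of the quiver $Q$ with two vertices $1,2$, loops $\alpha,\zeta$ at $1$, loops $\gamma,\eta$ at $2$, and arrows $\beta:1\to2$, $\delta:2\to1$, with relations $$\beta\alpha=\gamma\beta,\quad \beta\zeta=\eta\beta,\quad \zeta\delta=\delta\eta,\quad \alpha\delta=\delta\gamma,\quad \alpha\zeta=\zeta\alpha,\quad \gamma\eta=\eta\gamma.$$
   Context: All spaces are over $\mathbb C$; modules are finite-dimensional and $\mathbb Z_2$-graded, morphisms are parity-preserving. $\mathfrak{psl}(2|2)$ is $\mathfrak{sl}(2|2)$ modulo scalar matrices; $E_{ij}$ are matrix units of $\mathfrak{gl}(2|2)$ (indices $1,2$ even, $3,4$ odd). The center $Z$ of $\hat{\mathfrak g}$ is purely even and 3-dimensional, so $\hat{\mathfrak g}_{\bar1}=\mathfrak g_{\bar1}$; a basis of $Z$ is $z_1=[E_{13},E_{24}]$, $z_{-1}=[E_{31},E_{42}]$ and $\mathbf 1=[E_{13},E_{31}]+[E_{24},E_{42}]$ (brackets in $\hat{\mathfrak g}$; in $\mathfrak{sl}(2|2)$, $\mathbf 1$ becomes the identity matrix). Put $D(\chi)=\chi(\mathbf 1)^2-4\chi(z_1)\chi(z_{-1})$,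 which is invariant under the action of $SL(2)$ on $\hat{\mathfrak g}$ by automorphisms. ''Semisimple atypical'' means $D(\chi)=4$, i.e. $\chi$ lies in the $SL(2)$-orbit of the character with $\chi(\mathbf 1)=2$, $\chi(z_{\pm1})=0$. The short $\mathfrak{sl}_2$-subalgebra is spanned by $h=\frac12(E_{11}-E_{22}+E_{33}-E_{44})$ and suitable multiples $e,f$ of $E_{12}+E_{34}$, $E_{21}+E_{43}$ with $[e,f]=h$, $[h,e]=e$, $[h,f]=-f$; it lifts to $\hat{\mathfrak g}$. The $h$-eigenspaces give $\hat{\mathfrak g}=\hat{\mathfrak g}[-1]\oplus\hat{\mathfrak g}[0]\oplus\hat{\mathfrak g}[1]$, and $\mathfrak g[1]$ with product $x\cdot y=[[x,f],y]$ is the Jordan superalgebra $J\cong M_{1,1}^+$ ($\operatorname{End}(\mathbb C^{1|1})$ with product $\frac12(ab+(-1)^{|a||b|}ba)$). $\hat{\mathfrak g}\text{-mod}_1$ is the category of finite-dimensional $\hat{\mathfrak g}$-modules on which $h$ has eigenvalues in $\{-1,0,1\}$; $\hat{\mathfrak g}\text{-mod}_1^{\,\chi}$ is the full subcategory of modules on which $z-\chi(z)$ acts nilpotently for all $z\in Z$. $J\text{-mod}_1$ is the category of finite-dimensional unital Jordan $J$-bimodules (the null split extension $J\oplus M$ is Jordan, the identity acts as the identity); $Jor$ sends $N\in\hat{\mathfrak g}\text{-mod}_1$ to its $h$-eigenspace $N[1]$ with $x\cdot m=[x,f]m$, and $J\text{-mod}_1^{\,\chi}$ is the full subcategory of objects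 in the image of $\hat{\mathfrak g}\text{-mod}_1^{\,\chi}$. A block is an indecomposable direct summand. Nilpotent representations are those on which all sufficiently long paths act by zero; $\beta\alpha$ means ''first $\alpha$, then $\beta$''. *)

(* Defs.v *)
From HB Require Import structures.
From mathcomp Require Import all_boot all_order all_algebra.
From mathcomp Require Import boolp.
From mathcomp Require Import ring.

Set Implicit Arguments.
Unset Strict Implicit.
Unset Printing Implicit Defensive.

Import GRing.Theory.
Local Open Scope ring_scope.

(** The subspace of a module cut out by a linear property; it serves as the
    type of morphisms between two given objects. *)
Record lin_prop (F : fieldType) (V : lmodType F) := LinProp {
  lin_pred :> V -> Prop;
  lin_prop0 : lin_pred 0;
  lin_propP : forall (a : F) u v, lin_pred u -> lin_pred v ->
    lin_pred (a *: u + v) }.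

Section LinSub.
Variables (F : fieldType) (V : lmodType F) (P : lin_prop V).

Definition lin_mem : {pred V} := fun x => `[< P x >].

Fact lin_mem_submod : submod_closed lin_mem.
Proof.
split; first by apply/asboolP/lin_prop0.
by move=> a u v /asboolP Pu /asboolP Pv; apply/asboolP/lin_propP.
Qed.

HB.instance Definition _ := GRing.isSubmodClosed.Build F V lin_mem lin_mem_submod.

Record lin_sub := LinSub { lin_val :> V; _ : lin_val \in lin_mem }.

HB.instance Definition _ := [isSub for lin_val].
HB.instance Definition _ := [Choice of lin_sub by <:].
HB.instance Definition _ := [SubChoice_isSubLmodule of lin_sub by <:].

Lemma lin_subP (x : lin_sub) : P x.
Proof. by case: x => x /= /asboolP. Qed.

Definition lin_in x (Px : P x) : lin_sub := LinSub (introT (asboolP _) Px).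

End LinSub.

Record lincat (F : fieldType) := LinCat {
  ob :> Type;
  hom : ob -> ob -> lmodType F;
  idm : forall X, hom X X;
  cmp : forall X Y Z, hom Y Z -> hom X Y -> hom X Z;
  cmp1l : forall X Y (f : hom X Y), cmp (idm Y) f = f;
  cmp1r : forall X Y (f : hom X Y), cmp f (idm X) = f;
  cmpA : forall X Y Z T (h : hom Z T) (g : hom Y Z) (f : hom X Y),
    cmp h (cmp g f) = cmp (cmp h g) f;
  cmpPl : forall X Y Z a (g g' : hom Y Z) (f : hom X Y),
    cmp (a *: g + g') f = a *: cmp g f + cmp g' f;
  cmpPr : forall X Y Z a (g : hom Y Z) (f f' : hom X Y),
    cmp g (a *: f + f') = a *: cmp g f + cmp g f' }.

Arguments hom {F} _ _ _.
Arguments idm {F _} _.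
Arguments cmp {F _ _ _ _} _ _.

Section Categories.
Variable F : fieldType.
Implicit Types A B : lincat F.

Definition full A (P : A -> Prop) : lincat F :=
  @LinCat F {X : A | P X} (fun X Y => hom A (sval X) (sval Y))
    (fun X => idm (sval X)) (fun X Y Z => @cmp F A (sval X) (sval Y) (sval Z))
    (fun X Y => @cmp1l F A (sval X) (sval Y))
    (fun X Y => @cmp1r F A (sval X) (sval Y))
    (fun X Y Z T => @cmpA F A (sval X) (sval Y) (sval Z) (sval T))
    (fun X Y Z => @cmpPl F A (sval X) (sval Y) (sval Z))
    (fun X Y Z => @cmpPr F A (sval X) (sval Y) (sval Z)).

Definition isomorphic A (X Y : A) : Prop :=
  exists (f : hom A X Y) (g : hom A Y X), cmp g f = idm X /\ cmp f g = idm Y.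

Record functor A B := Functor {
  fob :> A -> B;
  fhom : forall X Y, {linear hom A X Y -> hom B (fob X) (fob Y)};
  fhom1 : forall X, fhom X X (idm X) = idm (fob X);
  fhomM : forall X Y Z (g : hom A Y Z) (f : hom A X Y),
    fhom X Z (cmp g f) = cmp (fhom Y Z g) (fhom X Y f) }.

Definition equivalent A B : Prop :=
  exists (S : functor A B) (T : functor B A),
    (exists u : forall X, hom A X (T (S X)),
      (forall X, exists v, cmp v (u X) = idm X /\ cmp (u X) v = idm _) /\
      (forall X Y (f : hom A X Y),
        cmp (u Y) f = cmp (fhom T _ _ (fhom S _ _ f)) (u X))) /\
    (exists u : forall X, hom B X (S (T X)),
      (forall X, exists v, cmp v (u X) = idm X /\ cmp (u X) v = idm _) /\
      (forall X Y (f : hom B X Y),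
        cmp (u Y) f = cmp (fhom S _ _ (fhom T _ _ f)) (u X))).

Definition direct_sum A (I : finType) (Y : I -> A) (X : A) : Prop :=
  exists (inj : forall i, hom A (Y i) X) (prj : forall i, hom A X (Y i)),
    [/\ forall i, cmp (prj i) (inj i) = idm (Y i),
        forall i j, i != j -> cmp (prj j) (inj i) = 0
      & \sum_i cmp (inj i) (prj i) = idm X].

Definition decomposition A (I : finType) (P : I -> A -> Prop) : Prop :=
  [/\ forall i X Y, isomorphic X Y -> P i X -> P i Y,
      forall i j X Y, i != j -> P i X -> P j Y -> forall f : hom A X Y, f = 0
    & forall X, exists Y : I -> A, (forall i, P i (Y i)) /\ direct_sum Y X].

Definition is_zero_ob A (X : A) : Prop := idm X = 0.

Definition indecomposable A : Prop :=
  (exists X : A, ~ is_zero_ob X) /\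
  (forall P : bool -> A -> Prop, decomposition P ->
    exists b, forall X, P b X -> is_zero_ob X).

Definition blocks A (I : finType) (P : I -> A -> Prop) : Prop :=
  decomposition P /\ forall i, indecomposable (full (P i)).

End Categories.

(** [part V false] is the even part and [part V true] the odd part. *)
Record superspace (F : fieldType) := SuperSpace {
  svect :> vectType F;
  part : bool -> {vspace svect};
  part_sum : (part false + part true = fullv)%VS;
  part_cap : (part false :&: part true = 0)%VS }.

Section Super.
Variable F : fieldType.

Definition scomp (V : superspace F) (p : bool) (v : V) : V :=
  daddv_pi (part V p) (part V (~~ p)) v.

(** The Koszul sign. *)
Definition ksign (p q : bool) : F := (-1) ^+ (p && q).

Definition even_map (V W : superspace F) (f : 'Hom(V, W)) : Prop :=
  forall q v, v \in part V q -> f v \in part W q.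

Lemma part_cap_compl (V : superspace F) p :
  (part V p :&: part V (~~ p) = 0)%VS.
Proof. by case: p; [rewrite capvC|]; exact: part_cap. Qed.

Lemma part_sum_compl (V : superspace F) p :
  (part V p + part V (~~ p) = fullv)%VS.
Proof. by case: p; [rewrite addvC|]; exact: part_sum. Qed.

Lemma scomp_linear (V : superspace F) p : linear (@scomp V p).
Proof. by move=> a u v; rewrite /scomp linearP. Qed.

Lemma scomp_part (V : superspace F) p (v : V) : scomp p v \in part V p.
Proof. exact: memv_pi. Qed.

Lemma scomp_id (V : superspace F) p (v : V) : v \in part V p -> scomp p v = v.
Proof. by move=> vp; rewrite /scomp daddv_pi_id ?part_cap_compl. Qed.

Lemma scomp_other (V : superspace F) p (v : V) :
  v \in part V (~~ p) -> scomp p v = 0.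
Proof.
move=> vp; have := daddv_pi_add (part_cap_compl V p).
move=> /(_ v); rewrite part_sum_compl memvf => /(_ isT).
rewrite [X in _ + X]daddv_pi_id //; last first.
  by rewrite capvC part_cap_compl.
by move/(canRL (addrK _)); rewrite subrr.
Qed.

Lemma scomp_sum (V : superspace F) (v : V) :
  scomp false v + scomp true v = v.
Proof.
by apply: (daddv_pi_add (part_cap_compl V false)); rewrite part_sum_compl memvf.
Qed.

End Super.

Record lieSuper (F : fieldType) := LieSuper {
  lie_sp :> superspace F;
  br : 'Hom(lie_sp, 'End(lie_sp));
  br_part : forall p q x y, x \in part lie_sp p -> y \in part lie_sp q ->
    br x y \in part lie_sp (p (+) q);
  br_anti : forall p q x y, x \in part lie_sp p -> y \in part lie_sp q ->
    br x y = - (ksign F p q *: br y x);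
  br_jacobi : forall p q x y z, x \in part lie_sp p -> y \in part lie_sp q ->
    br x (br y z) = br (br x y) z + ksign F p q *: br y (br x z) }.

Arguments br {F} _.

Section Lie.
Variable F : fieldType.
Implicit Types K L E : lieSuper F.

Definition center L : {vspace L} := lker (br L).

Definition lie_morphism K L (f : 'Hom(K, L)) : Prop :=
  even_map f /\ forall x y, f (br K x y) = br L (f x) (f y).

Definition central_extension E L (p : 'Hom(E, L)) : Prop :=
  [/\ lie_morphism p, limg p = fullv & (lker p <= center E)%VS].

Definition universal_central_extension E L (p : 'Hom(E, L)) : Prop :=
  central_extension p /\
  forall E' (p' : 'Hom(E', L)), central_extension p' ->
    exists! f : 'Hom(E, E'), lie_morphism f /\ (p' \o f)%VF = p.

End Lie.

Section SuperMatrices.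
Variables (F : fieldType) (n : nat) (d : 'I_n -> bool).
Local Notation M := 'M[F]_n.

(** The index [i] of a row or column has parity [d i]. *)
Definition mx_comp (p : bool) (A : M) : M :=
  \matrix_(i, j) if d i (+) d j == p then A i j else 0.

Fact mx_comp_linear p : linear (mx_comp p).
Proof.
by move=> a A B; apply/matrixP=> i j; rewrite !mxE; case: ifP; rewrite ?mulr0 ?addr0.
Qed.
HB.instance Definition _ p :=
  GRing.isLinear.Build F M M *:%R (mx_comp p) (mx_comp_linear p).

Definition mx_part (p : bool) : {vspace M} := lker (linfun (mx_comp (~~ p))).

Lemma mx_partP p (A : M) :
  reflect (forall i j, d i (+) d j != p -> A i j = 0) (A \in mx_part p).
Proof.
rewrite memv_ker lfunE /=; apply: (iffP eqP) => [/matrixP A0 i j dp|A0].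
  have:= A0 i j; rewrite !mxE; case: ifP => // /negP[].
  by move: dp; case: (_ (+) _); case: (p).
apply/matrixP=> i j; rewrite !mxE; case: ifP => // /eqP dp; apply: A0.
by rewrite dp; case: (p).
Qed.

Fact mx_part_sum : (mx_part false + mx_part true = fullv)%VS.
Proof.
apply/eqP; rewrite eqEsubv subvf /=; apply/subvP=> A _; apply/memv_addP.
exists (mx_comp false A); last exists (mx_comp true A).
- by apply/mx_partP=> i j /negbTE dp; rewrite mxE dp.
- by apply/mx_partP=> i j /negbTE dp; rewrite mxE dp.
by apply/matrixP=> i j; rewrite !mxE; case: (_ (+) _); rewrite /= ?addr0 ?add0r.
Qed.

Fact mx_part_cap : (mx_part false :&: mx_part true = 0)%VS.
Proof.
apply/eqP; rewrite -subv0; apply/subvP=> A; rewrite memv_cap memv0.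
case/andP=> /mx_partP A0 /mx_partP A1; apply/eqP/matrixP=> i j; rewrite mxE.
by case dij: (d i (+) d j); [apply: A0 | apply: A1]; rewrite dij.
Qed.

Definition mx_super : superspace F := SuperSpace mx_part_sum mx_part_cap.

(** [\sum_(p, q) (-1)^(p q) B_q A_p], the product in the opposite order with
    the Koszul sign. *)
Definition mx_opp_mul (A B : M) : M :=
  \sum_(p : bool) \sum_(q : bool)
    ksign F p q *: (mx_comp q B *m mx_comp p A).

Definition mx_bracket (A B : M) : M := A *m B - mx_opp_mul A B.

Definition mx_jordan (A B : M) : M := 2^-1 *: (A *m B + mx_opp_mul A B).

Definition supertrace (A : M) : F^o := \sum_i (-1) ^+ d i * A i i.

Fact supertrace_linear : linear supertrace.
Proof.
move=> a A B; rewrite /supertrace scaler_sumr -big_split /=.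
by apply: eq_bigr => i _; rewrite !mxE mulrDr mulrCA.
Qed.
HB.instance Definition _ :=
  GRing.isLinear.Build F M F^o *:%R supertrace supertrace_linear.

Definition sl_vs : {vspace M} := lker (linfun supertrace).

Lemma sl_vsE A : (A \in sl_vs) = (supertrace A == 0).
Proof. by rewrite memv_ker lfunE. Qed.

Lemma mx_comp_id p A : A \in mx_part p -> mx_comp p A = A.
Proof.
move/mx_partP=> A0; apply/matrixP=> i j; rewrite mxE.
by case: ifP => // /negbT /A0.
Qed.

Lemma mx_comp_other p A : A \in mx_part p -> mx_comp (~~ p) A = 0.
Proof. by rewrite memv_ker lfunE => /eqP. Qed.

Lemma mx_opp_mulE p q A B : A \in mx_part p -> B \in mx_part q ->
  mx_opp_mul A B = ksign F p q *: (B *m A).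
Proof.
move=> Ap Bq; rewrite /mx_opp_mul (bigD1 p) //= [X in _ + X]big1 => [|p' np].
  rewrite (bigD1 q) //= big1 => [|q' nq]; first by rewrite !mx_comp_id ?addr0.
  have ->: q' = ~~ q by case: (q') (q) nq => [] [].
  by rewrite (mx_comp_other Bq) mul0mx scaler0.
have ->: p' = ~~ p by case: (p') (p) np => [] [].
by rewrite big1 // => q' _; rewrite (mx_comp_other Ap) mulmx0 scaler0.
Qed.

Lemma mx_bracketE p q A B : A \in mx_part p -> B \in mx_part q ->
  mx_bracket A B = A *m B - ksign F p q *: (B *m A).
Proof. by move=> Ap Bq; rewrite /mx_bracket (mx_opp_mulE Ap Bq). Qed.

Lemma mx_opp_mulPl B : linear (mx_opp_mul^~ B).
Proof.
move=> a A A'; rewrite /mx_opp_mul scaler_sumr -big_split; apply: eq_bigr => p _.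
rewrite scaler_sumr -big_split; apply: eq_bigr => q _ /=.
by rewrite linearP /= mulmxDr -scalemxAr scalerDr !scalerA mulrC.
Qed.

Lemma mx_opp_mulPr A : linear (mx_opp_mul A).
Proof.
move=> a B B'; rewrite /mx_opp_mul scaler_sumr -big_split; apply: eq_bigr => p _.
rewrite scaler_sumr -big_split; apply: eq_bigr => q _ /=.
by rewrite linearP /= mulmxDl -scalemxAl scalerDr !scalerA mulrC.
Qed.

Lemma mx_bracketPl B : linear (mx_bracket^~ B).
Proof.
move=> a A A'; rewrite /mx_bracket mulmxDl -scalemxAl mx_opp_mulPl.
by rewrite scalerBr opprD addrACA.
Qed.

Lemma mx_bracketPr A : linear (mx_bracket A).
Proof.
move=> a B B'; rewrite /mx_bracket mulmxDr -scalemxAr mx_opp_mulPr.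
by rewrite scalerBr opprD addrACA.
Qed.

Lemma mulmx_part p q A B : A \in mx_part p -> B \in mx_part q ->
  A *m B \in mx_part (p (+) q).
Proof.
move=> /mx_partP Ap /mx_partP Bq; apply/mx_partP=> i j dij.
rewrite mxE big1 // => k _; case: (eqVneq (d i (+) d k) p) => [dik|/Ap->].
  rewrite Bq ?mulr0 //; apply: contraNneq dij => <-; rewrite -dik.
  by rewrite -addbA addKb.
by rewrite mul0r.
Qed.

Lemma mx_bracket_part p q A B : A \in mx_part p -> B \in mx_part q ->
  mx_bracket A B \in mx_part (p (+) q).
Proof.
move=> Ap Bq; rewrite (mx_bracketE Ap Bq) rpredB ?mulmx_part //.
by rewrite rpredZ // addbC mulmx_part.
Qed.

Lemma mx_bracket_anti p q A B : A \in mx_part p -> B \in mx_part q ->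
  mx_bracket A B = - (ksign F p q *: mx_bracket B A).
Proof.
move=> Ap Bq; rewrite (mx_bracketE Ap Bq) (mx_bracketE Bq Ap) scalerBr opprB.
by rewrite scalerA /ksign andbC -signr_addb addbb scale1r addrC.
Qed.

Lemma mx_comp_part p A : mx_comp p A \in mx_part p.
Proof. by apply/mx_partP=> i j /negbTE dp; rewrite mxE dp. Qed.

Lemma mx_comp_sum A : mx_comp false A + mx_comp true A = A.
Proof.
by apply/matrixP=> i j; rewrite !mxE; case: (_ (+) _); rewrite /= ?addr0 ?add0r.
Qed.

Lemma mx_bracket_jacobi p q A B D : A \in mx_part p -> B \in mx_part q ->
  mx_bracket A (mx_bracket B D) =
  mx_bracket (mx_bracket A B) D + ksign F p q *: mx_bracket B (mx_bracket A D).
Proof.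
move=> Ap Bq.
have addr' X : {morph mx_bracket X : x y / x + y}.
  by move=> x y; have:= mx_bracketPr X 1 x y; rewrite !scale1r.
suff jac r G : G \in mx_part r -> mx_bracket A (mx_bracket B G) =
    mx_bracket (mx_bracket A B) G + ksign F p q *: mx_bracket B (mx_bracket A G).
  rewrite -[D]mx_comp_sum; set X := mx_comp false D; set Y := mx_comp true D.
  rewrite (addr' B X Y) (addr' A X Y) (addr' (mx_bracket A B) X Y).
  rewrite (addr' A (mx_bracket B X)) (addr' B (mx_bracket A X)).
  by rewrite scalerDr [RHS]addrACA (jac false X) ?(jac true Y) ?mx_comp_part.
move=> Gr.
rewrite (mx_bracketE Ap (mx_bracket_part Bq Gr)) (mx_bracketE Bq Gr).
rewrite (mx_bracketE (mx_bracket_part Ap Bq) Gr) (mx_bracketE Ap Bq).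
rewrite (mx_bracketE Bq (mx_bracket_part Ap Gr)) (mx_bracketE Ap Gr).
rewrite !(mulmxBl, mulmxBr, =^~ scalemxAl, =^~ scalemxAr) !mulmxA.
apply/matrixP=> i j; rewrite !mxE /ksign.
by case: (p) (q) (r) => [] [] [] /=; ring.
Qed.

Lemma supertrace_odd A : A \in mx_part true -> supertrace A = 0.
Proof.
move/mx_partP=> A0; rewrite /supertrace big1 // => i _.
by rewrite A0 ?mulr0 // addbb.
Qed.

Lemma supertrace_opp p q A B : A \in mx_part p -> B \in mx_part q ->
  supertrace (A *m B) = ksign F p q * supertrace (B *m A).
Proof.
move=> Ap Bq; case: (boolP (p (+) q)) => pq.
  rewrite !supertrace_odd ?mulr0 //.
    by rewrite -pq addbC mulmx_part.
  by rewrite -pq mulmx_part.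
have qp : q = p by case: (p) (q) pq => [] [].
subst q; rewrite /supertrace mulr_sumr.
under eq_bigr => i _ do rewrite mxE mulr_sumr.
under [RHS]eq_bigr => i _ do rewrite mxE !mulr_sumr.
rewrite exchange_big /=; apply: eq_bigr => i _; apply: eq_bigr => j _.
case: (eqVneq (d j (+) d i) p) => [dp|dp]; last first.
  by rewrite (mx_partP _ _ Ap) // !(mul0r, mulr0).
rewrite [B i j * _]mulrC [RHS]mulrA; congr (_ * _).
by rewrite /ksign -signr_addb -dp; case: (d i); case: (d j).
Qed.

Lemma mx_bracket_sl A B : mx_bracket A B \in sl_vs.
Proof.
have addr' X : {morph mx_bracket X : x y / x + y}.
  by move=> x y; have:= mx_bracketPr X 1 x y; rewrite !scale1r.
have addl' X x y : mx_bracket (x + y) X = mx_bracket x X + mx_bracket y X.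
  by have:= mx_bracketPl X 1 x y; rewrite !scale1r.
suff bsl p q : mx_bracket (mx_comp p A) (mx_comp q B) \in sl_vs.
  rewrite -[A]mx_comp_sum -[B]mx_comp_sum.
  rewrite (addr' _ (mx_comp false B) (mx_comp true B)) rpredD //.
    by rewrite (addl' _ (mx_comp false A) (mx_comp true A)) rpredD.
  by rewrite (addl' _ (mx_comp false A) (mx_comp true A)) rpredD.
rewrite sl_vsE (mx_bracketE (mx_comp_part p A) (mx_comp_part q B)).
rewrite linearB /= linearZ /=.
by rewrite (supertrace_opp (mx_comp_part p A) (mx_comp_part q B)) subrr.
Qed.

Lemma mx_comp_sl p A : A \in sl_vs -> mx_comp p A \in sl_vs.
Proof.
rewrite !sl_vsE -{1}[A]mx_comp_sum linearD /=.
rewrite (supertrace_odd (mx_comp_part true A)) addr0.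
by case: p => // _; rewrite (supertrace_odd (mx_comp_part true A)).
Qed.

Local Notation S := (subvs_of sl_vs).

Definition sl_part p : {vspace S} := (linfun vsval @^-1: mx_part p)%VS.

Lemma sl_partE p (x : S) : (x \in sl_part p) = (vsval x \in mx_part p).
Proof. by rewrite -memv_preim lfunE. Qed.

Fact sl_part_sum : (sl_part false + sl_part true = fullv)%VS.
Proof.
apply/eqP; rewrite eqEsubv subvf /=; apply/subvP=> A _; apply/memv_addP.
exists (vsproj sl_vs (mx_comp false (vsval A))).
  by rewrite sl_partE vsprojK ?mx_comp_part ?mx_comp_sl ?subvsP.
exists (vsproj sl_vs (mx_comp true (vsval A))).
  by rewrite sl_partE vsprojK ?mx_comp_part ?mx_comp_sl ?subvsP.
by rewrite -linearD /= mx_comp_sum vsvalK.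
Qed.

Fact sl_part_cap : (sl_part false :&: sl_part true = 0)%VS.
Proof.
apply/eqP; rewrite -subv0; apply/subvP=> A; rewrite memv_cap memv0 !sl_partE.
rewrite -memv_cap mx_part_cap memv0 => /eqP A0; apply/eqP.
by apply: subvs_inj; rewrite A0.
Qed.

Definition sl_super : superspace F := SuperSpace sl_part_sum sl_part_cap.

Definition sl_ad (A : S) : 'End(S) :=
  linfun (fun B : S => vsproj sl_vs (mx_bracket (vsval A) (vsval B))).

Definition sl_br : 'Hom(S, 'End(S)) := linfun sl_ad.

Lemma sl_adE A B :
  sl_ad A B = vsproj sl_vs (mx_bracket (vsval A) (vsval B)).
Proof.
pose f (B : S) := vsproj sl_vs (mx_bracket (vsval A) (vsval B)).
have fl : linear f by move=> a x y; rewrite /f linearP /= mx_bracketPr linearP.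
pose L : {linear S -> S} :=
  HB.pack f (GRing.isLinear.Build F S S *:%R f fl).
exact: (lfunE L B).
Qed.

Lemma sl_brE A B :
  sl_br A B = vsproj sl_vs (mx_bracket (vsval A) (vsval B)).
Proof.
have fl : linear sl_ad.
  move=> a x y; apply/lfunP=> z; rewrite add_lfunE scale_lfunE !sl_adE.
  by rewrite linearP /= mx_bracketPl linearP.
pose L : {linear S -> 'End(S)} :=
  HB.pack sl_ad (GRing.isLinear.Build F S 'End(S) *:%R sl_ad fl).
by rewrite -sl_adE; congr (fun_of_lfun _ B); exact: (lfunE L A).
Qed.

Lemma sl_brK A B : vsval (sl_br A B) = mx_bracket (vsval A) (vsval B).
Proof. by rewrite sl_brE vsprojK ?mx_bracket_sl. Qed.

Fact sl_br_part p q x y : x \in sl_part p -> y \in sl_part q ->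
  sl_br x y \in sl_part (p (+) q).
Proof. by rewrite !sl_partE sl_brK; apply: mx_bracket_part. Qed.

Fact sl_br_anti p q x y : x \in sl_part p -> y \in sl_part q ->
  sl_br x y = - (ksign F p q *: sl_br y x).
Proof.
rewrite !sl_partE => xp yq; apply: subvs_inj.
by rewrite linearN linearZ /= !sl_brK scalerN; apply: mx_bracket_anti.
Qed.

Fact sl_br_jacobi p q x y z : x \in sl_part p -> y \in sl_part q ->
  sl_br x (sl_br y z) = sl_br (sl_br x y) z + ksign F p q *: sl_br y (sl_br x z).
Proof.
rewrite !sl_partE => xp yq; apply: subvs_inj.
by rewrite linearD linearZ /= !sl_brK; apply: mx_bracket_jacobi.
Qed.

Definition sl_lie : lieSuper F :=
  @LieSuper F sl_super sl_br sl_br_part sl_br_anti sl_br_jacobi.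

End SuperMatrices.

(** A superspace with a linear family of operators indexed by [A]. Both modules
    over a Lie superalgebra and bimodules over a Jordan superalgebra are of this
    kind, with the same notion of morphism. *)
Record act_space (F : fieldType) (A : vectType F) := ActSpace {
  act_sp :> superspace F;
  act : 'Hom(A, 'End(act_sp)) }.

Section Actions.
Variables (F : fieldType) (A : vectType F).
Implicit Types M N P Q : act_space A.

Definition act_morphism M N (f : 'Hom(M, N)) : Prop :=
  even_map f /\ forall a m, f (act M a m) = act N a (f m).

Fact act_morphism0 M N : @act_morphism M N 0.
Proof.
split=> [q v _|a m]; first by rewrite zero_lfunE mem0v.
by rewrite !zero_lfunE linear0.
Qed.

Fact act_morphismP M N (a : F) (f g : 'Hom(M, N)) :
  act_morphism f -> act_morphism g -> act_morphism (a *: f + g).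
Proof.
move=> [f0 fM] [g0 gM]; split=> [q v vq|b m].
  by rewrite add_lfunE scale_lfunE rpredD ?rpredZ ?f0 ?g0.
by rewrite !add_lfunE !scale_lfunE fM gM linearP.
Qed.

Fact act_morphism_id M : act_morphism (\1%VF : 'Hom(M, M)).
Proof. by split=> [q v|b m]; rewrite !id_lfunE. Qed.

Fact act_morphism_comp M N P (g : 'Hom(N, P)) (f : 'Hom(M, N)) :
  act_morphism g -> act_morphism f -> act_morphism (g \o f)%VF.
Proof.
move=> [g0 gM] [f0 fM]; split=> [q v vq|b m]; rewrite !comp_lfunE.
  by rewrite g0 ?f0.
by rewrite fM gM.
Qed.

Definition act_hom M N : lin_prop 'Hom(M, N) :=
  LinProp (act_morphism0 M N) (@act_morphismP M N).

Definition act_cmp M N P (g : lin_sub (act_hom N P)) (f : lin_sub (act_hom M N)) :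
    lin_sub (act_hom M P) :=
  @lin_in F _ (act_hom M P) (lin_val g \o lin_val f)%VF
    (act_morphism_comp (lin_subP g) (lin_subP f)).

Definition act_cat : lincat F.
Proof.
refine (@LinCat F (act_space A) (fun M N => lin_sub (act_hom M N))
  (fun M => @lin_in F _ (act_hom M M) \1%VF (act_morphism_id M)) act_cmp _ _ _ _ _).
- by move=> M N f; apply: val_inj; apply: comp_lfun1l.
- by move=> M N f; apply: val_inj; apply: comp_lfun1r.
- by move=> M N P Q h g f; apply: val_inj; apply: comp_lfunA.
- move=> M N P a g g' f; apply: val_inj => /=.
  by rewrite comp_lfunDl comp_lfunZl.
- move=> M N P a g f f'; apply: val_inj => /=.
  by rewrite comp_lfunDr comp_lfunZr.
Defined.

End Actions.

Definition lie_module (F : fieldType) (L : lieSuper F) (M : act_space L) : Prop :=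
  [/\ forall p q x m, x \in part L p -> m \in part M q ->
        act M x m \in part M (p (+) q)
    & forall p q x y m, x \in part L p -> y \in part L q ->
        act M (br L x y) m =
        act M x (act M y m) - ksign F p q *: act M y (act M x m)].

Section Jordan.
Variable F : fieldType.

Definition jordan_superalgebra (V : lmodType F) (par : bool -> V -> Prop)
    (mul : V -> V -> V) : Prop :=
  [/\ forall p q x y, par p x -> par q y -> par (p (+) q) (mul x y),
      forall p q x y, par p x -> par q y -> mul x y = ksign F p q *: mul y x
    & forall p q r s x y z t, par p x -> par q y -> par r z -> par s t ->
      mul (mul x y) (mul z t)
        + ksign F q r *: mul (mul x z) (mul y t)
        + ksign F (q (+) r) s *: mul (mul x t) (mul y z)
      = mul (mul (mul x y) z) t
        + (ksign F q r * ksign F q s * ksign F r s) *: mul (mul (mul x t) z) y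
        + (ksign F p (q (+) r (+) s) * ksign F r s) *:
            mul (mul (mul y t) z) x].

Definition par11 (i : 'I_2) : bool := i == 1 :> nat.

(** The underlying superspace of [M_{1,1}^+]; the product is [mx_jordan]. *)
Definition M11 : superspace F := mx_super F par11.

Variable M : act_space M11.

Definition split_par (p : bool) (x : M11 * M) : Prop :=
  x.1 \in part M11 p /\ x.2 \in part M p.

(** By supercommutativity of the null split extension the right action on a
    bimodule is [m b = (-1)^(|m||b|) b m], so a bimodule is given by its left
    action alone. *)
Definition split_mul (x y : M11 * M) : M11 * M :=
  (mx_jordan par11 x.1 y.1,
   act M x.1 y.2
   + \sum_(p : bool) \sum_(q : bool)
       ksign F p q *: act M (scomp p y.1) (scomp q x.2)).

Definition unital_jordan_bimodule : Prop :=
  jordan_superalgebra split_par split_mul /\ forall m, act M 1%:M m = m.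

End Jordan.

Section Psl.
Variable F : fieldType.

Definition par22 (i : 'I_4) : bool := (2 <= i)%N.

Definition sl22 : lieSuper F := sl_lie F par22.

(** [p : sl(2|2) -> g] exhibits [g] as the quotient of sl(2|2) by the scalar
    matrices. *)
Definition is_psl22 (g : lieSuper F) (p : 'Hom(sl22, g)) : Prop :=
  [/\ lie_morphism p, limg p = fullv
    & forall A : sl22, p A = 0 <-> exists c : F, vsval A = c%:M].

(** Matrix units with indices from 1 to 4, for [i != j]. *)
Definition E (i j : nat) : sl22 :=
  vsproj (sl_vs F par22) (delta_mx (inord i.-1) (inord j.-1)).

Definition short_e : sl22 := E 1 2 + E 3 4.
Definition short_f : sl22 := 2^-1 *: (E 2 1 + E 4 3).

(** The identification of [M_{1,1}^+] with the degree 1 part of psl(2|2): the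
    rows 1, 3 and the columns 2, 4. With the above normalisation of [short_f]
    it carries [mx_jordan] to the product [[x, f], y], and 1 to [short_e]. *)
Definition M11_emb (a : M11 F) : sl22 :=
  (a : 'M_2) 0 0 *: E 1 2 + (a : 'M_2) 0 1 *: E 1 4
  + (a : 'M_2) 1 0 *: E 3 2 + (a : 'M_2) 1 1 *: E 3 4.

Variables (g : lieSuper F) (p : 'Hom(sl22, g)).
Variables (gh : lieSuper F) (pi : 'Hom(gh, g)).

(** Some lift of an element of psl(2|2) to the extension [gh]; it is only used
    inside brackets, where its choice does not matter as [lker pi] is central. *)
Definition lift (A : sl22) : gh := (pi^-1)%VF (p A).

Definition br_lift (A B : sl22) : gh := br gh (lift A) (lift B).

Definition z_pos : gh := br_lift (E 1 3) (E 2 4).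
Definition z_neg : gh := br_lift (E 3 1) (E 4 2).
Definition z_one : gh := br_lift (E 1 3) (E 3 1) + br_lift (E 2 4) (E 4 2).

Definition short_h : gh := br_lift short_e short_f.

Local Notation Z := (center gh).
Variable chi : {scalar subvs_of Z}.

Definition discr : F :=
  chi (vsproj Z z_one) ^+ 2 - 4 * chi (vsproj Z z_pos) * chi (vsproj Z z_neg).

Definition semisimple_atypical : Prop := discr = 4.

Definition module1 (N : act_space gh) : Prop :=
  lie_module N /\
  forall c, passmx.leigenvalue (act N short_h) c -> c \in [:: -1; 0; 1].

Definition module1_chi (N : act_space gh) : Prop :=
  module1 N /\
  forall z : subvs_of Z, exists n, forall m : N,
    iter n (fun v => act N (vsval z) v - chi z *: v) m = 0.

(** [M] is isomorphic to [Jor(N)], the eigenspace [N[1]] of [short_h] on which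
    [a] acts as the bracket of [M11_emb a] and [short_f]. *)
Definition is_Jor (N : act_space gh) (M : act_space (M11 F)) : Prop :=
  exists phi : 'Hom(M, N),
    [/\ even_map phi, lker phi = 0%VS,
        limg phi = passmx.leigenspace (act N short_h) 1
      & forall a m,
          phi (act M a m) = act N (br_lift (M11_emb a) short_f) (phi m)].

(** J-mod_1^chi is closed under isomorphism: the essential image of gh-mod_1^chi under [Jor]. *)
Definition jordan1_chi (M : act_space (M11 F)) : Prop :=
  unital_jordan_bimodule M /\ exists N, module1_chi N /\ is_Jor N M.

Definition lie_mod1_chi : lincat F := full (A := act_cat gh) module1_chi.
Definition jordan_mod1_chi : lincat F := full (A := act_cat (M11 F)) jordan1_chi.

End Psl.

Inductive Qvert := v1 | v2.
Inductive Qarr := alpha | zeta | beta | gamma | eta | delta.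

Definition Qsrc (a : Qarr) : Qvert :=
  match a with alpha | zeta | beta => v1 | gamma | eta | delta => v2 end.
Definition Qtgt (a : Qarr) : Qvert :=
  match a with alpha | zeta | delta => v1 | gamma | eta | beta => v2 end.

Inductive Qpath (i : Qvert) : Qvert -> Type :=
| Qnil : Qpath i i
| Qcons (a : Qarr) : Qpath i (Qsrc a) -> Qpath i (Qtgt a).

Fixpoint Qlength i j (p : Qpath i j) : nat :=
  match p with Qnil => 0%N | Qcons a p => (Qlength p).+1 end.

Section Quiver.
Variable F : fieldType.

Record Qrep := QRep {
  Qsp :> Qvert -> vectType F;
  Qact : forall a, 'Hom(Qsp (Qsrc a), Qsp (Qtgt a)) }.

Implicit Types M N P R : Qrep.

Fixpoint Qpath_act M i j (p : Qpath i j) : 'Hom(M i, M j) :=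
  match p with
  | Qnil => \1%VF
  | Qcons a p => (Qact M a \o Qpath_act M p)%VF
  end.

Definition Qrelations M : Prop :=
  [/\ (Qact M beta \o Qact M alpha = Qact M gamma \o Qact M beta)%VF,
      (Qact M beta \o Qact M zeta = Qact M eta \o Qact M beta)%VF
    & (Qact M zeta \o Qact M delta = Qact M delta \o Qact M eta)%VF] /\
  [/\ (Qact M alpha \o Qact M delta = Qact M delta \o Qact M gamma)%VF,
      (Qact M alpha \o Qact M zeta = Qact M zeta \o Qact M alpha)%VF
    & (Qact M gamma \o Qact M eta = Qact M eta \o Qact M gamma)%VF].

Definition Qnilpotent M : Prop :=
  exists n, forall i j (p : Qpath i j), (n <= Qlength p)%N -> Qpath_act M p = 0.

Definition Qat M N (f : 'Hom(M v1, N v1) * 'Hom(M v2, N v2)) i : 'Hom(M i, N i) :=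
  match i with v1 => f.1 | v2 => f.2 end.

Definition Qmorphism M N (f : 'Hom(M v1, N v1) * 'Hom(M v2, N v2)) : Prop :=
  forall a, (Qat f (Qtgt a) \o Qact M a = Qact N a \o Qat f (Qsrc a))%VF.

Fact Qat0 M N i : @Qat M N 0 i = 0. Proof. by case: i. Qed.

Fact QatP M N (a : F) (f g : 'Hom(M v1, N v1) * 'Hom(M v2, N v2)) i :
  Qat (a *: f + g) i = a *: Qat f i + Qat g i.
Proof. by case: i. Qed.

Fact Qmorphism0 M N : @Qmorphism M N 0.
Proof. by move=> a; rewrite !Qat0 comp_lfun0l comp_lfun0r. Qed.

Fact QmorphismP M N (a : F) (f g : 'Hom(M v1, N v1) * 'Hom(M v2, N v2)) :
  Qmorphism f -> Qmorphism g -> Qmorphism (a *: f + g).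
Proof.
move=> fM gM b; rewrite !QatP comp_lfunDl comp_lfunDr -comp_lfunZl -comp_lfunZr.
by rewrite fM gM.
Qed.

Definition Qhom M N : lin_prop ('Hom(M v1, N v1) * 'Hom(M v2, N v2))%type :=
  LinProp (@Qmorphism0 M N) (@QmorphismP M N).

Fact Qmorphism_id M : @Qmorphism M M (\1%VF, \1%VF).
Proof.
move=> a.
have idE i : @Qat M M (\1%VF, \1%VF) i = \1%VF by case: i.
by rewrite !idE comp_lfun1l comp_lfun1r.
Qed.

Definition Qcomp M N P (g : 'Hom(N v1, P v1) * 'Hom(N v2, P v2))
    (f : 'Hom(M v1, N v1) * 'Hom(M v2, N v2)) :
    'Hom(M v1, P v1) * 'Hom(M v2, P v2) :=
  ((g.1 \o f.1)%VF, (g.2 \o f.2)%VF).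

Fact Qmorphism_comp M N P (g : 'Hom(N v1, P v1) * 'Hom(N v2, P v2))
    (f : 'Hom(M v1, N v1) * 'Hom(M v2, N v2)) :
  Qmorphism g -> Qmorphism f -> Qmorphism (Qcomp g f).
Proof.
move=> gM fM a.
have compE i : Qat (Qcomp g f) i = (Qat g i \o Qat f i)%VF by case: i.
by rewrite !compE -comp_lfunA fM !comp_lfunA gM.
Qed.

Definition Qcmp M N P (g : lin_sub (Qhom N P)) (f : lin_sub (Qhom M N)) :
    lin_sub (Qhom M P) :=
  @lin_in F _ (Qhom M P) (Qcomp (lin_val g) (lin_val f))
    (Qmorphism_comp (lin_subP g) (lin_subP f)).

Definition Qrep_cat : lincat F.
Proof.
refine (@LinCat F Qrep (fun M N => lin_sub (Qhom M N))
  (fun M => @lin_in F _ (Qhom M M) (\1%VF, \1%VF) (Qmorphism_id M)) Qcmp _ _ _ _ _).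
- move=> M N f; apply: val_inj; rewrite /= /Qcomp !comp_lfun1l.
  by case: (lin_val f).
- move=> M N f; apply: val_inj; rewrite /= /Qcomp !comp_lfun1r.
  by case: (lin_val f).
- by move=> M N P R h g f; apply: val_inj; rewrite /= /Qcomp /= !comp_lfunA.
- move=> M N P a g g' f; apply: val_inj => /=.
  by rewrite /Qcomp /= !comp_lfunDl -!comp_lfunZl.
- move=> M N P a g f f'; apply: val_inj => /=.
  by rewrite /Qcomp /= !comp_lfunDr -!comp_lfunZr.
Defined.

Definition Qnil_cat : lincat F :=
  full (A := Qrep_cat) (fun M => Qrelations M /\ Qnilpotent M).

End Quiver.

Definition two_blocks_equivalent_to (F : fieldType) (A B : lincat F) : Prop :=
  exists P : 'I_2 -> A -> Prop,
    blocks P /\ forall i, equivalent (full (P i)) B.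

(* Main.v *)
From HB Require Import structures.
From mathcomp Require Import all_boot all_order all_algebra.
From mathcomp Require Import boolp reals complex ring zify.
Require Import Defs.

Set Implicit Arguments.
Unset Strict Implicit.
Unset Printing Implicit Defensive.

Import GRing.Theory.
Local Open Scope ring_scope.

(** Over the even part sl2 x sl2, a module in which the short h has eigenvalues
    -1, 0, 1 is a sum of copies of the trivial, the two adjoint and the
    bifundamental representation; the odd part acts by maps between the four
    multiplicity spaces A, B, C, D, subject to quadratic relations in which the
    central operators appear.  The weight space N[1] is B + D + C, the Peirce
    decomposition of the corresponding Jordan bimodule, and N is both generated
    and cogenerated by it, so that Jor is fully faithful.

    The discriminant being 4, the quadratic form given by the central character
    is a product of two linear forms of determinant one, so a rotation by an
    element of SL(2) reduces to the character with value 2 on the identity and 0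
    on the other two central elements.  Then some of the odd maps become
    invertible and identify D with B + C up to parity; the remaining ones are the
    arrows of the quiver, with B at the vertex 1 and C at the vertex 2, and one of
    the relations expresses the last central operator through the arrows.  All
    maps preserve the parity of B and C, which gives the two blocks; each is
    indecomposable because the quiver category is, any object of which has one of
    the two linked simple representations as a subobject. *)

(** * Linear categories and their blocks *)

(** The extension [gh] is known only through its universal property and is never computed. That
    property is used from two sides. On one side it makes [gh] perfect, so suitable lifts of the
    matrix units together with their brackets span it, and the center is found inside this span. On
    the other side it gives a map from [gh] to an explicit extension of sl(2|2) by two cocycles,
    along which the model modules are pulled back.

    Let w be 1 plus half the central operator of the identity matrix, in rotated form. At the vertex
    1 the relations say w = 2 + alpha zeta - delta beta, and similarly at the vertex 2. So w is
    invertible by nilpotency, as is u = w - delta beta, and the operator version of D(chi) equals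
    4(1 - w delta beta): the two-cycles of the quiver measure how far D is from being exactly 4 on
    the module.

    Extending a bimodule morphism to modules is delicate because only N[1] is given. The extension
    is obtained as a graph: a submodule of the product N x N' with prescribed top weight space,
    which turns out to be total and single-valued. *)

Section CategoryTheory.
Variable F : fieldType.
Implicit Types A B C : lincat F.

Lemma cmp0l A (X Y Z : A) (f : hom A X Y) : cmp (0 : hom A Y Z) f = 0.
Proof.
have := cmpPl (-1) (0 : hom A Y Z) 0 f.
by rewrite scaler0 addr0 scaleN1r addNr.
Qed.

Lemma cmp0r A (X Y Z : A) (g : hom A Y Z) : cmp g (0 : hom A X Y) = 0.
Proof.
have := cmpPr (-1) g (0 : hom A X Y) 0.
by rewrite scaler0 addr0 scaleN1r addNr.
Qed.

Lemma cmpDl A (X Y Z : A) (g g' : hom A Y Z) (f : hom A X Y) :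
  cmp (g + g') f = cmp g f + cmp g' f.
Proof. by have := cmpPl 1 g g' f; rewrite !scale1r. Qed.

Lemma cmpDr A (X Y Z : A) (g : hom A Y Z) (f f' : hom A X Y) :
  cmp g (f + f') = cmp g f + cmp g f'.
Proof. by have := cmpPr 1 g f f'; rewrite !scale1r. Qed.

Lemma cmp_sumr A (I : Type) (s : seq I) (X Y Z : A) (g : hom A Y Z)
    (f : I -> hom A X Y) :
  cmp g (\sum_(i <- s) f i) = \sum_(i <- s) cmp g (f i).
Proof.
by elim: s => [|i s IH]; rewrite ?big_nil ?cmp0r // !big_cons cmpDr IH.
Qed.

Lemma cmp_suml A (I : Type) (s : seq I) (X Y Z : A) (g : I -> hom A Y Z)
    (f : hom A X Y) :
  cmp (\sum_(i <- s) g i) f = \sum_(i <- s) cmp (g i) f.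
Proof.
by elim: s => [|i s IH]; rewrite ?big_nil ?cmp0l // !big_cons cmpDl IH.
Qed.

Lemma isomorphic_refl A (X : A) : isomorphic X X.
Proof. by exists (idm X), (idm X); rewrite cmp1l. Qed.

Lemma isomorphic_sym A (X Y : A) : isomorphic X Y -> isomorphic Y X.
Proof. by case=> f [g [? ?]]; exists g, f. Qed.

Lemma isomorphic_trans A (X Y Z : A) :
  isomorphic X Y -> isomorphic Y Z -> isomorphic X Z.
Proof.
move=> [f [f' [f'f ff']]] [g [g' [g'g gg']]]; exists (cmp g f), (cmp f' g').
split; rewrite cmpA.
  by rewrite -[cmp (cmp f' g') g]cmpA g'g cmp1r.
by rewrite -[cmp (cmp g f) f']cmpA ff' cmp1r.
Qed.

Lemma zero_isomorphic A (X Y : A) :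
  isomorphic X Y -> is_zero_ob X -> is_zero_ob Y.
Proof.
move=> [f [g [_ fg]]] X0.
by rewrite /is_zero_ob -fg -[f]cmp1r X0 cmp0r cmp0l.
Qed.

Lemma direct_sum_isor A (I : finType) (Y : I -> A) (X X' : A) :
  isomorphic X X' -> direct_sum Y X -> direct_sum Y X'.
Proof.
move=> [f [g [gf fg]]] [inj [prj [pi1 pi0 ip]]].
exists (fun i => cmp f (inj i)), (fun i => cmp (prj i) g).
have pfi i j : cmp (cmp (prj j) g) (cmp f (inj i)) = cmp (prj j) (inj i).
  by rewrite -cmpA [cmp g (cmp _ _)]cmpA gf cmp1l.
split=> [i|i j ij|]; rewrite ?pfi ?pi1 ?pi0 //.
rewrite (eq_bigr (fun i => cmp f (cmp (cmp (inj i) (prj i)) g))) => [|i _].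
  by rewrite -cmp_sumr -cmp_suml ip cmp1l.
by rewrite !cmpA.
Qed.

Lemma direct_sum_isol A (I : finType) (Y Y' : I -> A) (X : A) :
  (forall i, isomorphic (Y i) (Y' i)) -> direct_sum Y X -> direct_sum Y' X.
Proof.
move=> YY' [inj [prj [pi1 pi0 ip]]].
pose f i := projT1 (cid (YY' i)); pose g i := projT1 (cid (projT2 (cid (YY' i)))).
have fgP i : cmp (g i) (f i) = idm (Y i) /\ cmp (f i) (g i) = idm (Y' i).
  exact: projT2 (cid (projT2 (cid (YY' i)))).
exists (fun i => cmp (inj i) (g i)), (fun i => cmp (f i) (prj i)).
have pfi i j : cmp (cmp (f j) (prj j)) (cmp (inj i) (g i)) =
    cmp (f j) (cmp (cmp (prj j) (inj i)) (g i)) by rewrite !cmpA.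
split=> [i|i j ij|].
- by rewrite pfi pi1 cmp1l (fgP i).2.
- by rewrite pfi pi0 // cmp0l cmp0r.
rewrite -ip; apply: eq_bigr => i _.
by rewrite cmpA -[cmp (cmp (inj i) (g i)) (f i)]cmpA (fgP i).1 cmp1r.
Qed.

(** Hom-functions being linear, a trivial kernel is injectivity ([faithful_inj]). *)
Definition functor_faithful A B (S : functor A B) : Prop :=
  forall X Y (f : hom A X Y), fhom S X Y f = 0 -> f = 0.

Definition functor_full A B (S : functor A B) : Prop :=
  forall X Y (g : hom B (S X) (S Y)), exists f, fhom S X Y f = g.

Definition functor_dense A B (S : functor A B) : Prop :=
  forall Y : B, exists X, isomorphic (S X) Y.

Lemma faithful_inj A B (S : functor A B) : functor_faithful S ->
  forall X Y, injective (fhom S X Y).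
Proof.
move=> Sf X Y f g fg; apply/eqP; rewrite -subr_eq0; apply/eqP/Sf.
by rewrite linearB /= fg subrr.
Qed.

Lemma functor_isomorphic A B (S : functor A B) X Y :
  isomorphic X Y -> isomorphic (S X) (S Y).
Proof.
move=> [f [g [gf fg]]]; exists (fhom S _ _ f), (fhom S _ _ g).
by rewrite -!fhomM gf fg !fhom1.
Qed.

Lemma functor_direct_sum A B (S : functor A B) (I : finType) (Y : I -> A) X :
  direct_sum Y X -> direct_sum (fun i => S (Y i)) (S X).
Proof.
move=> [inj [prj [pi1 pi0 ip]]].
exists (fun i => fhom S _ _ (inj i)), (fun i => fhom S _ _ (prj i)).
split=> [i|i j ij|]; rewrite -?fhomM ?pi1 ?fhom1 // ?pi0 ?linear0 //.
rewrite -fhom1 -ip linear_sum; apply: eq_bigr => i _; exact/esym/fhomM.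
Qed.

Definition functor_cmp A B C (S : functor B C) (T : functor A B) : functor A C.
Proof.
refine (@Functor F A C (fun X => S (T X))
  (fun X Y => (fhom S (T X) (T Y) \o fhom T X Y : {linear _ -> _})) _ _).
- by move=> X /=; rewrite !fhom1.
- by move=> X Y Z g f /=; rewrite !fhomM.
Defined.

Lemma equivalent_sym A B : equivalent A B -> equivalent B A.
Proof. by case=> S [T [? ?]]; exists T, S. Qed.

Section QuasiInverse.
Variables (A B : lincat F) (S : functor A B).
Hypotheses (Sfaith : functor_faithful S) (Sfull : functor_full S).
Hypothesis Sdense : functor_dense S.

Let tob (Y : B) : A := projT1 (cid (Sdense Y)).
Let e Y : hom B (S (tob Y)) Y := projT1 (cid (projT2 (cid (Sdense Y)))).
Let e' Y : hom B Y (S (tob Y)) :=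
  projT1 (cid (projT2 (cid (projT2 (cid (Sdense Y)))))).
Let eK Y : cmp (e' Y) (e Y) = idm _.
Proof. exact: (projT2 (cid (projT2 (cid (projT2 (cid (Sdense Y))))))).1. Qed.
Let e'K Y : cmp (e Y) (e' Y) = idm _.
Proof. exact: (projT2 (cid (projT2 (cid (projT2 (cid (Sdense Y))))))).2. Qed.

Let thom Y Z (g : hom B Y Z) : hom A (tob Y) (tob Z) :=
  projT1 (cid (Sfull (cmp (cmp (e' Z) g) (e Y)))).
Let thomE Y Z g : fhom S _ _ (@thom Y Z g) = cmp (cmp (e' Z) g) (e Y).
Proof. exact: projT2 (cid (Sfull (cmp (cmp (e' Z) g) (e Y)))). Qed.

Let thom_linear Y Z : linear (@thom Y Z).
Proof.
move=> a f g; apply: (faithful_inj Sfaith).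
by rewrite linearP /= !thomE cmpPr cmpPl.
Qed.

Let thomL Y Z : {linear hom B Y Z -> hom A (tob Y) (tob Z)} :=
  HB.pack (@thom Y Z) (GRing.isLinear.Build F _ _ *:%R _ (@thom_linear Y Z)).

Let tfun : functor B A.
Proof.
refine (@Functor F B A tob thomL _ _).
- move=> X; apply: (faithful_inj Sfaith).
  by rewrite [LHS]thomE cmp1r eK fhom1.
- move=> X Y Z g f; apply: (faithful_inj Sfaith).
  rewrite fhomM; rewrite [LHS]thomE [in RHS]thomE [in RHS]thomE.
  rewrite !cmpA -[cmp (cmp (cmp (e' Z) g) (e Y)) (e' Y)]cmpA e'K cmp1r.
  by rewrite -!cmpA.
Defined.

(** The inverse functor chooses a preimage [tob Y] of each object with an isomorphism [e Y], and
    sends a morphism to the unique preimage of its conjugate by these isomorphisms. The maps [e']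
    are the natural isomorphism on one side, their preimages the one on the other. *)
Lemma ff_dense_equivalent : equivalent A B.
Proof.
exists S, tfun; split.
  pose u X : hom A X (tob (S X)) := projT1 (cid (Sfull (e' (S X)))).
  have uE X : fhom S _ _ (u X) = e' (S X) := projT2 (cid (Sfull (e' (S X)))).
  exists u; split=> [X|X Y f].
    have [v vE] := Sfull (e (S X)); exists v.
    by split; apply: (faithful_inj Sfaith);
      rewrite fhomM fhom1 vE uE ?e'K ?eK.
  apply: (faithful_inj Sfaith); rewrite !fhomM !uE.
  have -> : fhom S _ _ (fhom tfun _ _ (fhom S _ _ f)) = _ := thomE _.
  by rewrite -(cmpA _ (e _) (e' _)) e'K cmp1r.
exists e'; split=> [X|X Y f]; first by exists (e X); rewrite e'K eK.
have -> : fhom S _ _ (fhom tfun _ _ f) = _ := thomE _.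
by rewrite -(cmpA _ (e _) (e' _)) e'K cmp1r.
Qed.

End QuasiInverse.

Lemma equivalent_faithful A B (S : functor A B) (T : functor B A)
    (u : forall X, hom A X (T (S X))) :
    (forall X, exists v, cmp v (u X) = idm X /\ cmp (u X) v = idm _) ->
    (forall X Y (f : hom A X Y),
        cmp (u Y) f = cmp (fhom T _ _ (fhom S _ _ f)) (u X)) ->
  functor_faithful S.
Proof.
move=> uiso unat X Y f Sf0; have [v [vu _]] := uiso Y.
by rewrite -[f]cmp1l -vu -cmpA unat Sf0 linear0 cmp0l cmp0r.
Qed.

Lemma equivalent_functor A B : equivalent A B ->
  exists S : functor A B,
    [/\ functor_faithful S, functor_full S & functor_dense S].
Proof.
move=> [S [T [[u [uiso unat]] [w [wiso wnat]]]]]; exists S.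
have Sf := equivalent_faithful uiso unat.
have Tf := equivalent_faithful wiso wnat.
split=> // [X Y g|Y].
  have [v [vu uv]] := uiso Y; have [v' [vu' uv']] := uiso X.
  exists (cmp (cmp v (fhom T _ _ g)) (u X)); apply: (faithful_inj Tf).
  set f := cmp _ _; have := unat _ _ f.
  rewrite {1}/f !cmpA uv cmp1l => /(congr1 (fun k => cmp k v')).
  by rewrite -!cmpA uv' !cmp1r.
exists (T Y); have [v [vw wv]] := wiso Y; by exists v, (w Y).
Qed.

(** A decomposition of [B] pulls back along [S] to one of [A]: summands are lifted by density,
    injections and projections by fullness, and the equations between them by faithfulness. *)
Lemma equivalent_indecomposable A B :
  equivalent A B -> indecomposable A -> indecomposable B.
Proof.
move=> AB [[X0 X0n] Aind]; have [S [Sf Sfull Sd]] := equivalent_functor AB.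
have [T [Tf _ Td]] := equivalent_functor (equivalent_sym AB).
split.
  exists (S X0) => SX0; apply: X0n; apply: Sf; rewrite fhom1; exact: SX0.
move=> P [Piso P0 Pdec].
have [|b Pb] := Aind (fun b X => P b (S X)).
  split=> [i X Y XY|i j X Y ij PX PY f|X].
  - exact/Piso/functor_isomorphic.
  - exact/Sf/(P0 i j).
  have [Y [PY YX]] := Pdec (S X).
  have dY i := cid (Sd (Y i)).
  exists (fun i => projT1 (dY i)); split.
    by move=> i; apply: Piso (PY i); exact: isomorphic_sym (projT2 (dY i)).
  have [inj [prj [pi1 pi0 ip]]] :=
    direct_sum_isol (fun i => isomorphic_sym (projT2 (dY i))) YX.
  have finj i := cid (Sfull _ _ (inj i)).
  have fprj i := cid (Sfull _ _ (prj i)).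
  exists (fun i => projT1 (finj i)), (fun i => projT1 (fprj i)).
  split=> [i|i j ij|]; apply: (faithful_inj Sf).
  - by rewrite fhomM (projT2 (finj i)) (projT2 (fprj i)) pi1 fhom1.
  - by rewrite fhomM (projT2 (finj i)) (projT2 (fprj j)) pi0 // linear0.
  rewrite linear_sum fhom1 -ip; apply: eq_bigr => i _.
  by rewrite [LHS]fhomM (projT2 (finj i)) (projT2 (fprj i)).
exists b => Y PY; have [X XY] := Sd Y.
have PX : P b (S X) by apply: Piso PY; exact: isomorphic_sym.
apply: zero_isomorphic XY _.
by rewrite /is_zero_ob -fhom1 (Pb _ PX) linear0.
Qed.

Definition full_corestr A B (P : B -> Prop) (S : functor A B)
  (PS : forall X, P (S X)) : functor A (full P) :=
  @Functor F A (full P) (fun X => exist P (S X) (PS X)) (fun X Y => fhom S X Y)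
    (@fhom1 F A B S) (@fhomM F A B S).

(** Says that [A] is the direct sum of two copies of [B] in terms of functors only. This form passes
    along equivalences of [A] without choosing subcategories. *)
Definition splits_into A B : Prop :=
  exists T : 'I_2 -> functor B A,
    [/\ forall i, functor_faithful (T i) /\ functor_full (T i),
        forall i j X Y, i != j -> forall f : hom A (T i X) (T j Y), f = 0
      & forall X, exists Y : 'I_2 -> B, direct_sum (fun i => T i (Y i)) X].

(** The block number [i] is the essential image of [T i], which is equivalent to [B]. *)
Lemma splits_two_blocks A B :
  indecomposable B -> splits_into A B -> two_blocks_equivalent_to A B.
Proof.
move=> Bind [T [Tff T0 Tdec]].
pose P i X := exists Y, isomorphic (T i Y) X.
have PT i Y : P i (T i Y) by exists Y; exact: isomorphic_refl.
have eqP i : equivalent B (full (P i)).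
  apply: (@ff_dense_equivalent _ _ (full_corestr (PT i))).
  - by move=> X Y f; apply: (Tff i).1.
  - by move=> X Y f; apply: (Tff i).2.
  - move=> [X [Y YX]]; exists Y; exact: YX.
exists P; split; last by move=> i; apply: equivalent_sym.
split; last by move=> i; apply: equivalent_indecomposable (eqP i) Bind.
split=> [i X X' XX' [Y YX]|i j X X' ij [Y YX] [Y' YX'] f|X].
- by exists Y; apply: isomorphic_trans XX'.
- have [u [v [vu uv]]] := YX; have [u' [v' [vu' uv']]] := YX'.
  have := T0 i j Y Y' ij (cmp (cmp v' f) u) => /(congr1 (fun k => cmp (cmp u' k) v)).
  rewrite !cmpA uv' cmp1l -cmpA uv cmp1r => ->.
  by rewrite cmp0r cmp0l.
by have [Y YX] := Tdec X; exists (fun i => T i (Y i)).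
Qed.

Lemma splits_equivalent A A' B :
  equivalent A A' -> splits_into A B -> splits_into A' B.
Proof.
move=> AA' [T [Tff T0 Tdec]]; have [S [Sf Sfull Sd]] := equivalent_functor AA'.
exists (fun i => functor_cmp S (T i)); split=> [i|i j X Y ij f|X'].
- split=> [X Y f /Sf /(Tff i).1 //|X Y g].
  have [f <-] := Sfull _ _ g; have [h <-] := (Tff i).2 _ _ f.
  by exists h.
- by have [h <-] := Sfull _ _ f; rewrite (T0 i j X Y ij h) linear0.
have [X XX'] := Sd X'; have [Y YX] := Tdec X; exists Y.
exact/(direct_sum_isor XX')/functor_direct_sum.
Qed.

End CategoryTheory.

(** * Indecomposability of the quiver category *)

Section LinSubTheory.
Variables (F : fieldType) (V : lmodType F) (P : lin_prop V).

Lemma lin_val_linear : linear (@lin_val F V P).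
Proof. exact: (linearP (\val : lin_sub P -> V)). Qed.

Lemma lin_val0 : lin_val (0 : lin_sub P) = 0.
Proof. exact: (linear0 (\val : lin_sub P -> V)). Qed.

Lemma lin_valZ c (u : lin_sub P) : lin_val (c *: u) = c *: lin_val u.
Proof.
by have := lin_val_linear c u 0; rewrite [X in _ = _ + X -> _]lin_val0 !addr0.
Qed.

End LinSubTheory.

Section QuiverIndecomposable.
Variable F : fieldType.

Lemma lfun_neq0 (V W : vectType F) (f : 'Hom(V, W)) :
  f <> 0 -> exists v, f v != 0.
Proof.
move=> f0; apply: contrapT => nf; apply: f0; apply/lfunP=> v.
rewrite zero_lfunE; apply: contrapT => fv; apply: nf.
by exists v; apply/eqP.
Qed.

Section Vector.
Variables (V : vectType F) (v : V).

Definition rV1_fun (r : 'rV[F]_1) : V := r 0 0 *: v.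

Fact rV1_fun_linear : linear rV1_fun.
Proof. by move=> a x y; rewrite /rV1_fun !mxE scalerDl scalerA. Qed.
HB.instance Definition _ :=
  GRing.isLinear.Build F 'rV[F]_1 V *:%R rV1_fun rV1_fun_linear.

Definition rV1_lfun : 'Hom('rV[F]_1, V) := linfun rV1_fun.

Lemma rV1_lfunE r : rV1_lfun r = r 0 0 *: v.
Proof. exact: lfunE. Qed.

End Vector.

Lemma rV1E (r : 'rV[F]_1) : r = r 0 0 *: const_mx 1.
Proof. by apply/matrixP=> i j; rewrite !ord1 !mxE mulr1. Qed.

Lemma rV1_end (f : 'End('rV[F]_1)) : exists c, f = c *: \1%VF.
Proof.
exists (f (const_mx 1) 0 0); apply/lfunP=> r.
rewrite scale_lfunE id_lfunE {1}[r]rV1E linearZ /= {1}[f _]rV1E.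
by rewrite scalerA mulrC -scalerA -rV1E.
Qed.

Lemma lfun_rV0 (V : vectType F) (f g : 'Hom('rV[F]_0, V)) : f = g.
Proof. by apply/lfunP=> r; rewrite thinmx0 !linear0. Qed.

Definition beta_sp (d1 d2 : nat) (i : Qvert) : vectType F :=
  match i with v1 => 'rV[F]_d1 | v2 => 'rV[F]_d2 end.

(** One family contains all test objects: both simple representations and the nonsplit extension
    between them. With only [beta] nonzero the relations hold and paths of length 2 vanish. *)
Definition beta_rep (d1 d2 : nat) (b : 'Hom('rV[F]_d1, 'rV[F]_d2)) : Qrep F :=
  @QRep F (beta_sp d1 d2)
    (fun a => match a return
        'Hom(beta_sp d1 d2 (Qsrc a), beta_sp d1 d2 (Qtgt a)) with
      | beta => b | alpha => 0 | zeta => 0 | gamma => 0 | eta => 0 | delta => 0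
      end).

Lemma beta_repP d1 d2 (b : 'Hom('rV[F]_d1, 'rV[F]_d2)) :
  Qrelations (beta_rep b) /\ Qnilpotent (beta_rep b).
Proof.
split; first by split; split; rewrite /= ?comp_lfun0l ?comp_lfun0r.
have to1 i j (p : Qpath i j) : match j with
    v1 => (0 < Qlength p)%N -> Qpath_act (beta_rep b) p = 0 | v2 => True end.
  by case: p => [|[] p] /=; rewrite ?comp_lfun0l //; case: i.
exists 2%N => i j p; case: p => [//|a p]; case: a p => p /=;
  rewrite ?comp_lfun0l // => len; have /= -> := to1 _ _ p len; exact: comp_lfun0r.
Qed.

Definition beta_ob d1 d2 (b : 'Hom('rV[F]_d1, 'rV[F]_d2)) : Qnil_cat F :=
  exist _ (beta_rep b) (beta_repP b).

Definition simple1 : Qnil_cat F := beta_ob (0 : 'Hom('rV[F]_1, 'rV[F]_0)).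
Definition simple2 : Qnil_cat F := beta_ob (0 : 'Hom('rV[F]_0, 'rV[F]_1)).
Definition uniserial12 : Qnil_cat F := beta_ob (\1%VF : 'End('rV[F]_1)).

Section QnilHom.
Variables X Y : Qnil_cat F.
Local Notation H :=
  ('Hom(sval X v1, sval Y v1) * 'Hom(sval X v2, sval Y v2))%type.

Definition Qval (f : hom (Qnil_cat F) X Y) : H :=
  @lin_val F _ (Qhom (sval X) (sval Y)) f.

Definition Qmk (f : H) (fP : Qmorphism f) : hom (Qnil_cat F) X Y :=
  @lin_in F _ (Qhom (sval X) (sval Y)) f fP.

Lemma Qval_mk f (fP : Qmorphism f) : Qval (Qmk fP) = f.
Proof. by []. Qed.

Lemma Qval_inj : injective Qval.
Proof. exact: (@val_inj _ _ (lin_sub (Qhom (sval X) (sval Y)))). Qed.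

Lemma Qval_linear : linear Qval.
Proof.
move=> a u v.
exact_no_check (@lin_val_linear F _ (Qhom (sval X) (sval Y)) a u v).
Qed.

Lemma Qval0 : Qval 0 = 0.
Proof. exact: (lin_val0 (Qhom (sval X) (sval Y))). Qed.

Lemma QvalP f : Qmorphism (Qval f).
Proof. exact: (@lin_subP F _ (Qhom (sval X) (sval Y)) f). Qed.

End QnilHom.

Lemma Qval_id (X : Qnil_cat F) : Qval (idm X) = (\1%VF, \1%VF).
Proof. by []. Qed.

Lemma Qval_cmp (X Y Z : Qnil_cat F) (g : hom _ Y Z) (f : hom _ X Y) :
  Qval (cmp g f) = (((Qval g).1 \o (Qval f).1)%VF, ((Qval g).2 \o (Qval f).2)%VF).
Proof. by []. Qed.

(** Schur's property, used as a criterion for lying in a single summand of a decomposition. *)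
Definition brick (A : lincat F) (X : A) : Prop :=
  ~ is_zero_ob X /\ forall f : hom A X X, exists c, f = c *: idm X.

Lemma rV1_id_neq0 : (\1%VF : 'End('rV[F]_1)) <> 0.
Proof.
move/lfunP/(_ (const_mx 1))/matrixP/(_ 0 0)/eqP.
by rewrite id_lfunE zero_lfunE !mxE oner_eq0.
Qed.

Lemma QvalZ (X Y : Qnil_cat F) (c : F) (f : hom _ X Y) :
  Qval (c *: f) = (c *: (Qval f).1, c *: (Qval f).2).
Proof. exact_no_check (@lin_valZ F _ (Qhom (sval X) (sval Y)) c f). Qed.

Lemma simple1_brick : brick simple1.
Proof.
split=> [/(congr1 (@Qval _ _))|f].
  by rewrite Qval_id Qval0 => -[/rV1_id_neq0].
have [c fc] := rV1_end (Qval f).1; exists c; apply: Qval_inj.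
rewrite QvalZ Qval_id [Qval f]surjective_pairing fc.
congr pair; exact: lfun_rV0.
Qed.

Lemma simple2_brick : brick simple2.
Proof.
split=> [/(congr1 (@Qval _ _))|f].
  by rewrite Qval_id Qval0 => -[_ /rV1_id_neq0].
have [c fc] := rV1_end (Qval f).2; exists c; apply: Qval_inj.
rewrite QvalZ Qval_id [Qval f]surjective_pairing fc.
congr pair; exact: lfun_rV0.
Qed.

Lemma uniserial12_brick : brick uniserial12.
Proof.
split=> [/(congr1 (@Qval _ _))|f].
  by rewrite Qval_id Qval0 => -[/rV1_id_neq0].
have [c fc] := rV1_end (Qval f).1; exists c; apply: Qval_inj.
rewrite QvalZ Qval_id [Qval f]surjective_pairing.
have := QvalP f beta; rewrite /= comp_lfun1l comp_lfun1r => ->.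
by rewrite fc.
Qed.

Lemma simple2_uniserial12 : exists f : hom _ simple2 uniserial12, f <> 0.
Proof.
have fP : @Qmorphism F (sval simple2) (sval uniserial12) (0, \1%VF).
  by case; apply/lfunP=> r; rewrite /= !comp_lfunE /= !(zero_lfunE, linear0).
exists (Qmk fP) => /(congr1 (@Qval _ _)); rewrite Qval_mk Qval0.
by case=> /rV1_id_neq0.
Qed.

Lemma uniserial12_simple1 : exists f : hom _ uniserial12 simple1, f <> 0.
Proof.
have fP : @Qmorphism F (sval uniserial12) (sval simple1) (\1%VF, 0).
  by case; apply/lfunP=> r; rewrite /= !comp_lfunE /= !(zero_lfunE, linear0).
exists (Qmk fP) => /(congr1 (@Qval _ _)); rewrite Qval_mk Qval0.
by case=> /rV1_id_neq0.
Qed.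

(** The projector of [X] onto its component in [P true] is a scalar c with c * c = c. If c = 0 then
    [X] is isomorphic to its other component, if c = 1 to this one. *)
Lemma brick_decomposition (A : lincat F) (P : bool -> A -> Prop) (X : A) :
  decomposition P -> brick X -> exists b, P b X.
Proof.
move=> [Piso P0 Pdec] [Xn0 Xbr]; have [Y [PY [inj [prj [pi1 pi0 ip]]]]] := Pdec X.
have [c fc] := Xbr (cmp (inj true) (prj true)).
have cc : c * c = c.
  apply/eqP; rewrite -subr_eq0; apply/eqP; apply: contrapT => /eqP ccn.
  apply: Xn0; have : (c * c - c) *: idm X = 0.
    rewrite scalerBl -fc -[X in _ - X]cmp1r.
    have -> : (c * c) *: idm X = cmp (cmp (inj true) (prj true))
       (cmp (inj true) (prj true)).
      rewrite fc; have := cmpPl c (idm X) 0 (c *: idm X).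
      by rewrite addr0 cmp0l addr0 cmp1l scalerA => ->.
    rewrite -cmpA [cmp (prj true) (cmp _ _)]cmpA pi1 cmp1l cmp1r.
    exact: subrr.
  move/(congr1 (fun k => (c * c - c)^-1 *: k)).
  by rewrite scalerA mulVf // scale1r scaler0.
have [c0|c1] : c = 0 \/ c = 1.
- have /eqP : c * (c - 1) = 0 by rewrite mulrBr mulr1 cc subrr.
  by rewrite mulf_eq0 subr_eq0 => /orP[] /eqP; [left|right].
- exists false; apply: Piso (PY false); exists (inj false), (prj false).
  by split=> //; rewrite -ip big_bool /= fc c0 scale0r add0r.
- exists true; apply: Piso (PY true); exists (inj true), (prj true).
  by split=> //; rewrite fc c1 scale1r.
Qed.

(** The end of a longest nonzero path is a vector killed by every arrow, so it spans a simple
    subrepresentation at the target vertex of that path. *)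
Lemma nilpotent_socle (X : Qnil_cat F) : ~ is_zero_ob X ->
  (exists f : hom _ simple1 X, f <> 0) \/ (exists f : hom _ simple2 X, f <> 0).
Proof.
case: X => X [Xrel Xnil] Xn0.
have exn : exists n, `[< forall i j (p : Qpath i j), (n <= Qlength p)%N ->
    Qpath_act X p = 0 >].
  by have [n nP] := Xnil; exists n; apply/asboolP.
(* Minimal bound for vanishing of paths. If it is 0, the trivial paths act by zero and [X] is
   zero. *)
have [[|n] /asboolP nP nmin] := ex_minnP exn.
  case: Xn0; apply: Qval_inj; rewrite Qval_id Qval0.
  by congr pair; [exact: (nP _ _ (Qnil v1)) | exact: (nP _ _ (Qnil v2))].
have [i [j [p [np pn0]]]] : exists i j (p : Qpath i j),
    (n <= Qlength p)%N /\ Qpath_act X p <> 0.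
  apply: contrapT => H.
  suff /asboolP/nmin : forall i j (p : Qpath i j), (n <= Qlength p)%N ->
    Qpath_act X p = 0 by rewrite ltnn.
  move=> i j p np; apply: contrapT => pn0.
  by apply: H; exists i, j, p.
have [u pu] := lfun_neq0 pn0.
case: j p np {pn0} pu => p np pu; pose v := Qpath_act X p u.
  have fP : @Qmorphism F (sval simple1) X (rV1_lfun v, 0).
    have kill a (q : Qpath i (Qsrc a)) : (n < (Qlength q).+1)%N ->
        forall w, Qact X a (Qpath_act X q w) = 0.
      by move=> nq w; have /lfunP/(_ w) := nP _ _ (Qcons q) nq;
         rewrite /= comp_lfunE zero_lfunE.
    case; apply/lfunP=> r; rewrite !comp_lfunE /= !(zero_lfunE, linear0) // rV1_lfunE linearZ /=.
    - by rewrite /v (kill alpha p) ?scaler0.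
    - by rewrite /v (kill zeta p) ?scaler0.
    - by rewrite /v (kill beta p) ?scaler0.
  left; exists (@Qmk simple1 (exist _ X (conj Xrel Xnil)) _ fP) => /(congr1 (fun f => (Qval f).1)).
  rewrite Qval_mk Qval0 => /lfunP/(_ (const_mx 1)) /=; rewrite rV1_lfunE mxE scale1r zero_lfunE.
  by move/eqP; rewrite /v (negbTE pu).
have fP : @Qmorphism F (sval simple2) X (0, rV1_lfun v).
  have kill a (q : Qpath i (Qsrc a)) : (n < (Qlength q).+1)%N ->
      forall w, Qact X a (Qpath_act X q w) = 0.
    by move=> nq w; have /lfunP/(_ w) := nP _ _ (Qcons q) nq;
       rewrite /= comp_lfunE zero_lfunE.
  case; apply/lfunP=> r; rewrite !comp_lfunE /= !(zero_lfunE, linear0) // rV1_lfunE linearZ /=.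
  - by rewrite /v (kill gamma p) ?scaler0.
  - by rewrite /v (kill eta p) ?scaler0.
  - by rewrite /v (kill delta p) ?scaler0.
right; exists (@Qmk simple2 (exist _ X (conj Xrel Xnil)) _ fP) => /(congr1 (fun f => (Qval f).2)).
  rewrite Qval_mk Qval0 => /lfunP/(_ (const_mx 1)) /=; rewrite rV1_lfunE mxE scale1r zero_lfunE.
by move/eqP; rewrite /v (negbTE pu).
Qed.

(** [simple2] maps nontrivially to [uniserial12], which maps nontrivially to [simple1], so the three
    lie in the same summand. A nonzero object of the other summand would receive a nonzero map from
    a simple one. *)
Lemma Qnil_indecomposable : indecomposable (Qnil_cat F).
Proof.
split; first by exists simple1; exact: simple1_brick.1.
move=> P Pdec; have [Piso P0 _] := Pdec.
have [b Pb] := brick_decomposition Pdec uniserial12_brick.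
have Psame c c' X Y (f : hom (Qnil_cat F) X Y) :
    P c X -> P c' Y -> f <> 0 -> c = c'.
  move=> PX PY f0; apply: contrapT => /eqP cc'; apply: f0.
  exact: P0 cc' PX PY f.
have [b1 Pb1] := brick_decomposition Pdec simple1_brick.
have [b2 Pb2] := brick_decomposition Pdec simple2_brick.
have [f f0] := simple2_uniserial12; have [f' f0'] := uniserial12_simple1.
have eb2 := Psame _ _ _ _ f Pb2 Pb f0; have eb1 := Psame _ _ _ _ f' Pb Pb1 f0'.
subst b1 b2; exists (~~ b) => X PX; apply: contrapT => /nilpotent_socle.
case=> [] [h h0].
  by have := Psame _ _ _ _ h Pb1 PX h0; case: (b).
by have := Psame _ _ _ _ h Pb2 PX h0; case: (b).
Qed.

End QuiverIndecomposable.

(** * Modules in terms of multiplicity spaces *)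

Section VectorEquality.
Variable F : fieldType.

(** Testing against all linear forms turns an identity between vectors into
    one between scalars, which [ring] can decide. *)
Lemma vect_eqP (V : vectType F) (x y : V) :
  (forall f : V -> F, (forall a u v, f (a *: u + v) = a * f u + f v) ->
     f x = f y) -> x = y.
Proof.
move=> H; rewrite (coord_vbasis (memvf x)) (coord_vbasis (memvf y)).
by apply: eq_bigr => i _; congr (_ *: _); apply: H => a u v; rewrite linearP.
Qed.

Section Form.
Variables (V : lmodType F) (f : V -> F).
Hypothesis fP : forall a u v, f (a *: u + v) = a * f u + f v.

Lemma form0 : f 0 = 0.
Proof.
by have := fP (-1) 0 0; rewrite scaler0 addr0 mulN1r addNr.
Qed.

Lemma formD u v : f (u + v) = f u + f v.
Proof. by rewrite -[u]scale1r fP mul1r scale1r. Qed.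

Lemma formZ a u : f (a *: u) = a * f u.
Proof. by have := fP a u 0; rewrite !addr0 form0 addr0. Qed.

Lemma formN u : f (- u) = - f u.
Proof. by rewrite -scaleN1r formZ mulN1r. Qed.

End Form.

Lemma lfunD (V W : vectType F) (f : 'Hom(V, W)) u v : f (u + v) = f u + f v.
Proof. exact: linearD. Qed.
Lemma lfunZ (V W : vectType F) (f : 'Hom(V, W)) a u : f (a *: u) = a *: f u.
Proof. exact: linearZ. Qed.
Lemma lfunN (V W : vectType F) (f : 'Hom(V, W)) u : f (- u) = - f u.
Proof. exact: linearN. Qed.
Lemma lfun0 (V W : vectType F) (f : 'Hom(V, W)) : f 0 = 0.
Proof. exact: linear0. Qed.

Definition lfun_pushE := (lfunD, lfunZ, lfunN, lfun0).
End VectorEquality.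

Section Push.
Variable F : fieldType.

Definition linear_form (V : lmodType F) (f : V -> F) :=
  forall a u v, f (a *: u + v) = a * f u + f v.

Definition push (V : lmodType F) (f : V -> F) (e : V) (r : F) := f e = r.

Section OneForm.
Variables (V : lmodType F) (f : V -> F).
Hypothesis fP : linear_form f.

Lemma push_add u v a b : push f u a -> push f v b -> push f (u + v) (a + b).
Proof. by rewrite /push (formD fP) => -> ->. Qed.

Lemma push_scale k u a : push f u a -> push f (k *: u) (k * a).
Proof. by rewrite /push (formZ fP) => ->. Qed.

Lemma push_opp u a : push f u a -> push f (- u) (- a).
Proof. by rewrite /push (formN fP) => ->. Qed.

Lemma push_zero : push f 0 0.
Proof. exact: (form0 fP). Qed.

Lemma push_leaf u : push f u (f u).
Proof. by []. Qed.

Lemma push_eq u v a b : push f u a -> push f v b -> a = b -> f u = f v.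
Proof. by move=> -> ->. Qed.
End OneForm.

Lemma linear_form_lfun (V W : vectType F) (f : W -> F) (g : 'Hom(V, W)) :
  linear_form f -> linear_form (fun x => f (g x)).
Proof. by move=> fP a u v; rewrite linearP fP. Qed.

Lemma push_lfun (V W : vectType F) (f : W -> F) (g : 'Hom(V, W)) e r :
  push (fun x => f (g x)) e r -> push f (g e) r.
Proof. by []. Qed.
End Push.

(** Expands a linear form on a linear combination in one traversal; rewriting
    with [linearP] instead takes quadratic time. *)
Ltac push_form H :=
  lazymatch goal with
  | |- push _ (@Algebra.add _ _ _) _ => eapply (push_add H); [push_form H | push_form H]
  | |- push _ (@GRing.scale _ _ _ _) _ => eapply (push_scale H); push_form H
  | |- push _ (@Algebra.opp _ _) _ => eapply (push_opp H); push_form H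
  | |- push _ (@Algebra.zero _) _ => exact (push_zero H)
  | |- push _ (@fun_of_lfun _ _ _ ?g _) _ =>
      eapply push_lfun; push_form constr:(linear_form_lfun g H)
  | |- _ => exact (@push_leaf _ _ _ _)
  end.

Ltac vect_push f fP :=
  apply: vect_eqP => f fP; eapply (push_eq (f := f));
    [push_form fP | push_form fP | cbv beta].

Ltac vect_ring :=
  let f := fresh "f" in let fP := fresh "fP" in vect_push f fP; ring.

Ltac vect_field F2 :=
  let f := fresh "f" in let fP := fresh "fP" in vect_push f fP; field; rewrite ?F2 //.

(** [rules] rewrites the composites of linear maps met after the expansion. *)
Ltac vect_norm rules :=
  let f := fresh "f" in let fP := fresh "fP" in vect_push f fP;
  repeat (progress (rules tt;
    rewrite ?lfun_pushE ?(formD fP, formZ fP, formN fP, form0 fP))).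

(** * Quadratic relations between the multiplicity spaces *)

Section OddMaps.
Variables (F : fieldType) (A B C D : vectType F).
Local Open Scope lfun_scope.

(** Multiplicity spaces of the trivial, the two adjoint and the bifundamental
    representations of [sl2 x sl2], and the effect on them of the odd elements
    carrying a fixed vector of the outer [C^2]. *)
Record omaps := OMaps {
  oA : 'Hom(D, A); oB : 'Hom(D, B); oC : 'Hom(D, C);
  uA : 'Hom(A, D); uB : 'Hom(B, D); uC : 'Hom(C, D) }.

Record zmaps := ZMaps { zA : 'End(A); zB : 'End(B); zC : 'End(C); zD : 'End(D) }.

Definition omaps_comb (l r : F) (O1 O2 : omaps) : omaps :=
  OMaps (l *: oA O1 + r *: oA O2) (l *: oB O1 + r *: oB O2)
    (l *: oC O1 + r *: oC O2) (l *: uA O1 + r *: uA O2)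
    (l *: uB O1 + r *: uB O2) (l *: uC O1 + r *: uC O2).

Definition zmaps_comb (k l m : F) (Z1 Z2 Z3 : zmaps) : zmaps :=
  ZMaps (k *: zA Z1 + l *: zA Z2 + m *: zA Z3)
    (k *: zB Z1 + l *: zB Z2 + m *: zB Z3)
    (k *: zC Z1 + l *: zC Z2 + m *: zC Z3)
    (k *: zD Z1 + l *: zD Z2 + m *: zD Z3).

(** What it takes for the supercommutator of two odd elements [q (x) u1] and
    [r (x) u2] to be [e] times an element of [sl2 x sl2] plus the central
    operator [Z] scaled by the pairing of [q] and [r]. *)
Record odd_rel (O1 O2 : omaps) (Z : zmaps) (e : F) : Prop := OddRel {
  rAA : forall x, oA O1 (uA O2 x) = zA Z x - oA O2 (uA O1 x);
  rAB : forall x, oB O1 (uA O2 x) = oB O2 (uA O1 x);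
  rAC : forall x, oC O1 (uA O2 x) = oC O2 (uA O1 x);
  rBB : forall x, oB O1 (uB O2 x) = zB Z x + e *: x;
  rBB' : forall x, oB O2 (uB O1 x) = zB Z x - e *: x;
  rBA : forall x, oA O1 (uB O2 x) = oA O2 (uB O1 x);
  rBC : forall x, oC O1 (uB O2 x) = - oC O2 (uB O1 x);
  rCC : forall x, oC O1 (uC O2 x) = zC Z x - e *: x;
  rCC' : forall x, oC O2 (uC O1 x) = zC Z x + e *: x;
  rCA : forall x, oA O1 (uC O2 x) = oA O2 (uC O1 x);
  rCB : forall x, oB O1 (uC O2 x) = - oB O2 (uC O1 x);
  rDC : forall x, uC O2 (oC O1 x) = zD Z x - e *: x - uB O1 (oB O2 x);
  rDC' : forall x, uC O1 (oC O2 x) = zD Z x + e *: x - uB O2 (oB O1 x);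
  rDA : forall x, uA O1 (oA O2 x) =
    2^-1 *: (zD Z x - e *: x + uB O2 (oB O1 x) - uB O1 (oB O2 x));
  rDA' : forall x, uA O2 (oA O1 x) =
    2^-1 *: (zD Z x + e *: x + uB O1 (oB O2 x) - uB O2 (oB O1 x)) }.

Record oz_commute (O : omaps) (Z : zmaps) : Prop := OZCommute {
  ozA : forall x, zA Z (oA O x) = oA O (zD Z x);
  ozB : forall x, zB Z (oB O x) = oB O (zD Z x);
  ozC : forall x, zC Z (oC O x) = oC O (zD Z x);
  uzA : forall x, zD Z (uA O x) = uA O (zA Z x);
  uzB : forall x, zD Z (uB O x) = uB O (zB Z x);
  uzC : forall x, zD Z (uC O x) = uC O (zC Z x) }.

Record zz_commute (Z Z' : zmaps) : Prop := ZZCommute {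
  zzA : forall x, zA Z (zA Z' x) = zA Z' (zA Z x);
  zzB : forall x, zB Z (zB Z' x) = zB Z' (zB Z x);
  zzC : forall x, zC Z (zC Z' x) = zC Z' (zC Z x);
  zzD : forall x, zD Z (zD Z' x) = zD Z' (zD Z x) }.


(** The case [O1 = O2], [e = 0] of [odd_rel], where relations of the form u = v - u have been solved
    for u. *)
Record odd_self (O : omaps) (Z : zmaps) : Prop := OddSelf {
  sAA : forall x, oA O (uA O x) = 2^-1 *: zA Z x;
  sBB : forall x, oB O (uB O x) = zB Z x;
  sBC : forall x, oC O (uB O x) = 0;
  sCC : forall x, oC O (uC O x) = zC Z x;
  sCB : forall x, oB O (uC O x) = 0;
  sDC : forall x, uC O (oC O x) = zD Z x - uB O (oB O x);
  sDA : forall x, uA O (oA O x) = 2^-1 *: zD Z x }.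

Hypothesis F2 : 2 != 0 :> F.

Lemma half_eq (V : vectType F) (u v : V) : u = v - u -> u = 2^-1 *: v.
Proof.
move=> uv; have -> : v = u + u by rewrite [in X in _ + X]uv addrC subrK.
by vect_field F2.
Qed.

Lemma odd_rel_self O Z : odd_self O Z -> odd_rel O O Z 0.
Proof.
move=> S; split=> x; rewrite ?(sAA S, sBB S, sBC S, sCC S, sCB S, sDC S, sDA S);
  by vect_field F2.
Qed.

Lemma odd_self_rel O Z : odd_rel O O Z 0 -> odd_self O Z.
Proof.
move=> S; split=> x.
- exact: half_eq (rAA S x).
- by rewrite (rBB S) scale0r addr0.
- by have := rBC S x; rewrite -sub0r => /half_eq ->; rewrite scaler0.
- by rewrite (rCC S) scale0r subr0.
- by have := rCB S x; rewrite -sub0r => /half_eq ->; rewrite scaler0.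
- by rewrite (rDC S) scale0r subr0.
- by rewrite (rDA S) scale0r subr0 addrK.
Qed.

(** The supercommutator is bilinear in the outer vectors: the central part transforms as a quadratic
    form, and [e], being alternating, is multiplied by a determinant. This is the action of SL(2) by
    automorphisms, seen on multiplicity spaces. *)
Lemma odd_rel_comb (l r l' r' : F) O1 O2 Z11 Z12 Z22 (e : F) :
  odd_self O1 Z11 -> odd_rel O1 O2 Z12 e -> odd_self O2 Z22 ->
  odd_rel (omaps_comb l r O1 O2) (omaps_comb l' r' O1 O2)
    (zmaps_comb (l * l') (l * r' + r * l') (r * r') Z11 Z12 Z22)
    ((l * r' - r * l') * e).
Proof.
move=> R1 R R2; split=> x /=;
  rewrite !(add_lfunE, scale_lfunE, lfun_pushE)
    ?(sAA R1, sBB R1, sBC R1, sCC R1, sCB R1, sDC R1, sDA R1)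
    ?(sAA R2, sBB R2, sBC R2, sCC R2, sCB R2, sDC R2, sDA R2)
    ?(rAA R, rAB R, rAC R, rBB R, rBB' R, rBA R, rBC R, rCC R, rCC' R, rCA R,
      rCB R, rDC R, rDC' R, rDA R, rDA' R);
  by vect_field F2.
Qed.

Lemma oz_commute_comb (l r k m n : F) O1 O2 Z1 Z2 Z3 :
  oz_commute O1 Z1 -> oz_commute O1 Z2 -> oz_commute O1 Z3 ->
  oz_commute O2 Z1 -> oz_commute O2 Z2 -> oz_commute O2 Z3 ->
  oz_commute (omaps_comb l r O1 O2) (zmaps_comb k m n Z1 Z2 Z3).
Proof.
move=> H1 H2 H3 K1 K2 K3; split=> x /=;
  rewrite !(add_lfunE, scale_lfunE, lfun_pushE)
    ?(ozA H1, ozA H2, ozA H3, ozB H1, ozB H2, ozB H3, ozC H1, ozC H2, ozC H3)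
    ?(uzA H1, uzA H2, uzA H3, uzB H1, uzB H2, uzB H3, uzC H1, uzC H2, uzC H3)
    ?(ozA K1, ozA K2, ozA K3, ozB K1, ozB K2, ozB K3, ozC K1, ozC K2, ozC K3)
    ?(uzA K1, uzA K2, uzA K3, uzB K1, uzB K2, uzB K3, uzC K1, uzC K2, uzC K3);
  by vect_ring.
Qed.

End OddMaps.

Section ModelOperators.
Variables (F : fieldType) (A B C D : vectType F).
Hypothesis F2 : 2 != 0 :> F.

(** The multiplicity space of an adjoint representation is stored as the
    triple of the coefficients of E12, E11 - E22 and E21, that of the
    bifundamental one as the quadruple of the matrix entries. *)
Definition Nsp : vectType F :=
  (A * (B * B * B) * (C * C * C) * (D * D * D * D))%type.

Lemma Nsp_eq (n m : Nsp) :
  n.1.1.1 = m.1.1.1 ->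
  n.1.1.2.1.1 = m.1.1.2.1.1 -> n.1.1.2.1.2 = m.1.1.2.1.2 ->
  n.1.1.2.2 = m.1.1.2.2 ->
  n.1.2.1.1 = m.1.2.1.1 -> n.1.2.1.2 = m.1.2.1.2 -> n.1.2.2 = m.1.2.2 ->
  n.2.1.1.1 = m.2.1.1.1 -> n.2.1.1.2 = m.2.1.1.2 -> n.2.1.2 = m.2.1.2 ->
  n.2.2 = m.2.2 -> n = m.
Proof.
case: n => [[[x [[be bh] bf]] [[ce ch] cf]] [[[d11 d12] d21] d22]].
case: m => [[[? [[? ?] ?]] [[? ?] ?]] [[[? ?] ?] ?]] /=.
by do 11!move=> ->.
Qed.

(** View the coordinates in B, C and D as 2 x 2 matrices b, c (traceless) and d. Up to the maps of
    [O], the D-component of the result is x q + b q + q c. The A-component is the trace of d adj(q),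
    the B-component the traceless part of d adj(q), the C-component that of adj(q) d. *)
Definition odd_op (O : omaps A B C D) (q11 q12 q21 q22 : F) (n : Nsp) : Nsp :=
  let: (x, (be, bh, bf), (ce, ch, cf), (d11, d12, d21, d22)) := n in
  (q22 *: oA O d11 - q21 *: oA O d12 - q12 *: oA O d21 + q11 *: oA O d22,
   (q11 *: oB O d12 - q12 *: oB O d11,
    2^-1 *: (q22 *: oB O d11 - q21 *: oB O d12 + q12 *: oB O d21
             - q11 *: oB O d22),
    q22 *: oB O d21 - q21 *: oB O d22),
   (q22 *: oC O d12 - q12 *: oC O d22,
    2^-1 *: (q22 *: oC O d11 - q12 *: oC O d21 + q21 *: oC O d12
             - q11 *: oC O d22),
    q11 *: oC O d21 - q21 *: oC O d11),
   (q11 *: uA O x + (q11 *: uB O bh + q21 *: uB O be)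
      + (q11 *: uC O ch + q12 *: uC O cf),
    q12 *: uA O x + (q12 *: uB O bh + q22 *: uB O be)
      + (q11 *: uC O ce - q12 *: uC O ch),
    q21 *: uA O x + (q11 *: uB O bf - q21 *: uB O bh)
      + (q21 *: uC O ch + q22 *: uC O cf),
    q22 *: uA O x + (q12 *: uB O bf - q22 *: uB O bh)
      + (q21 *: uC O ce - q22 *: uC O ch))).

(** For traceless P and S with entries [p pe pf] and [s se sf], this is [P, b], [S, c] and P d - d
    S. *)
Definition even_op (p pe pf s se sf : F) (n : Nsp) : Nsp :=
  let: (x, (be, bh, bf), (ce, ch, cf), (d11, d12, d21, d22)) := n in
  (0,
   (2 *: (p *: be - pe *: bh), pe *: bf - pf *: be, 2 *: (pf *: bh - p *: bf)),
   (2 *: (s *: ce - se *: ch), se *: cf - sf *: ce, 2 *: (sf *: ch - s *: cf)),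
   (p *: d11 + pe *: d21 - (s *: d11 + sf *: d12),
    p *: d12 + pe *: d22 - (se *: d11 - s *: d12),
    pf *: d11 - p *: d21 - (s *: d21 + sf *: d22),
    pf *: d12 - p *: d22 - (se *: d21 - s *: d22))).

Definition central_op (Z : zmaps A B C D) (n : Nsp) : Nsp :=
  let: (x, (be, bh, bf), (ce, ch, cf), (d11, d12, d21, d22)) := n in
  (zA Z x, (zB Z be, zB Z bh, zB Z bf), (zC Z ce, zC Z ch, zC Z cf),
   (zD Z d11, zD Z d12, zD Z d21, zD Z d22)).

Local Ltac destruct_N n :=
  case: n => [[[? [[? ?] ?]] [[? ?] ?]] [[[? ?] ?] ?]].

(** The arguments of [even_op] are the traceless parts of q adj(r) and of adj(r) q, the factor of
    [central_op] is the trace of q adj(r): the two sl2-valued pairings and the scalar pairing on the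
    bifundamental representation. *)
Lemma odd_odd O1 O2 Z e q11 q12 q21 q22 r11 r12 r21 r22 n :
  odd_rel O1 O2 Z e ->
  odd_op O1 q11 q12 q21 q22 (odd_op O2 r11 r12 r21 r22 n)
  + odd_op O2 r11 r12 r21 r22 (odd_op O1 q11 q12 q21 q22 n)
  = e *: even_op
      (2^-1 * (q11 * r22 - q12 * r21 + q21 * r12 - q22 * r11))
      (q12 * r11 - q11 * r12) (q21 * r22 - q22 * r21)
      (2^-1 * (r22 * q11 - r12 * q21 + r21 * q12 - r11 * q22))
      (r22 * q12 - r12 * q22) (r11 * q21 - r21 * q11) n
    + (q11 * r22 - q12 * r21 - q21 * r12 + q22 * r11) *: central_op Z n.
Proof.
move=> R; destruct_N n; rewrite /odd_op /even_op /central_op.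
apply: Nsp_eq; simpl;
  vect_norm ltac:(fun _ => rewrite
    ?(rAA R, rAB R, rAC R, rBA R, rCA R, rBB R, rBB' R, rCC R, rCC' R)
    ?(rBC R, rCB R, rDC R, rDC' R, rDA R, rDA' R));
  by field; rewrite ?F2.
Qed.

Lemma even_even p pe pf s se sf p' pe' pf' s' se' sf' n :
  even_op p pe pf s se sf (even_op p' pe' pf' s' se' sf' n)
  - even_op p' pe' pf' s' se' sf' (even_op p pe pf s se sf n)
  = even_op (pe * pf' - pf * pe') (2 * (p * pe' - pe * p'))
      (2 * (pf * p' - p * pf')) (se * sf' - sf * se') (2 * (s * se' - se * s'))
      (2 * (sf * s' - s * sf')) n.
Proof.
destruct_N n; rewrite /even_op; apply: Nsp_eq; simpl; by vect_ring.
Qed.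

Lemma even_odd O p pe pf s se sf q11 q12 q21 q22 n :
  even_op p pe pf s se sf (odd_op O q11 q12 q21 q22 n)
  - odd_op O q11 q12 q21 q22 (even_op p pe pf s se sf n)
  = odd_op O (p * q11 + pe * q21 - (s * q11 + sf * q12))
      (p * q12 + pe * q22 - (se * q11 - s * q12))
      (pf * q11 - p * q21 - (s * q21 + sf * q22))
      (pf * q12 - p * q22 - (se * q21 - s * q22)) n.
Proof.
destruct_N n; rewrite /even_op /odd_op; apply: Nsp_eq; simpl; by vect_field F2.
Qed.

Lemma central_odd O Z q11 q12 q21 q22 n : oz_commute O Z ->
  central_op Z (odd_op O q11 q12 q21 q22 n)
  = odd_op O q11 q12 q21 q22 (central_op Z n).
Proof.
move=> H; destruct_N n; rewrite /central_op /odd_op; apply: Nsp_eq; simpl;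
  by rewrite ?lfun_pushE ?(ozA H, ozB H, ozC H, uzA H, uzB H, uzC H).
Qed.

Lemma central_even Z p pe pf s se sf n :
  central_op Z (even_op p pe pf s se sf n)
  = even_op p pe pf s se sf (central_op Z n).
Proof.
by destruct_N n; rewrite /central_op /even_op; apply: Nsp_eq; simpl;
  rewrite ?lfun_pushE.
Qed.

Lemma central_central Z Z' n : zz_commute Z Z' ->
  central_op Z (central_op Z' n) = central_op Z' (central_op Z n).
Proof.
by move=> [HA HB HC HD]; destruct_N n;
  rewrite /central_op /even_op; apply: Nsp_eq; simpl.
Qed.


Lemma Nsp_lin k x be bh bf ce ch cf d11 d12 d21 d22
    x' be' bh' bf' ce' ch' cf' d11' d12' d21' d22' :
  k *: ((x, (be, bh, bf), (ce, ch, cf), (d11, d12, d21, d22)) : Nsp)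
    + (x', (be', bh', bf'), (ce', ch', cf'), (d11', d12', d21', d22'))
  = (k *: x + x', (k *: be + be', k *: bh + bh', k *: bf + bf'),
     (k *: ce + ce', k *: ch + ch', k *: cf + cf'),
     (k *: d11 + d11', k *: d12 + d12', k *: d21 + d21', k *: d22 + d22')).
Proof. by []. Qed.

Lemma odd_op_linear O q11 q12 q21 q22 : linear (odd_op O q11 q12 q21 q22).
Proof.
move=> k n m; destruct_N n; destruct_N m; rewrite Nsp_lin /odd_op.
apply: Nsp_eq; simpl; by vect_field F2.
Qed.

Lemma even_op_linear p pe pf s se sf : linear (even_op p pe pf s se sf).
Proof.
move=> k n m; destruct_N n; destruct_N m; rewrite Nsp_lin /even_op.
apply: Nsp_eq; simpl; by vect_ring.
Qed.

Lemma central_op_linear Z : linear (central_op Z).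
Proof.
move=> k n m; destruct_N n; destruct_N m; rewrite Nsp_lin /central_op.
apply: Nsp_eq; simpl; by rewrite !lfun_pushE.
Qed.

End ModelOperators.

(** * Constructions of superspaces and of Lie superalgebras *)

Section SuperspaceConstructions.
Variable F : fieldType.

Definition is_even_vs (V : vectType F) (p : bool) : {vspace V} :=
  if p then 0%VS else fullv.

Fact is_even_sum V : (is_even_vs V false + is_even_vs V true = fullv)%VS.
Proof. exact: addv0. Qed.

Fact is_even_cap V : (is_even_vs V false :&: is_even_vs V true = 0)%VS.
Proof. exact: capv0. Qed.

Definition even_space (V : vectType F) : superspace F :=
  SuperSpace (is_even_sum V) (is_even_cap V).

Definition shift_space (V : superspace F) : superspace F.
Proof.
refine (@SuperSpace F V (fun p => part V (~~ p)) _ _).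
- by rewrite addvC part_sum.
- by rewrite capvC part_cap.
Defined.

Section Product.
Variables V W : superspace F.

Fact fst_is_linear : linear (fst : (V * W)%type -> V). Proof. by []. Qed.
Fact snd_is_linear : linear (snd : (V * W)%type -> W). Proof. by []. Qed.

Definition fst_lin : {linear (V * W)%type -> V} :=
  HB.pack (fst : (V * W)%type -> V) (GRing.isLinear.Build F _ _ *:%R _ fst_is_linear).
Definition snd_lin : {linear (V * W)%type -> W} :=
  HB.pack (snd : (V * W)%type -> W) (GRing.isLinear.Build F _ _ *:%R _ snd_is_linear).

Definition prod_part (p : bool) : {vspace (V * W)%type} :=
  (linfun fst_lin @^-1: part V p :&: linfun snd_lin @^-1: part W p)%VS.

Lemma prod_partE p (x : V * W) :
  (x \in prod_part p) = (x.1 \in part V p) && (x.2 \in part W p).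
Proof. by rewrite memv_cap -!memv_preim !lfunE. Qed.

Fact prod_part_sum : (prod_part false + prod_part true = fullv)%VS.
Proof.
apply/eqP; rewrite eqEsubv subvf /=; apply/subvP=> x _; apply/memv_addP.
exists (scomp false x.1, scomp false x.2); first by rewrite prod_partE !scomp_part.
exists (scomp true x.1, scomp true x.2); first by rewrite prod_partE !scomp_part.
by case: x => v w; congr pair; rewrite /= scomp_sum.
Qed.

Fact prod_part_cap : (prod_part false :&: prod_part true = 0)%VS.
Proof.
apply/eqP; rewrite -subv0; apply/subvP=> -[v w].
rewrite memv_cap !prod_partE memv0 /= => /andP[/andP[v0 w0] /andP[v1 w1]].
have : v \in (part V false :&: part V true)%VS by rewrite memv_cap v0.
have : w \in (part W false :&: part W true)%VS by rewrite memv_cap w0.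
by rewrite !part_cap !memv0 => /eqP-> /eqP->.
Qed.

Definition prod_space : superspace F := SuperSpace prod_part_sum prod_part_cap.

Lemma prod_spaceE p (x : prod_space) :
  (x \in part prod_space p) = (x.1 \in part V p) && (x.2 \in part W p).
Proof. exact: prod_partE. Qed.
End Product.

Section Bilinear.
Variables (U V W : vectType F) (f : U -> V -> W).
Hypotheses (fr : forall u, linear (f u)) (fl : forall v, linear (f^~ v)).

Definition bilin_fun (u : U) : 'Hom(V, W) :=
  linfun (HB.pack (f u) (GRing.isLinear.Build F V W *:%R (f u) (fr u))
    : {linear V -> W}).

Lemma bilin_funE u v : bilin_fun u v = f u v.
Proof. by rewrite lfunE. Qed.

Fact bilin_fun_linear : linear bilin_fun.
Proof.
move=> a u u'; apply/lfunP=> v.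
by rewrite add_lfunE scale_lfunE !bilin_funE fl.
Qed.

Definition bilin_lfun : 'Hom(U, 'Hom(V, W)) :=
  linfun (HB.pack bilin_fun
    (GRing.isLinear.Build F U 'Hom(V, W) *:%R bilin_fun bilin_fun_linear)
    : {linear U -> 'Hom(V, W)}).

Lemma bilin_lfunE u v : bilin_lfun u v = f u v.
Proof. by rewrite lfunE bilin_funE. Qed.
End Bilinear.

Section LieFromHomogeneous.
Variables (L : superspace F) (b : 'Hom(L, 'End(L))).
Hypothesis b_part : forall p q x y, x \in part L p -> y \in part L q ->
  b x y \in part L (p (+) q).
Hypothesis b_anti : forall p q x y, x \in part L p -> y \in part L q ->
  b x y = - (ksign F p q *: b y x).
Hypothesis b_jacobi : forall p q r x y z,
  x \in part L p -> y \in part L q -> z \in part L r ->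
  b x (b y z) = b (b x y) z + ksign F p q *: b y (b x z).

Fact jacobi_any p q x y z : x \in part L p -> y \in part L q ->
  b x (b y z) = b (b x y) z + ksign F p q *: b y (b x z).
Proof.
move=> xp yq; rewrite -[z]scomp_sum !lfunD scalerDr.
rewrite (b_jacobi xp yq (scomp_part false z)).
by rewrite (b_jacobi xp yq (scomp_part true z)) addrACA.
Qed.

Definition lie_from_homogeneous : lieSuper F :=
  @LieSuper F L b b_part b_anti jacobi_any.
End LieFromHomogeneous.

End SuperspaceConstructions.

(** * An explicit central extension of sl(2|2) *)

Section Matrices4.
Variable F : fieldType.

Definition j0 : 'I_4 := @Ordinal 4 0 isT.
Definition j1 : 'I_4 := @Ordinal 4 1 isT.
Definition j2 : 'I_4 := @Ordinal 4 2 isT.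
Definition j3 : 'I_4 := @Ordinal 4 3 isT.

Lemma sum4 (V : nmodType) (f : 'I_4 -> V) :
  \sum_i f i = f j0 + f j1 + f j2 + f j3.
Proof.
rewrite !big_ord_recr big_ord0 /= add0r.
by congr (f _ + f _ + f _ + f _); apply: val_inj.
Qed.

Lemma ordI4 (i : 'I_4) : [\/ i = j0, i = j1, i = j2 | i = j3].
Proof.
case: i => [[|[|[|[|//]]]] H]; [constructor 1 | constructor 2 | constructor 3
  | constructor 4]; exact: val_inj.
Qed.

Definition odd_block_zero (A : 'M[F]_4) : Prop :=
  [/\ A j0 j2 = 0, A j0 j3 = 0, A j1 j2 = 0 & A j1 j3 = 0] /\
  [/\ A j2 j0 = 0, A j2 j1 = 0, A j3 j0 = 0 & A j3 j1 = 0].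

Definition even_block_zero (A : 'M[F]_4) : Prop :=
  [/\ A j0 j0 = 0, A j0 j1 = 0, A j1 j0 = 0 & A j1 j1 = 0] /\
  [/\ A j2 j2 = 0, A j2 j3 = 0, A j3 j2 = 0 & A j3 j3 = 0].

Lemma even_mx (A : 'M[F]_4) : A \in mx_part F par22 false -> odd_block_zero A.
Proof. by move/mx_partP=> A0; split; split; apply: A0. Qed.

Lemma odd_mx (A : 'M[F]_4) : A \in mx_part F par22 true -> even_block_zero A.
Proof. by move/mx_partP=> A0; split; split; apply: A0. Qed.

Lemma sl22_trace (x : sl22 F) :
  vsval x j0 j0 = vsval x j2 j2 + vsval x j3 j3 - vsval x j1 j1.
Proof.
have := subvsP x; rewrite sl_vsE /supertrace sum4 /= /par22 /= => /eqP.
rewrite !expr0 !expr1 !mul1r !mulN1r => H; apply/eqP; rewrite -subr_eq0.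
by rewrite -[X in _ == X]H; apply/eqP; ring.
Qed.
End Matrices4.

Section Extension.
Variable F : fieldType.
Local Notation SL := (sl22 F).

(** The polarised determinants of the two off-diagonal blocks (upper right for
    [s = true]) are the cocycles of sl(2|2) that survive besides the one hidden
    in sl(2|2) -> psl(2|2). *)
Definition cocycle (s : bool) (A B : 'M[F]_4) : F :=
  if s then A j0 j2 * B j1 j3 - A j0 j3 * B j1 j2 - A j1 j2 * B j0 j3
            + A j1 j3 * B j0 j2
  else A j2 j0 * B j3 j1 - A j2 j1 * B j3 j0 - A j3 j0 * B j2 j1
       + A j3 j1 * B j2 j0.

Lemma cocycle_evenl s A B : A \in mx_part F par22 false -> cocycle s A B = 0.
Proof. by case: s => /even_mx[[a b c d] [e f g h]]; rewrite /cocycle ?a ?b ?c ?d ?e ?f ?g ?h; ring. Qed.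

Lemma cocycle_sym s A B : cocycle s A B = cocycle s B A.
Proof. by case: s; rewrite /cocycle; ring. Qed.

Lemma cocycle_evenr s A B : B \in mx_part F par22 false -> cocycle s A B = 0.
Proof. by rewrite cocycle_sym; exact: cocycle_evenl. Qed.

Lemma cocycleN s A B : cocycle s A (- B) = - cocycle s A B.
Proof. by case: s; rewrite /cocycle !mxE; ring. Qed.

Definition ext_sp : superspace F :=
  prod_space (prod_space SL (even_space F^o)) (even_space F^o).

Lemma ext_partE p (x : ext_sp) : (x \in part ext_sp p) =
  [&& vsval x.1.1 \in mx_part F par22 p, p ==> (x.1.2 == 0) & p ==> (x.2 == 0)].
Proof.
rewrite !prod_spaceE -andbA; congr [&& _, _ & _].
- exact: sl_partE.
- by case: p; rewrite /= ?memv0 ?memvf.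
- by case: p; rewrite /= ?memv0 ?memvf.
Qed.

Definition ext_bracket (x y : ext_sp) : ext_sp :=
  (br SL x.1.1 y.1.1, cocycle true (vsval x.1.1) (vsval y.1.1),
   cocycle false (vsval x.1.1) (vsval y.1.1)).

Lemma ext_eq (x y : ext_sp) :
  x.1.1 = y.1.1 -> x.1.2 = y.1.2 -> x.2 = y.2 -> x = y.
Proof. by case: x => [[? ?] ?]; case: y => [[? ?] ?] /= -> -> ->. Qed.

Lemma ext_bracket_linear_r x : linear (ext_bracket x).
Proof.
move=> a y z; apply: ext_eq; first exact: linearP.
- by rewrite /= /cocycle !mxE /GRing.scale /=; ring.
- by rewrite /= /cocycle !mxE /GRing.scale /=; ring.
Qed.

Lemma ext_bracket_linear_l y : linear (ext_bracket^~ y).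
Proof.
move=> a x z; apply: ext_eq; first by rewrite /= linearP add_lfunE scale_lfunE.
- by rewrite /= /cocycle !mxE /GRing.scale /=; ring.
- by rewrite /= /cocycle !mxE /GRing.scale /=; ring.
Qed.

Definition ext_br : 'Hom(ext_sp, 'End(ext_sp)) :=
  bilin_lfun ext_bracket_linear_r ext_bracket_linear_l.

Lemma ext_brE x y : ext_br x y = ext_bracket x y.
Proof. exact: bilin_lfunE. Qed.

Lemma br_sl22E p q (x y : SL) :
  vsval x \in mx_part F par22 p -> vsval y \in mx_part F par22 q ->
  vsval (br SL x y) = vsval x *m vsval y - ksign F p q *: (vsval y *m vsval x).
Proof. by move=> xp yq; rewrite sl_brK (mx_bracketE xp yq). Qed.

Lemma cocycle_odd p q s A B : A \in mx_part F par22 p ->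
  B \in mx_part F par22 q -> p (+) q -> cocycle s A B = 0.
Proof.
by case: p q => [] [] //= Ap Bq _; [exact: cocycle_evenr | exact: cocycle_evenl].
Qed.

Fact ext_br_part p q x y : x \in part ext_sp p -> y \in part ext_sp q ->
  ext_br x y \in part ext_sp (p (+) q).
Proof.
rewrite ext_brE !ext_partE => /and3P[xp _ _] /and3P[yq _ _]; apply/and3P; split.
- by rewrite sl_brK mx_bracket_part.
- by apply/implyP=> pq; apply/eqP; exact: (cocycle_odd _ xp yq pq).
- by apply/implyP=> pq; apply/eqP; exact: (cocycle_odd _ xp yq pq).
Qed.

Lemma cocycle_anti p q s A B : A \in mx_part F par22 p ->
  B \in mx_part F par22 q -> cocycle s A B = - (ksign F p q * cocycle s B A).
Proof.
move=> Ap Bq; case pq: (p && q); first by rewrite /ksign pq mulN1r opprK cocycle_sym.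
have H : cocycle s A B = 0.
  case: p q Ap Bq pq => [] [] // Ap Bq _; first exact: cocycle_evenr.
    exact: cocycle_evenl.
  exact: cocycle_evenl.
by rewrite [cocycle s B A]cocycle_sym H mulr0 oppr0.
Qed.

Fact ext_br_anti p q x y : x \in part ext_sp p -> y \in part ext_sp q ->
  ext_br x y = - (ksign F p q *: ext_br y x).
Proof.
rewrite !ext_brE !ext_partE => /and3P[xp _ _] /and3P[yq _ _]; apply: ext_eq.
- by apply: br_anti; rewrite sl_partE.
- exact: cocycle_anti xp yq.
- exact: cocycle_anti xp yq.
Qed.

(** An even element with diagonal blocks X1, X2 sends an upper right block Y to X1 Y - Y X2. This
    changes the polarised determinant by the factor tr X1 - tr X2, the supertrace, which is zero;
    the lower left block gives the opposite factor. *)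
Lemma cocycle_invariant s (x y z : SL) :
  vsval x \in mx_part F par22 false -> vsval y \in mx_part F par22 true ->
  vsval z \in mx_part F par22 true ->
  cocycle s (vsval y) (vsval (br SL x z)) =
    - cocycle s (vsval z) (vsval (br SL x y)).
Proof.
move=> xe yo zo; rewrite (br_sl22E xe yo) (br_sl22E xe zo) /ksign /= expr0 !scale1r.
have tx := sl22_trace x.
have [[x02 x03 x12 x13] [x20 x21 x30 x31]] := even_mx xe.
have [[y00 y01 y10 y11] [y22 y23 y32 y33]] := odd_mx yo.
have [[z00 z01 z10 z11] [z22 z23 z32 z33]] := odd_mx zo.
have entry (T U : 'M[F]_4) i j : (T *m U - U *m T) i j =
  T i j0 * U j0 j + T i j1 * U j1 j + T i j2 * U j2 j + T i j3 * U j3 j -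
  (U i j0 * T j0 j + U i j1 * T j1 j + U i j2 * T j2 j + U i j3 * T j3 j).
  by rewrite !mxE !sum4.
by case: s; rewrite /cocycle !entry
  ?x02 ?x03 ?x12 ?x13 ?x20 ?x21 ?x30 ?x31 ?y00 ?y01 ?y10 ?y11 ?y22 ?y23 ?y32 ?y33
  ?z00 ?z01 ?z10 ?z11 ?z22 ?z23 ?z32 ?z33 ?tx; ring.
Qed.

(** The cocycle vanishes unless both arguments are odd. So only triples with exactly one even
    element matter, and after supersymmetry these are instances of [cocycle_invariant]. *)
Lemma cocycle_jacobi s p q r (x y z : SL) :
  vsval x \in mx_part F par22 p -> vsval y \in mx_part F par22 q ->
  vsval z \in mx_part F par22 r ->
  cocycle s (vsval x) (vsval (br SL y z)) =
    cocycle s (vsval (br SL x y)) (vsval z)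
    + ksign F p q * cocycle s (vsval y) (vsval (br SL x z)).
Proof.
move=> xp yq zr.
have pxy := mx_bracket_part xp yq; have pxz := mx_bracket_part xp zr.
have pyz := mx_bracket_part yq zr; rewrite -!sl_brK in pxy pxz pyz.
rewrite [cocycle s (vsval (br SL x y)) _]cocycle_sym.
have anti p' q' (u v : SL) : vsval u \in mx_part F par22 p' ->
    vsval v \in mx_part F par22 q' ->
    vsval (br SL u v) = - (ksign F p' q' *: vsval (br SL v u)).
  by move=> up vq; rewrite (@br_anti _ SL p' q') ?sl_partE // linearN linearZ.
case: p xp pxy pxz => xp; case: q yq pyz => yq; case: r zr => zr pyz pxy pxz;
  rewrite /ksign /= ?expr0 ?expr1 ?mul1r ?mulN1r.
- by rewrite !cocycle_evenr ?subr0 // addr0.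
- rewrite (cocycle_evenl _ _ _ : cocycle s (vsval z) _ = 0) // add0r.
  rewrite (anti _ _ _ _ yq zr) (anti _ _ _ _ xp zr) /ksign /= expr0 !scale1r.
  by rewrite !cocycleN (cocycle_invariant _ zr xp yq) opprK.
- rewrite (cocycle_evenl _ _ yq) addr0 (anti _ _ _ _ xp yq) /ksign /= scale1r.
  by rewrite cocycleN (cocycle_invariant _ yq xp zr).
- by rewrite (cocycle_evenr _ _ pyz) (cocycle_evenl _ _ zr) (cocycle_evenl _ _ yq) addr0.
- rewrite (cocycle_evenl _ _ xp) (cocycle_invariant _ xp yq zr).
  by rewrite addrN.
- by rewrite (cocycle_evenl _ _ xp) (cocycle_evenl _ _ zr) (cocycle_evenr _ _ pxz) addr0.
- by rewrite (cocycle_evenl _ _ xp) (cocycle_evenr _ _ pxy) (cocycle_evenl _ _ yq) addr0.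
- by rewrite (cocycle_evenl _ _ xp) (cocycle_evenl _ _ zr) (cocycle_evenl _ _ yq) addr0.
Qed.

Fact ext_br_jacobi p q r x y z :
  x \in part ext_sp p -> y \in part ext_sp q -> z \in part ext_sp r ->
  ext_br x (ext_br y z) =
  ext_br (ext_br x y) z + ksign F p q *: ext_br y (ext_br x z).
Proof.
rewrite !ext_brE !ext_partE => /and3P[xp _ _] /and3P[yq _ _] /and3P[zr _ _].
apply: ext_eq.
- by apply: br_jacobi; rewrite sl_partE.
- exact: cocycle_jacobi xp yq zr.
- exact: cocycle_jacobi xp yq zr.
Qed.

Definition ext_lie : lieSuper F :=
  lie_from_homogeneous ext_br_part ext_br_anti ext_br_jacobi.

End Extension.

(** * The model module over the explicit extension *)

Section ModelModule.
Variables (F : fieldType) (A B C D : superspace F).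
Hypothesis F2 : 2 != 0 :> F.

Local Notation OM := (omaps A B C D).
Local Notation ZM := (zmaps A B C D).
Local Notation N := (Nsp A B C D).

Definition odd_map (V W : superspace F) (f : 'Hom(V, W)) : Prop :=
  forall q v, v \in part V q -> f v \in part W (~~ q).

Record omaps_odd (O : OM) : Prop := OmapsOdd {
  odd_oA : odd_map (oA O); odd_oB : odd_map (oB O); odd_oC : odd_map (oC O);
  odd_uA : odd_map (uA O); odd_uB : odd_map (uB O); odd_uC : odd_map (uC O) }.

Record zmaps_even (Z : ZM) : Prop := ZmapsEven {
  even_zA : even_map (zA Z); even_zB : even_map (zB Z);
  even_zC : even_map (zC Z); even_zD : even_map (zD Z) }.

(** The bracket of E13 and E31 contains only half of [one]. Written as a combination so that it can
    enter [zmaps_comb] computations unchanged. *)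
Definition half_zmaps (Z : ZM) : ZM := zmaps_comb 2^-1 0 0 Z Z Z.

(** [O1] stands for the upper right and [O2] for the lower left block. Each anticommutes with itself
    to a central operator, [z1] and [z2]; together they produce the even part and half of [one]. *)
Record model_rel (O1 O2 : OM) (one z1 z2 : ZM) : Prop := ModelRel {
  rel11 : odd_self O1 z1;
  rel12 : odd_rel O1 O2 (half_zmaps one) 1;
  rel22 : odd_self O2 z2;
  rel1o : oz_commute O1 one; rel1z1 : oz_commute O1 z1; rel1z2 : oz_commute O1 z2;
  rel2o : oz_commute O2 one; rel2z1 : oz_commute O2 z1; rel2z2 : oz_commute O2 z2;
  relo1 : zz_commute one z1; relo2 : zz_commute one z2; relz12 : zz_commute z1 z2;
  relO1 : omaps_odd O1; relO2 : omaps_odd O2;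
  relone : zmaps_even one; relz1 : zmaps_even z1; relz2 : zmaps_even z2 }.

Variables (O1 O2 : OM) (one z1 z2 : ZM).

Definition even_mx_op (M : 'M[F]_4) (n : N) : N :=
  even_op (2^-1 * (M j0 j0 - M j1 j1)) (M j0 j1) (M j1 j0)
    (2^-1 * (M j2 j2 - M j3 j3)) (M j2 j3) (M j3 j2) n.

(** The second operator is fed the adjugate of the lower left block, which
    transforms under [sl2 x sl2] like the upper right one. *)
Definition odd_mx_op (M : 'M[F]_4) (n : N) : N :=
  odd_op O1 (M j0 j2) (M j0 j3) (M j1 j2) (M j1 j3) n
  + odd_op O2 (M j3 j1) (- M j2 j1) (- M j3 j0) (M j2 j0) n.

Definition center_op (k s t : F) (n : N) : N :=
  central_op (zmaps_comb k s t one z1 z2) n.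

(** In sl(2|2) both diagonal blocks have the same trace, so an even matrix is a pair of traceless
    blocks plus half that trace times the identity; the identity acts by [one]. *)
Definition ext_op (x : ext_sp F) (n : N) : N :=
  let M := vsval x.1.1 in
  even_mx_op M n + odd_mx_op M n
  + center_op (2^-1 * (M j0 j0 + M j1 j1)) x.1.2 x.2 n.

Lemma even_mx_op_linear M : linear (even_mx_op M).
Proof. exact: even_op_linear. Qed.

Lemma odd_mx_op_linear M : linear (odd_mx_op M).
Proof.
move=> a n m; rewrite /odd_mx_op !(odd_op_linear F2).
by rewrite scalerDr addrACA.
Qed.

Lemma center_op_linear k s t : linear (center_op k s t).
Proof. exact: central_op_linear. Qed.

Local Ltac destruct_N n :=
  case: n => [[[? [[? ?] ?]] [[? ?] ?]] [[[? ?] ?] ?]].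

Lemma central_comb k s t (Z Z' Z'' : ZM) (n : N) :
  central_op (zmaps_comb k s t Z Z' Z'') n =
  k *: central_op Z n + s *: central_op Z' n + t *: central_op Z'' n.
Proof.
destruct_N n; rewrite /central_op; apply: Nsp_eq; simpl;
  by rewrite !add_lfunE !scale_lfunE.
Qed.

Lemma center_opE k s t n : center_op k s t n =
  k *: central_op one n + s *: central_op z1 n + t *: central_op z2 n.
Proof. exact: central_comb. Qed.

Lemma even_mx_op_par n : linear (even_mx_op^~ n).
Proof.
move=> a M M'; rewrite /even_mx_op !mxE; destruct_N n; rewrite /even_op.
apply: Nsp_eq; simpl; by vect_field F2.
Qed.

Lemma odd_mx_op_par n : linear (odd_mx_op^~ n).
Proof.
move=> a M M'; rewrite /odd_mx_op !mxE; destruct_N n; rewrite /odd_op.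
apply: Nsp_eq; simpl; by vect_field F2.
Qed.

Lemma ext_op_par n : linear (ext_op^~ n).
Proof.
move=> a x y; rewrite /ext_op.
have -> : vsval (a *: x + y).1.1 = a *: vsval x.1.1 + vsval y.1.1.
  exact: (linearP (@vsval _ _ (sl_vs F par22)) a x.1.1 y.1.1).
have -> : (a *: x + y).1.2 = a * x.1.2 + y.1.2 by [].
have -> : (a *: x + y).2 = a * x.2 + y.2 by [].
rewrite even_mx_op_par odd_mx_op_par !center_opE !mxE.
move: (even_mx_op _ n) (even_mx_op _ n) (odd_mx_op _ n) (odd_mx_op _ n).
move: (central_op one n) (central_op z1 n) (central_op z2 n) => c1 c2 c3 u v w w'.
by vect_field F2.
Qed.

Lemma ext_op_linear x : linear (ext_op x).
Proof.
move=> a n m; rewrite /ext_op even_mx_op_linear odd_mx_op_linear center_op_linear.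
by vect_ring.
Qed.

Definition ext_act : 'Hom(ext_sp F, 'End(N)) :=
  bilin_lfun ext_op_linear ext_op_par.

Lemma ext_actE x n : ext_act x n = ext_op x n.
Proof. exact: bilin_lfunE. Qed.

Definition space3 (V : superspace F) := prod_space (prod_space V V) V.

Lemma space3_part (V : superspace F) p (v : space3 V) : (v \in part (space3 V) p) =
  [&& v.1.1 \in part V p, v.1.2 \in part V p & v.2 \in part V p].
Proof. by rewrite !prod_spaceE -andbA. Qed.

Definition space4 (V : superspace F) := prod_space (space3 V) V.

Lemma space4_part (V : superspace F) p (v : space4 V) : (v \in part (space4 V) p) =
  [&& v.1.1.1 \in part V p, v.1.1.2 \in part V p, v.1.2 \in part V p
    & v.2 \in part V p].
Proof. by rewrite prod_spaceE space3_part -!andbA. Qed.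

Definition Nspace : superspace F :=
  prod_space (prod_space (prod_space A (space3 B)) (space3 C)) (space4 D).

Definition Nsp_part (p : bool) (n : N) : bool :=
  (((n.1.1.1 \in part A p) &&
    [&& n.1.1.2.1.1 \in part B p, n.1.1.2.1.2 \in part B p & n.1.1.2.2 \in part B p]) &&
    [&& n.1.2.1.1 \in part C p, n.1.2.1.2 \in part C p & n.1.2.2 \in part C p]) &&
    [&& n.2.1.1.1 \in part D p, n.2.1.1.2 \in part D p, n.2.1.2 \in part D p
      & n.2.2 \in part D p].

Lemma Nspace_part p (n : Nspace) : (n \in part Nspace p) = Nsp_part p n.
Proof.
rewrite prod_spaceE; congr andb; last exact: space4_part.
rewrite prod_spaceE; congr andb; last exact: space3_part.
rewrite prod_spaceE; congr andb; exact: space3_part.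
Qed.

Local Ltac mem_tac := repeat first
  [assumption | apply: mem0v | apply: rpredB | apply: rpredD | apply: rpredN
  | apply: rpredZ].

Lemma Nsp_partD p (n m : N) : Nsp_part p n -> Nsp_part p m -> Nsp_part p (n + m).
Proof.
rewrite /Nsp_part; destruct_N n; destruct_N m => /=.
case/andP=> /andP[/andP[? /and3P[? ? ?]] /and3P[? ? ?]] /and4P[? ? ? ?].
case/andP=> /andP[/andP[? /and3P[? ? ?]] /and3P[? ? ?]] /and4P[? ? ? ?].
by do ![apply/andP; split]; mem_tac.
Qed.

Hypothesis R : model_rel O1 O2 one z1 z2.

Lemma even_mx_op_part M p (n : N) : Nsp_part p n ->
  Nsp_part p (even_mx_op M n).
Proof.
rewrite /Nsp_part; destruct_N n => /=.
case/andP=> /andP[/andP[? /and3P[? ? ?]] /and3P[? ? ?]] /and4P[? ? ? ?].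
by do ![apply/andP; split]; mem_tac.
Qed.

Lemma center_op_part k s t p (n : N) : Nsp_part p n ->
  Nsp_part p (center_op k s t n).
Proof.
have [oA' oB' oC' oD'] := relone R; have [aA aB aC aD] := relz1 R.
have [bA bB bC bD] := relz2 R.
rewrite /Nsp_part; destruct_N n => /=; rewrite !add_lfunE !scale_lfunE.
case/andP=> /andP[/andP[? /and3P[? ? ?]] /and3P[? ? ?]] /and4P[? ? ? ?].
by do ![apply/andP; split]; mem_tac;
  rewrite ?(oA', oB', oC', oD', aA, aB, aC, aD, bA, bB, bC, bD).
Qed.

Lemma odd_op_part O q11 q12 q21 q22 p (n : N) : omaps_odd O ->
  Nsp_part p n -> Nsp_part (~~ p) (odd_op O q11 q12 q21 q22 n).
Proof.
move=> [H1 H2 H3 H4 H5 H6]; rewrite /Nsp_part; destruct_N n => /=.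
case/andP=> /andP[/andP[? /and3P[? ? ?]] /and3P[? ? ?]] /and4P[? ? ? ?].
by do ![apply/andP; split]; mem_tac; rewrite ?(H1, H2, H3, H4, H5, H6).
Qed.

Lemma odd_mx_op_part M p (n : N) : Nsp_part p n ->
  Nsp_part (~~ p) (odd_mx_op M n).
Proof.
by move=> np; apply: Nsp_partD; apply: odd_op_part => //; [exact: relO1 R | exact: relO2 R].
Qed.

Lemma ext_op_even x n : x \in part (ext_sp F) false ->
  ext_op x n = even_mx_op (vsval x.1.1) n
    + center_op (2^-1 * (vsval x.1.1 j0 j0 + vsval x.1.1 j1 j1)) x.1.2 x.2 n.
Proof.
rewrite ext_partE => /and3P[/even_mx[[a b c d] [e f g h]] _ _].
rewrite /ext_op /odd_mx_op a b c d e f g h oppr0; congr (_ + _).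
rewrite -[RHS]addr0; congr (_ + _); destruct_N n; rewrite /odd_op.
by apply: Nsp_eq; simpl; vect_field F2.
Qed.

Lemma ext_op_odd x n : x \in part (ext_sp F) true ->
  ext_op x n = odd_mx_op (vsval x.1.1) n.
Proof.
rewrite ext_partE => /and3P[/odd_mx[[a b c d] [e f g h]] /eqP s /eqP t].
rewrite /ext_op /even_mx_op a b c d e f g h s t subr0 addr0 mulr0.
rewrite center_opE !scale0r !addr0 -[RHS]add0r; congr (_ + _).
by destruct_N n; rewrite /even_op; apply: Nsp_eq; simpl; vect_field F2.
Qed.

Lemma even_mx_comm M M' n (MM' := M *m M' - M' *m M) :
  odd_block_zero M -> odd_block_zero M' ->
  even_mx_op M (even_mx_op M' n) - even_mx_op M' (even_mx_op M n)
  = even_mx_op MM' n.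
Proof.
move=> [[a b c d] [e f g h]] [[a' b' c' d'] [e' f' g' h']].
rewrite /even_mx_op even_even {}/MM' !mxE !sum4.
rewrite ?(a, b, c, d, e, f, g, h, a', b', c', d', e', f', g', h').
by congr even_op; field.
Qed.

Lemma even_odd_mx_comm M M' n (MM' := M *m M' - M' *m M) :
  odd_block_zero M -> M j0 j0 = M j2 j2 + M j3 j3 - M j1 j1 ->
  even_block_zero M' ->
  even_mx_op M (odd_mx_op M' n) - odd_mx_op M' (even_mx_op M n)
  = odd_mx_op MM' n.
Proof.
move=> [[a b c d] [e f g h]] tr [[a' b' c' d'] [e' f' g' h']].
rewrite {1}/odd_mx_op -[odd_op O1 _ _ _ _ n]scale1r even_mx_op_linear scale1r.
rewrite {1}/odd_mx_op opprD addrACA /even_mx_op !even_odd // /odd_mx_op.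
rewrite {}/MM' !mxE !sum4.
rewrite ?(a, b, c, d, e, f, g, h, a', b', c', d', e', f', g', h') tr.
by congr (odd_op _ _ _ _ _ _ + odd_op _ _ _ _ _ _); field.
Qed.


End ModelModule.

Section ModelIsModule.
Variables (F : fieldType) (A B C D : superspace F).
Hypothesis F2 : 2 != 0 :> F.
Local Notation OM := (omaps A B C D).
Local Notation ZM := (zmaps A B C D).
Local Notation N := (Nsp A B C D).
Variables (O1 O2 : OM) (one z1 z2 : ZM).
Hypothesis R : model_rel O1 O2 one z1 z2.
Local Notation odd_mx_op := (odd_mx_op O1 O2).
Local Notation center_op := (center_op one z1 z2).
Local Notation ext_op := (ext_op O1 O2 one z1 z2).
Local Ltac destruct_N n :=
  case: n => [[[? [[? ?] ?]] [[? ?] ?]] [[[? ?] ?] ?]].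

Lemma even_op_parD p pe pf s se sf p' pe' pf' s' se' sf' (n : N) :
  even_op p pe pf s se sf n + even_op p' pe' pf' s' se' sf' n =
  even_op (p + p') (pe + pe') (pf + pf') (s + s') (se + se') (sf + sf') n.
Proof.
by destruct_N n; rewrite /even_op; apply: Nsp_eq; simpl; vect_ring.
Qed.

Lemma odd_opD O q11 q12 q21 q22 (n m : N) :
  odd_op O q11 q12 q21 q22 (n + m) =
  odd_op O q11 q12 q21 q22 n + odd_op O q11 q12 q21 q22 m.
Proof. by have := odd_op_linear F2 O q11 q12 q21 q22 1 n m; rewrite !scale1r. Qed.

Lemma oddodd_rearrange (u1 u2 u3 u4 v1 v2 v3 v4 : N) :
  (u1 + u2 + (u3 + u4)) + (v1 + v2 + (v3 + v4)) =
  (u1 + v1) + (u2 + v3) + (v2 + u3) + (u4 + v4).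
Proof. by vect_ring. Qed.

Lemma lincomb3 (k1 k2 k3 l1 l2 l3 : F) (u v w : N) : k1 = l1 -> k2 = l2 ->
  k3 = l3 -> k1 *: u + k2 *: v + k3 *: w = l1 *: u + l2 *: v + l3 *: w.
Proof. by move=> -> -> ->. Qed.

Lemma oddodd_combine (e1 e2 c1 co c2 : N) (k1 k2 k3 k4 : F) :
  k1 *: c1 + (e1 + k3 *: (2^-1 *: co + 0 *: co + 0 *: co))
    + (e2 + k4 *: (2^-1 *: co + 0 *: co + 0 *: co)) + k2 *: c2
  = (e1 + e2) + ((2^-1 * (k3 + k4)) *: co + k1 *: c1 + k2 *: c2).
Proof. by vect_ring. Qed.

(** Sum of four instances of [odd_odd]. The two self-relations have [e = 0] and give the two
    cocycles, the two mixed ones have [e = 1] and give the even part and the multiple of [one]. *)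
Lemma odd_mx_comm M M' n :
  even_block_zero M -> even_block_zero M' ->
  odd_mx_op M (odd_mx_op M' n) + odd_mx_op M' (odd_mx_op M n)
  = even_mx_op (M *m M' + M' *m M) n
    + center_op (2^-1 * ((M *m M' + M' *m M) j0 j0 + (M *m M' + M' *m M) j1 j1))
        (cocycle true M M') (cocycle false M M') n.
Proof.
move=> [[a b c d] [e f g h]] [[a' b' c' d'] [e' f' g' h']].
have R11 := odd_rel_self F2 (rel11 R); have R22 := odd_rel_self F2 (rel22 R).
have E11 := odd_odd F2 (M j0 j2) (M j0 j3) (M j1 j2) (M j1 j3)
  (M' j0 j2) (M' j0 j3) (M' j1 j2) (M' j1 j3) n R11.
have E22 := odd_odd F2 (M j3 j1) (- M j2 j1) (- M j3 j0) (M j2 j0)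
  (M' j3 j1) (- M' j2 j1) (- M' j3 j0) (M' j2 j0) n R22.
have E12 := odd_odd F2 (M j0 j2) (M j0 j3) (M j1 j2) (M j1 j3)
  (M' j3 j1) (- M' j2 j1) (- M' j3 j0) (M' j2 j0) n (rel12 R).
have E21 := odd_odd F2 (M' j0 j2) (M' j0 j3) (M' j1 j2) (M' j1 j3)
  (M j3 j1) (- M j2 j1) (- M j3 j0) (M j2 j0) n (rel12 R).
rewrite !scale0r !add0r in E11 E22; rewrite !scale1r in E12 E21.
rewrite /odd_mx_op !odd_opD.
rewrite oddodd_rearrange E11 E12 E21 E22 {E11 E12 E21 E22}.
rewrite center_opE !central_comb oddodd_combine even_op_parD; congr (_ + _).
  rewrite /even_mx_op !mxE !sum4.
  rewrite ?(a, b, c, d, e, f, g, h, a', b', c', d', e', f', g', h').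
  by congr even_op; field.
apply: lincomb3.
- rewrite !mxE !sum4.
  rewrite ?(a, b, c, d, e, f, g, h, a', b', c', d', e', f', g', h').
  by field.
- by [].
- by rewrite /cocycle; ring.
Qed.

Lemma center_op_commute k s t k' s' t' n :
  center_op k s t (center_op k' s' t' n) = center_op k' s' t' (center_op k s t n).
Proof.
have zzc O (Z Z' : ZM) : zz_commute Z Z' -> central_op Z (central_op Z' O) =
  central_op Z' (central_op Z O) by exact: central_central.
have cD Z k1 k2 k3 (u v w : N) : central_op Z (k1 *: u + k2 *: v + k3 *: w) =
    k1 *: central_op Z u + k2 *: central_op Z v + k3 *: central_op Z w.
  rewrite -addrA central_op_linear -[k2 *: v + _]scale1r -[1 *: _]addr0.
  have c0 : central_op Z (0 : N) = 0.
    by have := central_op_linear Z (-1) 0 0; rewrite scaler0 addr0 scaleN1r addNr.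
  rewrite central_op_linear c0 addr0 scale1r central_op_linear.
  by rewrite -[k3 *: w]addr0 central_op_linear c0 addr0 addrA.
rewrite !center_opE !cD.
rewrite (zzc n _ _ (relo1 R)) (zzc n _ _ (relo2 R)) (zzc n _ _ (relz12 R)).
by vect_ring.
Qed.

Lemma center_odd_commute k s t M n :
  center_op k s t (odd_mx_op M n) = odd_mx_op M (center_op k s t n).
Proof.
have oz i : oz_commute (if i then O1 else O2) (zmaps_comb k s t one z1 z2).
  have comb1 O : oz_commute O one -> oz_commute O z1 -> oz_commute O z2 ->
      oz_commute O (zmaps_comb k s t one z1 z2).
    move=> H1 H2 H3; split=> x /=;
      rewrite !(add_lfunE, scale_lfunE, lfun_pushE);
      by rewrite ?(ozA H1, ozA H2, ozA H3, ozB H1, ozB H2, ozB H3, ozC H1,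
        ozC H2, ozC H3, uzA H1, uzA H2, uzA H3, uzB H1, uzB H2, uzB H3, uzC H1,
        uzC H2, uzC H3).
  by case: i; apply: comb1; case: R.
rewrite /odd_mx_op -[X in center_op _ _ _ (X + _)]scale1r center_op_linear.
rewrite scale1r; congr (_ + _).
  exact: (central_odd _ _ _ _ _ (oz true)).
exact: (central_odd _ _ _ _ _ (oz false)).
Qed.

Lemma center_even_commute k s t M n :
  center_op k s t (even_mx_op M n) = even_mx_op M (center_op k s t n).
Proof. exact: central_even. Qed.

Lemma ext_op_part p q x n : x \in part (ext_sp F) p -> Nsp_part q n ->
  Nsp_part (p (+) q) (ext_op x n).
Proof.
case: p => xp nq.
  by rewrite ext_op_odd //; exact: (odd_mx_op_part R).
rewrite ext_op_even //; apply: Nsp_partD; first exact: even_mx_op_part.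
exact: (center_op_part R).
Qed.

Lemma fun_linearD (f : N -> N) u v : linear f -> f (u + v) = f u + f v.
Proof. by move=> fl; have := fl 1 u v; rewrite !scale1r. Qed.

Lemma odd_mx_opN M n : odd_mx_op (- M) n = - odd_mx_op M n.
Proof.
have H := odd_mx_op_par F2 O1 O2 n.
have H0 : odd_mx_op 0 n = 0.
  by have := H (-1) 0 0; rewrite scaler0 addr0 scaleN1r addNr.
by have := H (-1) M 0; rewrite H0 !addr0 !scaleN1r.
Qed.

Lemma even_even_rearrange (e1 e2 f1 f2 g1 g2 h1 h2 k : N) :
  g1 = k -> h1 = h2 -> g2 = f2 -> e1 - f1 = e2 -> 
  (e1 + g1) + (g2 + h1) - ((f1 + f2) + (k + h2)) = e2.
Proof. by move=> -> -> -> <-; vect_ring. Qed.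

Lemma ext_op_bracket p q x y n :
  x \in part (ext_sp F) p -> y \in part (ext_sp F) q ->
  ext_op (ext_bracket x y) n =
  ext_op x (ext_op y n) - ksign F p q *: ext_op y (ext_op x n).
Proof.
move=> xp yq.
have bp : ext_bracket x y \in part (ext_sp F) (p (+) q).
  by rewrite -ext_brE; exact: ext_br_part.
have xm : vsval x.1.1 \in mx_part F par22 p.
  by move: xp; rewrite ext_partE => /and3P[].
have ym : vsval y.1.1 \in mx_part F par22 q.
  by move: yq; rewrite ext_partE => /and3P[].
have bxy : vsval (ext_bracket x y).1.1 = _ := br_sl22E xm ym.
have tx := sl22_trace x.1.1; have ty := sl22_trace y.1.1.
case: p xp xm bp bxy => xp xm bp bxy; case: q yq ym bp bxy => yq ym bp bxy.
- rewrite (ext_op_even F2 _ _ _ _ _ _ bp) !(ext_op_odd _ _ _ _ _ _ xp).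
  rewrite !(ext_op_odd _ _ _ _ _ _ yq) bxy (_ : ksign F true true = -1) // !scaleN1r !opprK.
  by rewrite odd_mx_comm //; exact: odd_mx.
- rewrite (ext_op_odd _ _ _ _ _ _ bp) !(ext_op_odd _ _ _ _ _ _ xp).
  rewrite !(ext_op_even F2 _ _ _ _ _ _ yq) bxy (_ : ksign F true false = 1) // !scale1r.
  rewrite (fun_linearD _ _ (odd_mx_op_linear F2 _ _ _)) center_odd_commute.
  rewrite opprD addrACA subrr addr0 -[LHS]opprK -odd_mx_opN opprB.
  by rewrite -(even_odd_mx_comm F2) ?opprB //; [exact: even_mx|exact: odd_mx].
- rewrite (ext_op_odd _ _ _ _ _ _ bp) !(ext_op_odd _ _ _ _ _ _ yq).
  rewrite !(ext_op_even F2 _ _ _ _ _ _ xp) bxy (_ : ksign F false true = 1) // !scale1r.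
  rewrite (fun_linearD _ _ (odd_mx_op_linear F2 _ _ _)) center_odd_commute.
  rewrite opprD addrACA subrr addr0.
  by rewrite (even_odd_mx_comm F2) //; [exact: even_mx|exact: odd_mx].
- rewrite (ext_op_even F2 _ _ _ _ _ _ bp) !(ext_op_even F2 _ _ _ _ _ _ xp).
  rewrite !(ext_op_even F2 _ _ _ _ _ _ yq) bxy (_ : ksign F false false = 1) // !scale1r.
  rewrite !(fun_linearD _ _ (even_mx_op_linear _)).
  rewrite !(fun_linearD _ _ (center_op_linear _ _ _ _ _ _)).
  (* A commutator of even matrices has traceless blocks and no cocycle, hence no central term. *)
  have c0 : center_op (2^-1 * ((vsval x.1.1 *m vsval y.1.1 -
      vsval y.1.1 *m vsval x.1.1) j0 j0 + (vsval x.1.1 *m vsval y.1.1 -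
      vsval y.1.1 *m vsval x.1.1) j1 j1)) (ext_bracket x y).1.2
      (ext_bracket x y).2 n = 0.
    have -> : (ext_bracket x y).1.2 = 0 := cocycle_evenl true _ xm.
    have -> : (ext_bracket x y).2 = 0 := cocycle_evenl false _ xm.
    rewrite (_ : 2^-1 * _ = 0) ?center_opE ?scale0r ?addr0 //.
    have [[x02 x03 x12 x13] _] := even_mx xm.
    have [[y02 y03 y12 y13] _] := even_mx ym.
    by rewrite !mxE !sum4 x02 x03 x12 x13 y02 y03 y12 y13; ring.
  rewrite c0 addr0; apply/esym; apply: even_even_rearrange.
  + by rewrite center_even_commute.
  + exact: center_op_commute.
  + exact: center_even_commute.
  + by rewrite (even_mx_comm F2) //; exact: even_mx.
Qed.

Definition ext_module_space : act_space (ext_lie F) :=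
  @ActSpace F (ext_lie F) (Nspace A B C D) (ext_act F2 O1 O2 one z1 z2).

Lemma ext_module_actE x n : act ext_module_space x n = ext_op x n.
Proof. exact: ext_actE. Qed.

Lemma ext_module : lie_module ext_module_space.
Proof.
split=> [p q x m xp mq|p q x y m xp yq].
  move: mq; rewrite ext_module_actE !Nspace_part; exact: ext_op_part.
rewrite !ext_module_actE -(ext_op_bracket _ xp yq); congr (ext_op _ m).
exact: ext_brE.
Qed.

End ModelIsModule.

(** * The model attached to a quiver representation *)

Section BlockMaps.
Variable F : fieldType.

Section Row.
Variables (V W U : vectType F) (f : 'Hom(V, U)) (g : 'Hom(W, U)).
Definition row_fun (x : V * W) : U := f x.1 + g x.2.
Fact row_fun_linear : linear row_fun.
Proof. by move=> a x y; rewrite /row_fun !linearP /=; vect_ring. Qed.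
Definition row_lfun : 'Hom((V * W)%type, U) :=
  linfun (HB.pack row_fun (GRing.isLinear.Build F (V * W)%type U *:%R row_fun
    row_fun_linear) : {linear (V * W)%type -> U}).
Lemma row_lfunE x : row_lfun x = f x.1 + g x.2.
Proof. by rewrite lfunE. Qed.
End Row.

Section Col.
Variables (V W U : vectType F) (f : 'Hom(U, V)) (g : 'Hom(U, W)).
Definition col_fun (x : U) : V * W := (f x, g x).
Fact col_fun_linear : linear col_fun.
Proof. by move=> a x y; rewrite /col_fun !linearP. Qed.
Definition col_lfun : 'Hom(U, (V * W)%type) :=
  linfun (HB.pack col_fun (GRing.isLinear.Build F U (V * W)%type *:%R col_fun
    col_fun_linear) : {linear U -> (V * W)%type}).
Lemma col_lfunE x : col_lfun x = (f x, g x).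
Proof. by rewrite lfunE. Qed.
End Col.

Definition block_lfun (V W V' W' : vectType F) (f11 : 'Hom(V, V'))
    (f12 : 'Hom(W, V')) (f21 : 'Hom(V, W')) (f22 : 'Hom(W, W')) :
    'Hom((V * W)%type, (V' * W')%type) :=
  col_lfun (row_lfun f11 f12) (row_lfun f21 f22).

Lemma block_lfunE (V W V' W' : vectType F) (f11 : 'Hom(V, V'))
    (f12 : 'Hom(W, V')) (f21 : 'Hom(V, W')) (f22 : 'Hom(W, W')) x :
  block_lfun f11 f12 f21 f22 x = (f11 x.1 + f12 x.2, f21 x.1 + f22 x.2).
Proof. by rewrite /block_lfun col_lfunE !row_lfunE. Qed.

End BlockMaps.

Lemma prod_eq (T U : Type) (x y : T * U) : x.1 = y.1 -> x.2 = y.2 -> x = y.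
Proof. by case: x y => [? ?] [? ?] /= -> ->. Qed.

Section ModelRelations.
Variables (F : fieldType) (X1 X2 : vectType F).
Hypothesis F2 : 2 != 0 :> F.
Local Open Scope lfun_scope.
Variables (al ze u1 v1 : 'End(X1)) (ga et u2 v2 : 'End(X2)).
Variables (be : 'Hom(X1, X2)) (de : 'Hom(X2, X1)).
Hypothesis be_al : forall x, be (al x) = ga (be x).
Hypothesis be_ze : forall x, be (ze x) = et (be x).
Hypothesis ze_de : forall x, de (et x) = ze (de x).
Hypothesis al_de : forall x, de (ga x) = al (de x).
Hypothesis al_ze : forall x, ze (al x) = al (ze x).
Hypothesis ga_et : forall x, et (ga x) = ga (et x).
(** [u] is the invertible operator that has to be inverted in order to write
    down the maps from and to the multiplicity space of the trivial module. *)
Hypothesis u1E : forall x, al (ze x) = u1 x - 2 *: x + 2 *: de (be x).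
Hypothesis u2E : forall x, ga (et x) = u2 x - 2 *: x + 2 *: be (de x).
Hypothesis u1K : forall x, v1 (u1 x) = x.
Hypothesis v1K : forall x, u1 (v1 x) = x.
Hypothesis u2K : forall x, v2 (u2 x) = x.
Hypothesis v2K : forall x, u2 (v2 x) = x.

Let half : F := 2^-1.
Local Notation X12 := (X1 * X2)%type.

(** By [u1E] this is 2 + al ze - de be. On a module it corresponds to [wop], the central element
    [zc0] plus the identity. *)
Definition w1 : 'End(X1) := u1 + (de \o be).
Definition w2 : 'End(X2) := u2 + (be \o de).

(** Coordinates on D are normalised by the first family: [oB] is the first projection and [uC] the
    second inclusion. In the second family [uB] and [oC] then become [w1] and [w2]. Coordinates on A
    are normalised so that one diagonal block of [oA] is the identity in each family, at the price
    of the inverses [v1], [v2] in the other block. *)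
Definition model_O1 : omaps X12 X1 X2 X12 :=
  @OMaps F X12 X1 X2 X12
    (block_lfun (al \o v1) 0 (be \o ze \o v1) \1)
    (row_lfun \1 0) (row_lfun (- be) ga)
    (half *: block_lfun u1 0 (- (be \o ze)) ga)
    (col_lfun al be) (col_lfun 0 \1).

Definition model_O2 : omaps X12 X1 X2 X12 :=
  @OMaps F X12 X1 X2 X12
    (block_lfun \1 (al \o de \o v2) 0 (et + (be \o de \o et \o v2)))
    (row_lfun ze (- de)) (row_lfun 0 w2)
    (half *: block_lfun (w1 \o ze) (- (al \o de)) 0 u2)
    (col_lfun w1 0) (col_lfun de et).

Definition scalar_zmaps (f1 : 'End(X1)) (f2 : 'End(X2)) : zmaps X12 X1 X2 X12 :=
  @ZMaps F X12 X1 X2 X12 (block_lfun f1 0 0 f2) f1 f2 (block_lfun f1 0 0 f2).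

Definition model_one := scalar_zmaps (2 *: (w1 - \1)) (2 *: (w2 - \1)).
Definition model_z1 := scalar_zmaps al ga.
(** The second central operator is w times [ze], [et], not these loops themselves: the normalisation
    of D puts the factor here, and [topT] removes it by [winv]. *)
Definition model_z2 := scalar_zmaps (w1 \o ze) (w2 \o et).

(** By [u1E], [u1] is a polynomial in the arrows, so the quiver relations make it commute with the
    loops; the following lemmas are analogous. *)
Lemma al_u1 x : u1 (al x) = al (u1 x).
Proof.
have uE y : u1 y = al (ze y) + 2 *: y - 2 *: de (be y) by rewrite u1E; vect_ring.
by rewrite !uE !lfun_pushE al_ze be_al al_de.
Qed.

Lemma ze_u1 x : u1 (ze x) = ze (u1 x).
Proof.
have uE y : u1 y = al (ze y) + 2 *: y - 2 *: de (be y) by rewrite u1E; vect_ring.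
by rewrite !uE !lfun_pushE -al_ze be_ze ze_de.
Qed.

Lemma ga_u2 x : u2 (ga x) = ga (u2 x).
Proof.
have uE y : u2 y = ga (et y) + 2 *: y - 2 *: be (de y) by rewrite u2E; vect_ring.
by rewrite !uE !lfun_pushE ga_et al_de be_al.
Qed.

Lemma et_u2 x : u2 (et x) = et (u2 x).
Proof.
have uE y : u2 y = ga (et y) + 2 *: y - 2 *: be (de y) by rewrite u2E; vect_ring.
by rewrite !uE !lfun_pushE -ga_et ze_de be_ze.
Qed.

Lemma de_u x : de (u2 x) = u1 (de x).
Proof.
have uE y : u1 y = al (ze y) + 2 *: y - 2 *: de (be y) by rewrite u1E; vect_ring.
have uE' y : u2 y = ga (et y) + 2 *: y - 2 *: be (de y) by rewrite u2E; vect_ring.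
by rewrite uE uE' !lfun_pushE al_de ze_de.
Qed.

Lemma be_u x : be (u1 x) = u2 (be x).
Proof.
have uE y : u1 y = al (ze y) + 2 *: y - 2 *: de (be y) by rewrite u1E; vect_ring.
have uE' y : u2 y = ga (et y) + 2 *: y - 2 *: be (de y) by rewrite u2E; vect_ring.
by rewrite uE uE' !lfun_pushE be_al be_ze.
Qed.

Lemma al_v1 x : v1 (al x) = al (v1 x).
Proof. by rewrite -{1}[x]v1K -al_u1 u1K. Qed.
Lemma ze_v1 x : v1 (ze x) = ze (v1 x).
Proof. by rewrite -{1}[x]v1K -ze_u1 u1K. Qed.
Lemma ga_v2 x : v2 (ga x) = ga (v2 x).
Proof. by rewrite -{1}[x]v2K -ga_u2 u2K. Qed.
Lemma et_v2 x : v2 (et x) = et (v2 x).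
Proof. by rewrite -{1}[x]v2K -et_u2 u2K. Qed.
Lemma de_v x : de (v2 x) = v1 (de x).
Proof. by rewrite -{2}[x]v2K de_u u1K. Qed.
Lemma be_v x : be (v1 x) = v2 (be x).
Proof. by rewrite -{2}[x]v1K be_u u2K. Qed.

(** Normal form: [al], [ze], [u], [v], [de], [be], from the outside in. *)
Local Ltac nf := rewrite /= /w1 /w2;
  repeat (progress rewrite ?(add_lfunE, scale_lfunE, opp_lfunE, comp_lfunE)
    ?(id_lfunE, zero_lfunE) ?(row_lfunE, col_lfunE, block_lfunE) /=);
  repeat (progress rewrite ?lfun_pushE ?(be_al, be_ze, ze_de, al_de, al_ze, ga_et)
    ?(al_u1, ze_u1, ga_u2, et_u2, al_v1, ze_v1, ga_v2, et_v2, de_u, be_u)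
    ?(de_v, be_v) ?(u1E, u2E, u1K, v1K, u2K, v2K)).

Local Ltac model_tac := nf; try apply: prod_eq; nf; rewrite ?/half; vect_field F2.

Lemma model_self1 : odd_self model_O1 model_z1.
Proof. by split=> x; model_tac. Qed.

Lemma model_self2 : odd_self model_O2 model_z2.
Proof. by split=> x; model_tac. Qed.

Lemma model_rel12 : odd_rel model_O1 model_O2 
  (zmaps_comb 2^-1 0 0 model_one model_one model_one) 1.
Proof. by split=> x; model_tac. Qed.

Lemma model_O1_one : oz_commute model_O1 model_one.
Proof. by split=> x; model_tac. Qed.

Lemma model_O1_z1 : oz_commute model_O1 model_z1.
Proof. by split=> x; model_tac. Qed.

Lemma model_O1_z2 : oz_commute model_O1 model_z2.
Proof. by split=> x; model_tac. Qed.

Lemma model_O2_one : oz_commute model_O2 model_one.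
Proof. by split=> x; model_tac. Qed.

Lemma model_O2_z1 : oz_commute model_O2 model_z1.
Proof. by split=> x; model_tac. Qed.

Lemma model_O2_z2 : oz_commute model_O2 model_z2.
Proof. by split=> x; model_tac. Qed.

Lemma model_one_z1 : zz_commute model_one model_z1.
Proof. by split=> x; model_tac. Qed.

Lemma model_one_z2 : zz_commute model_one model_z2.
Proof. by split=> x; model_tac. Qed.

Lemma model_z1_z2 : zz_commute model_z1 model_z2.
Proof. by split=> x; model_tac. Qed.

End ModelRelations.

(** * The Jordan bimodule of a model *)

Section JordanOperators.
Variables (F : fieldType) (A B C D : superspace F).
Hypothesis F2 : 2 != 0 :> F.
Variables (O1 O2 : omaps A B C D) (one z1 z2 : zmaps A B C D).
Hypothesis R : model_rel O1 O2 one z1 z2.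

Local Notation J := 'M[F]_2.
Definition Jspace : superspace F := prod_space (prod_space B D) C.
Local Notation M := (B * D * C)%type.

(** The action of the bracket of [M11_emb a] and [short_f] on a top weight vector of the model, as
    [top_jop] confirms. The idempotent E11 acts by 1, 1/2 and 0 on B, D and C. *)
Definition jop (a : J) (m : M) : M :=
  let: (b, d, c) := m in
  (a 0 0 *: b + 2^-1 *: (a 0 1 *: oB O1 d - a 1 0 *: oB O2 d),
   2^-1 *: ((a 0 0 + a 1 1) *: d + a 0 1 *: (uC O1 c - uB O1 b)
            + a 1 0 *: (uB O2 b - uC O2 c)),
   a 1 1 *: c + 2^-1 *: (a 1 0 *: oC O2 d - a 0 1 *: oC O1 d)).

Lemma sum2 (V : nmodType) (f : 'I_2 -> V) : \sum_i f i = f 0 + f 1.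
Proof.
by rewrite big_ord_recl big_ord_recl big_ord0 addr0; congr (_ + f _); exact: val_inj.
Qed.

Lemma jop_linear a : linear (jop a).
Proof.
move=> k [[b d] c] [[b' d'] c'].
have -> : k *: ((b, d, c) : M) + (b', d', c') = (k *: b + b', k *: d + d', k *: c + c').
  by [].
by rewrite /jop; do 2?apply: prod_eq; simpl; rewrite !lfun_pushE; vect_field F2.
Qed.

Lemma jop_par m : linear (jop^~ m).
Proof.
case: m => [[b d] c] k a a'; rewrite /jop !mxE.
by do 2?apply: prod_eq; simpl; vect_field F2.
Qed.

Definition jact : 'Hom(M11 F, 'End(Jspace)) := bilin_lfun jop_linear jop_par.

Lemma jactE a m : jact a m = jop a m.
Proof. exact: bilin_lfunE. Qed.

Definition jordan_space : act_space (M11 F) := @ActSpace F _ Jspace jact.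

Lemma mx11_even (a : J) : a \in part (M11 F) false -> a 0 1 = 0 /\ a 1 0 = 0.
Proof. by move/mx_partP=> a0; split; apply: a0. Qed.

Lemma mx11_odd (a : J) : a \in part (M11 F) true -> a 0 0 = 0 /\ a 1 1 = 0.
Proof. by move/mx_partP=> a0; split; apply: a0. Qed.

Lemma mx_jordanE p q (a b : J) : a \in part (M11 F) p -> b \in part (M11 F) q ->
  mx_jordan par11 a b = 2^-1 *: (a *m b + ksign F p q *: (b *m a)).
Proof. by move=> ap bq; rewrite /mx_jordan (mx_opp_mulE ap bq). Qed.

Lemma mx_jordan_part p q (a b : J) : a \in part (M11 F) p -> b \in part (M11 F) q ->
  mx_jordan par11 a b \in part (M11 F) (p (+) q).
Proof.
move=> ap bq; rewrite (mx_jordanE ap bq) rpredZ // rpredD //.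
  exact: mulmx_part.
by rewrite rpredZ // addbC; exact: mulmx_part.
Qed.

Lemma ksignC p q : ksign F p q = ksign F q p.
Proof. by rewrite /ksign andbC. Qed.

Lemma ksignK p q : ksign F p q * ksign F p q = 1.
Proof. by rewrite /ksign -signr_addb addbb. Qed.

Lemma mx_jordanC p q (a b : J) : a \in part (M11 F) p -> b \in part (M11 F) q ->
  mx_jordan par11 a b = ksign F p q *: mx_jordan par11 b a.
Proof.
move=> ap bq; rewrite (mx_jordanE ap bq) (mx_jordanE bq ap) (ksignC q p).
rewrite scalerA [_ * 2^-1]mulrC -scalerA; congr (_ *: _).
by rewrite scalerDr scalerA ksignK scale1r addrC.
Qed.

Lemma mx_jordan_entry p q (a b : J) i j :
  a \in part (M11 F) p -> b \in part (M11 F) q ->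
  mx_jordan par11 a b i j = 2^-1 * (a i 0 * b 0 j + a i 1 * b 1 j
    + ksign F p q * (b i 0 * a 0 j + b i 1 * a 1 j)).
Proof. by move=> ap bq; rewrite (mx_jordanE ap bq) !mxE !sum2. Qed.

Let R11 := rel11 R.
Let R12 := rel12 R.
Let R22 := rel22 R.

Local Notation Z12 := (half_zmaps one).

Lemma oz_half O : oz_commute O one -> oz_commute O Z12.
Proof.
move=> H; split=> x; rewrite /= !(add_lfunE, scale_lfunE, lfun_pushE);
  by rewrite ?(ozA H, ozB H, ozC H, uzA H, uzB H, uzC H).
Qed.

Let H1 := oz_half (rel1o R).
Let H2 := oz_half (rel2o R).
Let H11 := rel1z1 R.
Let H12 := rel1z2 R.
Let H21 := rel2z1 R.
Let H22 := rel2z2 R.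

Local Ltac jnf :=
  rewrite ?(sBB R11, sBC R11, sCC R11, sCB R11, sDC R11)
   ?(sBB R22, sBC R22, sCC R22, sCB R22, sDC R22)
   ?(rBB R12, rBB' R12, rBC R12, rCC R12, rCC' R12, rCB R12, rDC R12, rDC' R12).

Local Ltac jz :=
  rewrite ?(ozB H1, ozB H2, ozB H11, ozB H12, ozB H21, ozB H22)
    ?(ozC H1, ozC H2, ozC H11, ozC H12, ozC H21, ozC H22)
    ?(uzB H1, uzB H2, uzB H11, uzB H12, uzB H21, uzB H22)
    ?(uzC H1, uzC H2, uzC H11, uzC H12, uzC H21, uzC H22).

Local Notation jm := (mx_jordan par11).

(** In terms of the halves of the entries the structure constants of the
    action and of the Jordan product are integers. *)
Definition hentry (a : J) i j : F := 2^-1 * a i j.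

Definition jeven (a0 a1 : F) (m : M) : M :=
  let: (b, d, c) := m in (2 * a0 *: b, (a0 + a1) *: d, 2 * a1 *: c).

Definition jodd (x y : F) (m : M) : M :=
  let: (b, d, c) := m in
  (x *: oB O1 d - y *: oB O2 d,
   x *: (uC O1 c - uB O1 b) + y *: (uB O2 b - uC O2 c),
   y *: oC O2 d - x *: oC O1 d).

Lemma jop_even a m : a \in part (M11 F) false ->
  jop a m = jeven (hentry a 0 0) (hentry a 1 1) m.
Proof.
move/mx11_even=> [a01 a10]; case: m => [[b d] c].
by rewrite /jop a01 a10 /jeven /hentry; do 2?apply: prod_eq; simpl; vect_field F2.
Qed.

Lemma jop_odd a m : a \in part (M11 F) true ->
  jop a m = jodd (hentry a 0 1) (hentry a 1 0) m.
Proof.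
move/mx11_odd=> [a00 a11]; case: m => [[b d] c].
by rewrite /jop a00 a11 /jodd /hentry; do 2?apply: prod_eq; simpl; vect_field F2.
Qed.

Lemma jm_ee (a b : J) : a \in part (M11 F) false -> b \in part (M11 F) false ->
  hentry (jm a b) 0 0 = 2 * hentry a 0 0 * hentry b 0 0 /\
  hentry (jm a b) 1 1 = 2 * hentry a 1 1 * hentry b 1 1.
Proof.
move=> a0 b0; rewrite /hentry !(mx_jordan_entry _ _ a0 b0) /ksign /=.
have [-> ->] := mx11_even a0; have [-> ->] := mx11_even b0.
by split; field.
Qed.

Lemma jm_eo (a b : J) : a \in part (M11 F) false -> b \in part (M11 F) true ->
  hentry (jm a b) 0 1 = (hentry a 0 0 + hentry a 1 1) * hentry b 0 1 /\
  hentry (jm a b) 1 0 = (hentry a 0 0 + hentry a 1 1) * hentry b 1 0.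
Proof.
move=> a0 b0; rewrite /hentry !(mx_jordan_entry _ _ a0 b0) /ksign /=.
have [-> ->] := mx11_even a0; have [-> ->] := mx11_odd b0.
by split; field.
Qed.

Lemma jm_oe (a b : J) : a \in part (M11 F) true -> b \in part (M11 F) false ->
  hentry (jm a b) 0 1 = (hentry b 0 0 + hentry b 1 1) * hentry a 0 1 /\
  hentry (jm a b) 1 0 = (hentry b 0 0 + hentry b 1 1) * hentry a 1 0.
Proof.
move=> a0 b0; rewrite /hentry !(mx_jordan_entry _ _ a0 b0) /ksign /=.
have [-> ->] := mx11_odd a0; have [-> ->] := mx11_even b0.
by split; field.
Qed.

Lemma jm_oo (a b : J) : a \in part (M11 F) true -> b \in part (M11 F) true ->
  hentry (jm a b) 0 0 = hentry a 0 1 * hentry b 1 0 - hentry b 0 1 * hentry a 1 0 /\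
  hentry (jm a b) 1 1 = hentry a 1 0 * hentry b 0 1 - hentry b 1 0 * hentry a 0 1.
Proof.
move=> a0 b0; rewrite /hentry !(mx_jordan_entry _ _ a0 b0) /ksign /= expr1.
have [-> ->] := mx11_odd a0; have [-> ->] := mx11_odd b0.
by split; field.
Qed.

Lemma ksign_tt : ksign F true true = -1. Proof. by []. Qed.
Lemma ksign_f p : ksign F false p = 1. Proof. by []. Qed.
Lemma ksign_tf : ksign F true false = 1. Proof. by []. Qed.

Local Ltac pop H := let E := fresh "E" in
  first [have E m := jop_even m H | have E m := jop_odd m H]; rewrite ?E {E}.
Local Ltac entries H H' := first [have [-> ->] := jm_ee H H' | have [-> ->] := jm_eo H H'
  | have [-> ->] := jm_oe H H' | have [-> ->] := jm_oo H H'].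

Local Ltac jstep := rewrite /addb ?(ksign_tt, ksign_f, ksign_tf) ?scaleN1r ?scale1r
    ?opprK /jeven /jodd;
  do 2?apply: prod_eq; simpl;
  repeat match goal with |- context [hentry ?a ?i ?j] => move: (hentry a i j) => ? end;
  vect_norm ltac:(fun _ => jnf; jz); ring.

(** One of the two operator identities to which the Jordan identity of the null split extension
    reduces. In each of the eight parity cases the relations of the model bring all composites to a
    normal form, and a polynomial identity remains. *)
Lemma jordan_left p q r (a b c : J) m :
  a \in part (M11 F) p -> b \in part (M11 F) q -> c \in part (M11 F) r ->
  jop (jm a b) (jop c m) = jop (jm (jm a b) c) m
    + ksign F p (q (+) r) *: jop b (jop c (jop a m))
    + ksign F q r *: jop a (jop c (jop b m))
    - ksign F q r *: jop (jm a c) (jop b m)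
    - ksign F p (q (+) r) *: jop (jm b c) (jop a m).
Proof.
move=> ap bq cr.
have abp := mx_jordan_part ap bq; have acp := mx_jordan_part ap cr.
have bcp := mx_jordan_part bq cr; have abcp := mx_jordan_part abp cr.
case: p ap abp acp abcp => ap abp acp abcp;
case: q bq abp bcp abcp => bq abp bcp abcp;
case: r cr acp bcp abcp => cr acp bcp abcp;
pop abcp; pop abp; pop acp; pop bcp; pop ap; pop bq; pop cr;
entries abp cr; entries ap bq; entries ap cr; entries bq cr;
case: m => [[bb dd] cc]; jstep.
Qed.

Lemma jordan_middle p q s (a b d : J) m :
  a \in part (M11 F) p -> b \in part (M11 F) q -> d \in part (M11 F) s ->
  jop (jm a b) (jop d m) = ksign F (p (+) q) s *: jop d (jop (jm a b) m)
    + ksign F p q *: jop b (jop (jm a d) m) + jop a (jop (jm b d) m)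
    - ksign F p (q (+) s) *: jop (jm b d) (jop a m)
    - ksign F q s *: jop (jm a d) (jop b m).
Proof.
move=> ap bq cr.
have abp := mx_jordan_part ap bq; have acp := mx_jordan_part ap cr.
have bcp := mx_jordan_part bq cr.
case: p ap abp acp => ap abp acp; case: q bq abp bcp => bq abp bcp;
case: s cr acp bcp => cr acp bcp;
pop abp; pop acp; pop bcp; pop ap; pop bq; pop cr;
entries ap bq; entries ap cr; entries bq cr; case: m => [[bb dd] cc]; jstep.
Qed.
End JordanOperators.

Section JordanProduct.
Variable F : fieldType.
Hypothesis F2 : 2 != 0 :> F.
Local Notation J := 'M[F]_2.
Local Notation jm := (mx_jordan par11).

Lemma hentry_eq (x y : J) : (forall i j, hentry x i j = hentry y i j) -> x = y.
Proof.
move=> H; apply/matrixP=> i j.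
by have := H i j; rewrite /hentry; apply: mulfI; rewrite invr_eq0.
Qed.

Lemma hentry_comb_eq (x y z x' y' z' : J) k l k' l' :
  (forall i j, hentry x i j + k * hentry y i j + l * hentry z i j =
     hentry x' i j + k' * hentry y' i j + l' * hentry z' i j) ->
  x + k *: y + l *: z = x' + k' *: y' + l' *: z'.
Proof.
move=> H; apply: hentry_eq => i j; have := H i j; rewrite /hentry !mxE.
by rewrite !mulrDr ![_ * (2^-1 * _)]mulrCA.
Qed.

Lemma hentry_even (x : J) : x \in part (M11 F) false ->
  hentry x 0 1 = 0 /\ hentry x 1 0 = 0.
Proof. by move/mx11_even=> [a b]; rewrite /hentry a b mulr0. Qed.

Lemma hentry_odd (x : J) : x \in part (M11 F) true ->
  hentry x 0 0 = 0 /\ hentry x 1 1 = 0.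
Proof. by move/mx11_odd=> [a b]; rewrite /hentry a b mulr0. Qed.

Lemma ord2E (i : 'I_2) : i = 0 \/ i = 1.
Proof. by case: i => [[|[|//]] H]; [left | right]; exact: val_inj. Qed.

(* The lemma is selected by the syntactic parities and the entries are abstracted
   syntactically, as unification would unfold the matrices. *)
Local Ltac subst_entries :=
  match goal with |- hentry ?x ?i ?j = _ /\ hentry ?y ?k ?l = _ -> _ =>
    generalize (hentry x i j) (hentry y k l) end;
  intros ? ? [-> ->].
Local Ltac ent H H' :=
  lazymatch type of H with
  | context [part _ false] =>
    lazymatch type of H' with
    | context [part _ false] => generalize (jm_ee F2 H H')
    | _ => generalize (jm_eo F2 H H')
    end
  | _ =>
    lazymatch type of H' with
    | context [part _ false] => generalize (jm_oe F2 H H')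
    | _ => generalize (jm_oo F2 H H')
    end
  end; subst_entries.
Local Ltac zer H :=
  lazymatch type of H with
  | context [part _ false] => generalize (hentry_even H)
  | _ => generalize (hentry_odd H)
  end; subst_entries.

(** The linearised Jordan identity in M_{1,1}^+, checked entry by entry in the sixteen parity cases;
    in each case the entries of the products are explicit polynomials. *)
Lemma mx_jordan_identity p q r s (a b c d : J) :
  a \in part (M11 F) p -> b \in part (M11 F) q -> c \in part (M11 F) r ->
  d \in part (M11 F) s ->
  jm (jm a b) (jm c d) + ksign F q r *: jm (jm a c) (jm b d)
    + ksign F (q (+) r) s *: jm (jm a d) (jm b c)
  = jm (jm (jm a b) c) d
    + (ksign F q r * ksign F q s * ksign F r s) *: jm (jm (jm a d) c) b
    + (ksign F p (q (+) r (+) s) * ksign F r s) *: jm (jm (jm b d) c) a.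
Proof.
move=> ap bp cp dp; apply: hentry_comb_eq => i j.
have ab := mx_jordan_part ap bp; have ac := mx_jordan_part ap cp.
have ad := mx_jordan_part ap dp; have bc := mx_jordan_part bp cp.
have bd := mx_jordan_part bp dp; have cd := mx_jordan_part cp dp.
have abc := mx_jordan_part ab cp; have adc := mx_jordan_part ad cp.
have bdc := mx_jordan_part bd cp; have abcd := mx_jordan_part ab cd.
have acbd := mx_jordan_part ac bd; have adbc := mx_jordan_part ad bc.
have abc_d := mx_jordan_part abc dp; have adc_b := mx_jordan_part adc bp.
have bdc_a := mx_jordan_part bdc ap.
case: p ap ab ac ad abc adc abcd acbd adbc abc_d adc_b bdc_a =>
  ap ab ac ad abc adc abcd acbd adbc abc_d adc_b bdc_a;
case: q bp ab bc bd abc bdc abcd acbd adbc abc_d adc_b bdc_a =>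
  bp ab bc bd abc bdc abcd acbd adbc abc_d adc_b bdc_a;
case: r cp ac bc cd abc adc bdc abcd acbd adbc abc_d adc_b bdc_a =>
  cp ac bc cd abc adc bdc abcd acbd adbc abc_d adc_b bdc_a;
case: s dp ad bd cd adc bdc abcd acbd adbc abc_d adc_b bdc_a =>
  dp ad bd cd adc bdc abcd acbd adbc abc_d adc_b bdc_a;
rewrite ?(ksign_tt, ksign_f, ksign_tf) /=;
simpl addb in ab, ac, ad, bc, bd, cd, abc, adc, bdc, abcd, acbd, adbc,
  abc_d, adc_b, bdc_a;
case: (ord2E i) => ->; case: (ord2E j) => ->; zer abcd; zer acbd; zer adbc; zer abc_d; zer adc_b; zer bdc_a;
ent ab cd; ent ac bd; ent ad bc; ent abc dp; ent adc bp; ent bdc ap;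
ent ab cp; ent ad cp; ent bd cp;
ent ap bp; ent ap cp; ent ap dp; ent bp cp; ent bp dp; ent cp dp;
ring.
Qed.

End JordanProduct.

Section SplitIdentity.
Variables (F : fieldType) (J M : superspace F) (L : 'Hom(J, 'End(M))).
Variable mul : J -> J -> J.
Hypothesis mulC : forall p q (a b : J), a \in part J p -> b \in part J q ->
  mul a b = ksign F p q *: mul b a.
Hypothesis L_left : forall p q r (a b c : J) m,
  a \in part J p -> b \in part J q -> c \in part J r ->
  L (mul a b) (L c m) = L (mul (mul a b) c) m
    + ksign F p (q (+) r) *: L b (L c (L a m))
    + ksign F q r *: L a (L c (L b m))
    - ksign F q r *: L (mul a c) (L b m)
    - ksign F p (q (+) r) *: L (mul b c) (L a m).
Hypothesis L_middle : forall p q s (a b d : J) m,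
  a \in part J p -> b \in part J q -> d \in part J s ->
  L (mul a b) (L d m) = ksign F (p (+) q) s *: L d (L (mul a b) m)
    + ksign F p q *: L b (L (mul a d) m) + L a (L (mul b d) m)
    - ksign F p (q (+) s) *: L (mul b d) (L a m)
    - ksign F q s *: L (mul a d) (L b m).

(** The four entries of the linearised Jordan identity being elements of the
    null split extension, [L_left] is used when the one in the bimodule stands
    in an outer position and [L_middle] when it stands in the third. *)
Lemma split_identity p q r s (a b c d : J) (n1 n2 n3 n4 : M) :
  a \in part J p -> b \in part J q -> c \in part J r -> d \in part J s ->
  L (mul a b) (L c n4 + ksign F r s *: L d n3)
    + ksign F (p (+) q) (r (+) s) *:
        L (mul c d) (L a n2 + ksign F p q *: L b n1)
    + ksign F q r *: (L (mul a c) (L b n4 + ksign F q s *: L d n2)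
        + ksign F (p (+) r) (q (+) s) *:
            L (mul b d) (L a n3 + ksign F p r *: L c n1))
    + ksign F (q (+) r) s *: (L (mul a d) (L b n3 + ksign F q r *: L c n2)
        + ksign F (p (+) s) (q (+) r) *:
            L (mul b c) (L a n4 + ksign F p s *: L d n1))
  = L (mul (mul a b) c) n4 + ksign F (p (+) q (+) r) s *:
      L d (L (mul a b) n3 + ksign F (p (+) q) r *:
        L c (L a n2 + ksign F p q *: L b n1))
    + (ksign F q r * ksign F q s * ksign F r s) *:
       (L (mul (mul a d) c) n2 + ksign F (p (+) s (+) r) q *:
          L b (L (mul a d) n3 + ksign F (p (+) s) r *:
            L c (L a n4 + ksign F p s *: L d n1)))
    + (ksign F p (q (+) r (+) s) * ksign F r s) *:
       (L (mul (mul b d) c) n1 + ksign F (q (+) s (+) r) p *: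
          L a (L (mul b d) n3 + ksign F (q (+) s) r *:
            L c (L b n4 + ksign F q s *: L d n2))).
Proof.
move=> ap bq cr ds; have dc := mulC ds cr.
have sw n : L (mul d c) n = ksign F s r *: L (mul c d) n.
  by rewrite dc linearZ scale_lfunE.
vect_push f fP; rewrite (L_left n4 ap bq cr) (L_left n1 bq ds cr).
rewrite (L_left n2 ap ds cr) (L_middle n3 ap bq ds) !sw.
rewrite ?lfunZ ?(formD fP, formZ fP, formN fP).
by case: (p); case: (q); case: (r); case: (s);
  rewrite /addb ?(ksign_tt, ksign_f, ksign_tf); ring.
Qed.
End SplitIdentity.

Section JordanCriterion.
Variables (F : fieldType) (M : act_space (M11 F)).
Hypothesis F2 : 2 != 0 :> F.
Local Notation J := 'M[F]_2.
Local Notation jm := (mx_jordan par11).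
Local Notation L := (act M).

Hypothesis L_part : forall p q (a : J) m, a \in part (M11 F) p ->
  m \in part M q -> L a m \in part M (p (+) q).
Hypothesis L_one : forall m, L 1%:M m = m.
Hypothesis L_left : forall p q r (a b c : J) m,
  a \in part (M11 F) p -> b \in part (M11 F) q -> c \in part (M11 F) r ->
  L (jm a b) (L c m) = L (jm (jm a b) c) m
    + ksign F p (q (+) r) *: L b (L c (L a m))
    + ksign F q r *: L a (L c (L b m))
    - ksign F q r *: L (jm a c) (L b m)
    - ksign F p (q (+) r) *: L (jm b c) (L a m).
Hypothesis L_middle : forall p q s (a b d : J) m,
  a \in part (M11 F) p -> b \in part (M11 F) q -> d \in part (M11 F) s ->
  L (jm a b) (L d m) = ksign F (p (+) q) s *: L d (L (jm a b) m)
    + ksign F p q *: L b (L (jm a d) m) + L a (L (jm b d) m)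
    - ksign F p (q (+) s) *: L (jm b d) (L a m)
    - ksign F q s *: L (jm a d) (L b m).

Lemma split_mulE p q (x y : M11 F * M) : split_par p x -> split_par q y ->
  split_mul x y =
  (jm x.1 y.1, L x.1 y.2 + ksign F p q *: L y.1 x.2).
Proof.
move=> [x1 x2] [y1 y2]; rewrite /split_mul; congr (_, _ + _).
rewrite (bigD1 q) //= [X in _ + X]big1 => [|q' nq].
  rewrite addr0 (bigD1 p) //= [X in _ + X]big1 => [|p' np].
    by rewrite addr0 !scomp_id // ksignC.
  have -> : scomp p' x.2 = 0.
    by rewrite scomp_other //; move: np x2; case: (p); case: p'.
  by rewrite linear0 scaler0.
rewrite big1 // => p' _; have -> : scomp q' y.1 = 0.
  by rewrite scomp_other //; move: nq y1; case: (q); case: q'.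
by rewrite linear0 zero_lfunE scaler0.
Qed.

Lemma split_mul_par p q x y : split_par p x -> split_par q y ->
  split_par (p (+) q) (@split_mul F M x y).
Proof.
move=> xp yq; rewrite (split_mulE xp yq); move: xp yq => [x1 x2] [y1 y2].
split=> /=; first exact: mx_jordan_part.
rewrite rpredD ?L_part // rpredZ // addbC; exact: L_part.
Qed.

Lemma jordan_criterion : unital_jordan_bimodule M.
Proof.
split=> //; split.
- exact: split_mul_par.
- move=> p q x y xp yq; rewrite (split_mulE xp yq) (split_mulE yq xp).
  move: xp yq => [x1 x2] [y1 y2]; apply: prod_eq => /=.
    exact: mx_jordanC.
  by rewrite scalerDr scalerA (ksignC F q p) ksignK scale1r addrC.
move=> p q r s x y z t xp yq zr ts.
have xy := split_mul_par xp yq; have xz := split_mul_par xp zr.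
have xt := split_mul_par xp ts; have yz := split_mul_par yq zr.
have yt := split_mul_par yq ts; have zt := split_mul_par zr ts.
have xyz := split_mul_par xy zr; have xtz := split_mul_par xt zr.
have ytz := split_mul_par yt zr.
rewrite (split_mulE xy zt) (split_mulE xz yt) (split_mulE xt yz).
rewrite (split_mulE xyz ts) (split_mulE xtz yq) (split_mulE ytz xp).
rewrite (split_mulE xy zr) (split_mulE xt zr) (split_mulE yt zr).
rewrite (split_mulE xp yq) (split_mulE xp zr) (split_mulE xp ts).
rewrite (split_mulE yq zr) (split_mulE yq ts) (split_mulE zr ts).
move: xp yq zr ts {xy xz xt yz yt zt xyz xtz ytz}.
case: x y z t => [a n1] [b n2] [c n3] [d n4].
move=> [/= ap n1p] [/= bq n2q] [/= cr n3r] [/= ds n4s].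
apply: prod_eq; simpl; first exact: mx_jordan_identity.
exact: (@split_identity F (M11 F) M (act M) (mx_jordan par11) (@mx_jordanC F)
  L_left L_middle p q r s a b c d n1 n2 n3 n4).
Qed.

End JordanCriterion.

(** * Brackets in the universal central extension *)

Section MatrixUnits.
Variable F : fieldType.
Local Notation SL := (sl22 F).

Definition unit22 (i j : 'I_4) : SL := vsproj (sl_vs F par22) (delta_mx i j).

Definition upar (i j : 'I_4) : bool := par22 i (+) par22 j.

Lemma delta_part (i j : 'I_4) : (delta_mx i j : 'M[F]_4) \in mx_part F par22 (upar i j).
Proof.
apply/mx_partP=> k l kl; rewrite mxE; case: (eqVneq k i) kl => [->|//] kl.
by case: (eqVneq l j) kl => [->|//]; rewrite eqxx.
Qed.

Lemma unit22E i j : i != j -> vsval (unit22 i j) = delta_mx i j.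
Proof.
move=> ij; rewrite vsprojK // sl_vsE /supertrace big1 // => k _.
by rewrite mxE; case: (eqVneq k i) => [->|_]; rewrite ?(negbTE ij) mulr0.
Qed.

Lemma unit22_part i j : i != j -> unit22 i j \in part SL (upar i j).
Proof. by move=> ij; rewrite sl_partE unit22E // delta_part. Qed.

Lemma unit22_br i j k l : i != j -> k != l ->
  vsval (br SL (unit22 i j) (unit22 k l)) =
  delta_mx i l *+ (j == k) - ksign F (upar i j) (upar k l) *: (delta_mx k j *+ (l == i)).
Proof.
move=> ij kl; rewrite sl_brK !unit22E //.
rewrite (mx_bracketE (delta_part i j) (delta_part k l)).
by rewrite !mul_delta_mx_cond.
Qed.

Definition diag22 (d : 'I_4 -> F) : SL :=
  vsproj (sl_vs F par22) (diag_mx (\row_i d i)).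

Lemma diag22E d : d j0 + d j1 = d j2 + d j3 ->
  vsval (diag22 d) = diag_mx (\row_i d i).
Proof.
move=> dd; rewrite vsprojK // sl_vsE /supertrace sum4 !mxE !eqxx !mulr1n /par22 /=.
by rewrite !expr0 !expr1 !mul1r !mulN1r dd; apply/eqP; ring.
Qed.

Lemma diag_part (d : 'rV[F]_4) : diag_mx d \in mx_part F par22 false.
Proof.
apply/mx_partP=> i j ij; rewrite mxE; case: (eqVneq i j) ij => [->|//].
by rewrite addbb.
Qed.

Lemma diag22_br d i j : d j0 + d j1 = d j2 + d j3 -> i != j ->
  br SL (diag22 d) (unit22 i j) = (d i - d j) *: unit22 i j.
Proof.
move=> dd ij; apply: subvs_inj; rewrite linearZ /= sl_brK diag22E // unit22E //.
rewrite (mx_bracketE (diag_part _) (delta_part i j)) /ksign /= expr0 scale1r.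
apply/matrixP=> k l; rewrite mul_diag_mx mul_mx_diag !mxE.
case: (eqVneq k i) => [->|_]; case: (eqVneq l j) => [->|_] /=; ring.
Qed.

Lemma inord4 : [/\ inord 0 = j0, inord 1 = j1, inord 2 = j2 & inord 3 = j3].
Proof. by split; apply: val_inj; rewrite /= inordK. Qed.

End MatrixUnits.

Section CentralExtension.
Variables (F : fieldType) (g : lieSuper F) (p : 'Hom(sl22 F, g)).
Variables (gh : lieSuper F) (pi : 'Hom(gh, g)).
Hypothesis psl_g : is_psl22 p.
Hypothesis pi_ext : central_extension pi.
Hypothesis char0 : forall n, n.+1%:R != 0 :> F.
Local Notation SL := (sl22 F).
Local Notation l := (lift p pi).

Lemma pi_lift A : pi (l A) = p A.
Proof. by rewrite /lift limg_lfunVK //; case: pi_ext => _ -> _; rewrite memvf. Qed.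

Lemma pi_br x y : pi (br gh x y) = br g (pi x) (pi y).
Proof. by case: pi_ext => -[_ H] _ _; apply: H. Qed.

Lemma p_br A B : p (br SL A B) = br g (p A) (p B).
Proof. by case: psl_g => -[_ H] _ _; apply: H. Qed.

Lemma scompD (V : superspace F) q (u v : V) :
  scomp q (u + v) = scomp q u + scomp q v.
Proof. by have := @scomp_linear F V q 1 u v; rewrite !scale1r. Qed.

Lemma scomp0 (V : superspace F) q : scomp q (0 : V) = 0.
Proof. by rewrite scomp_id ?mem0v. Qed.

Lemma even_map_scomp (V W : superspace F) (f : 'Hom(V, W)) q v :
  even_map f -> f (scomp q v) = scomp q (f v).
Proof.
move=> fe; have fv : f v = f (scomp false v) + f (scomp true v).
  by rewrite -lfunD scomp_sum.
rewrite fv scompD.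
have e r : scomp r (f (scomp r v)) = f (scomp r v).
  by rewrite scomp_id // fe // scomp_part.
have z r : scomp r (f (scomp (~~ r) v)) = 0.
  by rewrite scomp_other //; apply: fe; exact: scomp_part.
by case: q; rewrite e ?(z true) ?(z false) ?addr0 ?add0r.
Qed.

Lemma pi_even : even_map pi. Proof. by case: pi_ext => -[]. Qed.

Lemma ker_central k x : pi k = 0 -> br gh k x = 0.
Proof.
move=> k0; case: pi_ext => _ _ /subvP /(_ k); rewrite memv_ker k0 eqxx => /(_ isT).
by rewrite memv_ker => /eqP ->; rewrite zero_lfunE.
Qed.

(** [center] is the left kernel of the bracket. To annihilate from the right, skew-symmetry must be
    applied to homogeneous components, which stay in the kernel because [pi] is even. *)
Lemma br_ker x k : pi k = 0 -> br gh x k = 0.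
Proof.
move=> k0; have kq q : pi (scomp q k) = 0.
  by rewrite (even_map_scomp _ _ pi_even) k0 scomp0.
rewrite -[k]scomp_sum -[x]scomp_sum !linearD /= !add_lfunE.
have z r q : br gh (scomp r x) (scomp q k) = 0.
  by rewrite (br_anti (scomp_part r x) (scomp_part q k)) ker_central ?scaler0 ?oppr0.
by rewrite !z !addr0.
Qed.

(** Makes [br_lift] independent of the lifts, so that it may be computed with the eigenvectors
    [rootv]. *)
Lemma br_indep x x' y y' : pi x = pi x' -> pi y = pi y' -> br gh x y = br gh x' y'.
Proof.
move=> xx yy.
have kx : pi (x - x') = 0 by rewrite lfunD lfunN xx subrr.
have ky : pi (y - y') = 0 by rewrite lfunD lfunN yy subrr.
have := ker_central y kx; have := br_ker x' ky.
rewrite 2!lfunD !lfunN add_lfunE opp_lfunE => /subr0_eq ye /subr0_eq xe.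
by rewrite xe ye.
Qed.

(** A generic diagonal matrix of supertrace zero: 0 + 10 = 3 + 7. This is the only coincidence
    between sums of two of these numbers over disjoint index sets, so brackets of root vectors of
    weight zero occur only for opposite roots and for the pairs giving [zp] or [zn]. *)
Definition tnat (i : 'I_4) : nat := nth 0%N [:: 0; 10; 3; 7]%N i.
Local Notation t i := ((tnat i)%:R : F).

Lemma tnatE : t j0 + t j1 = t j2 + t j3.
Proof. by rewrite -!natrD. Qed.

Lemma natr_neq (m n : nat) : m != n -> m%:R - n%:R != 0 :> F.
Proof.
wlog mn : m n / (m < n)%N => [H|_].
  rewrite neq_ltn => /orP[mn|nm]; first by apply: H => //; rewrite neq_ltn mn.
  by rewrite -opprB oppr_eq0; apply: H => //; rewrite neq_ltn nm.
by rewrite -opprB oppr_eq0 -natrB ?(ltnW mn) // -(subnSK mn) char0.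
Qed.

Definition ht : gh := scomp false (l (diag22 (fun i => t i))).

Lemma ht_even : ht \in part gh false. Proof. exact: scomp_part. Qed.

Lemma pi_ht : pi ht = p (diag22 (fun i => t i)).
Proof.
rewrite even_map_scomp ?pi_lift; last exact: pi_even.
rewrite scomp_id //; case: psl_g => -[pe _] _ _; apply: pe.
by rewrite sl_partE diag22E ?diag_part // tnatE.
Qed.

(** A lift of [A] that is an exact eigenvector for [ht]; for a nonzero weight
    there is at most one, which fixes the central part of the lift. *)
Definition wt (A : SL) (a : F) (v : gh) : Prop :=
  pi v = p A /\ br gh ht v = a *: v.

Lemma wt_uniq A a v w : a != 0 -> wt A a v -> wt A a w -> v = w.
Proof.
move=> a0 [pv hv] [pw hw]; apply/eqP; rewrite -subr_eq0; apply/eqP.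
have : br gh ht (v - w) = 0 by rewrite br_ker // lfunD lfunN pv pw subrr.
rewrite linearB /= hv hw -scalerBr => /eqP.
by rewrite scaler_eq0 (negbTE a0) => /eqP.
Qed.

Lemma wt_br A B a b r v w : v \in part gh r -> wt A a v -> wt B b w ->
  wt (br SL A B) (a + b) (br gh v w).
Proof.
move=> vr [pv hv] [pw hw]; split; first by rewrite pi_br p_br pv pw.
rewrite (br_jacobi w ht_even vr) hv hw /ksign /= expr0 scale1r.
by rewrite !linearZ /= scale_lfunE -scalerDl.
Qed.

Lemma wtZ A a v c : wt A a v -> wt (c *: A) a (c *: v).
Proof. by case=> pv hv; split; rewrite !linearZ /= ?pv ?hv // !scalerA mulrC. Qed.

Lemma wt0 a : wt 0 a 0.
Proof. by split; rewrite ?linear0 ?scaler0. Qed.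

(** Bracketing a lift with [ht] removes its central ambiguity, and division by the weight restores
    the element; the result is an exact eigenvector. For [i = j] the inverse of 0 is 0, so
    [rootv i i = 0]. *)
Definition rootv : 'I_4 -> 'I_4 -> gh := locked (fun i j =>
  (t i - t j)^-1 *: br gh ht (scomp (upar i j) (l (unit22 F i j)))).
Local Notation x := rootv.

Lemma x_part i j : x i j \in part gh (upar i j).
Proof. by rewrite /x -lock rpredZ //; apply: (br_part ht_even); exact: scomp_part. Qed.

Lemma t_neq i j : i != j -> t i - t j != 0.
Proof.
move=> ij; apply: natr_neq; apply: contraNneq ij.
by case: (ordI4 i) => ->; case: (ordI4 j) => ->.
Qed.

Lemma wt_x i j : i != j -> wt (unit22 F i j) (t i - t j) (x i j).
Proof.
move=> ij; rewrite /x -lock; set y := scomp _ _.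
have py : pi y = p (unit22 F i j).
  rewrite even_map_scomp ?pi_lift; last exact: pi_even.
  by rewrite scomp_id //; case: psl_g => -[pe _] _ _; apply: pe; exact: unit22_part.
have ph : pi (br gh ht y) = (t i - t j) *: p (unit22 F i j).
  by rewrite pi_br pi_ht py -p_br diag22_br ?tnatE // linearZ.
split; first by rewrite linearZ /= ph scalerA mulVf ?t_neq // scale1r.
have e : br gh ht (br gh ht y) = (t i - t j) *: br gh ht y.
  by rewrite -[RHS]linearZ /=; apply: br_indep => //; rewrite ph linearZ /= py.
by rewrite linearZ /= e !scalerA mulrC.
Qed.

Lemma x_diag i : x i i = 0.
Proof. by rewrite /x -lock subrr invr0 scale0r. Qed.

Lemma pi_x i j : i != j -> pi (x i j) = p (unit22 F i j).
Proof. by case/wt_x. Qed.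

Lemma unit_br_mid i j k : i != j -> j != k -> i != k ->
  br SL (unit22 F i j) (unit22 F j k) = unit22 F i k.
Proof.
move=> ij jk ik; apply: subvs_inj; rewrite unit22_br // unit22E // eqxx.
by rewrite eq_sym (negbTE ik) mulr0n scaler0 subr0 mulr1n.
Qed.

Lemma unit_br_out i j k : i != j -> k != i -> k != j ->
  br SL (unit22 F i j) (unit22 F k i) =
  - ksign F (upar i j) (upar k i) *: unit22 F k j.
Proof.
move=> ij ki kj; apply: subvs_inj; rewrite unit22_br // linearZ /= unit22E //.
by rewrite eqxx [j == k]eq_sym (negbTE kj) mulr0n add0r mulr1n scalerN scaleNr.
Qed.

Lemma unit_br0 i j k m : i != j -> k != m -> j != k -> m != i ->
  br SL (unit22 F i j) (unit22 F k m) = 0.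
Proof.
move=> ij km jk mi; apply: subvs_inj; rewrite unit22_br //.
by rewrite (negbTE jk) (negbTE mi) !mulr0n scaler0 subr0.
Qed.

(** Both sides lift the same matrix unit and are eigenvectors of [ht] for the same nonzero weight,
    so [wt_uniq] applies. [br_out] and [br_zero] follow the same pattern. *)
Lemma br_mid i j k : i != j -> j != k -> i != k ->
  br gh (x i j) (x j k) = x i k.
Proof.
move=> ij jk ik; have := wt_br (x_part i j) (wt_x ij) (wt_x jk).
by rewrite subrKA unit_br_mid // => H; apply: wt_uniq H (wt_x ik); exact: t_neq.
Qed.

Lemma br_out i j k : i != j -> k != i -> k != j ->
  br gh (x i j) (x k i) = - ksign F (upar i j) (upar k i) *: x k j.
Proof.
move=> ij ki kj; have := wt_br (x_part i j) (wt_x ij) (wt_x ki).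
rewrite unit_br_out // addrC subrKA => H.
by apply: wt_uniq H (wtZ _ (wt_x kj)); exact: t_neq.
Qed.

Lemma br_zero i j k m : i != j -> k != m -> j != k -> m != i ->
  (tnat i + tnat k != tnat j + tnat m)%N -> br gh (x i j) (x k m) = 0.
Proof.
move=> ij km jk mi w; have := wt_br (x_part i j) (wt_x ij) (wt_x km).
rewrite unit_br0 // => H; apply: wt_uniq H (wt0 _).
by rewrite addrACA -opprD -!natrD; exact: natr_neq.
Qed.

Lemma br_diag d v k m : d j0 + d j1 = d j2 + d j3 -> v \in part gh false ->
  pi v = p (diag22 d) -> k != m -> br gh v (x k m) = (d k - d m) *: x k m.
Proof.
move=> dd ve pv km.
have hv : pi (br gh ht v) = 0.
  rewrite pi_br pi_ht pv -p_br; have -> : br SL (diag22 (fun i => t i)) (diag22 d) = 0.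
    apply: subvs_inj; rewrite sl_brK !diag22E ?tnatE // (mx_bracketE (diag_part _) (diag_part _)).
    rewrite /ksign /= expr0 scale1r !mulmx_diag.
    set a := diag_mx _; set b := diag_mx _; have -> : a = b.
      by congr diag_mx; apply/rowP=> i; rewrite !mxE mulrC.
    by rewrite subrr.
  exact: lfun0.
have [px hx] := wt_x km.
have H : wt ((d k - d m) *: unit22 F k m) (t k - t m) (br gh v (x k m)).
  split; first by rewrite pi_br pv px -p_br diag22_br.
  rewrite (br_jacobi _ ht_even ve) (ker_central _ hv) add0r hx /ksign /= expr0 scale1r.
  by rewrite lfunZ.
by apply: wt_uniq H (wtZ _ (wt_x km)); exact: t_neq.
Qed.

Lemma br_sym v w q r : v \in part gh q -> w \in part gh r ->
  br gh w v = - ksign F r q *: br gh v w.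
Proof. by move=> vq wr; rewrite (br_anti wr vq) scaleNr. Qed.

Definition hh1 : gh := br gh (x j0 j1) (x j1 j0).
Definition hh2 : gh := br gh (x j2 j3) (x j3 j2).
Definition zp : gh := br gh (x j0 j2) (x j1 j3).
Definition zn : gh := br gh (x j2 j0) (x j3 j1).
Definition k02 : gh := br gh (x j0 j2) (x j2 j0).
Definition k13 : gh := br gh (x j1 j3) (x j3 j1).
Definition k03 : gh := br gh (x j0 j3) (x j3 j0).
Definition k12 : gh := br gh (x j1 j2) (x j2 j1).
Definition one : gh := k02 + k13.

(** Jacobi identity for [x i j, [x j k, x k i]]. *)
Lemma k_triangle i j k : i != j -> j != k -> i != k ->
  br gh (x i j) (x j i) = br gh (x i k) (x k i)
   - (ksign F (upar i j) (upar j k) * ksign F (upar i j) (upar k i)) *: br gh (x j k) (x k j).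
Proof.
move=> ij jk ik; have ji : j != i by rewrite eq_sym.
have kj : k != j by rewrite eq_sym. have ki : k != i by rewrite eq_sym.
have := br_jacobi (x k i) (x_part i j) (x_part j k).
rewrite (br_mid jk ki ji) (br_mid ij jk ik) (br_out ij ki kj) lfunZ scalerA => ->.
by rewrite mulrN scaleNr.
Qed.

Lemma k02_hh1 : k02 = hh1 + k12.
Proof.
rewrite /k02 /hh1 (@k_triangle j0 j1 j2) // /ksign /upar /par22 /= !expr0 !mulr1 scale1r.
by rewrite subrK.
Qed.

Lemma k03_hh1 : k03 = hh1 + k13.
Proof.
rewrite /k03 /hh1 (@k_triangle j0 j1 j3) // /ksign /upar /par22 /= !expr0 !mulr1 scale1r.
by rewrite subrK.
Qed.

Lemma k02_hh2 : k02 = k03 + hh2.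
Proof.
rewrite /k02 (@k_triangle j0 j2 j3) // /ksign /upar /par22 /= expr0 expr1 mul1r scaleN1r opprK.
by [].
Qed.

Lemma oneE : one = k03 + k12.
Proof. by rewrite /one k02_hh1 k03_hh1 addrAC. Qed.

(** Jacobi identity for x 03, x 32, x 13, in which the bracket of x 03 and x 13 vanishes by its
    weight. *)
Lemma zp_alt : br gh (x j0 j3) (x j1 j2) = - zp.
Proof.
have := br_jacobi (x j1 j3) (x_part j0 j3) (x_part j3 j2).
have -> : br gh (x j3 j2) (x j1 j3) = - x j1 j2.
  by rewrite br_out // /ksign /= expr0 scaleN1r.
rewrite br_mid // (@br_zero j0 j3 j1 j3) // lfun0 scaler0 addr0 lfunN => /eqP.
by rewrite eqr_oppLR => /eqP.
Qed.

Lemma zn_alt : br gh (x j2 j1) (x j3 j0) = - zn.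
Proof.
have := br_jacobi (x j3 j1) (x_part j2 j1) (x_part j1 j0).
have -> : br gh (x j1 j0) (x j3 j1) = - x j3 j0.
  by rewrite br_out // /ksign /= expr0 scaleN1r.
rewrite br_mid // (@br_zero j2 j1 j3 j1) // lfun0 scaler0 addr0 lfunN => /eqP.
by rewrite eqr_oppLR => /eqP.
Qed.

Lemma hh1_even : hh1 \in part gh false. Proof. exact: br_part (x_part _ _) (x_part _ _). Qed.
Lemma hh2_even : hh2 \in part gh false. Proof. exact: br_part (x_part _ _) (x_part _ _). Qed.
Lemma zp_even : zp \in part gh false. Proof. exact: br_part (x_part _ _) (x_part _ _). Qed.
Lemma zn_even : zn \in part gh false. Proof. exact: br_part (x_part _ _) (x_part _ _). Qed.
Lemma one_even : one \in part gh false.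
Proof. by apply: rpredD; exact: br_part (x_part _ _) (x_part _ _). Qed.

Lemma pi_zp : pi zp = 0.
Proof. by rewrite pi_br !pi_x // -p_br unit_br0 // lfun0. Qed.
Lemma pi_zn : pi zn = 0.
Proof. by rewrite pi_br !pi_x // -p_br unit_br0 // lfun0. Qed.


Definition hdiag (a b : 'I_4) (i : 'I_4) : F := (i == a)%:R - (i == b)%:R.

Lemma pi_hh a b : upar a b = false -> a != b ->
  pi (br gh (x a b) (x b a)) = p (diag22 (hdiag a b)).
Proof.
move=> e ab; have ba : b != a by rewrite eq_sym.
rewrite pi_br !pi_x // -p_br; congr (p _); apply: subvs_inj.
have e' : upar b a = false by rewrite /upar addbC.
rewrite unit22_br // !eqxx e e' /ksign /= expr0 scale1r !mulr1n diag22E.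
  apply/matrixP=> i j; rewrite !mxE /hdiag; have [->|ij] := eqVneq i j.
    by rewrite !andbb mulr1n.
  have z c : (i == c) && (j == c) = false.
    by apply/negP=> /andP[/eqP ic /eqP jc]; rewrite ic jc eqxx in ij.
  by rewrite !z mulr0n subrr.
move: e; rewrite /hdiag /upar.
by case: (ordI4 a) => ->; case: (ordI4 b) => -> //= _; rewrite ?subrr ?subr0 ?sub0r ?addr0 ?add0r ?addrN ?addNr.
Qed.

Lemma hh1_x k m : k != m ->
  br gh hh1 (x k m) = (hdiag j0 j1 k - hdiag j0 j1 m) *: x k m.
Proof. by move=> km; apply: br_diag => //; [rewrite /hdiag /=; ring | exact: hh1_even | exact: pi_hh]. Qed.

Lemma hh2_x k m : k != m ->
  br gh hh2 (x k m) = (hdiag j2 j3 k - hdiag j2 j3 m) *: x k m.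
Proof. by move=> km; apply: br_diag => //; [rewrite /hdiag /=; ring | exact: hh2_even | exact: pi_hh]. Qed.

Lemma pi_one : pi one = 0.
Proof.
rewrite lfunD !pi_br !pi_x // -!p_br -lfunD; case: psl_g => _ _ H; apply/H; exists 1.
rewrite linearD /= !unit22_br // !eqxx /ksign /upar /par22 /= !expr1 !scaleN1r !mulr1n !opprK.
apply/matrixP=> i j; rewrite !mxE; case: (ordI4 i) => ->; case: (ordI4 j) => -> /=;
  by rewrite ?addr0 ?add0r.
Qed.


Lemma F2 : 2 != 0 :> F. Proof. exact: char0 1. Qed.

(** The triangle relations form a linear system that expresses the four brackets of opposite odd
    roots through [one], [hh1] and [hh2]. *)
Lemma k02E : k02 = 2^-1 *: (one + hh1 + hh2).
Proof.
apply: (half_eq F2); rewrite {1}k02_hh2 k03_hh1 /one.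
by vect_ring.
Qed.

Lemma k13E : k13 = 2^-1 *: (one - hh1 - hh2).
Proof.
have -> : k13 = one - k02 by rewrite /one addrC addKr.
by rewrite k02E; vect_field F2.
Qed.

Lemma k03E : k03 = 2^-1 *: (one + hh1 - hh2).
Proof. by rewrite k03_hh1 k13E; vect_field F2. Qed.

Lemma k12E : k12 = 2^-1 *: (one - hh1 + hh2).
Proof.
have -> : k12 = one - k03 by rewrite oneE addrC addKr.
by rewrite k03E; vect_field F2.
Qed.

(** Since [rootv i i = 0] the matrix carries twelve effective coefficients. With the other five this
    makes 17 = 14 + 3, the dimensions of psl(2|2) and of the center. *)
Definition gen_comb (c : 'M[F]_4 * 'rV[F]_5) : gh :=
  \sum_i \sum_j c.1 i j *: x i j
  + (c.2 0 (inord 0) *: hh1 + c.2 0 (inord 1) *: hh2 + c.2 0 (inord 2) *: one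
     + c.2 0 (inord 3) *: zp + c.2 0 (inord 4) *: zn).

Fact gen_comb_linear : linear gen_comb.
Proof.
move=> a c d; rewrite /gen_comb [a *: (_ + _)]scalerDr scaler_sumr addrACA -big_split /=; congr (_ + _).
  apply: eq_bigr => i _; rewrite scaler_sumr -big_split; apply: eq_bigr => j _ /=.
  by rewrite !mxE scalerDl scalerA.
by rewrite !mxE; vect_ring.
Qed.

Definition gen_span : {vspace gh} := limg (linfun (HB.pack gen_comb
  (GRing.isLinear.Build F _ gh *:%R gen_comb gen_comb_linear) : {linear ('M[F]_4 * 'rV[F]_5)%type -> gh})).

Lemma gen_spanP v : v \in gen_span -> exists c, v = gen_comb c.
Proof. by case/memv_imgP=> c _ ->; exists c; rewrite lfunE. Qed.

Lemma gen_comb_span c : gen_comb c \in gen_span.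
Proof. by apply/memv_imgP; exists c; rewrite ?memvf ?lfunE. Qed.

Lemma x_span i j : x i j \in gen_span.
Proof.
have := gen_comb_span (delta_mx i j, 0); rewrite /gen_comb /=.
rewrite !mxE !scale0r !addr0 (bigD1 i) //= (bigD1 j) //= !mxE !eqxx scale1r.
rewrite big1 ?addr0 => [|k kj]; last by rewrite mxE (negbTE kj) andbF scale0r.
rewrite big1 ?addr0 // => k ki; rewrite big1 // => m _.
by rewrite mxE (negbTE ki) scale0r.
Qed.

Lemma w_span (a b m n o : F) :
  a *: hh1 + b *: hh2 + m *: one + n *: zp + o *: zn \in gen_span.
Proof.
have := gen_comb_span (0, \row_i nth 0 [:: a; b; m; n; o] i); rewrite /gen_comb /=.
rewrite big1 ?add0r => [|i _]; first by rewrite !mxE !inordK.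
by rewrite big1 // => j _; rewrite mxE scale0r.
Qed.

Lemma hh1_span : hh1 \in gen_span.
Proof. by have := w_span 1 0 0 0 0; rewrite !scale0r scale1r !addr0. Qed.
Lemma hh2_span : hh2 \in gen_span.
Proof. by have := w_span 0 1 0 0 0; rewrite !scale0r scale1r !addr0 add0r. Qed.
Lemma one_span : one \in gen_span.
Proof. by have := w_span 0 0 1 0 0; rewrite !scale0r scale1r !addr0 !add0r. Qed.
Lemma zp_span : zp \in gen_span.
Proof. by have := w_span 0 0 0 1 0; rewrite !scale0r scale1r !addr0 !add0r. Qed.
Lemma zn_span : zn \in gen_span.
Proof. by have := w_span 0 0 0 0 1; rewrite !scale0r scale1r !add0r. Qed.

Lemma k_span i j : i != j -> br gh (x i j) (x j i) \in gen_span.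
Proof.
have kk : [/\ k02 \in gen_span, k13 \in gen_span, k03 \in gen_span & k12 \in gen_span].
  by rewrite k02E k13E k03E k12E; split; apply: rpredZ;
    do 2?[apply: rpredD]; rewrite ?rpredN ?hh1_span ?hh2_span ?one_span.
case: kk => s02 s13 s03 s12.
have sw k m : br gh (x k m) (x m k) \in gen_span -> br gh (x m k) (x k m) \in gen_span.
  by move=> H; rewrite (br_sym (x_part k m) (x_part m k)) rpredZ.
case: (ordI4 i) => ->; case: (ordI4 j) => -> // _;
  first [exact: hh1_span | exact: hh2_span | exact: s02 | exact: s13 | exact: s03
    | exact: s12 | apply: sw; first [exact: hh1_span | exact: hh2_span | exact: s02
    | exact: s13 | exact: s03 | exact: s12]].
Qed.

Lemma br_x_span i j k m : br gh (x i j) (x k m) \in gen_span.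
Proof.
have [->|ij] := eqVneq i j; first by rewrite x_diag lfun0 zero_lfunE mem0v.
have [->|km] := eqVneq k m; first by rewrite x_diag lfun0 mem0v.
have [jk|jk] := eqVneq j k; have [mi|mi] := eqVneq m i.
- by subst; exact: k_span.
- by subst; rewrite br_mid // 1?eq_sym // x_span.
- by subst; rewrite br_out // 1?eq_sym // rpredZ ?x_span.
(* Weight zero without opposite roots: only the pairs for [zp], [zn] and their variants remain. *)
have [w|w] := eqVneq (tnat i + tnat k)%N (tnat j + tnat m)%N; last first.
  by rewrite br_zero // mem0v.
have alt : [/\ br gh (x j0 j3) (x j1 j2) \in gen_span & br gh (x j2 j1) (x j3 j0) \in gen_span].
  by rewrite zp_alt zn_alt !rpredN zp_span zn_span.
case: alt => ap an.
have sw a b c d : br gh (x a b) (x c d) \in gen_span -> br gh (x c d) (x a b) \in gen_span.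
  by move=> H; rewrite (br_sym (x_part a b) (x_part c d)) rpredZ.
move: ij km jk mi w.
case: (ordI4 i) => ->; case: (ordI4 j) => -> //; case: (ordI4 k) => -> //;
  case: (ordI4 m) => -> // _ _ _ _ // _;
  first [exact: zp_span | exact: zn_span | exact: ap | exact: an |
      apply: sw; first [exact: zp_span | exact: zn_span | exact: ap | exact: an]].
Qed.
End CentralExtension.

(** * Perfectness of a universal central extension *)

Section PureSpace.
Variables (F : fieldType) (r : bool) (V : vectType F).

Definition pure_part (q : bool) : {vspace V} := if q == r then fullv else 0%VS.

Fact pure_sum : (pure_part false + pure_part true = fullv)%VS.
Proof. by rewrite /pure_part; case: r => /=; rewrite ?add0v ?addv0. Qed.

Fact pure_cap : (pure_part false :&: pure_part true = 0)%VS.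
Proof. by rewrite /pure_part; case: r => /=; rewrite ?cap0v ?capv0. Qed.

Definition pure_space : superspace F := SuperSpace pure_sum pure_cap.

Lemma pure_self (v : V) : v \in part pure_space r.
Proof. by rewrite /= /pure_part eqxx memvf. Qed.
End PureSpace.

Section TrivialExtension.
Variables (F : fieldType) (L : lieSuper F) (r : bool).
Local Notation V := (prod_space L (pure_space r L)).

(** The second summand is a copy of [L], placed wholly in parity [r] and central. It receives the
    values of linear maps defined on the component of parity [r]. *)
Definition triv_br (u v : V) : V := (br L u.1 v.1, 0).

Fact triv_br_r u : linear (triv_br u).
Proof. by move=> a v w; rewrite /triv_br; apply: prod_eq; rewrite /= ?linearP // scaler0 addr0. Qed.

Fact triv_br_l v : linear (triv_br^~ v).
Proof.
move=> a u w; rewrite /triv_br; apply: prod_eq => /=; last by rewrite scaler0 addr0.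
by rewrite linearP add_lfunE scale_lfunE.
Qed.

Definition triv_lbr := bilin_lfun triv_br_r triv_br_l.

Fact triv_part p q x y : x \in part V p -> y \in part V q ->
  triv_lbr x y \in part V (p (+) q).
Proof.
rewrite bilin_lfunE !prod_spaceE => /andP[x1 _] /andP[y1 _].
by rewrite mem0v (br_part x1 y1).
Qed.

Fact triv_anti p q x y : x \in part V p -> y \in part V q ->
  triv_lbr x y = - (ksign F p q *: triv_lbr y x).
Proof.
rewrite !bilin_lfunE !prod_spaceE => /andP[x1 _] /andP[y1 _].
by apply: prod_eq; rewrite /= ?(br_anti x1 y1) // scaler0 oppr0.
Qed.

Fact triv_jacobi p q x y z : x \in part V p -> y \in part V q ->
  triv_lbr x (triv_lbr y z) =
  triv_lbr (triv_lbr x y) z + ksign F p q *: triv_lbr y (triv_lbr x z).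
Proof.
rewrite !bilin_lfunE !prod_spaceE => /andP[x1 _] /andP[y1 _].
by apply: prod_eq; rewrite /= ?(br_jacobi _ x1 y1) // scaler0 addr0.
Qed.

Definition triv_lie : lieSuper F :=
  @LieSuper F V triv_lbr triv_part triv_anti triv_jacobi.
End TrivialExtension.

Section Universal.
Variables (F : fieldType) (g gh : lieSuper F) (pi : 'Hom(gh, g)).
Hypothesis uce : universal_central_extension pi.

Lemma br_scomp (L : lieSuper F) (S : {vspace L}) :
  (forall x y, br L x y \in S) -> forall q x y, scomp q (br L x y) \in S.
Proof.
move=> bS q x y; rewrite -[x]scomp_sum -[y]scomp_sum.
have H r s : scomp q (br L (scomp r x) (scomp s y)) \in S.
  have := br_part (scomp_part r x) (scomp_part s y).
  have [-> /scomp_id ->|rs rp] := eqVneq q (r (+) s); first exact: bS.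
  rewrite scomp_other ?mem0v //; suff -> : ~~ q = (r (+) s) by [].
  by move: rs; case: (q); case: (_ (+) _).
by rewrite !lfunD !add_lfunE !scompD !rpredD ?H.
Qed.

(** A linear map killing the brackets could be added, with values in an abelian
    summand, to the embedding of [gh] in a trivial central extension. *)
Lemma uce_perfect (S : {vspace gh}) : (forall x y, br gh x y \in S) -> S = fullv.
Proof.
move=> bS; pose q := daddv_pi (S^C)%VS S.
have qS v : v \in S -> q v = 0.
  move=> vS; have := daddv_pi_add (capv_compl S) (w := v).
  rewrite addv_complf memvf => /(_ isT); rewrite (daddv_pi_id (capv_compl S) vS).
  by rewrite -[RHS]addr0 => /addrI.
case: uce => -[[pe pb] psurj pker] U.
have z r v : q (scomp r v) = 0.
  pose E' := triv_lie gh r.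
  pose fl := fst_lin gh (pure_space r gh).
  pose p' : 'Hom(E', g) := (pi \o linfun fl)%VF.
  have p'E (u : E') : p' u = pi u.1 by rewrite comp_lfunE lfunE.
  have cp' : central_extension p'.
    split; first split.
    - by move=> s u; rewrite prod_spaceE p'E => /andP[u1 _]; exact: pe.
    - by move=> u w; rewrite !p'E bilin_lfunE pb.
    - apply/eqP; rewrite eqEsubv subvf -psurj; apply/subvP=> _ /memv_imgP[u _ ->].
      by apply/memv_imgP; exists (u, 0); rewrite ?memvf // p'E.
    - apply/subvP=> u; rewrite !memv_ker p'E => /eqP u0; apply/eqP.
      have : u.1 \in center gh by apply: (subvP pker); rewrite memv_ker u0.
      rewrite memv_ker => /eqP uz.
      by apply/lfunP=> w; rewrite zero_lfunE bilin_lfunE /triv_br uz zero_lfunE.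
  have fl0 : linear (fun v : gh => (v, 0) : E').
    by move=> a u w; apply: prod_eq; rewrite //= scaler0 addr0.
  have fl1 : linear (fun v : gh => (v, q (scomp r v)) : E').
    by move=> a u w; apply: prod_eq; rewrite //= scomp_linear linearP.
  pose f0 := linfun (HB.pack (fun v : gh => (v, 0) : E') (GRing.isLinear.Build F _ E' *:%R _ fl0)
    : {linear gh -> E'}).
  pose f1 := linfun (HB.pack (fun v : gh => (v, q (scomp r v)) : E')
    (GRing.isLinear.Build F _ E' *:%R _ fl1) : {linear gh -> E'}).
  have f0E u : f0 u = (u, 0) by rewrite lfunE.
  have f1E u : f1 u = (u, q (scomp r u)) by rewrite lfunE.
  have [f [fP fU]] := U E' p' cp'.
  have e0 : f = f0.
    apply: fU; split; last by apply/lfunP=> u; rewrite comp_lfunE p'E f0E.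
    split=> [s u us|u w]; first by rewrite f0E prod_spaceE mem0v us.
    by rewrite !f0E bilin_lfunE.
  have e1 : f = f1.
    apply: fU; split; last by apply/lfunP=> u; rewrite comp_lfunE p'E f1E.
    split=> [s u us|u w].
      rewrite f1E prod_spaceE us /=.
      have [<-|sr] := eqVneq s r; first exact: pure_self.
      rewrite scomp_other ?linear0 ?mem0v //; suff <- : s = ~~ r by [].
      by move: sr; case: (s); case: (r).
    rewrite !f1E bilin_lfunE; apply: prod_eq => //=.
    by rewrite qS // br_scomp.
  by have := f1E v; rewrite -e1 e0 f0E => -[].
apply/eqP; rewrite eqEsubv subvf /=; apply/subvP=> v _.
have qv : q v = 0 by rewrite -[v]scomp_sum lfunD !z addr0.
have := daddv_pi_add (etrans (capvC _ _) (capv_compl S)) (w := v).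
rewrite addvC addv_complf memvf => /(_ isT); rewrite -/q qv add0r => <-.
exact: memv_pi.
Qed.
End Universal.

(** * Generators and center of [gh] *)

Section Generation.
Variables (F : fieldType) (g : lieSuper F) (p : 'Hom(sl22 F, g)).
Variables (gh : lieSuper F) (pi : 'Hom(gh, g)).
Hypothesis psl_g : is_psl22 p.
Hypothesis uce : universal_central_extension pi.
Hypothesis char0 : forall n, n.+1%:R != 0 :> F.
Local Notation SL := (sl22 F).
Local Notation x := (rootv p pi).
Local Notation h1 := (hh1 p pi).
Local Notation h2 := (hh2 p pi).
Local Notation zp := (zp p pi).
Local Notation zn := (zn p pi).
Local Notation one := (one p pi).

Let pi_ext : central_extension pi := proj1 uce.
Let F2 := F2 char0.

Lemma supertrace_sl (A : SL) :
  vsval A j0 j0 + vsval A j1 j1 = vsval A j2 j2 + vsval A j3 j3.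
Proof.
have := subvsP A; rewrite sl_vsE /supertrace sum4 /par22 /= !expr0 !expr1 !mul1r !mulN1r.
by move=> /eqP H; apply/eqP; rewrite -subr_eq0 -[X in _ == X]H; apply/eqP; ring.
Qed.

Lemma pi_gen v : exists c : 'M[F]_4, exists a b,
  pi v = pi (\sum_i \sum_j c i j *: x i j + (a *: h1 + b *: h2)).
Proof.
have [A _ ->] : exists2 A, A \in fullv & pi v = p A.
  by apply/memv_imgP; case: psl_g => _ -> _; rewrite memvf.
pose d i := vsval A i i; pose B := A - diag22 d; pose c := vsval B.
have dd : d j0 + d j1 = d j2 + d j3 by exact: supertrace_sl.
have cii i : c i i = 0.
  by rewrite /c linearB /= diag22E // !mxE eqxx mulr1n subrr.
(* The diagonal part is these multiples of E11 - E22 and E33 - E44 plus a scalar matrix, which [p]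
   kills. *)
exists c, (2^-1 * (d j0 - d j1)), (2^-1 * (d j2 - d j3)).
have -> : A = B + diag22 d by rewrite subrK.
have BE : B = \sum_i \sum_j c i j *: unit22 F i j.
  apply: subvs_inj; rewrite linear_sum [LHS]matrix_sum_delta; apply: eq_bigr => i _.
  rewrite linear_sum; apply: eq_bigr => j _; rewrite linearZ /=.
  by have [->|ij] := eqVneq i j; rewrite ?cii ?scale0r // unit22E.
rewrite lfunD [in RHS]lfunD; congr (_ + _).
  rewrite {1}BE !linear_sum; apply: eq_bigr => i _; rewrite !linear_sum; apply: eq_bigr => j _.
  rewrite !linearZ /=; have [->|ij] := eqVneq i j; first by rewrite cii !scale0r.
  by rewrite pi_x.
rewrite lfunD !lfunZ !pi_hh // -!lfunZ -lfunD; apply/eqP; rewrite -subr_eq0 -lfunN -lfunD; apply/eqP.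
case: psl_g => _ _ H; apply/H; exists (2^-1 * (d j0 + d j1)).
have ed : d j3 = d j0 + d j1 - d j2 by rewrite dd addrAC subrr add0r.
rewrite linearB linearD !linearZ /= !diag22E //; try by rewrite /hdiag /=; ring.
apply/matrixP=> i j; rewrite !mxE; case: (eqVneq i j) => [->|_]; rewrite ?mulr0n ?mulr1n; last ring.
rewrite /hdiag; case: (ordI4 j) => ->; rewrite ?eqxx /= ?ed; field; exact: F2.
Qed.

(** Brackets depend only on images under [pi], so by [pi_gen] every bracket is one of combinations
    of root vectors, [hh1] and [hh2]; these stay in the span. Perfectness does the rest. *)
Lemma gen_span_br : gen_span p pi = fullv.
Proof.
apply: (uce_perfect uce) => v w.
have [c [a [b ev]]] := pi_gen v; have [c' [a' [b' ew]]] := pi_gen w.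
rewrite (br_indep pi_ext ev ew).
have closed q c1 a1 b1 : (forall i j, br gh q (x i j) \in gen_span p pi) ->
    br gh q h1 \in gen_span p pi -> br gh q h2 \in gen_span p pi ->
    br gh q (\sum_i \sum_j c1 i j *: x i j + (a1 *: h1 + b1 *: h2)) \in gen_span p pi.
  move=> qx q1 q2; rewrite 2!lfunD !lfunZ linear_sum; do 2?[apply: rpredD]; last 2 first.
  - exact: rpredZ.
  - exact: rpredZ.
  by apply: rpred_sum => i _; rewrite linear_sum; apply: rpred_sum => j _; rewrite /= lfunZ; apply: rpredZ.
have closedl q c1 a1 b1 : (forall i j, br gh (x i j) q \in gen_span p pi) ->
    br gh h1 q \in gen_span p pi -> br gh h2 q \in gen_span p pi ->
    br gh (\sum_i \sum_j c1 i j *: x i j + (a1 *: h1 + b1 *: h2)) q \in gen_span p pi.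
  move=> qx q1 q2; rewrite 2!lfunD !lfunZ !add_lfunE !scale_lfunE linear_sum sum_lfunE.
  do 2?[apply: rpredD]; last 2 first.
  - exact: rpredZ.
  - exact: rpredZ.
  apply: rpred_sum => i _; rewrite linear_sum sum_lfunE; apply: rpred_sum => j _.
  by rewrite /= lfunZ scale_lfunE; apply: rpredZ.
have hx1 i j : br gh h1 (x i j) \in gen_span p pi.
  have [->|ij] := eqVneq i j; first by rewrite x_diag lfun0 mem0v.
  by rewrite (hh1_x psl_g pi_ext char0 ij) rpredZ ?x_span.
have hx2 i j : br gh h2 (x i j) \in gen_span p pi.
  have [->|ij] := eqVneq i j; first by rewrite x_diag lfun0 mem0v.
  by rewrite (hh2_x psl_g pi_ext char0 ij) rpredZ ?x_span.
have sw q r u t : u \in part gh q -> t \in part gh r ->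
    br gh u t \in gen_span p pi -> br gh t u \in gen_span p pi.
  by move=> uq tr H; rewrite (br_sym uq tr) rpredZ.
have e1 := hh1_even p pi; have e2 := hh2_even p pi.
have hk q i j : q \in part gh false -> i != j -> (forall k m, k != m -> exists s, br gh q (x k m) = s *: x k m) ->
    br gh q (br gh (x i j) (x j i)) \in gen_span p pi.
  move=> qe ij H; have ji : j != i by rewrite eq_sym.
  rewrite (br_jacobi _ qe (x_part p pi i j)); case: (H _ _ ij) => s ->; case: (H _ _ ji) => t ->.
  by rewrite !lfunZ scale_lfunE !(rpredD, rpredZ) ?br_x_span.
have H1 k m : k != m -> exists s, br gh h1 (x k m) = s *: x k m.
  by move=> km; exists (hdiag F j0 j1 k - hdiag F j0 j1 m); exact: hh1_x.
have H2 k m : k != m -> exists s, br gh h2 (x k m) = s *: x k m.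
  by move=> km; exists (hdiag F j2 j3 k - hdiag F j2 j3 m); exact: hh2_x.
have e12 : br gh h1 h2 \in gen_span p pi by exact: hk.
apply: closed => [i j||]; apply: closedl => [k m||].
- exact: br_x_span.
- exact: hx1.
- exact: hx2.
- exact: (sw _ _ _ _ e1 (x_part p pi _ _)).
- exact: hk.
- exact: (sw _ _ _ _ e1 e2).
- exact: (sw _ _ _ _ e2 (x_part p pi _ _)).
- exact: e12.
- exact: hk.
Qed.

Lemma gen_combP v : exists c, v = gen_comb p pi c.
Proof. by apply: gen_spanP; rewrite gen_span_br memvf. Qed.

Lemma unit22_comb0 (c : 'M[F]_4) (k : F) :
  vsval (\sum_i \sum_(j | i != j) c i j *: unit22 F i j) = k%:M ->
  forall i j, i != j -> c i j = 0.
Proof.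
move=> H i j ij; pose M : 'M[F]_4 := \matrix_(i, j) (if i != j then c i j else 0).
have eM : M = k%:M.
  rewrite -H [LHS]matrix_sum_delta linear_sum; apply: eq_bigr => a _.
  rewrite /= linear_sum [RHS]big_mkcond; apply: eq_bigr => b _; rewrite mxE.
  by case: ifP => ab; rewrite ?scale0r // linearZ /= unit22E.
by have /matrixP/(_ i j) := eM; rewrite !mxE ij (negbTE ij) mulr0n.
Qed.

Lemma x_neq0 i j : i != j -> x i j != 0.
Proof.
move=> ij; apply/eqP=> x0; have := pi_x psl_g pi_ext char0 ij; rewrite x0 lfun0 => /esym.
case: psl_g => _ _ H /H [k]; rewrite unit22E // => /matrixP /(_ i j) /eqP.
by rewrite !mxE !eqxx (negbTE ij) mulr0n oner_eq0.
Qed.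

Lemma center_ext z : pi z = 0 -> z \in center gh.
Proof.
move=> z0; rewrite memv_ker; apply/eqP/lfunP=> w.
by rewrite (ker_central pi_ext) // zero_lfunE.
Qed.

(** A central element commutes with [ht], which multiplies each root coefficient by a nonzero
    weight; so these coefficients vanish. Commuting with x 01 and x 23 then removes [hh1] and
    [hh2]. *)
Lemma centerP z : z \in center gh -> exists a b c, z = a *: one + b *: zp + c *: zn.
Proof.
rewrite memv_ker => /eqP zc; have {}zc w : br gh z w = 0 by rewrite zc zero_lfunE.
have [[c d] ez] := gen_combP z; rewrite /gen_comb /= in ez.
have cz w : w \in part gh false -> br gh w z = 0.
  move=> we; rewrite -[z]scomp_sum lfunD.
  have H r : br gh w (scomp r z) = - br gh (scomp r z) w.
    by rewrite (br_anti we (scomp_part r z)) /ksign /= expr0 scale1r.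
  by rewrite !H -opprD -add_lfunE -lfunD scomp_sum zc oppr0.
have hth a b : a != b -> br gh (ht p pi) (br gh (x a b) (x b a)) = 0.
  move=> ab; have ba : b != a by rewrite eq_sym.
  have [_ ->] := wt_br psl_g pi_ext (x_part p pi a b) (wt_x psl_g pi_ext char0 ab) (wt_x psl_g pi_ext char0 ba).
  by rewrite subrKA subrr scale0r.
have t0 w : pi w = 0 -> br gh (ht p pi) w = 0 by exact: br_ker.
have c0 i j : i != j -> c i j = 0.
  have := cz _ (ht_even p pi); rewrite {1}ez 5!lfunD !lfunZ.
  rewrite [br gh _ h1]hth // [br gh _ h2]hth // [br gh _ one]t0 ?pi_one //.
  rewrite [br gh _ zp]t0 ?pi_zp // [br gh _ zn]t0 ?pi_zn // !scaler0 !addr0.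
  pose c' : 'M[F]_4 := \matrix_(i, j) (c i j * ((tnat i)%:R - (tnat j)%:R)).
  move=> /(congr1 pi); rewrite lfun0 => H0.
  have : p (\sum_i \sum_(j | i != j) c' i j *: unit22 F i j) = 0.
    rewrite -[RHS]H0 !linear_sum; apply: eq_bigr => k _; rewrite !linear_sum /= big_mkcond.
    apply: eq_bigr => m _; rewrite !lfunZ.
    case: (eqVneq k m) => [->|km] /=; first by rewrite x_diag !lfun0 scaler0.
    have [e1 ->] := wt_x psl_g pi_ext char0 km.
    by rewrite lfunZ e1 scalerA mxE.
  case: psl_g => _ _ H /H [k /unit22_comb0 H1] ij.
  have := H1 i j ij; rewrite mxE => /eqP; rewrite mulf_eq0.
  by rewrite (negbTE (t_neq char0 ij)) orbF => /eqP.
have ez' : z = d 0 (inord 0) *: h1 + d 0 (inord 1) *: h2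
    + (d 0 (inord 2) *: one + d 0 (inord 3) *: zp + d 0 (inord 4) *: zn).
  rewrite {1}ez big1 ?add0r ?addrA // => i _; rewrite big1 // => j _.
  by case: (eqVneq i j) => [->|/c0 ->]; rewrite ?x_diag ?scaler0 ?scale0r.
have cc : pi (d 0 (inord 2) *: one + d 0 (inord 3) *: zp + d 0 (inord 4) *: zn) = 0.
  by rewrite 2!lfunD !lfunZ pi_one // pi_zp // pi_zn // !scaler0 !addr0.
have coef a b (u : F) : a != b -> upar a b = false -> br gh h1 (x a b) = u *: x a b ->
    forall w, br gh h2 (x a b) = w *: x a b ->
    d 0 (inord 0) * u + d 0 (inord 1) * w = 0.
  move=> ab e h1x w h2x.
  have xe : x a b \in part gh false by rewrite -e x_part.
  have := zc (x a b); rewrite ez' 2!lfunD !lfunZ !add_lfunE !scale_lfunE h1x h2x.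
  rewrite (ker_central pi_ext _ cc) addr0 !scalerA -scalerDl => /eqP.
  by rewrite scaler_eq0 (negbTE (x_neq0 ab)) orbF => /eqP.
have n01 : j0 != j1 by []. have n23 : j2 != j3 by [].
have H1 := coef j0 j1 _ n01 (erefl _) (hh1_x psl_g pi_ext char0 n01) _ (hh2_x psl_g pi_ext char0 n01).
have H2 := coef j2 j3 _ n23 (erefl _) (hh1_x psl_g pi_ext char0 n23) _ (hh2_x psl_g pi_ext char0 n23).
rewrite /hdiag /= in H1 H2.
have d0 : d 0 (inord 0) = 0.
  apply: (mulIf F2); rewrite mul0r -[RHS]H1; ring.
have d1 : d 0 (inord 1) = 0.
  apply: (mulIf F2); rewrite mul0r -[RHS]H2; ring.
by rewrite ez' d0 d1 !scale0r !add0r; do 3!eexists.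
Qed.
End Generation.

(** * The short grading of [gh] *)

Section Grading.
Variables (F : fieldType) (g : lieSuper F) (p : 'Hom(sl22 F, g)).
Variables (gh : lieSuper F) (pi : 'Hom(gh, g)).
Hypothesis psl_g : is_psl22 p.
Hypothesis uce : universal_central_extension pi.
Hypothesis char0 : forall n, n.+1%:R != 0 :> F.
Local Notation x := (rootv p pi).
Local Notation h1 := (hh1 p pi).
Local Notation h2 := (hh2 p pi).
Local Notation hs := (short_h p pi).

Let pi_ext : central_extension pi := proj1 uce.
Let F2 := F2 char0.

Definition raise_e : gh := x j0 j1 + x j2 j3.
Definition lower_f : gh := 2^-1 *: (x j1 j0 + x j3 j2).

Lemma EE i j : E F i.+1 j.+1 = unit22 F (inord i) (inord j).
Proof. by []. Qed.

Lemma pi_liftE i j : i != j -> pi (lift p pi (unit22 F i j)) = pi (x i j).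
Proof. by move=> ij; rewrite (pi_lift p pi_ext) pi_x. Qed.

Lemma z_posE : z_pos p pi = zp p pi.
Proof.
have [e0 e1 e2 e3] := inord4.
by rewrite /z_pos /br_lift !EE e0 e1 e2 e3; apply: (br_indep pi_ext); apply: pi_liftE.
Qed.

Lemma z_negE : z_neg p pi = zn p pi.
Proof.
have [e0 e1 e2 e3] := inord4.
by rewrite /z_neg /br_lift !EE e0 e1 e2 e3; apply: (br_indep pi_ext); apply: pi_liftE.
Qed.

Lemma z_oneE : z_one p pi = one p pi.
Proof.
have [e0 e1 e2 e3] := inord4; rewrite /z_one /br_lift !EE e0 e1 e2 e3 /one.
by congr (_ + _); apply: (br_indep pi_ext); apply: pi_liftE.
Qed.

Lemma pi_e : pi (lift p pi (short_e F)) = pi raise_e.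
Proof.
have [e0 e1 e2 e3] := inord4.
by rewrite (pi_lift p pi_ext) /short_e !EE e0 e1 e2 e3 /raise_e !lfunD !pi_x.
Qed.

Lemma pi_f : pi (lift p pi (short_f F)) = pi lower_f.
Proof.
have [e0 e1 e2 e3] := inord4.
by rewrite (pi_lift p pi_ext) /short_f !EE e0 e1 e2 e3 /lower_f !lfunZ !lfunD !pi_x.
Qed.

Lemma short_hE : hs = 2^-1 *: (h1 + h2).
Proof.
rewrite /short_h /br_lift (br_indep pi_ext pi_e pi_f) /raise_e /lower_f lfunZ !lfunD !add_lfunE.
rewrite (@br_zero _ _ p _ pi psl_g pi_ext char0 j0 j1 j3 j2) //.
by rewrite (@br_zero _ _ p _ pi psl_g pi_ext char0 j2 j3 j1 j0) // addr0 add0r.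
Qed.

Lemma br_ef : br gh raise_e lower_f = hs.
Proof. by rewrite /short_h /br_lift (br_indep pi_ext pi_e pi_f). Qed.

Lemma hs_even : hs \in part gh false.
Proof. by rewrite short_hE rpredZ // rpredD ?hh1_even ?hh2_even. Qed.

Lemma e_even : raise_e \in part gh false.
Proof. by apply: rpredD; exact: x_part. Qed.

Lemma f_even : lower_f \in part gh false.
Proof. by apply: rpredZ; apply: rpredD; exact: x_part. Qed.

(** Twice the eigenvalue of h on the i-th basis vector of the natural representation. *)
Definition sdeg (i : 'I_4) : int := nth 0 [:: 1; -1; 1; -1] i.

Lemma hs_x i j : i != j -> br gh hs (x i j) =
  (2^-1 * (sdeg i - sdeg j)%:~R) *: x i j.
Proof.
move=> ij; rewrite short_hE lfunZ lfunD scale_lfunE add_lfunE hh1_x // hh2_x //.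
rewrite -scalerDl scalerA; congr (_ * _ *: _); rewrite rmorphB /= /hdiag /sdeg.
by case: (ordI4 i) => ->; case: (ordI4 j) => ->; rewrite ?eqxx /=; ring.
Qed.

Lemma hs_x1 i j : sdeg i = 1 -> sdeg j = - 1 -> br gh hs (x i j) = x i j.
Proof.
move=> di dj; rewrite hs_x; last by apply/eqP=> ij; rewrite ij dj in di.
by rewrite di dj opprK mulVf ?scale1r // F2.
Qed.

Lemma hs_xN i j : sdeg i = -1 -> sdeg j = 1 -> br gh hs (x i j) = - x i j.
Proof.
move=> di dj; rewrite hs_x; last by apply/eqP=> ij; rewrite ij dj in di.
by rewrite di dj (_ : (-1 - 1 : int) = - (2%:Z)) // rmorphN /= mulrN mulVf ?scaleN1r // F2.
Qed.

Lemma hs_x0 i j : sdeg i = sdeg j -> br gh hs (x i j) = 0.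
Proof.
have [->|ij] := eqVneq i j; first by rewrite x_diag lfun0.
by move=> d; rewrite hs_x // d subrr mulr0 scale0r.
Qed.

Lemma br_he : br gh hs raise_e = raise_e.
Proof. by rewrite lfunD !hs_x1. Qed.

Lemma br_hf : br gh hs lower_f = - lower_f.
Proof. by rewrite lfunZ lfunD !hs_xN // -opprD scalerN. Qed.

Lemma jordan_brE (a : M11 F) : br_lift p pi (M11_emb a) (short_f F) =
  (a : 'M_2) 0 0 *: (2^-1 *: h1) + (a : 'M_2) 1 1 *: (2^-1 *: h2)
  + (a : 'M_2) 0 1 *: (2^-1 *: (x j0 j2 - x j1 j3))
  + (a : 'M_2) 1 0 *: (2^-1 *: (x j2 j0 - x j3 j1)).
Proof.
have [e0 e1 e2 e3] := inord4.
have pa : pi (lift p pi (M11_emb a)) = pi ((a : 'M_2) 0 0 *: x j0 j1 + (a : 'M_2) 0 1 *: x j0 j3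
  + (a : 'M_2) 1 0 *: x j2 j1 + (a : 'M_2) 1 1 *: x j2 j3).
  by rewrite (pi_lift p pi_ext) /M11_emb !EE e0 e1 e2 e3 !lfunD !lfunZ !pi_x.
rewrite /br_lift (br_indep pi_ext pa pi_f) 3!lfunD !lfunZ !add_lfunE !scale_lfunE !lfunD.
have bz := @br_zero _ _ p _ pi psl_g pi_ext char0; have bo := @br_out _ _ p _ pi psl_g pi_ext char0.
have bm := @br_mid _ _ p _ pi psl_g pi_ext char0.
rewrite (bz j0 j1 j3 j2) // (bz j2 j3 j1 j0) // (bo j0 j3 j1) // (bm j0 j3 j2) //.
rewrite (bm j2 j1 j0) // (bo j2 j1 j3) // /ksign /upar /par22 /= !expr0 !scaleN1r addr0 add0r.
rewrite -/h1 -/h2; move: h1 h2 => u v; move: ((a : 'M_2) 0 0) ((a : 'M_2) 0 1)  => s t.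
by move: ((a : 'M_2) 1 0) ((a : 'M_2) 1 1) => s' t'; vect_ring.
Qed.

Lemma gh_grading v : exists a b c, [/\ v = a + b + c, br gh hs a = a, br gh hs c = - c &
  exists k : 'I_9 -> F, b = k 0 *: x j0 j2 + k 1 *: x j1 j3 + k 2 *: x j2 j0 + k 3 *: x j3 j1
     + (k 4 *: h1 + k 5 *: h2 + k 6 *: one p pi + k 7 *: zp p pi + k 8 *: zn p pi)].
Proof.
have [[c d] ->] := gen_combP psl_g uce char0 v; rewrite /gen_comb /=.
exists (c j0 j1 *: x j0 j1 + c j0 j3 *: x j0 j3 + c j2 j1 *: x j2 j1 + c j2 j3 *: x j2 j3).
exists (c j0 j2 *: x j0 j2 + c j1 j3 *: x j1 j3 + c j2 j0 *: x j2 j0 + c j3 j1 *: x j3 j1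
  + (d 0 (inord 0) *: h1 + d 0 (inord 1) *: h2 + d 0 (inord 2) *: one p pi
     + d 0 (inord 3) *: zp p pi + d 0 (inord 4) *: zn p pi)).
exists (c j1 j0 *: x j1 j0 + c j1 j2 *: x j1 j2 + c j3 j0 *: x j3 j0 + c j3 j2 *: x j3 j2).
split.
- rewrite !sum4 !x_diag !scaler0 addrA; set w := _ + _ *: zn p pi; move: w => w.
  by vect_ring.
- by rewrite 3!lfunD !lfunZ !hs_x1.
- by rewrite 3!lfunD !lfunZ !hs_xN // !scalerN !opprD.
exists (fun i => nth 0 [:: c j0 j2; c j1 j3; c j2 j0; c j3 j1; d 0 (inord 0); d 0 (inord 1); d 0 (inord 2); d 0 (inord 3); d 0 (inord 4)] i).
by [].
Qed.
End Grading.

(** * From the universal to the explicit extension *)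

Section ExplicitExtension.
Variables (F : fieldType) (g : lieSuper F) (p : 'Hom(sl22 F, g)).
Hypothesis psl_g : is_psl22 p.
Local Notation SL := (sl22 F).
Local Notation E := (ext_lie F).

Definition ext_fst : 'Hom(E, SL) :=
  (linfun (fst_lin SL (even_space F^o)) \o linfun (fst_lin (prod_space SL (even_space F^o)) (even_space F^o)))%VF.

Lemma ext_fstE (u : E) : ext_fst u = u.1.1.
Proof. by rewrite comp_lfunE !lfunE. Qed.

Definition ext_proj : 'Hom(E, g) := (p \o ext_fst)%VF.

Lemma ext_projE (u : E) : ext_proj u = p u.1.1.
Proof. by rewrite comp_lfunE ext_fstE. Qed.

Lemma mx_bracket_scalar (k : F) (B : 'M[F]_4) : mx_bracket par22 k%:M B = 0.
Proof.
have kp : k%:M \in mx_part F par22 false.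
  by apply/mx_partP=> i j ij; rewrite mxE; case: (eqVneq i j) ij => [->|] //; rewrite addbb.
have [b0 b1] := (mx_comp_part par22 false B, mx_comp_part par22 true B).
rewrite -[B](mx_comp_sum par22) -[mx_comp _ false B]scale1r mx_bracketPr scale1r.
rewrite (mx_bracketE kp b0) (mx_bracketE kp b1) /ksign /= !expr0 !scale1r.
by rewrite !mul_scalar_mx !mul_mx_scalar !subrr addr0.
Qed.

Lemma cocycle_scalar s k (B : 'M[F]_4) : cocycle s k%:M B = 0.
Proof. by case: s; rewrite /cocycle !mxE /= !mulr0n; ring. Qed.

Lemma ext_proj_central : central_extension ext_proj.
Proof.
case: psl_g => -[pe pb] psurj pker; split; first split.
- move=> q u; rewrite ext_partE ext_projE => /and3P[u1 _ _].
  by apply: pe; rewrite sl_partE.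
- by move=> u w; rewrite !ext_projE /= ext_brE -pb.
- apply/eqP; rewrite eqEsubv subvf -psurj; apply/subvP=> _ /memv_imgP[u _ ->].
  by apply/memv_imgP; exists ((u, 0), 0); rewrite ?memvf // ext_projE.
- apply/subvP=> u uk.
  have : ext_proj u = 0 by apply/eqP; move: uk; rewrite memv_ker.
  rewrite (ext_projE u); case/pker=> k ku.
  suff H w : ext_bracket u w = 0.
    apply: (etrans (memv_ker _ _)); apply/eqP/lfunP=> w.
    by rewrite zero_lfunE -[RHS](H w) -ext_brE.
  apply: ext_eq.
  + by apply: subvs_inj; rewrite sl_brK ku mx_bracket_scalar.
  + exact: (etrans (congr1 (fun M => cocycle true M _) ku) (cocycle_scalar _ _ _)).
  + exact: (etrans (congr1 (fun M => cocycle false M _) ku) (cocycle_scalar _ _ _)).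
Qed.

Variables (gh : lieSuper F) (pi : 'Hom(gh, g)).
Hypothesis uce : universal_central_extension pi.

(** The morphism comes from universality. Its value on a bracket of lifts is forced, because any two
    lifts to the explicit extension differ by elements of the central kernel. *)
Lemma uce_to_ext : exists f : 'Hom(gh, E), lie_morphism f /\
  forall A B, f (br_lift p pi A B) = ext_bracket ((A, 0), 0) ((B, 0), 0).
Proof.
case: uce => pi_ext /(_ E _ ext_proj_central)[f [[fm fp] _]].
exists f; split=> // A B; rewrite -ext_brE; case: fm => _ ->.
have H C : ext_proj (f (lift p pi C)) = ext_proj ((C, 0), 0).
  by rewrite -[LHS](comp_lfunE ext_proj f) fp (pi_lift p pi_ext) ext_projE.
exact: (br_indep ext_proj_central (H A) (H B)).
Qed.
End ExplicitExtension.

(** * Nilpotent representations of the quiver *)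

Section Nilpotent.
Variable F : fieldType.

Definition nilp (V : vectType F) (f : 'End(V)) : Prop := exists n, forall v, iter n f v = 0.

Definition lcomm (V : vectType F) (f g : 'End(V)) : Prop := forall v, f (g v) = g (f v).

Variable V : vectType F.
Implicit Types f g h : 'End(V).

Lemma iter0 f n : iter n f 0 = 0.
Proof. by elim: n => //= n ->; rewrite lfun0. Qed.

Lemma iter_addv f n u v : iter n f (u + v) = iter n f u + iter n f v.
Proof. by elim: n => //= n ->; rewrite lfunD. Qed.

Lemma iter_comm f g n v : lcomm f g -> iter n f (g v) = g (iter n f v).
Proof. by move=> fg; elim: n => //= n ->. Qed.

Lemma iter_ge f n m v : (n <= m)%N -> iter n f v = 0 -> iter m f v = 0.
Proof. by move=> /subnK <- nv; rewrite iterD nv iter0. Qed.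

(** The binomial argument by induction: one application of f + g yields f v and g v, for each of
    which one of the two exponents has dropped. *)
Lemma iter_addf f g n m v : lcomm f g -> iter n f v = 0 -> iter m g v = 0 ->
  iter (n + m) (f + g) v = 0.
Proof.
move=> fg; have gf w : g (f w) = f (g w) by rewrite fg.
elim: n m v => [m v /= -> _|n IH m]; first exact: iter0.
elim: m => [v _ /= ->|m IHm v fv gv]; first by rewrite iter0 add_lfunE !lfun0 addr0.
rewrite addSn iterSr add_lfunE iter_addv IH ?add0r -?iterSr //; last first.
  by rewrite iter_comm // gv lfun0.
by rewrite addnS -addSn IHm -?iterSr // iter_comm // fv lfun0.
Qed.

Lemma nilp_add f g : lcomm f g -> nilp f -> nilp g -> nilp (f + g).
Proof. by move=> fg [n fn] [m gm]; exists (n + m)%N => v; apply: iter_addf. Qed.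

Lemma nilp_comp f g : lcomm f g -> nilp f -> nilp (f \o g)%VF.
Proof.
move=> fg [n fn]; exists n => v; suff -> : iter n (f \o g)%VF v = iter n f (iter n g v) by [].
elim: n {fn} v => //= n IH v; rewrite comp_lfunE IH; congr (f _).
by apply/esym; apply: iter_comm => w; rewrite fg.
Qed.

Lemma nilpZ a f : nilp f -> nilp (a *: f).
Proof.
case=> n fn; exists n => v; suff -> : iter n (a *: f) v = a ^+ n *: iter n f v.
  by rewrite fn scaler0.
by elim: n {fn} => [|n IH]; rewrite ?scale1r //= IH scale_lfunE lfunZ scalerA exprS.
Qed.

Lemma nilp_ext f g : f =1 g -> nilp f -> nilp g.
Proof. by move=> fg; have -> : f = g by apply/lfunP. Qed.

Lemma lker0_bij f : lker f = 0%VS ->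
  exists g, (forall v, g (f v) = v) /\ (forall v, f (g v) = v).
Proof.
move=> /eqP k0; exists (f^-1)%VF; split=> v; first by rewrite lker0_lfunK.
rewrite limg_lfunVK //; suff -> : limg f = fullv by rewrite memvf.
apply/eqP; rewrite eqEdim subvf limg_dim_eq ?leqnn // capfv; exact/eqP.
Qed.

(** A vector killed by c + f is an eigenvector of f for -c, which nilpotency excludes; in finite
    dimension injectivity gives an inverse. *)
Lemma nilp_unit c f : c != 0 -> nilp f ->
  exists g, (forall v, g (c *: v + f v) = v) /\ (forall v, c *: g v + f (g v) = v).
Proof.
move=> c0 [n fn]; pose h := c *: \1%VF + f.
have hE v : h v = c *: v + f v by rewrite add_lfunE scale_lfunE id_lfunE.
have [|g [gh hg]] := @lker0_bij h.
  apply/eqP; rewrite -subv0; apply/subvP=> v; rewrite memv_ker memv0 hE addr_eq0 => /eqP cv.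
  have e k : iter k f v = (- c) ^+ k *: v.
    elim: k => [|k IH]; rewrite ?scale1r //= IH lfunZ.
    have -> : f v = - c *: v by rewrite scaleNr cv opprK.
    by rewrite scalerA exprSr.
  have := e n; rewrite fn => /esym/eqP; rewrite scaler_eq0 expf_eq0 oppr_eq0.
  by rewrite (negbTE c0) andbF.
by exists g; split=> v; rewrite -hE.
Qed.
End Nilpotent.

Section QuiverNilpotent.
Variables (F : fieldType) (X : Qrep F).
Hypothesis rel : Qrelations X.

(** [alpha] with [gamma], [zeta] with [eta], and the two-cycles form three families commuting with
    all arrows: central elements of the quiver algebra. This symmetry between the vertices shortens
    the case analysis. *)
Definition Qdiag (i : Qvert) : 'End(X i) :=
  match i with v1 => Qact X alpha | v2 => Qact X gamma end.
Definition Qdiag' (i : Qvert) : 'End(X i) :=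
  match i with v1 => Qact X zeta | v2 => Qact X eta end.
Definition Qturn (i : Qvert) : 'End(X i) :=
  match i with v1 => (Qact X delta \o Qact X beta)%VF | v2 => (Qact X beta \o Qact X delta)%VF end.
Definition Qjump (i j : Qvert) : 'Hom(X i, X j) :=
  match i, j with
  | v1, v2 => Qact X beta | v2, v1 => Qact X delta
  | v1, v1 => \1%VF | v2, v2 => \1%VF end.

Lemma be_al x : Qact X beta (Qact X alpha x) = Qact X gamma (Qact X beta x).
Proof. by case: rel => -[/lfunP /(_ x)]; rewrite !comp_lfunE. Qed.
Lemma be_ze x : Qact X beta (Qact X zeta x) = Qact X eta (Qact X beta x).
Proof. by case: rel => -[_ /lfunP /(_ x)]; rewrite !comp_lfunE. Qed.
Lemma ze_de x : Qact X delta (Qact X eta x) = Qact X zeta (Qact X delta x).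
Proof. by case: rel => -[_ _ /lfunP /(_ x)]; rewrite !comp_lfunE. Qed.
Lemma al_de x : Qact X delta (Qact X gamma x) = Qact X alpha (Qact X delta x).
Proof. by case: rel => _ [/lfunP /(_ x)]; rewrite !comp_lfunE. Qed.
Lemma al_ze x : Qact X zeta (Qact X alpha x) = Qact X alpha (Qact X zeta x).
Proof. by case: rel => _ [_ /lfunP /(_ x)]; rewrite !comp_lfunE. Qed.
Lemma ga_et x : Qact X eta (Qact X gamma x) = Qact X gamma (Qact X eta x).
Proof. by case: rel => _ [_ _ /lfunP /(_ x)]; rewrite !comp_lfunE. Qed.

Lemma Qdiag_comm i : lcomm (Qdiag' i) (Qdiag i).
Proof. by case: i => x; [exact: al_ze | exact: ga_et]. Qed.

Lemma Qdiag_jump i j x : Qjump i j (Qdiag i x) = Qdiag j (Qjump i j x).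
Proof. by case: i j x => -[] x; rewrite ?id_lfunE //; [exact: be_al | exact: al_de]. Qed.

Lemma Qdiag'_jump i j x : Qjump i j (Qdiag' i x) = Qdiag' j (Qjump i j x).
Proof. by case: i j x => -[] x; rewrite ?id_lfunE //; [exact: be_ze | exact: ze_de]. Qed.

Lemma Qturn_diag i : lcomm (Qturn i) (Qdiag i).
Proof. by case: i => x; rewrite !comp_lfunE /= ?be_al ?al_de // ?be_al. Qed.

Lemma Qturn_diag' i : lcomm (Qturn i) (Qdiag' i).
Proof. by case: i => x; rewrite !comp_lfunE /= ?be_ze ?ze_de // ?be_ze. Qed.

Lemma Qturn_jump k l n x :
  Qjump k l (iter n (Qturn k) x) = iter n (Qturn l) (Qjump k l x).
Proof.
elim: n => [|n IH] //; rewrite !iterS -IH; move: (iter n _ x) => y.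
by case: k l y {IH x} => -[] y; rewrite /= ?comp_lfunE ?id_lfunE ?comp_lfunE.
Qed.

Definition Qdiff (i j : Qvert) : nat :=
  match i, j with v1, v2 | v2, v1 => 1 | _, _ => 0 end.

(** A path acts as a monomial in the three central families after at most one arrow between the
    vertices; a two-cycle counts twice in the length. *)
Lemma Qpath_normal i j (q : Qpath i j) : exists a b c,
  Qlength q = (a + b + 2 * c + Qdiff i j)%N /\ forall x, Qpath_act X q x =
     iter a (Qdiag j) (iter b (Qdiag' j) (iter c (Qturn j) (Qjump i j x))).
Proof.
elim: q => [|a q [n [m [c [le IH]]]]].
  by exists 0%N, 0%N, 0%N; case: (i); split=> // x; rewrite /= id_lfunE.
have push k l (y : X k) : Qjump k l (iter n (Qdiag k) (iter m (Qdiag' k) (iter c (Qturn k) y))) =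
    iter n (Qdiag l) (iter m (Qdiag' l) (iter c (Qturn l) (Qjump k l y))).
  elim: n {le IH} => [|n IHn]; last by rewrite !iterS Qdiag_jump IHn.
  elim: m => [|m IHm]; last by rewrite !iterS Qdiag'_jump IHm.
  exact: Qturn_jump.
have comm k : lcomm (Qdiag k) (Qdiag' k) by move=> y; rewrite Qdiag_comm.
case: a q le IH => q le IH.
- by exists n.+1, m, c; split=> [|x] /=; rewrite ?comp_lfunE ?IH // le !addSn.
- exists n, m.+1, c; split=> [|x] /=; first by rewrite le addnS !addSn.
  by rewrite comp_lfunE IH -(iter_comm _ _ (comm v1)).
- case: i q le IH => q le IH.
    exists n, m, c; split=> [|x] /=; first by rewrite le addn0 addn1.
    by rewrite comp_lfunE IH (push v1 v2) /= id_lfunE.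
  exists n, m, c.+1; split=> [|x] /=; first by rewrite le /= addn0 mulnS addn1; lia.
  rewrite comp_lfunE IH (push v1 v2) -iterS iterSr /= comp_lfunE id_lfunE //.
- by exists n.+1, m, c; split=> [|x] /=; rewrite ?comp_lfunE ?IH // le !addSn.
- exists n, m.+1, c; split=> [|x] /=; first by rewrite le addnS !addSn.
  by rewrite comp_lfunE IH -(iter_comm _ _ (comm v2)).
- case: i q le IH => q le IH.
    exists n, m, c.+1; split=> [|x] /=; first by rewrite le /= addn0 mulnS addn1; lia.
    by rewrite comp_lfunE IH (push v2 v1) -iterS iterSr /= comp_lfunE id_lfunE.
  exists n, m, c; split=> [|x] /=; first by rewrite le addn0 addn1.
  by rewrite comp_lfunE IH (push v2 v1) /= id_lfunE.
Qed.

(** Pigeonhole on the normal form: in a long enough path one of the exponents reaches its nilpotency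
    bound. The final 1 pays for the possible arrow between the vertices. *)
Lemma Qnilp_of i : nilp (Qdiag i) -> nilp (Qdiag' i) -> nilp (Qturn i) ->
  exists n, forall j (q : Qpath j i), (n <= Qlength q)%N -> Qpath_act X q = 0.
Proof.
move=> [a fa] [b fb] [c fc]; exists (a + b + 2 * c + 1)%N => j q le.
have [n [m [k [e H]]]] := Qpath_normal q.
have d1 : (Qdiff j i <= 1)%N by case: (j); case: (i).
have : [|| (a <= n)%N, (b <= m)%N | (c <= k)%N] by lia.
move=> /or3P[h|h|h]; apply/lfunP=> x; rewrite zero_lfunE H.
- by apply: iter_ge h _; exact: fa.
- by rewrite [iter m _ _](iter_ge h) ?iter0 //; exact: fb.
- by rewrite [iter k _ _](iter_ge h) ?iter0 //; exact: fc.
Qed.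

Lemma Qnilpotent_of : (forall i, [/\ nilp (Qdiag i), nilp (Qdiag' i) & nilp (Qturn i)]) ->
  Qnilpotent X.
Proof.
move=> H; have [[a1 b1 c1] [a2 b2 c2]] := (H v1, H v2).
have [n1 H1] := Qnilp_of a1 b1 c1; have [n2 H2] := Qnilp_of a2 b2 c2.
exists (n1 + n2)%N => i j q le.
by case: j q le => q le; [apply: H1 | apply: H2]; lia.
Qed.

Section Converse.
Hypothesis N : Qnilpotent X.

Lemma nilp_paths i (f : 'End(X i)) (P : nat -> Qpath i i) :
  (forall n, n <= Qlength (P n))%N -> (forall n x, Qpath_act X (P n) x = iter n f x) -> nilp f.
Proof.
by move=> le E; case: N => n H; exists n => v; rewrite -E H ?le ?zero_lfunE.
Qed.

Definition ploop1 (n : nat) : Qpath v1 v1 := iter n (@Qcons v1 alpha) (Qnil v1).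
Definition ploop1' (n : nat) : Qpath v1 v1 := iter n (@Qcons v1 zeta) (Qnil v1).
Definition ploop2 (n : nat) : Qpath v2 v2 := iter n (@Qcons v2 gamma) (Qnil v2).
Definition ploop2' (n : nat) : Qpath v2 v2 := iter n (@Qcons v2 eta) (Qnil v2).
Definition pturn1 (n : nat) : Qpath v1 v1 :=
  iter n (fun q => @Qcons v1 delta (@Qcons v1 beta q)) (Qnil v1).
Definition pturn2 (n : nat) : Qpath v2 v2 :=
  iter n (fun q => @Qcons v2 beta (@Qcons v2 delta q)) (Qnil v2).

Lemma Qdiag_nilp i : nilp (Qdiag i).
Proof.
case: i; [apply: (@nilp_paths v1 _ ploop1) | apply: (@nilp_paths v2 _ ploop2)] => n;
  by elim: n => [|n IH] //= x; rewrite ?id_lfunE ?comp_lfunE ?IH.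
Qed.

Lemma Qdiag'_nilp i : nilp (Qdiag' i).
Proof.
case: i; [apply: (@nilp_paths v1 _ ploop1') | apply: (@nilp_paths v2 _ ploop2')] => n;
  by elim: n => [|n IH] //= x; rewrite ?id_lfunE ?comp_lfunE ?IH.
Qed.

Lemma Qturn_nilp i : nilp (Qturn i).
Proof.
case: i; [apply: (@nilp_paths v1 _ pturn1) | apply: (@nilp_paths v2 _ pturn2)] => n;
  elim: n => [|n IH] //=; do ?[exact: ltnW | exact: leqW]; by move=> x; rewrite ?id_lfunE ?comp_lfunE ?IH.
Qed.
End Converse.
End QuiverNilpotent.

(** * The action of SL(2) on models *)

Section Rotation.
Variables (F : fieldType) (A B C D : superspace F).
Hypothesis F2 : 2 != 0 :> F.
Local Notation OM := (omaps A B C D).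
Local Notation ZM := (zmaps A B C D).

Lemma zmaps_eq (Z Z' : ZM) : zA Z =1 zA Z' -> zB Z =1 zB Z' -> zC Z =1 zC Z' ->
  zD Z =1 zD Z' -> Z = Z'.
Proof. by case: Z Z' => [? ? ? ?] [? ? ? ?] /= /lfunP-> /lfunP-> /lfunP-> /lfunP->. Qed.

Lemma zz_commute_comb k l m k' l' m' (Z1 Z2 Z3 : ZM) :
  zz_commute Z1 Z2 -> zz_commute Z1 Z3 -> zz_commute Z2 Z3 ->
  zz_commute (zmaps_comb k l m Z1 Z2 Z3) (zmaps_comb k' l' m' Z1 Z2 Z3).
Proof.
move=> H12 H13 H23; split=> x /=; rewrite !(add_lfunE, scale_lfunE, lfun_pushE)
  ?(zzA H12, zzA H13, zzA H23, zzB H12, zzB H13, zzB H23)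
  ?(zzC H12, zzC H13, zzC H23, zzD H12, zzD H13, zzD H23); by vect_ring.
Qed.

Lemma even_map_comb (V W : superspace F) (k l m : F) (f1 f2 f3 : 'Hom(V, W)) :
  even_map f1 -> even_map f2 -> even_map f3 ->
  even_map (k *: f1 + l *: f2 + m *: f3).
Proof.
move=> e1 e2 e3 q v vq; rewrite !add_lfunE !scale_lfunE.
by rewrite !rpredD ?rpredZ ?e1 ?e2 ?e3.
Qed.

Lemma odd_map_comb (V W : superspace F) (k l : F) (f1 f2 : 'Hom(V, W)) :
  odd_map f1 -> odd_map f2 -> odd_map (k *: f1 + l *: f2).
Proof.
move=> e1 e2 q v vq; rewrite !add_lfunE !scale_lfunE.
by rewrite !rpredD ?rpredZ ?e1 ?e2.
Qed.

Variables (O1 O2 : OM) (one z1 z2 : ZM).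
Hypothesis R : model_rel O1 O2 one z1 z2.
Variables l1 r1 l2 r2 : F.
Hypothesis det1 : l1 * r2 - r1 * l2 = 1.

Local Notation H := (half_zmaps one).
(** The quadratic form of central operators, polarised at two outer vectors. The factor [k] is 1 for
    the two self-relations and 2 for the new [one], as [odd_rel] contains half of it. *)
Definition rot_z (l r l' r' k : F) : ZM :=
  zmaps_comb (k * (l * l')) (k * (l * r' + r * l')) (k * (r * r')) z1 H z2.

Lemma rot_self l r : odd_self (omaps_comb l r O1 O2) (rot_z l r l r 1).
Proof.
apply: (odd_self_rel F2); have := odd_rel_comb F2 l r l r (rel11 R) (rel12 R) (rel22 R).
rewrite mulr1 (_ : l * r - r * l = 0); last ring.
by congr odd_rel; rewrite /rot_z !mul1r.
Qed.

Lemma oz_half' O : oz_commute O one -> oz_commute O H.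
Proof.
move=> K; split=> x; rewrite /= !(add_lfunE, scale_lfunE, lfun_pushE);
  by rewrite ?(ozA K, ozB K, ozC K, uzA K, uzB K, uzC K).
Qed.

Lemma zz_half Z : zz_commute one Z -> zz_commute H Z.
Proof.
move=> K; split=> x; rewrite /= !(add_lfunE, scale_lfunE, lfun_pushE);
  by rewrite ?(zzA K, zzB K, zzC K, zzD K).
Qed.

Lemma zz_sym (Z Z' : ZM) : zz_commute Z Z' -> zz_commute Z' Z.
Proof. by move=> K; split=> x; rewrite ?(zzA K, zzB K, zzC K, zzD K). Qed.

Lemma rot_oz a b l r l' r' k : oz_commute (omaps_comb a b O1 O2) (rot_z l r l' r' k).
Proof.
by apply: oz_commute_comb; rewrite ?(rel1z1 R, rel1z2 R, rel2z1 R, rel2z2 R);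
  do ?[exact: oz_half' (rel1o R) | exact: oz_half' (rel2o R)
    | exact: (rel1z1 R) | exact: (rel1z2 R) | exact: (rel2z1 R) | exact: (rel2z2 R)].
Qed.

Lemma rot_zz l r l' r' k a b a' b' k' : zz_commute (rot_z l r l' r' k) (rot_z a b a' b' k').
Proof.
apply: zz_commute_comb; first exact/zz_sym/zz_half/(relo1 R).
  exact: relz12 R.
exact/zz_half/(relo2 R).
Qed.

Lemma rot_even l r l' r' k : zmaps_even (rot_z l r l' r' k).
Proof.
by split; do ?apply: even_map_comb; case: (relone R) => ? ? ? ?; case: (relz1 R) => ? ? ? ?;
  case: (relz2 R).
Qed.

Lemma rot_odd l r : omaps_odd (omaps_comb l r O1 O2).
Proof.
by split; apply: odd_map_comb; case: (relO1 R) => ? ? ? ? ? ?; case: (relO2 R).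
Qed.

Lemma model_rotate : model_rel (omaps_comb l1 r1 O1 O2) (omaps_comb l2 r2 O1 O2)
  (rot_z l1 r1 l2 r2 2) (rot_z l1 r1 l1 r1 1) (rot_z l2 r2 l2 r2 1).
Proof.
split; try exact: rot_self; try exact: rot_oz; try exact: rot_zz; try exact: rot_even;
  try exact: rot_odd.
have := odd_rel_comb F2 l1 r1 l2 r2 (rel11 R) (rel12 R) (rel22 R).
rewrite det1 mulr1; congr odd_rel.
by apply: zmaps_eq => x; rewrite /= !(add_lfunE, scale_lfunE); vect_field F2.
Qed.
End Rotation.

(** * Even maps and graded quiver representations *)

Section Homogeneous.
Variable F : fieldType.

Definition concentrated (r : bool) (V : superspace F) : Prop :=
  part V r = fullv /\ part V (~~ r) = 0%VS.

Lemma pure_concentrated r V : concentrated r (pure_space r V : superspace F).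
Proof. by rewrite /concentrated /= /pure_part eqxx; split=> //; case: r. Qed.

Lemma concentrated_even r (V W : superspace F) (f : 'Hom(V, W)) :
  concentrated r V -> concentrated r W -> even_map f.
Proof.
move=> [v1 v0] [w1 w0] q v; have [->|qr] := eqVneq q r; first by rewrite w1 memvf.
have -> : q = ~~ r by move: qr; case: (q); case: (r).
by rewrite v0 memv0 => /eqP->; rewrite lfun0 mem0v.
Qed.

Lemma lfun_invK (V : vectType F) (f g : 'End(V)) :
  (forall v, g (f v) = v) -> (forall v, f (g v) = v) ->
  (forall v, (f^-1)%VF (f v) = v) /\ (forall v, f ((f^-1)%VF v) = v).
Proof.
move=> gf fg; split=> v; last first.
  by rewrite limg_lfunVK // -[v]fg memv_img // memvf.
rewrite lker0_lfunK // -subv0; apply/subvP=> w; rewrite memv_ker memv0 => /eqP w0.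
by rewrite -[w]gf w0 lfun0.
Qed.

Lemma even_map_add (V W : superspace F) (f g : 'Hom(V, W)) :
  even_map f -> even_map g -> even_map (f + g).
Proof. by move=> fe ge q v vq; rewrite add_lfunE rpredD ?fe ?ge. Qed.

Lemma even_map_scale (V W : superspace F) k (f : 'Hom(V, W)) :
  even_map f -> even_map (k *: f).
Proof. by move=> fe q v vq; rewrite scale_lfunE rpredZ ?fe. Qed.

Lemma even_map_opp (V W : superspace F) (f : 'Hom(V, W)) : even_map f -> even_map (- f).
Proof. by move=> fe q v vq; rewrite opp_lfunE rpredN fe. Qed.

Lemma even_map_comp (U V W : superspace F) (f : 'Hom(V, W)) (g : 'Hom(U, V)) :
  even_map f -> even_map g -> even_map (f \o g)%VF.
Proof. by move=> fe ge q v vq; rewrite comp_lfunE fe ?ge. Qed.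

Lemma even_map1 (V : superspace F) : even_map (\1%VF : 'Hom(V, V)).
Proof. by move=> q v; rewrite id_lfunE. Qed.

Lemma even_map0 (V W : superspace F) : even_map (0 : 'Hom(V, W)).
Proof. by move=> q v _; rewrite zero_lfunE mem0v. Qed.

Lemma even_map_inv (V : superspace F) (f : 'Hom(V, V)) : even_map f ->
  (forall v, (f^-1)%VF (f v) = v) -> (forall v, f ((f^-1)%VF v) = v) -> even_map (f^-1)%VF.
Proof.
move=> fe fK Kf q v vq; have <- : scomp q ((f^-1)%VF v) = (f^-1)%VF v; last exact: scomp_part.
by rewrite -[LHS]fK (even_map_scomp _ _ fe) Kf scomp_id.
Qed.

Lemma even_map_row (V W U : superspace F) (f : 'Hom(V, U)) (g : 'Hom(W, U)) :
  even_map f -> even_map g -> @even_map F (prod_space V W) U (row_lfun f g).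
Proof.
by move=> fe ge q x; rewrite prod_spaceE row_lfunE => /andP[x1 x2]; rewrite rpredD ?fe ?ge.
Qed.

Lemma even_map_col (V W U : superspace F) (f : 'Hom(U, V)) (g : 'Hom(U, W)) :
  even_map f -> even_map g -> @even_map F U (prod_space V W) (col_lfun f g).
Proof. by move=> fe ge q x xq; rewrite prod_spaceE col_lfunE fe ?ge. Qed.

Lemma odd_from_shift (V W : superspace F) (f : 'Hom(V, W)) :
  @even_map F V W f -> @odd_map F (shift_space V) W f.
Proof. by move=> fe q v; exact: fe. Qed.

Lemma odd_to_shift (V W : superspace F) (f : 'Hom(V, W)) :
  @even_map F V W f -> @odd_map F V (shift_space W) f.
Proof. by move=> fe q v vq; rewrite /= negbK; exact: fe. Qed.

Lemma even_shift (V : superspace F) (f : 'Hom(V, V)) :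
  @even_map F V V f -> @even_map F (shift_space V) (shift_space V) f.
Proof. by move=> fe q v; exact: fe. Qed.
End Homogeneous.

(** Quiver representations in superspaces with even arrows. Leaving the parities of B and C free
    lets one construction serve both blocks and all sums of their objects. *)
Record gradedRep (F : fieldType) := GradedRep {
  gsp :> Qvert -> superspace F;
  gact : forall a, 'Hom(gsp (Qsrc a), gsp (Qtgt a));
  gact_even : forall a, even_map (gact a) }.

Definition gforget (F : fieldType) (X : gradedRep F) : Qrep F :=
  @QRep F (fun i => X i) (gact X).

Section QuiverModel.
Variables (F : fieldType) (F2 : 2 != 0 :> F) (G : gradedRep F).
Local Notation X := (gforget G).
Hypothesis rel : Qrelations X.
Hypothesis nil : Qnilpotent X.

(** 2 plus commuting nilpotents, hence invertible; [Qu] plus [Qturn] is the operator w. *)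
Definition Qu (i : Qvert) : 'End(X i) :=
  2 *: \1%VF + ((Qdiag X i \o Qdiag' X i)%VF + (- 2) *: Qturn X i).

Lemma QuE i x : Qdiag X i (Qdiag' X i x) = Qu i x - 2 *: x + 2 *: Qturn X i x.
Proof. by rewrite !add_lfunE !scale_lfunE id_lfunE comp_lfunE; vect_ring. Qed.

Lemma diag_prod_nilp i : nilp (Qdiag X i \o Qdiag' X i)%VF.
Proof. by apply: nilp_comp; [move=> x; rewrite Qdiag_comm | exact: Qdiag_nilp]. Qed.

Lemma prod_turn_comm i k : lcomm (Qdiag X i \o Qdiag' X i)%VF (k *: Qturn X i).
Proof.
move=> x; rewrite comp_lfunE [LHS]/= !scale_lfunE comp_lfunE !lfunZ.
by rewrite (Qturn_diag rel) (Qturn_diag' rel).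
Qed.

Lemma Qu_inv i : (forall x, (Qu i)^-1%VF (Qu i x) = x) /\ (forall x, Qu i ((Qu i)^-1%VF x) = x).
Proof.
have [g [gK Kg]] : exists g : 'End(X i), (forall v : X i, g (2 *: v + ((Qdiag X i \o Qdiag' X i)%VF + (- 2) *: Qturn X i) v) = v) /\
    (forall v, 2 *: g v + ((Qdiag X i \o Qdiag' X i)%VF + (- 2) *: Qturn X i) (g v) = v).
  apply: nilp_unit => //; apply: nilp_add; first exact: prod_turn_comm.
    exact: diag_prod_nilp.
  by apply: nilpZ; exact: Qturn_nilp.
have E v : Qu i v = 2 *: v + ((Qdiag X i \o Qdiag' X i)%VF + (- 2) *: Qturn X i) v.
  by rewrite [LHS]add_lfunE scale_lfunE id_lfunE.
by apply: (@lfun_invK _ _ _ g) => v; rewrite E.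
Qed.

Definition QA : superspace F := prod_space (G v1) (G v2).
Definition QD : superspace F := shift_space QA.
Local Notation al := (Qact X alpha).
Local Notation ze := (Qact X zeta).
Local Notation be := (Qact X beta).
Local Notation ga := (Qact X gamma).
Local Notation et := (Qact X eta).
Local Notation de := (Qact X delta).
Local Notation u1 := (Qu v1).
Local Notation u2 := (Qu v2).

Definition QO1 : omaps QA (G v1) (G v2) QD :=
  model_O1 al ze u1 (u1^-1)%VF ga be.
Definition QO2 : omaps QA (G v1) (G v2) QD :=
  model_O2 al ze u1 et u2 (u2^-1)%VF be de.
Definition Qone : zmaps QA (G v1) (G v2) QD := model_one u1 u2 be de.
Definition Qz1 : zmaps QA (G v1) (G v2) QD := model_z1 al ga.
Definition Qz2 : zmaps QA (G v1) (G v2) QD := model_z2 ze u1 et u2 be de.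

Local Ltac even_tac := repeat first
  [ assumption | exact: (@gact_even F G alpha) | exact: (@gact_even F G zeta)
  | exact: (@gact_even F G beta) | exact: (@gact_even F G gamma) | exact: (@gact_even F G eta)
  | exact: (@gact_even F G delta) | exact: even_map1 | exact: even_map0
  | apply: even_map_row | apply: even_map_col | apply: even_map_scale
  | apply: even_map_opp | apply: even_map_add | apply: even_map_comp ].

Lemma Qmodel : model_rel QO1 QO2 Qone Qz1 Qz2.
Proof.
have [u1K v1K] := Qu_inv v1; have [u2K v2K] := Qu_inv v2.
have u1E x : al (ze x) = u1 x - 2 *: x + 2 *: de (be x).
  by have := @QuE v1 x; rewrite comp_lfunE.
have u2E x : ga (et x) = u2 x - 2 *: x + 2 *: be (de x).
  by have := @QuE v2 x; rewrite comp_lfunE.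
have ue i : even_map (Qu i : 'Hom(G i, G i)).
  have e1 : even_map (Qdiag X i : 'Hom(G i, G i)).
    by case: i; [exact: (@gact_even F G alpha) | exact: (@gact_even F G gamma)].
  have e2 : even_map (Qdiag' X i : 'Hom(G i, G i)).
    by case: i {e1}; [exact: (@gact_even F G zeta) | exact: (@gact_even F G eta)].
  have e3 : even_map (Qturn X i : 'Hom(G i, G i)).
    case: i {e1 e2}.
      exact: (even_map_comp (@gact_even F G delta) (@gact_even F G beta)).
    exact: (even_map_comp (@gact_even F G beta) (@gact_even F G delta)).
  apply: even_map_add; first exact: (even_map_scale _ (@even_map1 _ (G i))).
  apply: even_map_add; first exact: (even_map_comp e1 e2).
  exact: even_map_scale.
have ve1 : even_map (u1^-1%VF : 'Hom(G v1, G v1)) by exact: (even_map_inv (ue v1)).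
have ve2 : even_map (u2^-1%VF : 'Hom(G v2, G v2)) by exact: (even_map_inv (ue v2)).
have we1 : even_map (w1 u1 be de : 'Hom(G v1, G v1)).
  by apply: even_map_add; [exact: ue | even_tac].
have we2 : even_map (w2 u2 be de : 'Hom(G v2, G v2)).
  by apply: even_map_add; [exact: ue | even_tac].
have := (be_al rel, be_ze rel, (ze_de rel, al_de rel), (al_ze rel, ga_et rel)).
move=> [[[ba bz] [zd ad]] [az ge]].
split.
- exact: model_self1.
- exact: model_rel12.
- exact: model_self2.
- exact: model_O1_one.
- exact: model_O1_z1.
- exact: model_O1_z2.
- exact: model_O2_one.
- exact: model_O2_z1.
- exact: model_O2_z2.
- exact: model_one_z1.
- exact: model_one_z2.
- exact: model_z1_z2.
- split; (apply: odd_from_shift || apply: odd_to_shift); even_tac.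
- split; (apply: odd_from_shift || apply: odd_to_shift); even_tac.
- by split; try apply: even_shift; even_tac.
- by split; try apply: even_shift; even_tac.
- by split; try apply: even_shift; even_tac.
Qed.
End QuiverModel.

(** * The short subalgebra in matrices *)

Section ShortMatrices.
Variable F : fieldType.


Lemma mx_bracket_even (A B : 'M[F]_4) : B \in mx_part F par22 false ->
  mx_bracket par22 A B = A *m B - B *m A.
Proof.
move=> be; have [a0 a1] := (mx_comp_part par22 false A, mx_comp_part par22 true A).
rewrite -{1}[A](mx_comp_sum par22) -[mx_comp _ false A]scale1r mx_bracketPl scale1r.
rewrite (mx_bracketE a0 be) (mx_bracketE a1 be) /ksign /= !expr0 !scale1r.
by rewrite addrACA -opprD -mulmxDl -mulmxDr mx_comp_sum.
Qed.

Lemma short_fE : vsval (short_f F) = 2^-1 *: (delta_mx j1 j0 + delta_mx j3 j2).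
Proof.
have [e0 e1 e2 e3] := inord4.
by rewrite /short_f !EE e0 e1 e2 e3 linearZ linearD /= !unit22E.
Qed.

Lemma M11_embE (a : M11 F) : vsval (M11_emb a) =
  (a : 'M_2) 0 0 *: delta_mx j0 j1 + (a : 'M_2) 0 1 *: delta_mx j0 j3
  + (a : 'M_2) 1 0 *: delta_mx j2 j1 + (a : 'M_2) 1 1 *: delta_mx j2 j3.
Proof.
have [e0 e1 e2 e3] := inord4.
rewrite /M11_emb !EE e0 e1 e2 e3.
by rewrite 3!linearD !linearZ /= !unit22E.
Qed.

Lemma short_f_even : vsval (short_f F) \in mx_part F par22 false.
Proof.
by rewrite short_fE rpredZ // rpredD //; exact: delta_part.
Qed.

Lemma jordan_matrix (a : M11 F) : vsval (br (sl22 F) (M11_emb a) (short_f F)) =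
  2^-1 *: ((a : 'M_2) 0 0 *: (delta_mx j0 j0 - delta_mx j1 j1)
    + (a : 'M_2) 0 1 *: (delta_mx j0 j2 - delta_mx j1 j3)
    + (a : 'M_2) 1 0 *: (delta_mx j2 j0 - delta_mx j3 j1)
    + (a : 'M_2) 1 1 *: (delta_mx j2 j2 - delta_mx j3 j3)).
Proof.
rewrite sl_brK mx_bracket_even ?short_f_even // M11_embE short_fE.
rewrite -scalemxAr -scalemxAl -scalerBr; congr (_ *: _).
move: ((a : 'M_2) 0 0) ((a : 'M_2) 0 1) ((a : 'M_2) 1 0) ((a : 'M_2) 1 1) => s t s' t'.
rewrite !mulmxDl !mulmxDr -!scalemxAl -!scalemxAr !mul_delta_mx_cond /= ?mulr1n ?mulr0n.
by move: (delta_mx _ _) => m; vect_ring.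
Qed.

Lemma short_e_emb : short_e F = M11_emb (1%:M : 'M[F]_2).
Proof. by rewrite /short_e /M11_emb !mxE /= !scale1r !scale0r !addr0. Qed.
End ShortMatrices.

(** * The module attached to a model *)

Section Pullback.
Variables (F : fieldType) (L K : lieSuper F) (f : 'Hom(L, K)).
Variable M : act_space K.

Definition pull_space : act_space L := @ActSpace F L M (act M \o f)%VF.

Lemma pullE x m : act pull_space x m = act M (f x) m.
Proof. by rewrite /= comp_lfunE. Qed.

Lemma pull_module : lie_morphism f -> lie_module M -> lie_module pull_space.
Proof.
move=> [fe fb] [H1 H2]; split=> [q s x m xq ms|q s x y m xq ys].
  by rewrite pullE; apply: H1 => //; exact: fe.
by rewrite !pullE fb; apply: H2; exact: fe.
Qed.
End Pullback.

Section InducedModule.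
Variables (F : fieldType) (F2 : 2 != 0 :> F) (A B C D : superspace F).
Variables (O1 O2 : omaps A B C D) (one z1 z2 : zmaps A B C D).
Hypothesis R : model_rel O1 O2 one z1 z2.
Variables (g : lieSuper F) (p : 'Hom(sl22 F, g)) (gh : lieSuper F) (pi : 'Hom(gh, g)).
Variable f : 'Hom(gh, ext_lie F).
Hypothesis f_lie : lie_morphism f.
Hypothesis fE : forall S T, f (br_lift p pi S T) = ext_bracket ((S, 0), 0) ((T, 0), 0).
Local Notation N := (Nsp A B C D).
Local Notation ext_op := (ext_op O1 O2 one z1 z2).

Definition Nmod : act_space gh := pull_space f (ext_module_space F2 O1 O2 one z1 z2).

Lemma NmodE x n : act Nmod x n = ext_op (f x) n.
Proof. by rewrite /Nmod pullE ext_module_actE. Qed.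

Lemma Nmod_lie : lie_module Nmod.
Proof. exact: pull_module f_lie (ext_module F2 R). Qed.

(** The coordinates of weight 1: the E12-coefficients in both adjoint representations and the entry
    [d12] of the bifundamental one. *)
Definition top_vec (m : B * D * C) : N :=
  let: (b, d, c) := m in (0, (b, 0, 0), (c, 0, 0), (0, d, 0, 0)).

Fact top_vec_linear : linear top_vec.
Proof.
move=> k [[b d] c] [[b' d'] c'].
have -> : k *: ((b, d, c) : (B * D * C)%type) + (b', d', c') = (k *: b + b', k *: d + d', k *: c + c').
  by [].
by apply: Nsp_eq; rewrite //= scaler0 addr0.
Qed.

Definition top_map : 'Hom(Jspace B C D, Nspace A B C D) :=
  linfun (HB.pack top_vec (GRing.isLinear.Build F (B * D * C)%type N *:%R top_vec top_vec_linear)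
    : {linear (B * D * C)%type -> N}).

Lemma top_mapE m : top_map m = top_vec m.
Proof. exact: lfunE. Qed.

Lemma f_jordan a : f (br_lift p pi (M11_emb a) (short_f F)) =
  ((br (sl22 F) (M11_emb a) (short_f F), 0), 0).
Proof.
rewrite fE; apply: ext_eq; first by [].
  exact: (cocycle_evenr true _ (short_f_even F)).
exact: (cocycle_evenr false _ (short_f_even F)).
Qed.

Lemma even_op_zero (n : N) : even_op 0 0 0 0 0 0 n = 0.
Proof.
move: n => [[[x [[be bh] bf]] [[ce ch] cf]] [[[d11 d12] d21] d22]].
by apply: Nsp_eq; rewrite /even_op //=; vect_ring.
Qed.

Lemma odd_op_zero O (n : N) : odd_op O 0 0 0 0 n = 0.
Proof.
move: n => [[[x [[be bh] bf]] [[ce ch] cf]] [[[d11 d12] d21] d22]].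
by apply: Nsp_eq; rewrite /odd_op //=; vect_ring.
Qed.

(** Entries as separate equations keep the computation in the field. *)
Lemma ext_op_of (x : ext_sp F) n h e fl h' e' fl' q11 q12 q21 q22 r11 r12 r21 r22 k s t :
  let M := vsval x.1.1 in
  [/\ 2^-1 * (M j0 j0 - M j1 j1) = h, M j0 j1 = e & M j1 j0 = fl] ->
  [/\ 2^-1 * (M j2 j2 - M j3 j3) = h', M j2 j3 = e' & M j3 j2 = fl'] ->
  [/\ M j0 j2 = q11, M j0 j3 = q12, M j1 j2 = q21 & M j1 j3 = q22] ->
  [/\ M j3 j1 = r11, - M j2 j1 = r12, - M j3 j0 = r21 & M j2 j0 = r22] ->
  [/\ 2^-1 * (M j0 j0 + M j1 j1) = k, x.1.2 = s & x.2 = t] ->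
  ext_op x n = even_op h e fl h' e' fl' n + (odd_op O1 q11 q12 q21 q22 n
    + odd_op O2 r11 r12 r21 r22 n)
    + (k *: central_op one n + s *: central_op z1 n + t *: central_op z2 n).
Proof.
move=> M [<- <- <-] [<- <- <-] [<- <- <- <-] [<- <- <- <-] [<- <- <-].
by rewrite -center_opE.
Qed.

Lemma jordan_entries (a : M11 F) (a' := a : 'M_2) (M := vsval (br (sl22 F) (M11_emb a) (short_f F))) :
  [/\ [/\ 2^-1 * (M j0 j0 - M j1 j1) = 2^-1 * a' 0 0, M j0 j1 = 0 & M j1 j0 = 0],
      [/\ 2^-1 * (M j2 j2 - M j3 j3) = 2^-1 * a' 1 1, M j2 j3 = 0 & M j3 j2 = 0],
      [/\ M j0 j2 = 2^-1 * a' 0 1, M j0 j3 = 0, M j1 j2 = 0 & M j1 j3 = - (2^-1 * a' 0 1)],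
      [/\ M j3 j1 = - (2^-1 * a' 1 0), - M j2 j1 = 0, - M j3 j0 = 0 & M j2 j0 = 2^-1 * a' 1 0]
    & 2^-1 * (M j0 j0 + M j1 j1) = 0].
Proof.
rewrite /M jordan_matrix -/a' !mxE /=; move: (a' 0 0) (a' 0 1) (a' 1 0) (a' 1 1) => ? ? ? ?.
by do ?split; field; rewrite ?F2.
Qed.

Lemma top_jop (a : 'M[F]_2) m :
  even_op (2^-1 * a 0 0) 0 0 (2^-1 * a 1 1) 0 0 (top_vec m)
  + (odd_op O1 (2^-1 * a 0 1) 0 0 (- (2^-1 * a 0 1)) (top_vec m)
     + odd_op O2 (- (2^-1 * a 1 0)) 0 0 (2^-1 * a 1 0) (top_vec m))
  = top_vec (jop O1 O2 a m).
Proof.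
move: m => [[b d] c]; rewrite /jop /odd_op /even_op.
by apply: Nsp_eq; simpl; vect_field F2.
Qed.

Lemma central0 (u v w : N) : 0 *: u + 0 *: v + 0 *: w = 0.
Proof. by rewrite !scale0r !addr0. Qed.

Lemma Nmod_jordan a m :
  act Nmod (br_lift p pi (M11_emb a) (short_f F)) (top_vec m) = top_vec (jop O1 O2 a m).
Proof.
rewrite NmodE f_jordan; have [H1 H2 H3 H4 H5] := jordan_entries a.
rewrite (@ext_op_of ((br (sl22 F) (M11_emb a) (short_f F), 0), 0) _ _ _ _ _ _ _ _ _ _ _ _ _ _ _ _ _ _
   H1 H2 H3 H4 (And3 H5 (erefl _) (erefl _))).
by rewrite central0 addr0 top_jop.
Qed.

Lemma odd_op_zero2 (n : N) : odd_op O1 0 0 0 0 n + odd_op O2 0 0 0 0 n = 0.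
Proof. by rewrite !odd_op_zero addr0. Qed.

Lemma Nmod_h n : act Nmod (short_h p pi) n = even_op 2^-1 0 0 2^-1 0 0 n.
Proof.
rewrite NmodE /short_h short_e_emb f_jordan; have [H1 H2 H3 H4 H5] := jordan_entries (1%:M : 'M[F]_2).
rewrite !mxE /= mulr1 mulr0 oppr0 in H1 H2 H3 H4.
rewrite (@ext_op_of ((br (sl22 F) (M11_emb (1%:M : 'M[F]_2)) (short_f F), 0), 0) _ _ _ _ _ _ _ _ _ _ _ _ _ _ _ _ _ _
   H1 H2 H3 H4 (And3 H5 (erefl _) (erefl _))).
by rewrite central0 odd_op_zero2 !addr0.
Qed.

Lemma Nmod_scalar x (k s t : F) n : f x = ((vsproj _ (k%:M : 'M[F]_4), s), t) ->
  act Nmod x n = k *: central_op one n + s *: central_op z1 n + t *: central_op z2 n.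
Proof.
move=> fx; rewrite NmodE fx.
have kE : vsval (vsproj (sl_vs F par22) (k%:M : 'M[F]_4)) = k%:M.
  by rewrite vsprojK // sl_vsE /supertrace sum4 /par22 !mxE /=; apply/eqP; ring.
rewrite (@ext_op_of ((vsproj _ (k%:M : 'M[F]_4), s), t) n 0 0 0 0 0 0 0 0 0 0 0 0 0 0 k s t).
- by rewrite even_op_zero odd_op_zero2 !add0r.
- by rewrite [X in vsval X]/= kE !mxE /= subrr mulr0.
- by rewrite [X in vsval X]/= kE !mxE /= subrr mulr0.
- by rewrite [X in vsval X]/= kE !mxE.
- by rewrite [X in vsval X]/= kE !mxE /= oppr0.
- by rewrite [X in vsval X]/= kE !mxE /=; split=> //; field; rewrite F2.
Qed.

Lemma f_zpos : f (z_pos p pi) = ((vsproj _ (0%:M : 'M[F]_4), 1), 0).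
Proof.
have [e0 e1 e2 e3] := inord4; rewrite /z_pos fE !EE e0 e1 e2 e3; apply: ext_eq.
- by rewrite /= unit_br0 // raddf0 linear0.
- by rewrite /= !unit22E // !mxE /=; ring.
- by rewrite /= !unit22E // !mxE /=; ring.
Qed.

Lemma f_zneg : f (z_neg p pi) = ((vsproj _ (0%:M : 'M[F]_4), 0), 1).
Proof.
have [e0 e1 e2 e3] := inord4; rewrite /z_neg fE !EE e0 e1 e2 e3; apply: ext_eq.
- by rewrite /= unit_br0 // raddf0 linear0.
- by rewrite /= !unit22E // !mxE /=; ring.
- by rewrite /= !unit22E // !mxE /=; ring.
Qed.

Lemma f_zone : f (z_one p pi) = ((vsproj _ (1%:M : 'M[F]_4), 0), 0).
Proof.
have [e0 e1 e2 e3] := inord4; rewrite /z_one lfunD !fE !EE e0 e1 e2 e3; apply: ext_eq.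
- apply: subvs_inj; rewrite vsprojK; last first.
    by rewrite sl_vsE /supertrace sum4 /par22 !mxE /=; apply/eqP; ring.
  rewrite linearD /= !unit22_br // !eqxx /ksign /upar /par22 /= !expr1 !scaleN1r !mulr1n !opprK.
  by apply/matrixP=> i j; rewrite !mxE; case: (ordI4 i) => ->; case: (ordI4 j) => -> /=;
    rewrite ?addr0 ?add0r.
- by rewrite /= !unit22E // !mxE /=; ring.
- by rewrite /= !unit22E // !mxE /=; ring.
Qed.

Lemma Nmod_zpos n : act Nmod (z_pos p pi) n = central_op z1 n.
Proof. by rewrite (Nmod_scalar _ f_zpos) !scale0r add0r scale1r addr0. Qed.

Lemma Nmod_zneg n : act Nmod (z_neg p pi) n = central_op z2 n.
Proof. by rewrite (Nmod_scalar _ f_zneg) !scale0r !add0r scale1r. Qed.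

Lemma Nmod_zone n : act Nmod (z_one p pi) n = central_op one n.
Proof. by rewrite (Nmod_scalar _ f_zone) !scale0r !addr0 scale1r. Qed.
End InducedModule.

Section InducedModuleChi.
Variables (F : fieldType) (char0 : forall n, n.+1%:R != 0 :> F) (A B C D : superspace F).
Let F2 : 2 != 0 :> F := char0 1.
Variables (O1 O2 : omaps A B C D) (one z1 z2 : zmaps A B C D).
Hypothesis R : model_rel O1 O2 one z1 z2.

Lemma jordan_space_unital : unital_jordan_bimodule (jordan_space F2 O1 O2).
Proof.
have [[_ ob1 oc1 _ ub1 uc1] [_ ob2 oc2 _ ub2 uc2]] := (relO1 R, relO2 R).
apply: (jordan_criterion F2) => [q s a [[b d] c] aq ms|[[b d] c]|q s t a b c m aq bs ct|q s t a b c m aq bs ct].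
- rewrite [act _ a _](jactE F2) /jop; move: ms; rewrite !prod_spaceE /= => /andP[/andP[bs ds] cs].
  case: q aq => aq; last first.
    have [-> ->] := mx11_even aq; rewrite !scale0r !subrr !scaler0 !addr0.
    by apply/andP; split; [apply/andP; split|]; do ?apply: rpredZ.
  have [-> ->] := mx11_odd aq; rewrite !scale0r addr0 scale0r !add0r.
  have ob1' : oB O1 d \in part B (~~ s) by exact: ob1.
  have ob2' : oB O2 d \in part B (~~ s) by exact: ob2.
  have oc1' : oC O1 d \in part C (~~ s) by exact: oc1.
  have oc2' : oC O2 d \in part C (~~ s) by exact: oc2.
  have ub1' : uB O1 b \in part D (~~ s) by exact: ub1.
  have ub2' : uB O2 b \in part D (~~ s) by exact: ub2.
  have uc1' : uC O1 c \in part D (~~ s) by exact: uc1.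
  have uc2' : uC O2 c \in part D (~~ s) by exact: uc2.
  by apply/andP; split; [apply/andP; split|];
    do ?first [assumption | apply: rpredZ | apply: rpredB | apply: rpredD].
- rewrite [act _ _ _](jactE F2) /jop !mxE /= !scale0r !subrr !scaler0 !addr0 !scale1r.
  by rewrite (_ : 1 + 1 = 2 :> F) // scalerA mulVf // scale1r.
- rewrite ![act _ _ _](jactE F2); exact: (jordan_left F2 R).
- rewrite ![act _ _ _](jactE F2); exact: (jordan_middle F2 R).
Qed.
End InducedModuleChi.

(** * Central characters *)

Section CenterNilpotent.
Variables (F : fieldType) (g : lieSuper F) (p : 'Hom(sl22 F, g)).
Variables (gh : lieSuper F) (pi : 'Hom(gh, g)).
Hypothesis psl_g : is_psl22 p.
Hypothesis uce : universal_central_extension pi.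
Hypothesis char0 : forall n, n.+1%:R != 0 :> F.
Variable chi : {scalar subvs_of (center gh)}.
Let pi_ext : central_extension pi := proj1 uce.
Local Notation Z := (center gh).

(** Composition with [vsproj] extends [chi] linearly to all of [gh], so that central elements need
    not be carried in a subtype. *)
Definition chiv (z : gh) : F := chi (vsproj Z z).

Lemma chivP a u v : chiv (a *: u + v) = a * chiv u + chiv v.
Proof. by rewrite /chiv !linearP. Qed.

Definition zshift (N : act_space gh) (z : gh) : 'End(N) := act N z - chiv z *: \1%VF.

Lemma zshiftE N z v : zshift N z v = act N z v - chiv z *: v.
Proof. by rewrite add_lfunE opp_lfunE scale_lfunE id_lfunE. Qed.

Lemma zshiftP N a u v w : zshift N (a *: u + v) w = a *: zshift N u w + zshift N v w.
Proof.
by rewrite !zshiftE linearP add_lfunE scale_lfunE chivP; vect_ring.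
Qed.

Lemma z_center z : z \in [:: z_one p pi; z_pos p pi; z_neg p pi] -> z \in Z.
Proof.
rewrite !inE => /or3P[] /eqP->; apply: (center_ext uce).
- by rewrite (z_oneE psl_g uce char0) (pi_one psl_g pi_ext char0).
- by rewrite (z_posE psl_g uce char0) (pi_zp psl_g pi_ext char0).
- by rewrite (z_negE psl_g uce char0) (pi_zn psl_g pi_ext char0).
Qed.

Lemma chi_vsval (z : subvs_of Z) : chiv (vsval z) = chi z.
Proof. by rewrite /chiv vsvalK. Qed.

Lemma chi_nilp (N : act_space gh) z : module1_chi p pi chi N -> z \in Z -> nilp (zshift N z).
Proof.
move=> [_ H] zc; have [n Hn] := H (vsproj Z z); exists n => v.
rewrite -[RHS](Hn v); apply: eq_iter => w; rewrite zshiftE vsprojK //.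
Qed.

Variable N : act_space gh.
Hypothesis NL : lie_module N.

Lemma central_act z x m : z \in Z -> act N z (act N x m) = act N x (act N z m).
Proof.
move=> zc.
have bz w : br gh z w = 0 by move: zc; rewrite memv_ker => /eqP->; rewrite zero_lfunE.
have ze : z \in part gh false.
  have [a [b [c ->]]] := centerP psl_g uce char0 zc.
  by rewrite !rpredD ?rpredZ ?one_even ?zp_even ?zn_even.
have [_ NB] := NL; have H q : act N z (act N (scomp q x) m) = act N (scomp q x) (act N z m).
  have := NB _ _ _ _ m ze (scomp_part q x); rewrite bz linear0 zero_lfunE /ksign /= expr0 scale1r.
  by move/esym/subr0_eq.
by rewrite -[x]scomp_sum linearD !add_lfunE lfunD !H.
Qed.

(** The center is spanned by three elements whose shifted actions commute, and sums of commuting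
    nilpotents are nilpotent. *)
Lemma center_chi :
  (forall z, z \in [:: z_one p pi; z_pos p pi; z_neg p pi] -> nilp (zshift N z)) ->
  forall z : subvs_of Z, exists n, forall m : N,
    iter n (fun v => act N (vsval z) v - chi z *: v) m = 0.
Proof.
move=> H z; have [a [b [c ez]]] := centerP psl_g uce char0 (subvsP z).
rewrite -(z_oneE psl_g uce char0) -(z_posE psl_g uce char0) -(z_negE psl_g uce char0) in ez.
have comm u v : u \in Z -> v \in Z -> lcomm (zshift N u) (zshift N v).
  move=> uz vz w; rewrite !zshiftE !lfunD !lfunN !lfunZ (central_act _ _ uz).
  by vect_ring.
have lc k w : zshift N (k *: w) =1 k *: zshift N w.
  move=> v; have := zshiftP k w 0 v; rewrite addr0 => ->.
  by rewrite scale_lfunE [zshift N 0 v]zshiftE linear0 zero_lfunE /chiv linear0 linear0 scale0r subr0 addr0.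
have la u w : zshift N (u + w) =1 (zshift N u + zshift N w)%R.
  by move=> v; have := zshiftP 1 u w v; rewrite !scale1r add_lfunE.
have nz k w : w \in [:: z_one p pi; z_pos p pi; z_neg p pi] -> nilp (zshift N (k *: w)).
  move=> wz; apply: nilp_ext (fun v => esym (lc k w v)) _.
  by apply: nilpZ; exact: H.
have mz k w : w \in [:: z_one p pi; z_pos p pi; z_neg p pi] -> k *: w \in Z.
  by move=> wz; apply: rpredZ; exact: z_center.
have i1 : z_one p pi \in [:: z_one p pi; z_pos p pi; z_neg p pi] by rewrite inE eqxx.
have i2 : z_pos p pi \in [:: z_one p pi; z_pos p pi; z_neg p pi] by rewrite !inE eqxx orbT.
have i3 : z_neg p pi \in [:: z_one p pi; z_pos p pi; z_neg p pi] by rewrite !inE eqxx !orbT.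
have : nilp (zshift N (vsval z)).
  rewrite ez; apply: nilp_ext (fun v => esym (la _ _ v)) _; apply: nilp_add; last exact: nz.
    by apply: comm; rewrite ?rpredD ?mz.
  by apply: nilp_ext (fun v => esym (la _ _ v)) _; apply: nilp_add; [apply: comm; exact: mz | exact: nz | exact: nz].
case=> n Hn; exists n => m; rewrite -[RHS](Hn m); apply: eq_iter => w.
by rewrite zshiftE chi_vsval.
Qed.
End CenterNilpotent.

Section InducedChi.
Variables (F : fieldType) (char0 : forall n, n.+1%:R != 0 :> F) (A B C D : superspace F).
Let F2 : 2 != 0 :> F := char0 1.
Variables (O1 O2 : omaps A B C D) (one z1 z2 : zmaps A B C D).
Hypothesis R : model_rel O1 O2 one z1 z2.
Variables (g : lieSuper F) (p : 'Hom(sl22 F, g)) (gh : lieSuper F) (pi : 'Hom(gh, g)).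
Hypothesis psl_g : is_psl22 p.
Hypothesis uce : universal_central_extension pi.
Variable f : 'Hom(gh, ext_lie F).
Hypothesis f_lie : lie_morphism f.
Hypothesis fE : forall S T, f (br_lift p pi S T) = ext_bracket ((S, 0), 0) ((T, 0), 0).
Local Notation N := (Nsp A B C D).
Local Notation NX := (Nmod F2 O1 O2 one z1 z2 f).
Local Notation hs := (short_h p pi).

Lemma leigen_in (V : vectType F) (h : 'End(V)) c v :
  (v \in passmx.leigenspace h c) = (h v == c *: v).
Proof. by rewrite memv_ker add_lfunE opp_lfunE scale_lfunE id_lfunE subr_eq0. Qed.

Lemma module1_of_cube (M : act_space gh) : lie_module M ->
  (forall m, act M hs (act M hs (act M hs m)) = act M hs m) -> module1 p pi M.
Proof.
move=> ML H; split=> // c /eqP/vspaceP Hc.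
have [v vc v0] : exists2 v, v \in passmx.leigenspace (act M hs) c & v != 0.
  have : passmx.leigenspace (act M hs) c != 0%VS by apply/eqP => H0; apply: Hc => v; rewrite H0.
  by move=> H0; exists (vpick (passmx.leigenspace (act M hs) c)); rewrite ?memv_pick ?vpick0.
move: vc; rewrite leigen_in => /eqP vc.
have := H v; rewrite !(vc, lfunZ) !scalerA => /eqP.
rewrite -subr_eq0 -scalerBl scaler_eq0 (negbTE v0) orbF.
have -> : c * c * c - c = (c + 1) * (c * (c - 1)) by ring.
rewrite !mulf_eq0 addr_eq0 subr_eq0 !inE.
by case/or3P=> ->; rewrite ?orbT.
Qed.

Definition hop (n : N) : N :=
  let: (x, (be, bh, bf), (ce, ch, cf), (d11, d12, d21, d22)) := n in
  (0, (be, 0, - bf), (ce, 0, - cf), (0, d12, - d21, 0)).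

Lemma hopE n : even_op 2^-1 0 0 2^-1 0 0 n = hop n.
Proof.
move: n => [[[x [[be bh] bf]] [[ce ch] cf]] [[[d11 d12] d21] d22]].
by rewrite /even_op /hop; apply: Nsp_eq; simpl; vect_field F2.
Qed.

Lemma Nmod_hop n : act NX hs n = hop n.
Proof. by rewrite (Nmod_h fE) hopE. Qed.

Lemma Nmod_module1 : module1 p pi NX.
Proof.
apply: module1_of_cube; first exact: Nmod_lie.
move=> n; rewrite !Nmod_hop.
move: n => [[[x [[be bh] bf]] [[ce ch] cf]] [[[d11 d12] d21] d22]].
by rewrite /hop; apply: Nsp_eq; rewrite //= opprK.
Qed.

Lemma Nmod_Jor : is_Jor p pi NX (jordan_space F2 O1 O2).
Proof.
exists (top_map A B C D); split.
- move=> q [[b d] c]; rewrite top_mapE Nspace_part !prod_spaceE /Nsp_part /=.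
  by case/andP=> /andP[-> ->] ->; rewrite !mem0v.
- apply/eqP; rewrite -subv0; apply/subvP=> -[[b d] c]; rewrite memv_ker memv0 top_mapE.
  by move=> /eqP[-> -> ->].
- apply/vspaceP=> n; rewrite leigen_in scale1r Nmod_hop; apply/memv_imgP/eqP=> [[m _ ->]|].
    by move: m => [[b d] c]; rewrite top_mapE /top_vec /hop; apply: Nsp_eq; rewrite //= oppr0.
  move=> H; exists (n.1.1.2.1.1, n.2.1.1.2, n.1.2.1.1); first exact: memvf.
  rewrite top_mapE /top_vec -{1}H; move: n H => [[[x [[be bh] bf]] [[ce ch] cf]] [[[d11 d12] d21] d22]].
  move=> [hx hb hbf hc hcf h11 h21 h22].
  have neg (V : vectType F) (v : V) : - v = v -> v = 0.
    move=> vv; apply/eqP; have : 2 *: v = 0 by rewrite scaler_nat mulr2n -{1}vv addNr.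
    by move=> /eqP; rewrite scaler_eq0 (negbTE F2).
  by apply: Nsp_eq => //=; rewrite ?(neg _ _ hbf) ?(neg _ _ hcf) ?(neg _ _ h21) ?oppr0.
move=> a m; rewrite [act _ a m](jactE F2) [LHS]top_mapE [in RHS]top_mapE.
by rewrite (Nmod_jordan F2 O1 O2 one z1 z2 fE).
Qed.

Definition zmaps_nil (Z : zmaps A B C D) (c : F) : Prop :=
  [/\ nilp (zA Z - c *: \1%VF), nilp (zB Z - c *: \1%VF), nilp (zC Z - c *: \1%VF)
    & nilp (zD Z - c *: \1%VF)].

Lemma central_nil Z c : zmaps_nil Z c -> exists n, forall m : N,
  iter n (fun v => central_op Z v - c *: v) m = 0.
Proof.
move=> [[nA HA] [nB HB] [nC HC] [nD HD]]; exists (nA + nB + nC + nD)%N.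
have sh (V : vectType F) (h : 'End(V)) v : h v - c *: v = (h - c *: \1%VF) v.
  by rewrite add_lfunE opp_lfunE scale_lfunE id_lfunE.
have cA v : iter (nA + nB + nC + nD) (zA Z - c *: \1%VF) v = 0.
  by apply: (@iter_ge _ _ _ nA); rewrite ?HA // -!addnA leq_addr.
have cB v : iter (nA + nB + nC + nD) (zB Z - c *: \1%VF) v = 0.
  by apply: (@iter_ge _ _ _ nB); rewrite ?HB //; lia.
have cC v : iter (nA + nB + nC + nD) (zC Z - c *: \1%VF) v = 0.
  by apply: (@iter_ge _ _ _ nC); rewrite ?HC //; lia.
have cD v : iter (nA + nB + nC + nD) (zD Z - c *: \1%VF) v = 0.
  by apply: (@iter_ge _ _ _ nD); rewrite ?HD //; lia.
have step x be bh bf ce ch cf d11 d12 d21 d22 :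
    let n := (x, (be, bh, bf), (ce, ch, cf), (d11, d12, d21, d22)) : N in
    central_op Z n - c *: n =
    (zA Z x - c *: x, (zB Z be - c *: be, zB Z bh - c *: bh, zB Z bf - c *: bf),
     (zC Z ce - c *: ce, zC Z ch - c *: ch, zC Z cf - c *: cf),
     (zD Z d11 - c *: d11, zD Z d12 - c *: d12, zD Z d21 - c *: d21, zD Z d22 - c *: d22)) by [].
move: (nA + nB + nC + nD)%N cA cB cC cD => k cA cB cC cD.
have E x be bh bf ce ch cf d11 d12 d21 d22 :
    iter k (fun v : N => central_op Z v - c *: v)
      (x, (be, bh, bf), (ce, ch, cf), (d11, d12, d21, d22)) =
    (iter k (zA Z - c *: \1%VF) x,
     (iter k (zB Z - c *: \1%VF) be, iter k (zB Z - c *: \1%VF) bh, iter k (zB Z - c *: \1%VF) bf),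
     (iter k (zC Z - c *: \1%VF) ce, iter k (zC Z - c *: \1%VF) ch, iter k (zC Z - c *: \1%VF) cf),
     (iter k (zD Z - c *: \1%VF) d11, iter k (zD Z - c *: \1%VF) d12,
      iter k (zD Z - c *: \1%VF) d21, iter k (zD Z - c *: \1%VF) d22)).
  by elim: k {cA cB cC cD} => // k IH; rewrite !iterS IH step !sh.
by move=> [[[x [[be bh] bf]] [[ce ch] cf]] [[[d11 d12] d21] d22]]; rewrite E !cA !cB !cC !cD.
Qed.

Variable chi : {scalar subvs_of (center gh)}.
Hypothesis nil_one : zmaps_nil one (chiv chi (z_one p pi)).
Hypothesis nil_pos : zmaps_nil z1 (chiv chi (z_pos p pi)).
Hypothesis nil_neg : zmaps_nil z2 (chiv chi (z_neg p pi)).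

Lemma Nmod_chi : module1_chi p pi chi NX.
Proof.
split; first exact: Nmod_module1.
have NL := Nmod_lie F2 R f_lie.
apply: (center_chi psl_g uce char0 NL) => z.
have H Z c w : (forall n, act NX w n = central_op Z n) -> zmaps_nil Z c -> chiv chi w = c ->
    nilp (zshift chi NX w).
  move=> wE /central_nil[n Hn] cw; exists n => v; rewrite -[RHS](Hn v).
  by apply: eq_iter => u; rewrite zshiftE wE cw.
rewrite !inE => /or3P[] /eqP->.
- by apply: (H one _ _ _ nil_one) => // n; exact: (Nmod_zone fE).
- by apply: (H z1 _ _ _ nil_pos) => // n; exact: (Nmod_zpos fE).
- by apply: (H z2 _ _ _ nil_neg) => // n; exact: (Nmod_zneg fE).
Qed.

Lemma jordan_space_chi : jordan1_chi p pi chi (jordan_space F2 O1 O2).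
Proof.
split; first exact: (jordan_space_unital char0 R).
by exists NX; split; [exact: Nmod_chi | exact: Nmod_Jor].
Qed.
End InducedChi.

(** * Semisimplicity of h on a module *)

Section Eigen.
Variables (F : closedFieldType) (V : vectType F) (H : 'End(V)).

Definition sub_ev (a : F) (v : V) : V := H v - a *: v.

Lemma sub_evD a u v : sub_ev a (u + v) = sub_ev a u + sub_ev a v.
Proof. by rewrite /sub_ev lfunD; vect_ring. Qed.
Lemma sub_evZ a k v : sub_ev a (k *: v) = k *: sub_ev a v.
Proof. by rewrite /sub_ev lfunZ; vect_ring. Qed.
Lemma sub_ev0 a : sub_ev a 0 = 0.
Proof. by rewrite /sub_ev lfun0 scaler0 subr0. Qed.
Lemma sub_evC a b v : sub_ev a (sub_ev b v) = sub_ev b (sub_ev a v).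
Proof. by rewrite /sub_ev !lfunD !lfunN !lfunZ; vect_ring. Qed.

(** Evaluation of a polynomial at [H], with an explicit number of terms independent of the degree so
    that sums of different ranges can be compared. *)
Definition pact n (q : {poly F}) (v : V) : V := \sum_(i < n) q`_i *: iter i H v.

Lemma pactX n (q : {poly F}) a v : (size q <= n)%N ->
  pact n.+1 (('X - a%:P) * q) v = sub_ev a (pact n q v).
Proof.
move=> qn; rewrite /pact /sub_ev linear_sum scaler_sumr.
under eq_bigr do rewrite mulrBl coefB coefXM coefCM scalerBl.
rewrite sumrB; congr (_ - _).
  rewrite big_ord_recl /= scale0r add0r; apply: eq_bigr => i _.
  by rewrite lfunZ.
rewrite big_ord_recr /= nth_default // mulr0 scale0r addr0.
by apply: eq_bigr => i _; rewrite scalerA.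
Qed.

Fixpoint prodact (s : seq F) (v : V) : V :=
  if s is a :: s' then sub_ev a (prodact s' v) else v.

Lemma prodact_sub s a v : prodact s (sub_ev a v) = sub_ev a (prodact s v).
Proof. by elim: s => //= b s ->; rewrite sub_evC. Qed.

Lemma pact_prod s v :
  pact (size s).+1 (\prod_(z <- s) ('X - z%:P)) v = prodact s v.
Proof.
elim: s => [|a s IH].
  by rewrite big_nil /pact big_ord1 coef1 scale1r.
by rewrite big_cons pactX ?size_prod_XsubC //= IH.
Qed.

(** The vectors v, H v, ..., H^n v are linearly dependent for n the dimension, and the resulting
    polynomial splits into linear factors over the closed field. *)
Lemma annihilated v : exists s, prodact s v = 0.
Proof.
pose n := \dim {:V}; pose X := [tuple iter i H v | i < n.+1].
have nf : ~~ free X.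
  apply/negP=> /eqP fX; have := dimvS (subvf <<X>>); by rewrite fX size_tuple ltnn.
have [k kX [i0 ki0]] : exists2 k : 'I_n.+1 -> F, \sum_(i < n.+1) k i *: X`_i = 0 & exists i, k i != 0.
  apply: contrapT => nk; case/negP: nf; apply/freeP => k kX i.
  apply/eqP; apply: contrapT => /negP ki; by apply: nk; exists k => //; exists i.
pose q := \poly_(i < n.+1) k (inord i).
have q0 : q != 0.
  apply/eqP=> /polyP /(_ i0); rewrite coef_poly coef0 ltn_ord inord_val => /eqP.
  by rewrite (negbTE ki0).
have qv : pact n.+1 q v = 0.
  rewrite -[RHS]kX /pact; apply: eq_bigr => i _.
  by rewrite coef_poly ltn_ord inord_val (nth_mktuple _ 0 i).
have [s qs] := closed_field_poly_normal q.
exists s; rewrite -pact_prod; set r := \prod_(z <- s) _ in qs *.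
have lq : lead_coef q != 0 by rewrite lead_coef_eq0.
have sr : size r = (size s).+1 by rewrite size_prod_XsubC.
have szq : (size s < n.+1)%N.
  by rewrite -sr -(size_scale r lq) -qs size_poly.
move: (lead_coef q) szq qs lq => c szq qs lq.
have : c *: pact (size s).+1 r v = 0.
  rewrite -[RHS]qv qs /pact scaler_sumr.
  rewrite [RHS](eq_bigr (fun i : 'I_n.+1 => c *: (r`_i *: iter i H v))); last first.
    by move=> i _; rewrite coefZ scalerA.
  rewrite (big_ord_widen _ (fun i => c *: (r`_i *: iter i H v)) szq) [RHS](bigID (fun i : 'I_n.+1 => (i < (size s).+1)%N)) /=.
  rewrite [X in _ + X]big1 ?addr0 // => i; rewrite -leqNgt => si.
  by rewrite nth_default ?scale0r ?scaler0 // sr.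
by move/eqP; rewrite scaler_eq0 (negbTE lq) => /eqP.
Qed.

Definition gen_ev (a : F) (v : V) : Prop := exists n, iter n (sub_ev a) v = 0.

Lemma iter_subD a n u v : iter n (sub_ev a) (u + v) = iter n (sub_ev a) u + iter n (sub_ev a) v.
Proof. by elim: n => //= n ->; rewrite sub_evD. Qed.
Lemma iter_subZ a n k v : iter n (sub_ev a) (k *: v) = k *: iter n (sub_ev a) v.
Proof. by elim: n => //= n ->; rewrite sub_evZ. Qed.
Lemma iter_subC a b n v : iter n (sub_ev a) (sub_ev b v) = sub_ev b (iter n (sub_ev a) v).
Proof. by elim: n => //= n ->; rewrite sub_evC. Qed.

Lemma gen_ev0 a : gen_ev a 0. Proof. by exists 0%N. Qed.

(** H - a is the nonzero scalar b - a plus H - b, which is nilpotent on generalised eigenvectors for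
    b; so it can be inverted there. *)
Lemma gen_ev_solve a b w : a != b -> gen_ev b w -> exists2 u, gen_ev b u & sub_ev a u = w.
Proof.
move=> ab [n wn]; suff [u un ue] : exists2 u, iter n (sub_ev b) u = 0 & sub_ev a u = w.
  by exists u => //; exists n.
elim: n w wn => [w /= ->|n IH w]; first by exists 0; rewrite ?sub_ev0.
rewrite iterSr => wn; have [u ub ue] := IH _ wn.
have ba : b - a != 0 by rewrite subr_eq0 eq_sym.
(* With (H - a) u = (H - b) w one has (H - a)(w - u) = (b - a) w. *)
exists ((b - a)^-1 *: (w + (-1) *: u)).
  by rewrite iter_subZ iter_subD iter_subZ iterSr wn /= ub sub_ev0 scaler0 addr0 scaler0.
rewrite sub_evZ sub_evD sub_evZ ue.
have -> : sub_ev a w + (-1) *: sub_ev b w = (b - a) *: w by rewrite /sub_ev; vect_ring.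
by rewrite scalerA mulVf // scale1r.
Qed.

Lemma gen_ev_inj a b v : a != b -> gen_ev b v -> H v = a *: v -> v = 0.
Proof.
move=> ab [n vn] av; have E k : iter k (sub_ev b) v = (a - b) ^+ k *: v.
  elim: k => [|k IH]; rewrite ?scale1r // iterS IH sub_evZ /sub_ev av -scalerBl.
  by rewrite scalerA exprSr.
by move: vn; rewrite E => /eqP; rewrite scaler_eq0 expf_eq0 subr_eq0 (negbTE ab) andbF => /eqP.
Qed.

Lemma gen_ev_stable a b v : gen_ev a v -> gen_ev a (sub_ev b v).
Proof. by move=> [n vn]; exists n; rewrite iter_subC vn sub_ev0. Qed.

Lemma gen_evZ a k v : gen_ev a v -> gen_ev a (k *: v).
Proof. by move=> [n vn]; exists n; rewrite iter_subZ vn scaler0. Qed.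

Hypothesis ev : forall c v, v != 0 -> H v = c *: v -> c \in [:: -1; 0; 1].
Hypothesis char0 : forall n, n.+1%:R != 0 :> F.

Lemma sub_ev_inj c v : c \notin [:: -1; 0; 1] -> sub_ev c v = 0 -> v = 0.
Proof.
move=> cn /subr0_eq Hv; apply/eqP/negPn/negP=> v0.
by move: cn; rewrite (ev v0 Hv).
Qed.

Lemma gen_ev_none c v : c \notin [:: -1; 0; 1] -> gen_ev c v -> v = 0.
Proof. by move=> cn [n]; elim: n => //= n IH /(sub_ev_inj cn)/IH. Qed.

Lemma annihilated_ev v : exists2 s, {subset s <= [:: -1; 0; 1]} & prodact s v = 0.
Proof.
have [s] := annihilated v; elim: s v => [v|a s IH v /=]; first by exists [::].
rewrite -prodact_sub; case: (boolP (a \in [:: -1; 0; 1])) => ai; last first.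
  by rewrite prodact_sub => /(sub_ev_inj ai)/IH.
move=> /IH[s' s's e]; exists (a :: s'); last by rewrite /= -prodact_sub.
by move=> b; rewrite inE => /orP[/eqP->|/s's].
Qed.

(** Induction on the annihilating product: decompose (H - k) v, solve for its two components of
    eigenvalue other than k, and let the remainder of v be the component for k. *)
Lemma gen_ev_decomp v : exists a b c, [/\ v = a + b + c, gen_ev 1 a, gen_ev 0 b & gen_ev (-1) c].
Proof.
have [s ss] := annihilated_ev v; elim: s ss v => [_ v /= ->|k s IH ss v].
  by exists 0, 0, 0; split; rewrite ?addr0 //; exact: gen_ev0.
rewrite /= -prodact_sub => /(IH (fun x xs => ss x (mem_behead (s := k :: s) xs)))[a [b [c [e ga gb gc]]]].
have N1 : (-1 != 1 :> F) by rewrite eq_sym -subr_eq0 opprK; exact: char0 1.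
have N2 : (-1 != 0 :> F) by rewrite oppr_eq0; exact: char0 0.
have N3 : (1 != 0 :> F) by exact: char0 0.
have := ss k (mem_head _ _); rewrite !inE => /or3P[] /eqP kE; subst k.
- have [a' ga' ea] := gen_ev_solve N1 ga; have [b' gb' eb] := gen_ev_solve N2 gb.
  exists a', b', (v - a' - b'); split=> //; first by vect_ring.
  have E : sub_ev (-1) (v - a' - b') = c.
    have -> : v - a' - b' = v + (-1) *: a' + (-1) *: b' by rewrite !scaleN1r.
    by rewrite 2!sub_evD !sub_evZ ea eb e; vect_ring.
  by case: gc => n cn; exists n.+1; rewrite iterSr E.
- rewrite eq_sym in N2; rewrite eq_sym in N3.
  have [a' ga' ea] := gen_ev_solve N3 ga; have [b' gb' eb] := gen_ev_solve N2 gc.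
  exists a', (v - a' - b'), b'; split=> //; first by vect_ring.
  have E : sub_ev 0 (v - a' - b') = b.
    have -> : v - a' - b' = v + (-1) *: a' + (-1) *: b' by rewrite !scaleN1r.
    by rewrite 2!sub_evD !sub_evZ ea eb e; vect_ring.
  by case: gb => n cn; exists n.+1; rewrite iterSr E.
- rewrite eq_sym in N1.
  have [a' ga' ea] := gen_ev_solve N3 gb; have [b' gb' eb] := gen_ev_solve N1 gc.
  exists (v - a' - b'), a', b'; split=> //; first by vect_ring.
  have E : sub_ev 1 (v - a' - b') = a.
    have -> : v - a' - b' = v + (-1) *: a' + (-1) *: b' by rewrite !scaleN1r.
    by rewrite 2!sub_evD !sub_evZ ea eb e; vect_ring.
  by case: ga => n cn; exists n.+1; rewrite iterSr E.
Qed.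
End Eigen.

Section ShortSl2.
Variables (F : closedFieldType) (V : vectType F) (H E L : 'End(V)).
Hypothesis char0 : forall n, n.+1%:R != 0 :> F.
Hypothesis ev : forall c v, v != 0 -> H v = c *: v -> c \in [:: -1; 0; 1].
Hypothesis HE : forall v, H (E v) = E (H v) + E v.
Hypothesis HL : forall v, H (L v) = L (H v) - L v.
Hypothesis EL : forall v, E (L v) = L (E v) + H v.

Lemma natr_inj_char0 (m n : nat) : m != n -> m%:R != n%:R :> F.
Proof. by move=> mn; rewrite -subr_eq0 natr_neq. Qed.

Lemma not_weight2 : 2 \notin [:: -1; 0; 1 : F].
Proof.
rewrite !inE !negb_or; apply/and3P; split; [|exact: char0 1|exact: (@natr_inj_char0 2 1)].
by rewrite -subr_eq0 (_ : 2 - -1 = 3 :> F); [exact: char0 2 | ring].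
Qed.

Lemma sub_ev_raise a v : sub_ev H (a + 1) (E v) = E (sub_ev H a v).
Proof. by rewrite /sub_ev HE lfunD lfunN lfunZ scalerDl scale1r; vect_ring. Qed.

Lemma sub_ev_lower a v : sub_ev H (a - 1) (L v) = L (sub_ev H a v).
Proof. by rewrite /sub_ev HL lfunD lfunN lfunZ scalerBl scale1r; vect_ring. Qed.

Lemma gen_raise a v : gen_ev H a v -> gen_ev H (a + 1) (E v).
Proof.
move=> [n vn]; exists n; suff -> : iter n (sub_ev H (a + 1)) (E v) = E (iter n (sub_ev H a) v).
  by rewrite vn lfun0.
by elim: n {vn} => //= n ->; rewrite sub_ev_raise.
Qed.

Lemma gen_lower a v : gen_ev H a v -> gen_ev H (a - 1) (L v).
Proof.
move=> [n vn]; exists n; suff -> : iter n (sub_ev H (a - 1)) (L v) = L (iter n (sub_ev H a) v).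
  by rewrite vn lfun0.
by elim: n {vn} => //= n ->; rewrite sub_ev_lower.
Qed.

Lemma not_weightN2 : -2 \notin [:: -1; 0; 1 : F].
Proof.
have := not_weight2; rewrite !inE eqr_opp oppr_eq0 eqr_oppLR !negb_or.
by case/and3P=> -> -> ->.
Qed.

(** For E v = 0 one has E^3 L^3 v = 3 H (2H - 1)(H - 1) v. Here L^3 v would have weight -2 and
    vanishes. On generalised eigenvectors for 1 the factors H and 2H - 1 are injective, which leaves
    (H - 1) v = 0. *)
Lemma gen_weight1 v : gen_ev H 1 v -> H v = v.
Proof.
move=> g1; have Ev : E v = 0 by apply: (gen_ev_none ev not_weight2); exact: gen_raise g1.
have gL : gen_ev H (1 - 1 - 1 - 1) (L (L (L v))) by do 3!apply: gen_lower.
have L3 : L (L (L v)) = 0.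
  apply: (gen_ev_none ev not_weightN2).
  by rewrite (_ : -2 = 1 - 1 - 1 - 1) //; ring.
have Ek w : E w = 0 -> E (H w) = 0.
  by move=> Ew; have := HE w; rewrite Ew lfun0 addr0.
have E1 w : E w = 0 -> E (L w) = H w by move=> Ew; rewrite EL Ew lfun0 add0r.
have E2 w : E w = 0 -> E (L (L w)) = L (2 *: H w - w).
  by move=> Ew; rewrite EL HL E1 //; vect_ring.
have E3 w : E w = 0 -> E (L (L (L w))) = L (L (3 *: (H w - w))).
  by move=> Ew; rewrite EL E2 // !HL; vect_ring.
pose w := 3 *: (H v - v).
have Ew : E w = 0 by rewrite lfunZ lfunD lfunN Ek // Ev subr0 scaler0.
pose w' := 2 *: H w - w.
have Ew' : E w' = 0 by rewrite lfunD lfunN lfunZ Ek // Ew subr0 scaler0.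
have Hw' : H w' = 0 by rewrite -E1 // -E2 // -[L (L w)]E3 // L3 !lfun0.
have gw : gen_ev H 1 w.
  rewrite /w; have -> : 3 *: (H v - v) = 3 *: sub_ev H 1 v by rewrite /sub_ev scale1r.
  by apply: gen_evZ; exact: gen_ev_stable.
have w'E : w' = 2 *: sub_ev H 2^-1 w.
  by rewrite /w' /sub_ev scalerBr scalerA mulfV ?scale1r //; exact: char0 1.
have gw' : gen_ev H 1 w' by rewrite w'E; apply: gen_evZ; exact: gen_ev_stable.
have w'0 : w' = 0.
  by apply: (gen_ev_inj _ gw' (a := 0)); rewrite ?scale0r // eq_sym; exact: char0 0.
have w0 : w = 0.
  apply: (gen_ev_inj _ gw (a := 2^-1)).
    apply/eqP=> h; have : 2 * 2^-1 = 2 * 1 :> F by rewrite h.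
    rewrite mulfV ?mulr1; last exact: char0 1.
    by apply/eqP; exact: (@natr_inj_char0 1 2).
  have : sub_ev H 2^-1 w = 0.
    by move: w'E; rewrite w'0 => /esym/eqP; rewrite scaler_eq0 (negbTE (char0 1)) => /eqP.
  by move/subr0_eq.
by move/eqP: w0; rewrite scaler_eq0 (negbTE (char0 2)) /= subr_eq0 => /eqP.
Qed.
End ShortSl2.

Section ShortSemisimple.
Variables (F : closedFieldType) (V : vectType F) (H E L : 'End(V)).
Hypothesis char0 : forall n, n.+1%:R != 0 :> F.
Hypothesis ev : forall c v, v != 0 -> H v = c *: v -> c \in [:: -1; 0; 1].
Hypothesis HE : forall v, H (E v) = E (H v) + E v.
Hypothesis HL : forall v, H (L v) = L (H v) - L v.
Hypothesis EL : forall v, E (L v) = L (E v) + H v.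

(** The previous lemma for the triple -H, L, E, obtained by reversing the grading. *)
Lemma gen_weightN1 v : gen_ev H (-1) v -> H v = - v.
Proof.
move=> [n vn]; suff : (- H) v = v by rewrite opp_lfunE => /eqP; rewrite eqr_oppLR => /eqP.
apply: (@gen_weight1 F V (- H) L E char0).
- move=> c w w0; rewrite opp_lfunE => /eqP; rewrite eqr_oppLR -scaleNr => /eqP /(ev w0).
  by rewrite !inE eqr_opp oppr_eq0 eqr_oppLR; case/or3P => ->; rewrite ?orbT.
- by move=> w; rewrite !opp_lfunE HL lfunN; vect_ring.
- by move=> w; rewrite !opp_lfunE HE lfunN; vect_ring.
- by move=> w; rewrite opp_lfunE EL; vect_ring.
exists n; have E1 m w : iter m (sub_ev (- H) 1) w = (-1) ^+ m *: iter m (sub_ev H (-1)) w.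
  elim: m => [|m IH]; rewrite ?scale1r // !iterS IH sub_evZ exprS mulrC -scalerA; congr (_ *: _).
  by rewrite /sub_ev opp_lfunE; vect_ring.
by rewrite E1 vn scaler0.
Qed.

(** E v and L v are genuine eigenvectors and E, L kill H v. From L E L v = L v follows L L E v = L
    v, and the relation for [E, L] on L E v becomes E L v = L E v, that is H v = 0. *)
Lemma gen_weight0 v : gen_ev H 0 v -> H v = 0.
Proof.
move=> g0; have gE := gen_raise HE g0; have gL := gen_lower HL g0; rewrite add0r in gE; rewrite sub0r in gL.
have hE := gen_weight1 char0 ev HE HL EL gE; have hL := gen_weightN1 gL.
have EE : E (E v) = 0.
  apply: (gen_ev_none ev (not_weight2 char0)); exact: (gen_raise HE gE).
have eH : E (H v) = 0 by have := HE v; rewrite hE => /eqP; rewrite -subr_eq0 opprD addrCA subrr addr0 oppr_eq0 => /eqP.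
have lH : L (H v) = 0 by have := HL v; rewrite hL -{1}[- L v]add0r => /addIr.
have Et : E (L (E v)) = E v by rewrite EL EE lfun0 add0r hE.
have Ht : H (L (E v)) = 0 by rewrite HL hE subrr.
have LL0 : L (L v) = 0.
  apply: (gen_ev_none ev (not_weightN2 char0)); rewrite (_ : -2 = -1 - 1 :> F); last ring.
  exact: (gen_lower HL gL).
have LEL : L (E (L v)) = L v.
  by have := EL (L v); rewrite LL0 lfun0 hL => /esym/subr0_eq.
have LL : L (L (E v)) = L v by rewrite -LEL EL lfunD lH addr0.
by have := EL (L (E v)); rewrite Ht Et LL addr0 EL -{2}[L (E v)]addr0 => /addrI.
Qed.

Lemma short_semisimple v : exists a b c, [/\ v = a + b + c, H a = a, H b = 0 & H c = - c].
Proof.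
have [a [b [c [-> ga gb gc]]]] := gen_ev_decomp ev char0 v.
exists a, b, c; split=> //; first exact: (gen_weight1 char0 ev HE HL EL).
  exact: gen_weight0.
exact: gen_weightN1.
Qed.
End ShortSemisimple.

(** * Modules are determined by their top weight space *)

Section GradedModules.
Variables (F : closedFieldType) (g : lieSuper F) (p : 'Hom(sl22 F, g)).
Variables (gh : lieSuper F) (pi : 'Hom(gh, g)).
Hypothesis psl_g : is_psl22 p.
Hypothesis uce : universal_central_extension pi.
Hypothesis char0 : forall n, n.+1%:R != 0 :> F.
Let pi_ext : central_extension pi := proj1 uce.
Local Notation hs := (short_h p pi).
Local Notation e := (raise_e p pi).
Local Notation f := (lower_f p pi).

Definition short_graded (N : act_space gh) : Prop := forall n : N, exists a b c,
  [/\ n = a + b + c, act N hs a = a, act N hs b = 0 & act N hs c = - c].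

(** Subspaces as predicates: [Rel] is defined by quantification over raising elements, not as a
    [{vspace}]. *)
Definition linear_pred (V : lmodType F) (P : V -> Prop) : Prop :=
  P 0 /\ forall k u v, P u -> P v -> P (k *: u + v).

Lemma linear_predD (V : lmodType F) (P : V -> Prop) u v : linear_pred P -> P u -> P v -> P (u + v).
Proof. by move=> [_ H] Pu Pv; rewrite -[u]scale1r; exact: H. Qed.
Lemma linear_predZ (V : lmodType F) (P : V -> Prop) k u : linear_pred P -> P u -> P (k *: u).
Proof. by move=> [H0 H] Pu; rewrite -[_ *: _]addr0; exact: H. Qed.
Lemma linear_predN (V : lmodType F) (P : V -> Prop) u : linear_pred P -> P u -> P (- u).
Proof. by move=> H Pu; rewrite -scaleN1r; exact: linear_predZ. Qed.

Definition deg0_comb (k : 'I_9 -> F) : gh :=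
  k 0 *: rootv p pi j0 j2 + k 1 *: rootv p pi j1 j3 + k 2 *: rootv p pi j2 j0 + k 3 *: rootv p pi j3 j1
     + (k 4 *: hh1 p pi + k 5 *: hh2 p pi + k 6 *: one p pi + k 7 *: zp p pi + k 8 *: zn p pi).

Lemma hs_deg0 k : br gh hs (deg0_comb k) = 0.
Proof.
have hh i j : i != j -> sdeg i = 1 -> sdeg j = -1 -> br gh hs (br gh (rootv p pi i j) (rootv p pi j i)) = 0.
  move=> ij di dj; have ji : j != i by rewrite eq_sym.
  rewrite (br_jacobi _ (hs_even psl_g uce char0) (x_part p pi i j)).
  by rewrite (hs_x1 psl_g uce char0) // (hs_xN psl_g uce char0) // /ksign /= expr0 scale1r lfunN subrr.
rewrite /deg0_comb 8!lfunD !lfunZ !(hs_x0 psl_g uce char0) //.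
rewrite [br gh hs (hh1 p pi)]hh // [br gh hs (hh2 p pi)]hh //.
rewrite [br gh hs (one p pi)](br_ker pi_ext) ?(pi_one psl_g pi_ext char0) //.
rewrite [br gh hs (zp p pi)](br_ker pi_ext) ?(pi_zp psl_g pi_ext char0) //.
rewrite [br gh hs (zn p pi)](br_ker pi_ext) ?(pi_zn psl_g pi_ext char0) //.
by rewrite !scaler0 !addr0.
Qed.

Lemma deg0_span z : br gh hs z = 0 -> exists k, z = deg0_comb k.
Proof.
have [a [b [c [ez ha hc [k bk]]]]] := gh_grading psl_g uce char0 z => hz.
have hb : br gh hs b = 0 by rewrite bk; exact: hs_deg0.
have ac : a - c = 0 by rewrite -hz ez 2!lfunD ha hb hc addr0.
have ac2 : a + c = 0.
  by have := congr1 (br gh hs) ac; rewrite lfunD lfunN lfun0 ha hc opprK.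
have a0 : a = 0.
  have : 2 *: a = (a - c) + (a + c) by vect_ring.
  by rewrite ac ac2 addr0 => /eqP; rewrite scaler_eq0 (negbTE (char0 1)) => /eqP.
have c0 : c = 0 by move: ac2; rewrite a0 add0r.
by exists k; rewrite ez a0 c0 add0r addr0.
Qed.

Section OneModule.
Variable N : act_space gh.
Hypothesis NL : lie_module N.
Hypothesis dec : short_graded N.
Local Notation "x ** n" := (act N x n) (at level 40, left associativity).

Lemma act_br q s x y n : x \in part gh q -> y \in part gh s ->
  br gh x y ** n = x ** (y ** n) - ksign F q s *: (y ** (x ** n)).
Proof. by case: NL => _ H xq ys; exact: H. Qed.

Lemma act_swap q s x y n : x \in part gh q -> y \in part gh s ->
  y ** (x ** n) = ksign F q s *: (x ** (y ** n) - br gh x y ** n).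
Proof.
move=> xq ys; rewrite (act_br n xq ys) opprB addrCA subrr addr0 scalerA ksignK scale1r //.
Qed.

Lemma act_hs x n : hs ** (x ** n) = x ** (hs ** n) + br gh hs x ** n.
Proof.
rewrite -[x]scomp_sum !(linearD, add_lfunE) /=.
have H q : hs ** (scomp q x ** n) = scomp q x ** (hs ** n) + br gh hs (scomp q x) ** n.
  rewrite (act_br n (hs_even psl_g uce char0) (scomp_part q x)) /ksign /= expr0 scale1r.
  by rewrite addrCA subrr addr0.
by rewrite !H addrACA.
Qed.

Definition wgt (k : F) (n : N) : Prop := hs ** n = k *: n.

Lemma wgt_none k n : k \notin [:: -1; 0; 1] -> wgt k n -> n = 0.
Proof.
move=> kn hn; have cube : hs ** (hs ** (hs ** n)) = hs ** n.
  have [a [b [c [-> ha hb hc]]]] := dec n.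
  by rewrite !(lfunD, lfunN, ha, hb, hc, lfun0, opprK).
move: cube; rewrite !(hn, lfunZ, scalerA) => /eqP.
rewrite -subr_eq0 -scalerBl scaler_eq0 => /orP[|/eqP//].
have -> : k * k * k - k = (k + 1) * (k * (k - 1)) by ring.
rewrite !mulf_eq0 addr_eq0 subr_eq0; move: kn; rewrite !inE !negb_or.
by case/and3P=> /negbTE-> /negbTE-> /negbTE->.
Qed.

Lemma wgt_act k l x n : br gh hs x = k *: x -> wgt l n -> wgt (l + k) (x ** n).
Proof.
by move=> hx hn; rewrite /wgt act_hs hn hx lfunZ (lfunZ (act N)) scale_lfunE scalerDl.
Qed.

Lemma raise_top u n : br gh hs u = u -> wgt 1 n -> u ** n = 0.
Proof.
move=> hu hn; apply: (wgt_none (not_weight2 char0)); rewrite (_ : 2 = 1 + 1) //.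
by apply: wgt_act; rewrite ?scale1r.
Qed.

Lemma lower_bottom y n : br gh hs y = - y -> wgt (-1) n -> y ** n = 0.
Proof.
move=> hy hn; apply: (wgt_none (not_weightN2 char0)); rewrite (_ : -2 = -1 + -1 :> F); last by ring.
by apply: wgt_act; rewrite ?scaleN1r.
Qed.

Lemma wgt_up u n k : br gh hs u = u -> wgt k n -> wgt (k + 1) (u ** n).
Proof. by move=> hu; apply: wgt_act; rewrite scale1r. Qed.

Lemma wgt_down y n k : br gh hs y = - y -> wgt k n -> wgt (k - 1) (y ** n).
Proof. by move=> hy; apply: wgt_act; rewrite scaleN1r. Qed.

Lemma ef_act n : e ** (f ** n) = f ** (e ** n) + hs ** n.
Proof.
rewrite -(br_ef psl_g uce char0) (act_br n (e_even p pi) (f_even p pi)) /ksign /= expr0 scale1r.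
by rewrite addrCA subrr addr0.
Qed.

Definition submod (P : N -> Prop) : Prop := linear_pred P /\ forall x n, P n -> P (x ** n).

Variables (u1 y1 u2 y2 ze : gh).
Hypothesis u1_odd : u1 \in part gh true. Hypothesis y1_odd : y1 \in part gh true.
Hypothesis u2_odd : u2 \in part gh true. Hypothesis y2_odd : y2 \in part gh true.
Hypothesis u1_deg : br gh hs u1 = u1. Hypothesis y1_deg : br gh hs y1 = - y1.
Hypothesis u2_deg : br gh hs u2 = u2. Hypothesis y2_deg : br gh hs y2 = - y2.
Hypothesis zeE : ze = br gh u1 y1 + br gh u2 y2.
Hypothesis ze_center : ze \in center gh.
Hypothesis ze_bij : exists k : 'End(N), (forall n, k (ze ** n) = n) /\ (forall n, ze ** (k n) = n).

Lemma ze_act n : ze ** n = u1 ** (y1 ** n) + y1 ** (u1 ** n) + (u2 ** (y2 ** n) + y2 ** (u2 ** n)).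
Proof.
rewrite zeE linearD add_lfunE (act_br n u1_odd y1_odd) (act_br n u2_odd y2_odd).
by rewrite (_ : ksign F true true = -1) // !scaleN1r !opprK.
Qed.

(** N is generated by N[1]. Weight -1 is reached from weight 1 by applying f twice. In weight 0 the
    bijective central [ze] is a sum of terms u y + y u, so each vector is a sum of images of vectors
    of weight 1 and -1. *)
Lemma submod_full P : submod P -> (forall n, wgt 1 n -> P n) -> forall n, P n.
Proof.
move=> [Pl Pa] P1; have he := br_he psl_g uce char0; have hf := br_hf psl_g uce char0.
have low n : wgt 0 n -> P (f ** n).
  move=> w0; have w1 := wgt_up he w0; rewrite add0r in w1.
  have wN := wgt_down hf w0; rewrite sub0r in wN.
  have E1 : e ** (f ** n) = f ** (e ** n) by rewrite ef_act w0 scale0r addr0.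
  have -> : f ** n = f ** (e ** (f ** n)).
    have := ef_act (f ** n); rewrite [f ** (f ** n)](lower_bottom hf wN) lfun0 wN scaleN1r.
    by move/esym/subr0_eq/esym.
  by apply: (Pa); rewrite E1; apply: (Pa); exact: P1.
have bot n : wgt (-1) n -> P n.
  move=> wN; have w0 := wgt_up he wN; rewrite addNr in w0.
  have := ef_act n; rewrite (lower_bottom hf wN) lfun0 wN scaleN1r => /esym/subr0_eq <-.
  exact: low.
have mid n : wgt 0 n -> P n.
  move=> w0; have [k [kz zk]] := ze_bij; rewrite -[n]zk.
  have wk : wgt 0 (k n).
    rewrite /wgt scale0r -[hs ** k n]kz (central_act psl_g uce char0 NL) // zk w0.
    by rewrite scale0r lfun0.
  have wu u : br gh hs u = u -> wgt 1 (u ** k n) by move=> hu; have := wgt_up hu wk; rewrite add0r.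
  have wy y : br gh hs y = - y -> wgt (-1) (y ** k n) by move=> hy; have := wgt_down hy wk; rewrite sub0r.
  rewrite ze_act; do 3?[apply: (linear_predD Pl)]; apply: (Pa);
    first [by apply: (bot); exact: wy | by apply: (P1); exact: wu].
move=> n; have [a [b [c [-> ha hb hc]]]] := dec n.
apply: (linear_predD Pl); first apply: (linear_predD Pl).
- by apply: (P1); rewrite /wgt ha scale1r.
- by apply: (mid); rewrite /wgt hb scale0r.
- by apply: (bot); rewrite /wgt hc scaleN1r.
Qed.

(** Dual to [submod_full]: if the top part of P is zero, raising kills its part of weight 0, hence f
    does too and the part of weight -1 vanishes. Every term of [ze] then kills the part of weight 0,
    on which [ze] is injective. *)
Lemma submod_zero P : submod P -> (forall n, wgt 1 n -> P n -> n = 0) -> forall n, P n -> n = 0.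
Proof.
move=> [Pl Pa] P1; have he := br_he psl_g uce char0; have hf := br_hf psl_g uce char0.
have up u n : br gh hs u = u -> wgt 0 n -> P n -> u ** n = 0.
  move=> hu w0 Pn; apply: (P1); last exact: Pa.
  by have := wgt_up hu w0; rewrite add0r.
have low n : wgt 0 n -> P n -> f ** n = 0.
  move=> w0 Pn; have wN := wgt_down hf w0; rewrite sub0r in wN.
  have := ef_act (f ** n); rewrite [f ** (f ** n)](lower_bottom hf wN) lfun0 wN scaleN1r.
  by rewrite ef_act (up _ _ he) // w0 scale0r lfun0 addr0 lfun0 sub0r => /esym/eqP; rewrite oppr_eq0 => /eqP.
have bot n : wgt (-1) n -> P n -> n = 0.
  move=> wN Pn; have w0 := wgt_up he wN; rewrite addNr in w0.
  have := ef_act n; rewrite (lower_bottom hf wN) lfun0 wN scaleN1r low //; last exact: Pa.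
  by rewrite sub0r => /esym/eqP; rewrite oppr_eq0 => /eqP.
have mid n : wgt 0 n -> P n -> n = 0.
  move=> w0 Pn; have [k [kz zk]] := ze_bij; rewrite -[n]kz ze_act.
  have down y : br gh hs y = - y -> y ** n = 0.
    by move=> hy; apply: (bot); [have := wgt_down hy w0; rewrite sub0r | exact: Pa].
  by rewrite (down y1) // (down y2) // (up u1 n) // (up u2 n) // !lfun0 !addr0 lfun0.
move=> n; have [a [b [c [-> ha hb hc]]]] := dec n => Pn.
have Ph := Pa hs _ Pn; have Phh := Pa hs _ Ph.
rewrite !(lfunD, lfunN, ha, hb, hc, lfun0, addr0, opprK) in Ph Phh.
have F2 := char0 1; have Pa' : P a.
  by have -> : a = 2^-1 *: ((a - c) + (a + c)); [vect_field F2 | apply: linear_predZ => //; exact: linear_predD].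
have Pc : P c.
  have -> : c = (a + c) + (- a) by vect_ring.
  by apply: linear_predD => //; exact: linear_predN.
have Pb : P b.
  have -> : b = (a + b + c) + (- (a + c)) by vect_ring.
  by apply: linear_predD => //; exact: linear_predN.
have -> : a = 0 by apply: (P1) => //; rewrite /wgt ha scale1r.
have -> : b = 0 by apply: (mid) => //; rewrite /wgt hb scale0r.
have -> : c = 0 by apply: (bot) => //; rewrite /wgt hc scaleN1r.
by rewrite !addr0.
Qed.
End OneModule.
End GradedModules.

(** * Submodules with prescribed top weight space *)

Section TopRelation.
Variables (F : closedFieldType) (g : lieSuper F) (p : 'Hom(sl22 F, g)).
Variables (gh : lieSuper F) (pi : 'Hom(gh, g)).
Hypothesis psl_g : is_psl22 p.
Hypothesis uce : universal_central_extension pi.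
Hypothesis char0 : forall n, n.+1%:R != 0 :> F.
Let pi_ext : central_extension pi := proj1 uce.
Local Notation hs := (short_h p pi).
Local Notation x := (rootv p pi).
Variable N : act_space gh.
Hypothesis NL : lie_module N.
Hypothesis dec : short_graded p pi N.
Local Notation "x ** n" := (act N x n) (at level 40, left associativity).
Local Notation wgt := (wgt p pi).
Variable S : N -> Prop.
Hypothesis Sl : linear_pred S.
Hypothesis S1 : forall n, S n -> wgt 1 n.
Hypothesis SJ : forall (a : M11 F) n, S n -> S (br_lift p pi (M11_emb a) (short_f F) ** n).

Definition stab (z : gh) : Prop := forall n, S n -> S (z ** n).

Lemma stabD z w : stab z -> stab w -> stab (z + w).
Proof. by move=> Hz Hw n Sn; rewrite lfunD add_lfunE; apply: linear_predD => //; [exact: Hz | exact: Hw]. Qed.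

Lemma stabZ k z : stab z -> stab (k *: z).
Proof. by move=> Hz n Sn; rewrite lfunZ scale_lfunE; apply: linear_predZ => //; exact: Hz. Qed.

Lemma stab_br q s z w : z \in part gh q -> w \in part gh s -> stab z -> stab w -> stab (br gh z w).
Proof.
move=> zq ws Hz Hw n Sn; rewrite (act_br NL n zq ws) -scaleNr; apply: linear_predD => //.
  by apply: (Hz); exact: Hw.
by apply: linear_predZ => //; apply: (Hw); exact: Hz.
Qed.

(** The degree 0 part is generated by the elements through which the Jordan algebra acts. These give
    [hh1], [hh2] and the differences of odd root vectors; bracketing with [hh1] gives the sums,
    hence each odd root vector, and their brackets give the center. *)
Lemma stab_deg0 z : br gh hs z = 0 -> stab z.
Proof.
have F2 := char0 1; have half z' : stab (2^-1 *: z') -> stab z'.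
  by move=> H; have -> : z' = 2 *: (2^-1 *: z'); [rewrite scalerA mulfV ?scale1r | exact: stabZ].
have J a : stab (br_lift p pi (M11_emb a) (short_f F)) by move=> n; exact: SJ.
have e00 : stab (hh1 p pi).
  apply: half; have := J (delta_mx 0 0 : 'M[F]_2); rewrite (jordan_brE psl_g uce char0) !mxE /=.
  by rewrite !scale0r !addr0 scale1r.
have e11 : stab (hh2 p pi).
  apply: half; have := J (delta_mx 1 1 : 'M[F]_2); rewrite (jordan_brE psl_g uce char0) !mxE /=.
  by rewrite !scale0r !addr0 add0r scale1r.
have e01 : stab (x j0 j2 - x j1 j3).
  apply: half; have := J (delta_mx 0 1 : 'M[F]_2); rewrite (jordan_brE psl_g uce char0) !mxE /=.
  by rewrite !scale0r !add0r addr0 scale1r.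
have e10 : stab (x j2 j0 - x j3 j1).
  apply: half; have := J (delta_mx 1 0 : 'M[F]_2); rewrite (jordan_brE psl_g uce char0) !mxE /=.
  by rewrite !scale0r !add0r scale1r.
have o i j : upar i j = true -> x i j \in part gh true by move=> <-; exact: x_part.
have h1e := hh1_even p pi.
have f01 : stab (x j0 j2 + x j1 j3).
  have -> : x j0 j2 + x j1 j3 = br gh (hh1 p pi) (x j0 j2 - x j1 j3).
    rewrite lfunD lfunN !(hh1_x psl_g pi_ext char0) // /hdiag /= subr0 subr0 sub0r !subr0.
    by rewrite scale1r scaleN1r opprK.
  by apply: (stab_br h1e _ e00 e01); apply: rpredB; apply: o.
have f10 : stab (- x j2 j0 - x j3 j1).
  have -> : - x j2 j0 - x j3 j1 = br gh (hh1 p pi) (x j2 j0 - x j3 j1).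
    rewrite lfunD lfunN !(hh1_x psl_g pi_ext char0) // /hdiag /= !subr0 !sub0r opprK.
    by rewrite scale1r scaleN1r.
  by apply: (stab_br h1e _ e00 e10); apply: rpredB; apply: o.
have s02 : stab (x j0 j2).
  have -> : x j0 j2 = 2^-1 *: ((x j0 j2 - x j1 j3) + (x j0 j2 + x j1 j3)) by vect_field F2.
  by apply: stabZ; exact: stabD.
have s13 : stab (x j1 j3).
  have -> : x j1 j3 = (x j0 j2 + x j1 j3) + (-1) *: x j0 j2 by vect_ring.
  by apply: stabD => //; exact: stabZ.
have s31 : stab (x j3 j1).
  have -> : x j3 j1 = - 2^-1 *: ((x j2 j0 - x j3 j1) + (- x j2 j0 - x j3 j1)) by vect_field F2.
  by apply: stabZ; exact: stabD.
have s20 : stab (x j2 j0).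
  have -> : x j2 j0 = (x j2 j0 - x j3 j1) + x j3 j1 by vect_ring.
  exact: stabD.
have zps : stab (zp p pi) by apply: (stab_br (o _ _ _) (o _ _ _)).
have zns : stab (zn p pi) by apply: (stab_br (o _ _ _) (o _ _ _)).
have ons : stab (one p pi).
  by apply: stabD; apply: (stab_br (o _ _ _) (o _ _ _)).
move=> /(deg0_span psl_g uce char0)[k ->].
by rewrite /deg0_comb; do ?[apply: stabD]; apply: stabZ.
Qed.

Definition raising (u : gh) : Prop := br gh hs u = u /\ exists q, u \in part gh q.

(** The largest submodule whose top weight space is contained in S: whatever raising produces in
    weight 1 must lie in S. Defining it from above makes its intersection with N[1] immediate and
    leaves stability to be checked. *)
Definition Rel (n : N) : Prop := exists a b c,
  [/\ n = a + b + c, [/\ wgt 1 a, wgt 0 b & wgt (-1) c], S a,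
      forall u, raising u -> S (u ** b)
    & forall u v, raising u -> raising v -> S (u ** (v ** c))].

Lemma wgtD k u v : wgt k u -> wgt k v -> wgt k (u + v : N).
Proof. by rewrite /wgt lfunD scalerDr => -> ->. Qed.
Lemma wgtZ k l u : wgt k u -> wgt k (l *: u : N).
Proof. by rewrite /wgt lfunZ => ->; rewrite !scalerA mulrC. Qed.
Lemma wgt0v k : wgt k (0 : N).
Proof. by rewrite /wgt lfun0 scaler0. Qed.

Lemma Rel_linear : linear_pred Rel.
Proof.
split.
  exists 0, 0, 0; split; rewrite ?addr0 //; first (by split; exact: wgt0v).
  - by case: Sl.
  - by move=> u _; rewrite lfun0; case: Sl.
  - by move=> u v _ _; rewrite !lfun0; case: Sl.
move=> k _ _ [a [b [c [-> [wa wb wc] Sa Sb Sc]]]] [a' [b' [c' [-> [wa' wb' wc'] Sa' Sb' Sc']]]].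
exists (k *: a + a'), (k *: b + b'), (k *: c + c'); split.
- by vect_ring.
- by split; apply: wgtD => //; exact: wgtZ.
- by case: Sl => _; apply.
- by move=> u ru; rewrite lfunD lfunZ; case: Sl => _; apply; [exact: Sb | exact: Sb'].
- move=> u v ru rv; rewrite [v ** _]lfunD [v ** (_ *: _)]lfunZ lfunD lfunZ.
  by case: Sl => _; apply; [exact: Sc | exact: Sc'].
Qed.

Lemma Rel_top n : S n -> Rel n.
Proof.
move=> Sn; exists n, 0, 0; split; rewrite ?addr0 //.
- by split; [exact: S1 | exact: wgt0v | exact: wgt0v].
- by move=> u _; rewrite lfun0; case: Sl.
- by move=> u v _ _; rewrite !lfun0; case: Sl.
Qed.

Lemma Rel_wgt1 n : wgt 1 n -> Rel n -> S n.
Proof.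
move=> wn [a [b [c [e [wa wb wc] Sa _ _]]]]; suff -> : n = a by [].
have F2 := char0 1.
have e1 : n = a - c.
  by rewrite -[n]scale1r -wn e !lfunD wa wb wc scale1r scale0r scaleN1r addr0.
have e2 : n = a + c.
  rewrite -[n]scale1r -wn {1}e1 lfunD lfunN wa wc scale1r scaleN1r opprK //.
have : 2 *: n = 2 *: a by rewrite scaler_nat mulr2n {1}e1 e2; vect_ring.
by move/(scalerI F2).
Qed.

Lemma raising_br q z u : z \in part gh q -> br gh hs z = 0 -> raising u -> raising (br gh z u).
Proof.
move=> zq hz [hu [s us]]; split; last by exists (q (+) s); exact: br_part.
rewrite (br_jacobi _ (hs_even psl_g uce char0) zq) hz lfun0 zero_lfunE add0r hu /ksign /= expr0.
exact: scale1r.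
Qed.

Lemma lowering_br q y u : y \in part gh q -> br gh hs y = - y -> raising u ->
  br gh hs (br gh y u) = 0.
Proof.
move=> yq hy [hu [s us]]; rewrite (br_jacobi _ (hs_even psl_g uce char0) yq) hy hu lfunN opp_lfunE.
by rewrite /ksign /= expr0 scale1r addNr.
Qed.

Lemma S_swap q s z w n : z \in part gh q -> w \in part gh s ->
  S (z ** (w ** n)) -> S (br gh z w ** n) -> S (w ** (z ** n)).
Proof.
move=> zq ws H1 H2; rewrite (act_swap NL n zq ws); apply: linear_predZ => //.
by apply: linear_predD => //; exact: linear_predN.
Qed.

Lemma S0 : S 0. Proof. by case: Sl. Qed.

Lemma Rel_raise u n : raising u -> Rel n -> Rel (u ** n).
Proof.
move=> ru [a [b [c [-> [wa wb wc] Sa Sb Sc]]]]; have [hu _] := ru.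
exists (u ** b), (u ** c), 0; split.
- by rewrite !lfunD (raise_top psl_g uce char0 NL dec hu wa) add0r addr0.
- split; last exact: wgt0v.
    by have := wgt_up psl_g uce char0 NL hu wb; rewrite add0r.
  by have := wgt_up psl_g uce char0 NL hu wc; rewrite addNr.
- exact: Sb.
- by move=> v rv; exact: Sc.
- by move=> v w _ _; rewrite !lfun0; exact: S0.
Qed.

Lemma Rel_deg0 q z n : z \in part gh q -> br gh hs z = 0 -> Rel n -> Rel (z ** n).
Proof.
move=> zq hz [a [b [c [-> [wa wb wc] Sa Sb Sc]]]]; have zs := stab_deg0 hz.
have wz k m : wgt k m -> wgt k (z ** m).
  by move=> wm; have := @wgt_act _ _ _ _ _ psl_g uce char0 N NL 0 k z m _ wm;
    rewrite addr0 scale0r; apply.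
have comm u m : raising u -> S (u ** m) -> S (br gh z u ** m) -> S (u ** (z ** m)).
  by move=> [_ [s us]] H1 H2; apply: (S_swap zq us) => //; exact: zs.
exists (z ** a), (z ** b), (z ** c); split.
- by rewrite !lfunD.
- by split; exact: wz.
- exact: zs.
- by move=> u ru; apply: comm => //; apply: (Sb) => //; exact: (raising_br zq hz ru).
move=> u v ru rv; have [_ [s vs]] := rv.
have r1 := raising_br zq hz rv; have r2 := raising_br zq hz ru.
rewrite (act_swap NL c zq vs) lfunZ lfunD lfunN; apply: linear_predZ => //.
apply: linear_predD => //; last by apply: linear_predN => //; exact: Sc.
by apply: comm => //; exact: Sc.
Qed.

(** Moving a raising element past [y] leaves a commutator of degree 0, which stabilises S; in the
    double raising such a commutator is in turn moved past the other raising element and yields a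
    new raising element. *)
Lemma Rel_lower q y n : y \in part gh q -> br gh hs y = - y -> Rel n -> Rel (y ** n).
Proof.
move=> yq hy [a [b [c [-> [wa wb wc] Sa Sb Sc]]]].
have down m : wgt 1 m -> forall u, raising u -> S m -> S (u ** (y ** m)).
  move=> wm u ru Sm; have [hu [s us]] := ru; apply: (S_swap yq us).
    by rewrite (raise_top psl_g uce char0 NL dec hu wm) lfun0; exact: S0.
  by apply: (stab_deg0 (lowering_br yq hy ru)).
exists 0, (y ** a), (y ** b); split.
- by rewrite !lfunD (lower_bottom psl_g uce char0 NL dec hy wc) addr0 add0r.
- split; first exact: wgt0v.
    by have := wgt_down psl_g uce char0 NL hy wa; rewrite subrr.
  by have := wgt_down psl_g uce char0 NL hy wb; rewrite sub0r.
- exact: S0.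
- by move=> u ru; apply: down.
move=> u v ru rv; have [hv [s vs]] := rv; have [hu [t ut]] := ru.
have wvb : wgt 1 (v ** b) by have := wgt_up psl_g uce char0 NL hv wb; rewrite add0r.
have hz := lowering_br yq hy rv; have zq := br_part yq vs.
rewrite (act_swap NL b yq vs) lfunZ lfunD lfunN; apply: linear_predZ => //.
apply: linear_predD => //; first by apply: down => //; exact: Sb.
apply: linear_predN => //; apply: (S_swap zq ut).
  by apply: (stab_deg0 hz); exact: Sb.
exact: (Sb _ (raising_br zq hz ru)).
Qed.

Lemma Rel_submod : submod Rel.
Proof.
split; first exact: Rel_linear.
move=> w n Rn; have [a [b [c [-> ha hc [k bk]]]]] := gh_grading psl_g uce char0 w.
have hq z l q : br gh hs z = l *: z -> br gh hs (scomp q z) = l *: scomp q z.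
  move=> hz; have := even_map_scomp q z (f := br gh hs).
  move=> ->; first by rewrite hz -[l *: z]addr0 scomp_linear scomp0 addr0.
  by move=> r v vr; have := br_part (hs_even psl_g uce char0) vr.
have split_par z : (forall q, Rel (scomp q z ** n)) -> Rel (z ** n).
  move=> H; rewrite -[z]scomp_sum lfunD add_lfunE; apply: linear_predD => //; exact: Rel_linear.
rewrite 2!lfunD !add_lfunE; apply: linear_predD; first exact: Rel_linear.
  apply: linear_predD; first exact: Rel_linear.
    apply: split_par => q; apply: Rel_raise => //; split; last by exists q; exact: scomp_part.
    by have := @hq a 1 q; rewrite !scale1r; apply.
  apply: split_par => q; apply: (Rel_deg0 (scomp_part q b)) => //.
  have hb : br gh hs b = 0 by rewrite bk; exact: (hs_deg0 psl_g uce char0).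
  by have := @hq b 0 q; rewrite !scale0r; apply.
apply: split_par => q; apply: (Rel_lower (scomp_part q c)) => //.
by have := @hq c (-1) q; rewrite !scaleN1r; apply.
Qed.
End TopRelation.

Section ProductModule.
Variables (F : fieldType) (L : lieSuper F) (N N' : act_space L).

Definition pmod_op (x : L) (n : (N * N')%type) : (N * N')%type := (act N x n.1, act N' x n.2).

Fact pmod_r x : linear (pmod_op x).
Proof. by move=> a u v; apply: prod_eq; rewrite /= linearP. Qed.

Fact pmod_l n : linear (pmod_op^~ n).
Proof. by move=> a u v; apply: prod_eq; rewrite /= linearP add_lfunE scale_lfunE. Qed.

(** Serves as the ambient module of graphs of morphisms. *)
Definition pmod : act_space L := @ActSpace F L (prod_space N N') (bilin_lfun pmod_r pmod_l).

Lemma pmodE x n : act pmod x n = pmod_op x n.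
Proof. exact: bilin_lfunE. Qed.

Lemma pmod_lie : lie_module N -> lie_module N' -> lie_module pmod.
Proof.
move=> [H1 H2] [K1 K2]; split=> [q s x m xq|q s x y m xq ys].
  by rewrite pmodE !prod_spaceE => /andP[m1 m2]; rewrite /pmod_op H1 // K1.
by rewrite !pmodE; apply: prod_eq; rewrite /= ?(H2 _ _ _ _ _ xq ys) ?(K2 _ _ _ _ _ xq ys).
Qed.
End ProductModule.

Lemma scomp_act (F : fieldType) (L : lieSuper F) (N : act_space L) q s x n :
  lie_module N -> x \in part L s ->
  scomp q (act N x n) = act N x (scomp (q (+) s) n).
Proof.
move=> [H _] xs; rewrite -{1}[n](scomp_sum n) lfunD scompD.
have E r : scomp q (act N x (scomp r n)) = if r == q (+) s then act N x (scomp r n) else 0.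
  have := H _ _ _ _ xs (scomp_part r n); case: eqP => [->|rq] Hp.
    by apply: scomp_id; move: Hp; rewrite addbCA addbb addbF.
  apply: scomp_other; suff -> : ~~ q = s (+) r by [].
  by move: rq; case: (q); case: (s); case: (r).
by rewrite !E; case: (q (+) s); rewrite /= ?addr0 ?add0r.
Qed.

(** * Extension of bimodule morphisms to modules *)

Section Extend.
Variables (F : closedFieldType) (g : lieSuper F) (p : 'Hom(sl22 F, g)).
Variables (gh : lieSuper F) (pi : 'Hom(gh, g)).
Hypothesis psl_g : is_psl22 p.
Hypothesis uce : universal_central_extension pi.
Hypothesis char0 : forall n, n.+1%:R != 0 :> F.
Variable chi : {scalar subvs_of (center gh)}.
Hypothesis chi_atyp : semisimple_atypical p pi chi.
Let pi_ext : central_extension pi := proj1 uce.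
Local Notation hs := (short_h p pi).
Local Notation x := (rootv p pi).

Lemma chi_short_graded N : module1_chi p pi chi N -> short_graded p pi N.
Proof.
move=> [[NL ev] _]; apply: (@short_semisimple F N (act N hs) (act N (raise_e p pi)) (act N (lower_f p pi)) char0).
- move=> c v v0 hv; apply: ev; apply/eqP=> /vspaceP /(_ v); rewrite leigen_in hv eqxx memv0 => /esym.
  by rewrite (negbTE v0).
- by move=> v; rewrite (act_hs psl_g uce char0 NL) (br_he psl_g uce char0).
- by move=> v; rewrite (act_hs psl_g uce char0 NL) (br_hf psl_g uce char0) lfunN opp_lfunE.
- exact: (ef_act psl_g uce char0 NL).
Qed.

Definition pivot (u1 y1 u2 y2 z : gh) : Prop :=
  [/\ [/\ u1 \in part gh true, y1 \in part gh true, u2 \in part gh true & y2 \in part gh true],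
      [/\ br gh hs u1 = u1, br gh hs y1 = - y1, br gh hs u2 = u2 & br gh hs y2 = - y2],
      z = br gh u1 y1 + br gh u2 y2, z \in center gh
    & chiv chi z != 0].

(** D(chi) = 4 is nonzero, so chi cannot vanish on both [z_one] and [z_pos]. The first is a sum of
    two brackets of raising with lowering odd elements, the second a single one, completed by
    zeros. *)
Lemma pivot_exists : exists u1 y1 u2 y2 z, pivot u1 y1 u2 y2 z.
Proof.
have o i j : upar i j = true -> x i j \in part gh true by move=> <-; exact: x_part.
have h1 := hs_x1 psl_g uce char0; have hN := hs_xN psl_g uce char0.
have ce := z_center psl_g uce char0.
have [c1|c1] := eqVneq (chiv chi (z_one p pi)) 0; last first.
  exists (x j0 j3), (x j3 j0), (x j2 j1), (x j1 j2), (z_one p pi); split=> //; last first.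
  - by apply: ce; rewrite !inE eqxx.
  - rewrite (z_oneE psl_g uce char0) (oneE psl_g pi_ext char0) (br_sym (x_part p pi j1 j2) (x_part p pi j2 j1)).
    by rewrite (_ : ksign F _ _ = -1) // opprK scale1r.
  - by split; [exact: h1 | exact: hN | exact: h1 | exact: hN].
  - by split; exact: o.
have c2 : chiv chi (z_pos p pi) != 0.
  apply/eqP=> c2; have := chi_atyp; rewrite /semisimple_atypical /discr -!/(chiv chi _) c1 c2.
  rewrite mulr0 mul0r subr0 expr0n /= => /esym/eqP; rewrite (_ : 4 = 4%:R :> F) //.
  by rewrite (negbTE (char0 3)).
exists (- x j0 j3), (x j1 j2), 0, 0, (z_pos p pi); split=> //.
- by split; rewrite ?mem0v ?rpredN; try exact: o.
- by split; rewrite ?lfunN ?lfun0 ?oppr0 //; [rewrite h1 | exact: hN].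
- rewrite lfun0 addr0 (z_posE psl_g uce char0) lfunN opp_lfunE.
  by rewrite (zp_alt psl_g pi_ext char0) opprK.
- by apply: ce; rewrite !inE eqxx orbT.
Qed.

Lemma pivot_bij N z : module1_chi p pi chi N -> z \in center gh -> chiv chi z != 0 ->
  exists k : 'End(N), (forall n, k (act N z n) = n) /\ (forall n, act N z (k n) = n).
Proof.
move=> NX zc cz; have [k [k1 k2]] := nilp_unit cz (chi_nilp NX zc).
have E n : chiv chi z *: n + zshift chi N z n = act N z n by rewrite zshiftE addrC subrK.
by exists k; split=> n; rewrite -E.
Qed.

Lemma chi_full (N : act_space gh) (P : N -> Prop) : module1_chi p pi chi N -> submod P ->
  (forall n, wgt p pi 1 n -> P n) -> forall n, P n.
Proof.
move=> NX; have [u1 [y1 [u2 [y2 [z [[? ? ? ?] [? ? ? ?] zE zc cz]]]]]] := pivot_exists.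
have NL : lie_module N by case: NX => -[].
exact: (submod_full psl_g uce char0 NL (chi_short_graded NX) _ _ _ _ _ _ _ _ zE zc (pivot_bij NX zc cz)).
Qed.

Lemma chi_zero (N : act_space gh) (P : N -> Prop) : module1_chi p pi chi N -> submod P ->
  (forall n, wgt p pi 1 n -> P n -> n = 0) -> forall n, P n -> n = 0.
Proof.
move=> NX; have [u1 [y1 [u2 [y2 [z [[? ? ? ?] [? ? ? ?] zE zc cz]]]]]] := pivot_exists.
have NL : lie_module N by case: NX => -[].
exact: (submod_zero psl_g uce char0 NL (chi_short_graded NX) _ _ _ _ _ _ _ _ zE (pivot_bij NX zc cz)).
Qed.

Variables (N N' : act_space gh) (M M' : act_space (M11 F)).
Hypothesis NX : module1_chi p pi chi N.
Hypothesis NX' : module1_chi p pi chi N'.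
Variables (phi : 'Hom(M, N)) (phi' : 'Hom(M', N')).
Definition Jor_map (N : act_space gh) (M : act_space (M11 F)) (phi : 'Hom(M, N)) : Prop :=
    [/\ even_map phi, lker phi = 0%VS,
        limg phi = passmx.leigenspace (act N (short_h p pi)) 1
      & forall a m,
          phi (act M a m) = act N (br_lift p pi (M11_emb a) (short_f F)) (phi m)].
Hypothesis J : Jor_map phi.
Hypothesis J' : Jor_map phi'.

Lemma Jor_inj (N0 : act_space gh) (M0 : act_space (M11 F)) (q : 'Hom(M0, N0)) : Jor_map q -> forall m m', q m = q m' -> m = m'.
Proof. by move=> [_ /eqP k0 _ _] m m' E; rewrite -[m](lker0_lfunK k0) E lker0_lfunK. Qed.

Lemma Jor_wgt (N0 : act_space gh) (M0 : act_space (M11 F)) (q : 'Hom(M0, N0)) n : Jor_map q ->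
  wgt p pi 1 n <-> exists m, n = q m.
Proof.
move=> [_ _ im _]; split=> [wn|[m ->]].
  have : n \in limg q by rewrite im leigen_in; apply/eqP.
  by case/memv_imgP=> m _ ->; exists m.
by apply/eqP; rewrite -leigen_in -im memv_img // memvf.
Qed.

Lemma morphism_zero (G : 'Hom(N, N')) : (forall x n, G (act N x n) = act N' x (G n)) ->
  (forall m, G (phi m) = 0) -> G = 0.
Proof.
move=> Gm G0; apply/lfunP=> n; rewrite zero_lfunE; move: n.
apply: (@chi_full N (fun n => G n = 0) NX).
  split; last by move=> y n Gn; rewrite Gm Gn lfun0.
  by split=> [|k u v Gu Gv]; rewrite ?lfun0 // lfunD lfunZ Gu Gv scaler0 addr0.
by move=> n /(Jor_wgt _ J)[m ->].
Qed.

(** Take S to be the graph of [gm] inside the top weight space of N x N'. [Rel S] is a submodule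
    with top S, and it is the graph of the wanted map. *)
Lemma extend_morphism (gm : 'Hom(M, M')) : act_morphism gm ->
  exists2 G : 'Hom(N, N'), act_morphism G & forall m, G (phi m) = phi' (gm m).
Proof.
move=> [ge ga]; have NL : lie_module N by case: NX => -[].
have NL' : lie_module N' by case: NX' => -[].
pose P := pmod N N'; have PL : lie_module P := pmod_lie NL NL'.
have PD : short_graded p pi P.
  move=> [n n']; have [a [b [c [-> ha hb hc]]]] := chi_short_graded NX n.
  have [a' [b' [c' [-> ha' hb' hc']]]] := chi_short_graded NX' n'.
  exists (a, a'), (b, b'), (c, c'); split=> //; rewrite pmodE /pmod_op /=.
  - by rewrite ha ha'.
  - by rewrite hb hb'.
  - by rewrite hc hc'.
pose S (n : P) : Prop := exists m, n = (phi m, phi' (gm m)).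
have Sl : linear_pred S.
  split; first by exists 0; rewrite !lfun0.
  move=> k _ _ [m ->] [m' ->]; exists (k *: m + m').
  by rewrite !lfunD !lfunZ.
have wP k n n' : wgt p pi k ((n, n') : P) <-> wgt p pi k n /\ wgt p pi k n'.
  by rewrite /wgt pmodE /pmod_op; split=> [[-> ->] //|[/= -> ->]].
have S1 n : S n -> wgt p pi 1 n.
  by move=> [m ->]; apply/wP; split; [apply/(Jor_wgt _ J) | apply/(Jor_wgt _ J')]; eexists.
have SJ (a : M11 F) n : S n -> S (act P (br_lift p pi (M11_emb a) (short_f F)) n).
  move=> [m ->]; exists (act M a m); rewrite pmodE /pmod_op /=.
  by case: J => _ _ _ ->; case: J' => _ _ _ <-; rewrite ga.
have Rs := Rel_submod psl_g uce char0 PL PD Sl SJ.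
have R1 n : S n -> Rel p pi S n by exact: Rel_top.
have R2 n : wgt p pi 1 n -> Rel p pi S n -> S n by exact: (Rel_wgt1 char0).
case: Rs => Rl Ra; pose R := Rel p pi S.
(* The projection of the relation to N is a submodule containing N[1], hence everything. *)
have tot : forall n, exists n', R (n, n').
  apply: (chi_full NX).
    split; last by move=> y n [n' Rn]; exists (act N' y n'); have := Ra y _ Rn; rewrite pmodE.
    split; first by exists 0; case: Rl.
    by move=> k u v [u' Ru] [v' Rv]; exists (k *: u' + v'); exact: (proj2 Rl k _ _ Ru Rv).
  by move=> n /(Jor_wgt _ J)[m ->]; exists (phi' (gm m)); apply: R1; exists m.
(* The fibre over 0 is a submodule of N' without top part, because [phi] is injective. *)
have fun0 : forall n', R (0, n') -> n' = 0.
  apply: (chi_zero NX').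
    split; last by move=> y n Rn; have := Ra y _ Rn; rewrite pmodE /pmod_op /= lfun0.
    split; first by case: Rl.
    move=> k u v Ru Rv; case: Rl => _ /(_ k _ _ Ru Rv).
    rewrite (_ : k *: ((0, u) : P) + (0, v) = (0, k *: u + v)) //.
    by apply: prod_eq; rewrite //= scaler0 addr0.
  move=> n' wn Rn; have : S (0, n') by apply: R2 => //; apply/wP; split=> //; rewrite /wgt lfun0 scaler0.
  by move=> [m [m0 ->]]; rewrite (_ : m = 0) ?lfun0 //; apply: (Jor_inj J); rewrite lfun0.
have funR n u v : R (n, u) -> R (n, v) -> u = v.
  move=> Ru Rv; apply/eqP; rewrite -subr_eq0; apply/eqP/fun0.
  have := proj2 Rl (-1) _ _ Rv Ru; rewrite (_ : -1 *: ((n, v) : P) + (n, u) = (0, u - v)) //.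
  by apply: prod_eq; rewrite /= scaleN1r ?addNr // addrC.
pose Gf n : N' := sval (cid (tot n)).
have GR n : R (n, Gf n) by exact: svalP (cid (tot n)).
have Gl : linear Gf.
  by move=> k u v; apply: (funR _ _ _ (GR _)); exact: (proj2 Rl k _ _ (GR u) (GR v)).
pose G : 'Hom(N, N') := linfun (HB.pack Gf (GRing.isLinear.Build F N N' *:%R Gf Gl) : {linear N -> N'}).
have GE n : G n = Gf n by rewrite lfunE.
have Ga y n : G (act N y n) = act N' y (G n).
  by rewrite !GE; apply: (funR _ _ _ (GR _)); have := Ra y _ (GR n); rewrite pmodE.
have Gphi m : G (phi m) = phi' (gm m).
  by rewrite GE; apply: (funR _ _ _ (GR _)); apply: R1; exists m.
exists G => //; split=> // q n nq.
(* Vectors on which G respects parity form a submodule containing N[1]. *)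
have par : forall n r, scomp (~~ r) (G (scomp r n)) = 0.
  apply: (chi_full NX); last first.
    move=> _ /(Jor_wgt _ J)[m ->] r; case: J => pe _ _ _; case: J' => pe' _ _ _.
    rewrite -(even_map_scomp _ _ pe) Gphi scomp_other // negbK.
    by apply: pe'; apply: ge; exact: scomp_part.
  split.
    split=> [r|k u v Hu Hv r]; first by rewrite scomp0 lfun0 scomp0.
    by rewrite scomp_linear lfunD lfunZ scomp_linear Hu Hv scaler0 addr0.
  move=> y w Hw r; rewrite -[y]scomp_sum lfunD add_lfunE scompD lfunD scompD.
  have H s : scomp (~~ r) (G (scomp r (act N (scomp s y) w))) = 0.
    rewrite (scomp_act _ _ NL (scomp_part s y)) Ga (scomp_act _ _ NL' (scomp_part s y)).
    by rewrite addNb Hw lfun0.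
  by rewrite !H addr0.
have H0 : scomp (~~ q) (G n) = 0 by have := par n q; rewrite (scomp_id nq).
by rewrite -[G n]scomp_sum; case: q {nq} H0 => /= ->; rewrite ?addr0 ?add0r scomp_part.
Qed.
End Extend.

(** * The quiver representation of a module *)

Section SubSuperspace.
Variables (F : fieldType) (V : superspace F) (U : {vspace V}).
Hypothesis U_graded : forall q v, v \in U -> scomp q v \in U.
Local Notation S := (subvs_of U).

Definition sub_part p : {vspace S} := (linfun vsval @^-1: part V p)%VS.

Lemma sub_partE p (x : S) : (x \in sub_part p) = (vsval x \in part V p).
Proof. by rewrite -memv_preim lfunE. Qed.

Fact sub_part_sum : (sub_part false + sub_part true = fullv)%VS.
Proof.
apply/eqP; rewrite eqEsubv subvf /=; apply/subvP=> A _; apply/memv_addP.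
exists (vsproj U (scomp false (vsval A))).
  by rewrite sub_partE vsprojK ?scomp_part ?U_graded ?subvsP.
exists (vsproj U (scomp true (vsval A))).
  by rewrite sub_partE vsprojK ?scomp_part ?U_graded ?subvsP.
by rewrite -linearD /= scomp_sum vsvalK.
Qed.

Fact sub_part_cap : (sub_part false :&: sub_part true = 0)%VS.
Proof.
apply/eqP; rewrite -subv0; apply/subvP=> A; rewrite memv_cap memv0 !sub_partE.
rewrite -memv_cap part_cap memv0 => /eqP A0; apply/eqP.
by apply: subvs_inj; rewrite A0.
Qed.

Definition sub_space : superspace F := SuperSpace sub_part_sum sub_part_cap.
End SubSuperspace.

Section Restriction.
Variables (F : fieldType) (V W : vectType F) (T : 'Hom(V, W)) (U : {vspace V}) (U' : {vspace W}).

Definition restrict : 'Hom(subvs_of U, subvs_of U') :=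
  locked (linfun (vsproj U') \o T \o linfun vsval)%VF.

Lemma restrictE : (forall v, v \in U -> T v \in U') ->
  forall u, vsval (restrict u) = T (vsval u).
Proof. by move=> H u; rewrite /restrict -lock !comp_lfunE !lfunE /= vsprojK ?H ?subvsP. Qed.
End Restriction.

Section ModelComponents.
Variables (F : fieldType) (G : gradedRep F).
Local Notation X := (gforget G).
Implicit Types (d : (X v1 * X v2)%type) (b : X v1) (c : X v2).
Local Ltac comp_tac := rewrite /= ?row_lfunE ?col_lfunE ?opp_lfunE ?id_lfunE ?zero_lfunE ?addr0 ?add0r.

Lemma oB_QO1 d : oB (QO1 G) d = d.1. Proof. by comp_tac. Qed.
Lemma oC_QO1 d : oC (QO1 G) d = - Qact X beta d.1 + Qact X gamma d.2. Proof. by comp_tac. Qed.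
Lemma uB_QO1 b : uB (QO1 G) b = (Qact X alpha b, Qact X beta b). Proof. by comp_tac. Qed.
Lemma uC_QO1 c : uC (QO1 G) c = (0, c). Proof. by comp_tac. Qed.
Lemma oB_QO2 d : oB (QO2 G) d = Qact X zeta d.1 - Qact X delta d.2. Proof. by comp_tac. Qed.
Lemma oC_QO2 d : oC (QO2 G) d = Qu G v2 d.2 + Qturn X v2 d.2.
Proof. by comp_tac; rewrite add_lfunE. Qed.
Lemma uB_QO2 b : uB (QO2 G) b = (Qu G v1 b + Qturn X v1 b, 0).
Proof. by comp_tac; rewrite add_lfunE. Qed.
Lemma uC_QO2 c : uC (QO2 G) c = (Qact X delta c, Qact X eta c). Proof. by comp_tac. Qed.
End ModelComponents.

(** * Rotated odd elements and the arrows on N[1] *)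

Section RotatedElements.
Variables (F : closedFieldType) (g : lieSuper F) (p : 'Hom(sl22 F, g)).
Variables (gh : lieSuper F) (pi : 'Hom(gh, g)).
Hypothesis psl_g : is_psl22 p.
Hypothesis uce : universal_central_extension pi.
Hypothesis char0 : forall n, n.+1%:R != 0 :> F.
Let pi_ext : central_extension pi := proj1 uce.
Let F2 := char0 1.
Variable chi : {scalar subvs_of (center gh)}.
Variables l1 r1 l2 r2 : F.
Hypothesis det1 : l1 * r2 - r1 * l2 = 1.
Hypothesis chi_one : chiv chi (z_one p pi) = 2 * (l1 * r2 + r1 * l2).
Hypothesis chi_pos : chiv chi (z_pos p pi) = 2 * (l1 * r1).
Hypothesis chi_neg : chiv chi (z_neg p pi) = 2 * (l2 * r2).
Local Notation hs := (short_h p pi).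
Local Notation x := (rootv p pi).
Local Notation h1 := (hh1 p pi).
Local Notation zp := (zp p pi).
Local Notation zn := (zn p pi).
Local Notation one := (one p pi).

(** [up i] and [dn i] are the images of E11 and E22 under the i-th rotated
    family of odd elements; they raise, resp. lower, the weight of [h1] by 1. *)
Definition up1 : gh := locked (r2 *: x j0 j2 - r1 *: x j3 j1).
Definition up2 : gh := locked (l1 *: x j3 j1 - l2 *: x j0 j2).
Definition dn1 : gh := locked (r2 *: x j1 j3 - r1 *: x j2 j0).
Definition dn2 : gh := locked (l1 *: x j2 j0 - l2 *: x j1 j3).
(** [zc1] and [zc2] are the self-brackets of the two rotated families and [zc0] half of their
    rotated identity. The factorisation of [chi] makes its values on them 0, 0 and 1. *)
Definition zc1 : gh := locked (r2 * r2 *: zp - r1 * r2 *: one + r1 * r1 *: zn).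
Definition zc2 : gh := locked (l2 * l2 *: zp - l1 * l2 *: one + l1 * l1 *: zn).
Definition zc0 : gh := locked ((2^-1 * (r2 * l1 + r1 * l2)) *: one - r2 * l2 *: zp - r1 * l1 *: zn).

Lemma up1_def : up1 = r2 *: x j0 j2 - r1 *: x j3 j1. Proof. by rewrite /up1 -lock. Qed.
Lemma up2_def : up2 = l1 *: x j3 j1 - l2 *: x j0 j2. Proof. by rewrite /up2 -lock. Qed.
Lemma dn1_def : dn1 = r2 *: x j1 j3 - r1 *: x j2 j0. Proof. by rewrite /dn1 -lock. Qed.
Lemma dn2_def : dn2 = l1 *: x j2 j0 - l2 *: x j1 j3. Proof. by rewrite /dn2 -lock. Qed.
Lemma zc1_def : zc1 = r2 * r2 *: zp - r1 * r2 *: one + r1 * r1 *: zn. Proof. by rewrite /zc1 -lock. Qed.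
Lemma zc2_def : zc2 = l2 * l2 *: zp - l1 * l2 *: one + l1 * l1 *: zn. Proof. by rewrite /zc2 -lock. Qed.
Lemma zc0_def : zc0 = (2^-1 * (r2 * l1 + r1 * l2)) *: one - r2 * l2 *: zp - r1 * l1 *: zn. Proof. by rewrite /zc0 -lock. Qed.

Lemma odd_root i j : upar i j = true -> x i j \in part gh true.
Proof. by move=> <-; exact: x_part. Qed.

Lemma up1_odd : up1 \in part gh true. Proof. by rewrite up1_def; apply: rpredB; apply: rpredZ; exact: odd_root. Qed.
Lemma up2_odd : up2 \in part gh true. Proof. by rewrite up2_def; apply: rpredB; apply: rpredZ; exact: odd_root. Qed.
Lemma dn1_odd : dn1 \in part gh true. Proof. by rewrite dn1_def; apply: rpredB; apply: rpredZ; exact: odd_root. Qed.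
Lemma dn2_odd : dn2 \in part gh true. Proof. by rewrite dn2_def; apply: rpredB; apply: rpredZ; exact: odd_root. Qed.

Lemma odd_sym u v : u \in part gh true -> v \in part gh true -> br gh u v = br gh v u.
Proof. by move=> uo vo; rewrite (br_sym vo uo) (_ : ksign F true true = -1) // opprK scale1r. Qed.

Let b1 : br gh (x j0 j2) (x j1 j3) = zp := erefl.
Let b2 : br gh (x j0 j2) (x j2 j0) = 2^-1 *: (one + h1 + hh2 p pi) := k02E psl_g pi_ext char0.
Let b3 : br gh (x j3 j1) (x j1 j3) = 2^-1 *: (one - h1 - hh2 p pi).
Proof. by rewrite (odd_sym (odd_root _) (odd_root _)) //; exact: (k13E psl_g pi_ext char0). Qed.
Let b4 : br gh (x j3 j1) (x j2 j0) = zn.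
Proof. by rewrite (odd_sym (odd_root _) (odd_root _)). Qed.
Let bz i j k m : i != j -> k != m -> j != k -> m != i ->
  (tnat i + tnat k != tnat j + tnat m)%N -> br gh (x i j) (x k m) = 0
  := @br_zero _ _ _ _ _ psl_g pi_ext char0 i j k m.

Local Ltac expand := rewrite ?(up1_def, up2_def, dn1_def, dn2_def) !(lfunD, lfunN, lfunZ, add_lfunE, opp_lfunE, scale_lfunE).
Local Ltac fin := match goal with |- context [h1] => idtac | _ => idtac end;
  move: zp zn one h1 (hh2 p pi) => u v w s t; vect_field F2.

Lemma br_up1_dn1 : br gh up1 dn1 = zc1.
Proof. by expand; rewrite b1 b2 b3 b4 zc1_def; fin. Qed.
Lemma br_up2_dn2 : br gh up2 dn2 = zc2.
Proof. by expand; rewrite b1 b2 b3 b4 zc2_def; fin. Qed.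
Lemma br_up1_dn2 : br gh up1 dn2 = zc0 + hs.
Proof.
expand; rewrite b1 b2 b3 b4 zc0_def (short_hE psl_g uce char0).
have -> : 2^-1 *: (h1 + hh2 p pi) = ((l1 * r2 - r1 * l2) * 2^-1) *: (h1 + hh2 p pi) by rewrite det1 mul1r.
by fin.
Qed.
Lemma br_up2_dn1 : br gh up2 dn1 = zc0 - hs.
Proof.
expand; rewrite b1 b2 b3 b4 zc0_def (short_hE psl_g uce char0).
have -> : 2^-1 *: (h1 + hh2 p pi) = ((l1 * r2 - r1 * l2) * 2^-1) *: (h1 + hh2 p pi) by rewrite det1 mul1r.
by fin.
Qed.

Lemma br_up_up a b c d : br gh (a *: x j0 j2 - b *: x j3 j1) (c *: x j0 j2 - d *: x j3 j1) = 0.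
Proof.
have z0 : br gh (x j0 j2) (x j0 j2) = 0 by exact: bz.
have z1 : br gh (x j0 j2) (x j3 j1) = 0 by exact: bz.
have z2 : br gh (x j3 j1) (x j0 j2) = 0 by exact: bz.
have z3 : br gh (x j3 j1) (x j3 j1) = 0 by exact: bz.
rewrite !(lfunD, lfunN, lfunZ, add_lfunE, opp_lfunE, scale_lfunE) z0 z1 z2 z3.
by rewrite !(scaler0, oppr0, addr0).
Qed.
Lemma br_dn_dn a b c d : br gh (a *: x j1 j3 - b *: x j2 j0) (c *: x j1 j3 - d *: x j2 j0) = 0.
Proof.
have z0 : br gh (x j1 j3) (x j1 j3) = 0 by exact: bz.
have z1 : br gh (x j1 j3) (x j2 j0) = 0 by exact: bz.
have z2 : br gh (x j2 j0) (x j1 j3) = 0 by exact: bz.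
have z3 : br gh (x j2 j0) (x j2 j0) = 0 by exact: bz.
rewrite !(lfunD, lfunN, lfunZ, add_lfunE, opp_lfunE, scale_lfunE) z0 z1 z2 z3.
by rewrite !(scaler0, oppr0, addr0).
Qed.

Lemma up2E : up2 = (- l2) *: x j0 j2 - (- l1) *: x j3 j1.
Proof. by rewrite up2_def !scaleNr opprK addrC. Qed.
Lemma dn2E : dn2 = (- l2) *: x j1 j3 - (- l1) *: x j2 j0.
Proof. by rewrite dn2_def !scaleNr opprK addrC. Qed.

Lemma h1_up u : u \in [:: up1; up2] -> br gh h1 u = u.
Proof.
rewrite !inE => /orP[] /eqP->; expand; rewrite !(hh1_x psl_g pi_ext char0) // /hdiag /=;
  by rewrite !(subr0, sub0r, opprK) !scale1r.
Qed.
Lemma h1_dn u : u \in [:: dn1; dn2] -> br gh h1 u = - u.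
Proof.
rewrite !inE => /orP[] /eqP->; expand; rewrite !(hh1_x psl_g pi_ext char0) // /hdiag /=;
  by rewrite !(subr0, sub0r, opprK) !scaleN1r; vect_ring.
Qed.
Lemma hs_updn u : u \in [:: up1; up2; dn1; dn2] -> br gh hs u = 0.
Proof.
by rewrite !inE => /or4P[] /eqP->; expand; rewrite !(hs_x0 psl_g uce char0) // !scaler0 ?oppr0 addr0.
Qed.

Lemma zc_center z : z \in [:: zc0; zc1; zc2] -> z \in center gh.
Proof.
have c1 : one \in center gh by apply: (center_ext uce); exact: (pi_one psl_g pi_ext char0).
have c2 : zp \in center gh by apply: (center_ext uce); exact: (pi_zp psl_g pi_ext char0).
have c3 : zn \in center gh by apply: (center_ext uce); exact: (pi_zn psl_g pi_ext char0).
by rewrite !inE => /or3P[] /eqP->; rewrite ?(zc0_def, zc1_def, zc2_def); do ?[apply: rpredD | apply: rpredB | rewrite rpredN]; apply: rpredZ.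
Qed.

Lemma chiv_comb a b c : chiv chi (a *: one + b *: zp + c *: zn) =
  2 * (a * (l1 * r2 + r1 * l2) + b * (l1 * r1) + c * (l2 * r2)).
Proof.
rewrite -(z_oneE psl_g uce char0) -(z_posE psl_g uce char0) -(z_negE psl_g uce char0).
rewrite -addrA !chivP -[c *: _]addr0 chivP chi_one chi_pos chi_neg /chiv !linear0.
by ring.
Qed.

Lemma chi_zc : [/\ chiv chi zc0 = 1, chiv chi zc1 = 0 & chiv chi zc2 = 0].
Proof.
split.
- have -> : zc0 = (2^-1 * (r2 * l1 + r1 * l2)) *: one + (- (r2 * l2)) *: zp + (- (r1 * l1)) *: zn.
    by rewrite zc0_def !scaleNr.
  rewrite chiv_comb; transitivity ((l1 * r2 - r1 * l2) ^+ 2); last by rewrite det1 expr1n.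
  by field; rewrite F2.
- have -> : zc1 = (- (r1 * r2)) *: one + (r2 * r2) *: zp + (r1 * r1) *: zn.
    by rewrite zc1_def scaleNr [_ - _]addrC.
  by rewrite chiv_comb; ring.
have -> : zc2 = (- (l1 * l2)) *: one + (l2 * l2) *: zp + (l1 * l1) *: zn.
  by rewrite zc2_def scaleNr [_ - _]addrC.
by rewrite chiv_comb; ring.
Qed.

Section OnModule.
Variable N : act_space gh.
Hypothesis NX : module1_chi p pi chi N.
Let NL : lie_module N. Proof. by case: NX => -[]. Qed.
Local Notation "x ** n" := (act N x n) (at level 40, left associativity).
Local Notation wgt := (wgt p pi).

Definition top (k : F) (n : N) : Prop := wgt 1 n /\ h1 ** n = k *: n.

Lemma h1_act u n : h1 ** (u ** n) = u ** (h1 ** n) + br gh h1 u ** n.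
Proof.
rewrite -[u]scomp_sum !(linearD, add_lfunE) /=.
have H q : h1 ** (scomp q u ** n) = scomp q u ** (h1 ** n) + br gh h1 (scomp q u) ** n.
  rewrite (act_br NL n (hh1_even p pi) (scomp_part q u)) /ksign /= expr0 scale1r.
  by rewrite addrCA subrr addr0.
by rewrite !H addrACA.
Qed.

Lemma hs_h1 n : hs ** (h1 ** n) = h1 ** (hs ** n).
Proof.
rewrite (act_hs psl_g uce char0 NL) (_ : br gh hs h1 = 0) ?linear0 ?zero_lfunE ?addr0 //.
rewrite (br_jacobi _ (hs_even psl_g uce char0) (x_part p pi j0 j1)).
by rewrite (hs_x1 psl_g uce char0) // (hs_xN psl_g uce char0) // /ksign /= expr0 scale1r lfunN subrr.
Qed.

(** The computation of [gen_weight1] for the triple of the first sl2, where [h1] shifts by 2: e^3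
    f^3 n = 6 h1 (h1 - 1)(h1 - 2) n, and f^3 n = 0 by the grading. *)
Lemma h1_cubic n : wgt 1 n -> h1 ** (h1 ** (h1 ** n)) = 3 *: (h1 ** (h1 ** n)) - 2 *: (h1 ** n).
Proof.
pose e := x j0 j1; pose f := x j1 j0.
have dec := chi_short_graded psl_g uce char0 NX.
have he : br gh hs e = e by exact: (hs_x1 psl_g uce char0).
have hf : br gh hs f = - f by exact: (hs_xN psl_g uce char0).
have EL v : e ** (f ** v) = f ** (e ** v) + h1 ** v.
  rewrite [h1 ** v](act_br NL v (x_part p pi j0 j1) (x_part p pi j1 j0)) /ksign /= expr0 scale1r.
  by rewrite addrCA subrr addr0.
have HL v : h1 ** (f ** v) = f ** (h1 ** v) - 2 *: (f ** v).
  rewrite h1_act (hh1_x psl_g pi_ext char0) // lfunZ scale_lfunE.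
  have -> : hdiag F j0 j1 j1 - hdiag F j0 j1 j0 = - 2 by rewrite /hdiag /=; ring.
  by rewrite scaleNr.
have HE v : h1 ** (e ** v) = e ** (h1 ** v) + 2 *: (e ** v).
  rewrite h1_act (hh1_x psl_g pi_ext char0) // lfunZ scale_lfunE.
  by have -> : hdiag F j0 j1 j0 - hdiag F j0 j1 j1 = 2 by rewrite /hdiag /=; ring.
have Ek w : e ** w = 0 -> e ** (h1 ** w) = 0.
  by move=> Ew; have := HE w; rewrite Ew lfun0 scaler0 addr0.
have E1 w : e ** w = 0 -> e ** (f ** w) = h1 ** w by move=> Ew; rewrite EL Ew lfun0 add0r.
have E2 w : e ** w = 0 -> e ** (f ** (f ** w)) = f ** (2 *: (h1 ** w) - 2 *: w).
  by move=> Ew; rewrite EL HL E1 //; vect_ring.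
have E3 w : e ** w = 0 -> e ** (f ** (f ** (f ** w))) = f ** (f ** (3 *: (h1 ** w) - 6 *: w)).
  by move=> Ew; rewrite EL E2 // !HL; vect_ring.
move=> w1; have Ev : e ** n = 0 by exact: (raise_top psl_g uce char0 NL dec he).
have F3 : f ** (f ** (f ** n)) = 0.
  have a := wgt_down psl_g uce char0 NL hf w1; rewrite subrr in a.
  have b := wgt_down psl_g uce char0 NL hf a; rewrite sub0r in b.
  exact: (lower_bottom psl_g uce char0 NL dec hf b).
pose w := 3 *: (h1 ** n) - 6 *: n.
have Ew : e ** w = 0 by rewrite lfunD lfunN !lfunZ Ek // Ev !scaler0 subr0.
pose w' := 2 *: (h1 ** w) - 2 *: w.
have Ew' : e ** w' = 0 by rewrite lfunD lfunN !lfunZ Ek // Ew !scaler0 subr0.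
have : h1 ** w' = 0 by rewrite -E1 // -E2 // -[f ** (f ** w)]E3 // F3 !lfun0.
rewrite /w' /w => H; apply/eqP; rewrite -subr_eq0; apply/eqP.
have c6 : 6 != 0 :> F := char0 5.
apply: (scalerI c6); rewrite scaler0 -[RHS]H; vect_ring.
Qed.

Lemma top_split n : wgt 1 n -> exists b d c, [/\ n = b + d + c, top 2 b, top 1 d & top 0 c].
Proof.
move=> wn; have H := h1_cubic wn; pose h := act N h1.
have w1 : wgt 1 (h n) by rewrite /wgt hs_h1 wn !scale1r.
have w2 : wgt 1 (h (h n)) by rewrite /wgt hs_h1 w1 !scale1r.
have wc a b c : wgt 1 (a *: h (h n) + b *: h n + c *: n).
  by apply: wgtD; [apply: wgtD|]; apply: wgtZ.
(* Lagrange projectors for the eigenvalues 2, 1 and 0 of [h1]. *)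
exists (2^-1 *: h (h n) + (- 2^-1) *: h n + 0 *: n),
  ((-1) *: h (h n) + 2 *: h n + 0 *: n), (2^-1 *: h (h n) + (- (3 * 2^-1)) *: h n + 1 *: n).
have hE a b c : h (a *: h (h n) + b *: h n + c *: n) = (3 * a + b) *: h (h n) + (c - 2 * a) *: h n.
  by rewrite 2!lfunD !lfunZ H; move: (h (h n)) (h n) => u v; vect_ring.
split; [|split=> //|split=> //|split=> //]; rewrite ?hE; move: (h (h n)) (h n) => u v;
  by vect_field F2.
Qed.

(** As chi takes the value 1 on [zc0], the operator [zc0] + 1 is 2 plus a nilpotent one. *)
Lemma zc_bij : exists K : 'End(N), (forall n, K (zc0 ** n + n) = n) /\
  (forall n, zc0 ** K n + K n = n).
Proof.
have [c0 _ _] := chi_zc; have zc : zc0 \in center gh by apply: zc_center; rewrite inE eqxx.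
have [K [K1 K2]] := nilp_unit F2 (chi_nilp NX zc).
have E n : 2 *: n + zshift chi N zc0 n = zc0 ** n + n.
  by rewrite zshiftE c0; vect_ring.
by exists K; split=> n; rewrite -E.
Qed.

Lemma bracket_act u v n : u \in part gh true -> v \in part gh true ->
  u ** (v ** n) = br gh u v ** n - v ** (u ** n).
Proof.
move=> uo vo; rewrite (act_br NL n uo vo) (_ : ksign F true true = -1) // scaleN1r opprK.
by rewrite addrK.
Qed.

Lemma sq_zero u n : u \in part gh true -> br gh u u = 0 -> u ** (u ** n) = 0.
Proof.
move=> uo u0; have := bracket_act n uo uo; rewrite u0 lfun0 zero_lfunE sub0r => /eqP.
rewrite -addr_eq0 -mulr2n -scaler_nat scaler_eq0 => /orP[|/eqP //].
by rewrite (negbTE F2).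
Qed.

Lemma up1_up1 n : up1 ** (up1 ** n) = 0.
Proof. by apply: sq_zero; [exact: up1_odd | rewrite up1_def; exact: br_up_up]. Qed.
Lemma dn2_dn2 n : dn2 ** (dn2 ** n) = 0.
Proof. by apply: sq_zero; [exact: dn2_odd | rewrite dn2E; exact: br_dn_dn]. Qed.
Lemma up2_up1 n : up2 ** (up1 ** n) = - (up1 ** (up2 ** n)).
Proof. by rewrite (bracket_act _ up2_odd up1_odd) up2E up1_def br_up_up lfun0 zero_lfunE sub0r. Qed.
Lemma dn1_dn2 n : dn1 ** (dn2 ** n) = - (dn2 ** (dn1 ** n)).
Proof. by rewrite (bracket_act _ dn1_odd dn2_odd) dn2E dn1_def br_dn_dn lfun0 zero_lfunE sub0r. Qed.
Lemma up1_dn1 n : up1 ** (dn1 ** n) = zc1 ** n - dn1 ** (up1 ** n).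
Proof. by rewrite (bracket_act _ up1_odd dn1_odd) br_up1_dn1. Qed.
Lemma up2_dn2 n : up2 ** (dn2 ** n) = zc2 ** n - dn2 ** (up2 ** n).
Proof. by rewrite (bracket_act _ up2_odd dn2_odd) br_up2_dn2. Qed.

Definition wop : 'End(N) := act N zc0 + \1%VF.
Lemma wopE n : wop n = zc0 ** n + n. Proof. by rewrite add_lfunE id_lfunE. Qed.

Lemma up1_dn2 n : wgt 1 n -> up1 ** (dn2 ** n) = wop n - dn2 ** (up1 ** n).
Proof.
move=> wn; rewrite (bracket_act _ up1_odd dn2_odd) br_up1_dn2 lfunD add_lfunE wn scale1r.
by rewrite wopE.
Qed.
Lemma up2_dn1 n : wgt 1 n -> up2 ** (dn1 ** n) = wop n - 2 *: n - dn1 ** (up2 ** n).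
Proof.
move=> wn; rewrite (bracket_act _ up2_odd dn1_odd) br_up2_dn1 lfunD lfunN add_lfunE opp_lfunE wn scale1r.
by rewrite wopE; vect_ring.
Qed.

Lemma top_up k u n : u \in [:: up1; up2] -> top k n -> top (k + 1) (u ** n).
Proof.
move=> ui [wn hn]; split.
  have hu : br gh hs u = 0 * 1 *: u.
    by rewrite mul0r scale0r; apply: hs_updn; move: ui; rewrite !inE => /orP[] ->; rewrite ?orbT.
  by rewrite -[1]addr0 -(mul0r 1); apply: (wgt_act psl_g uce char0 NL hu wn).
by rewrite h1_act hn (h1_up ui) lfunZ scalerDl scale1r.
Qed.

Lemma top_dn k u n : u \in [:: dn1; dn2] -> top k n -> top (k - 1) (u ** n).
Proof.
move=> ui [wn hn]; split.
  have hu : br gh hs u = 0 * 1 *: u.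
    by rewrite mul0r scale0r; apply: hs_updn; move: ui; rewrite !inE => /orP[] ->; rewrite ?orbT.
  by rewrite -[1]addr0 -(mul0r 1); apply: (wgt_act psl_g uce char0 NL hu wn).
by rewrite h1_act hn (h1_dn ui) lfunZ lfunN opp_lfunE scalerBl scale1r.
Qed.

Lemma top_none k n : k * k * k != 3 * (k * k) - 2 * k -> top k n -> n = 0.
Proof.
move=> kn [wn hn]; have := h1_cubic wn; rewrite !(hn, lfunZ, scalerA) -scalerBl => /eqP.
rewrite -subr_eq0 -scalerBl scaler_eq0 subr_eq0 => /orP[H|/eqP //].
by case/negP: kn; apply/eqP; rewrite !mulrA; move/eqP: H => ->; ring.
Qed.

Lemma top3 n : top (2 + 1) n -> n = 0.
Proof.
apply: top_none; rewrite -subr_eq0 (_ : _ - _ = 6 :> F); first exact: char0 5.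
by ring.
Qed.
Lemma topN1 n : top (0 - 1) n -> n = 0.
Proof.
apply: top_none; rewrite -subr_eq0 (_ : _ - _ = - 6 :> F); last by ring.
by rewrite oppr_eq0; exact: char0 5.
Qed.

Let i1 : up1 \in [:: up1; up2]. Proof. by rewrite inE eqxx. Qed.
Let i2 : up2 \in [:: up1; up2]. Proof. by rewrite !inE eqxx orbT. Qed.
Let k1 : dn1 \in [:: dn1; dn2]. Proof. by rewrite inE eqxx. Qed.
Let k2 : dn2 \in [:: dn1; dn2]. Proof. by rewrite !inE eqxx orbT. Qed.
Let c0 : zc0 \in center gh. Proof. by apply: zc_center; rewrite inE eqxx. Qed.
Let c1 : zc1 \in center gh. Proof. by apply: zc_center; rewrite !inE eqxx orbT. Qed.
Let c2 : zc2 \in center gh. Proof. by apply: zc_center; rewrite !inE eqxx !orbT. Qed.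

Lemma up1_top2 b : top 2 b -> up1 ** b = 0. Proof. by move=> /(top_up i1)/top3. Qed.
Lemma up2_top2 b : top 2 b -> up2 ** b = 0. Proof. by move=> /(top_up i2)/top3. Qed.
Lemma dn1_top0 c : top 0 c -> dn1 ** c = 0. Proof. by move=> /(top_dn k1)/topN1. Qed.
Lemma dn2_top0 c : top 0 c -> dn2 ** c = 0. Proof. by move=> /(top_dn k2)/topN1. Qed.

Lemma ca z u n : z \in center gh -> z ** (u ** n) = u ** (z ** n).
Proof. exact: (central_act psl_g uce char0 NL). Qed.

Lemma wop_act u n : wop (u ** n) = u ** (wop n).
Proof. by rewrite !wopE (ca _ _ c0) lfunD. Qed.

Definition winv : 'End(N) := (wop^-1)%VF.

Lemma wop_inv : (forall n, winv (wop n) = n) /\ (forall n, wop (winv n) = n).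
Proof.
have [K [K1 K2]] := zc_bij; have a v : K (wop v) = v by rewrite wopE.
have b v : wop (K v) = v by rewrite wopE.
exact: lfun_invK a b.
Qed.

Lemma winvK n : winv (wop n) = n. Proof. by case: wop_inv. Qed.
Lemma wopK n : wop (winv n) = n. Proof. by case: wop_inv. Qed.

Lemma winv_act u n : winv (u ** n) = u ** (winv n).
Proof. by rewrite -{1}[n]wopK -wop_act winvK. Qed.

Lemma top_center k z n : z \in center gh -> top k n -> top k (z ** n).
Proof.
move=> zc [wn hn]; split; last by rewrite -(ca _ _ zc) hn lfunZ.
by change (hs ** (z ** n) = 1 *: (z ** n)); rewrite -(ca _ _ zc) wn lfunZ.
Qed.

Lemma top_winv k n : top k n -> top k (winv n).
Proof.
move=> [wn hn]; split; last by rewrite -winv_act hn lfunZ.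
by change (hs ** winv n = 1 *: winv n); rewrite -winv_act wn lfunZ.
Qed.

Lemma topD k u v : top k u -> top k v -> top k (u + v).
Proof. by move=> [a b] [c d]; split; [exact: wgtD | rewrite lfunD b d scalerDr]. Qed.
Lemma topZ k l u : top k u -> top k (l *: u).
Proof. by move=> [a b]; split; [exact: wgtZ | rewrite lfunZ b !scalerA mulrC]. Qed.

(** The raising elements kill b, so moving [up2] and then [up1] to the right leaves only central
    operators. This is delta beta = 2 + zc1 zc2 / w - w, the relation that eliminates w in favour of
    the arrows. *)
Lemma turn_top2 b : top 2 b -> up1 ** (up2 ** (winv (dn2 ** (dn1 ** b)))) =
  2 *: b + zc1 ** (zc2 ** (winv b)) - wop b.
Proof.
move=> tb; rewrite !winv_act; have tb' := top_winv tb; set b' := winv b in tb' *.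
have wb' : wgt 1 b' by case: tb'.
rewrite up2_dn2 (up2_dn1 wb') (up2_top2 tb') lfun0 subr0.
have ty : top 2 (wop b' - 2 *: b').
  rewrite -scaleNr; apply: topD; last exact: topZ.
  by rewrite wopE; apply: topD => //; exact: top_center.
have wy : wgt 1 (wop b' - 2 *: b') by case: ty.
set y := wop b' - 2 *: b' in ty wy *.
rewrite [up1 ** _]lfunD lfunN (up1_dn2 wy) (up1_top2 ty) lfun0 subr0 -(ca up1 _ c2) up1_dn1 (up1_top2 tb') lfun0 subr0.
rewrite [zc2 ** (zc1 ** b')](ca _ _ c2).
have -> : y = b - 2 *: b' by rewrite /y /b' wopK.
by rewrite [wop _]lfunD lfunN lfunZ [wop b']wopK; vect_ring.
Qed.

Lemma turn_top0 c : top 0 c -> winv (dn2 ** (dn1 ** (up1 ** (up2 ** c)))) =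
  2 *: c + zc1 ** (zc2 ** (winv c)) - wop c.
Proof.
move=> tc; have wc : wgt 1 c by case: tc.
have E2 : dn1 ** (up2 ** c) = wop c - 2 *: c.
  by have := up2_dn1 wc; rewrite (dn1_top0 tc) lfun0 => /esym/subr0_eq.
have ty : top 0 (wop c - 2 *: c).
  rewrite -scaleNr; apply: topD; last exact: topZ.
  by rewrite wopE; apply: topD => //; exact: top_center.
have wy : wgt 1 (wop c - 2 *: c) by case: ty.
have E1 : dn1 ** (up1 ** (up2 ** c)) = zc1 ** (up2 ** c) - up1 ** (dn1 ** (up2 ** c)).
  by rewrite up1_dn1; vect_ring.
have E3 : dn2 ** (up1 ** (wop c - 2 *: c)) = wop (wop c - 2 *: c).
  by have := up1_dn2 wy; rewrite (dn2_top0 ty) lfun0 => /esym/subr0_eq.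
have E4 : dn2 ** (up2 ** c) = zc2 ** c.
  by have := up2_dn2 c; rewrite (dn2_top0 tc) lfun0 => /esym/subr0_eq.
set y := wop c - 2 *: c in ty wy E2 E3 *.
rewrite E1 E2 [dn2 ** _]lfunD lfunN E3 -(ca dn2 _ c1) E4 lfunD lfunN winvK !winv_act /y; vect_ring.
Qed.
Definition Utop (k : F) : {vspace N} :=
  (passmx.leigenspace (act N hs) 1 :&: passmx.leigenspace (act N h1) k)%VS.

Lemma UtopP k n : reflect (top k n) (n \in Utop k).
Proof.
rewrite memv_cap !leigen_in; apply: (iffP andP) => [[/eqP a /eqP b]|[a b]]; first by split.
by split; apply/eqP.
Qed.

Lemma Utop_graded k q v : v \in Utop k -> scomp q v \in Utop k.
Proof.
move=> /UtopP[wv hv]; apply/UtopP.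
have E z : z \in part gh false -> z ** scomp q v = scomp q (z ** v).
  by move=> ze; rewrite (scomp_act q v NL ze) addbF.
have sZ a u : scomp q (a *: u : N) = a *: scomp q u.
  by rewrite -[a *: u]addr0 scomp_linear scomp0 addr0.
split; last by rewrite (E _ (hh1_even p pi)) hv sZ.
by change (hs ** scomp q v = 1 *: scomp q v); rewrite (E _ (hs_even psl_g uce char0)) wv sZ.
Qed.

Definition topS (i : Qvert) : superspace F :=
  match i with v1 => sub_space (@Utop_graded 2) | v2 => sub_space (@Utop_graded 0) end.

(** The factors [winv] match the normalisation of the model: [zeta] and [eta] undo the w in
    [model_z2], and [beta] is the second coordinate of [dn1] b in the identification of D with B + C
    (see [dn1_b]). *)
Definition topT (a : Qarr) : 'End(N) :=
  match a with
  | alpha | gamma => act N zc1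
  | zeta | eta => (act N zc2 \o winv)%VF
  | beta => (winv \o (act N dn2 \o act N dn1))%VF
  | delta => (act N up1 \o act N up2)%VF end.

Definition topA (a : Qarr) : 'Hom(topS (Qsrc a), topS (Qtgt a)) :=
  match a with
  | alpha => restrict (topT alpha) (Utop 2) (Utop 2)
  | zeta => restrict (topT zeta) (Utop 2) (Utop 2)
  | beta => restrict (topT beta) (Utop 2) (Utop 0)
  | gamma => restrict (topT gamma) (Utop 0) (Utop 0)
  | eta => restrict (topT eta) (Utop 0) (Utop 0)
  | delta => restrict (topT delta) (Utop 0) (Utop 2) end.

Lemma sub11 : 2 - 1 - 1 = 0 :> F. Proof. by ring. Qed.
Lemma add11 : 0 + 1 + 1 = 2 :> F. Proof. by ring. Qed.

Lemma top_be n : top 2 n -> top 0 (topT beta n).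
Proof.
by move=> tn; rewrite !comp_lfunE; apply: top_winv; rewrite -sub11; apply: (top_dn k2); apply: (top_dn k1).
Qed.
Lemma top_de n : top 0 n -> top 2 (topT delta n).
Proof. by move=> tn; rewrite comp_lfunE -add11; apply: (top_up i1); apply: (top_up i2). Qed.
Lemma top_ze k n : top k n -> top k (topT zeta n).
Proof. by move=> tn; rewrite comp_lfunE; apply: top_center => //; exact: top_winv. Qed.

Lemma val_al u : vsval (topA alpha u) = zc1 ** vsval u.
Proof. by apply: restrictE => v /UtopP tv; apply/UtopP; exact: top_center. Qed.
Lemma val_ga u : vsval (topA gamma u) = zc1 ** vsval u.
Proof. by apply: restrictE => v /UtopP tv; apply/UtopP; exact: top_center. Qed.
Lemma val_ze u : vsval (topA zeta u) = zc2 ** winv (vsval u).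
Proof.
rewrite -[RHS](comp_lfunE (act N zc2) winv).
by apply: restrictE => v /UtopP tv; apply/UtopP; exact: top_ze.
Qed.
Lemma val_et u : vsval (topA eta u) = zc2 ** winv (vsval u).
Proof.
rewrite -[RHS](comp_lfunE (act N zc2) winv).
by apply: restrictE => v /UtopP tv; apply/UtopP; exact: top_ze.
Qed.
Lemma val_be u : vsval (topA beta u) = winv (dn2 ** (dn1 ** vsval u)).
Proof.
rewrite -[RHS]/(winv (act N dn2 (act N dn1 _))) -[X in winv X]comp_lfunE -comp_lfunE.
by apply: restrictE => v /UtopP tv; apply/UtopP; exact: top_be.
Qed.
Lemma val_de u : vsval (topA delta u) = up1 ** (up2 ** vsval u).
Proof.
rewrite -[RHS](comp_lfunE (act N up1) (act N up2)).
by apply: restrictE => v /UtopP tv; apply/UtopP; exact: top_de.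
Qed.

Lemma act_even_map z : z \in part gh false -> even_map (act N z).
Proof. by move=> ze q v vq; case: NL => H _; have := H _ _ _ _ ze vq; rewrite addFb. Qed.

Lemma zc_even z : z \in [:: zc0; zc1; zc2] -> z \in part gh false.
Proof.
by rewrite !inE => /or3P[] /eqP->; rewrite ?(zc0_def, zc1_def, zc2_def);
  do ?[apply: rpredD | apply: rpredB | rewrite rpredN]; apply: rpredZ;
  rewrite ?one_even ?zp_even ?zn_even.
Qed.

Lemma winv_even : even_map winv.
Proof.
apply: even_map_inv winvK wopK; apply: even_map_add; last exact: even_map1.
by apply: act_even_map; apply: zc_even; rewrite inE eqxx.
Qed.

Lemma topT_even a : even_map (topT a).
Proof.
have e1 : even_map (act N zc1) by apply: act_even_map; apply: zc_even; rewrite !inE eqxx orbT.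
have e2 : even_map (act N zc2) by apply: act_even_map; apply: zc_even; rewrite !inE eqxx !orbT.
have oo u v : u \in part gh true -> v \in part gh true -> even_map (act N u \o act N v)%VF.
  move=> uo vo q n nq; rewrite comp_lfunE; case: NL => H _.
  by have := H _ _ _ _ uo (H _ _ _ _ vo nq); rewrite addTb negbK.
case: a => //=.
- exact: even_map_comp e2 winv_even.
- by apply: even_map_comp winv_even _; apply: oo; [exact: dn2_odd | exact: dn1_odd].
- exact: even_map_comp e2 winv_even.
- by apply: oo; [exact: up1_odd | exact: up2_odd].
Qed.

Lemma topA_even a : even_map (topA a).
Proof.
have r (T : 'End(N)) k l : even_map T -> (forall v, v \in Utop k -> T v \in Utop l) ->
    @even_map F (sub_space (@Utop_graded k)) (sub_space (@Utop_graded l)) (restrict T (Utop k) (Utop l)).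
  by move=> Te H q u; rewrite !sub_partE restrictE //; exact: Te.
have c k v : v \in Utop k -> zc1 ** v \in Utop k by move=> /UtopP tv; apply/UtopP; exact: top_center.
have z k v : v \in Utop k -> topT zeta v \in Utop k by move=> /UtopP tv; apply/UtopP; exact: top_ze.
case: a.
- by apply: (r _ 2 2) => [|v]; [exact: (topT_even alpha) | exact: c].
- by apply: (r _ 2 2) => [|v]; [exact: (topT_even zeta) | exact: z].
- by apply: (r _ 2 0) => [|v /UtopP tv]; [exact: (topT_even beta) | apply/UtopP; exact: top_be].
- by apply: (r _ 0 0) => [|v]; [exact: (topT_even gamma) | exact: c].
- by apply: (r _ 0 0) => [|v]; [exact: (topT_even eta) | exact: z].
- by apply: (r _ 0 2) => [|v /UtopP tv]; [exact: (topT_even delta) | apply/UtopP; exact: top_de].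
Qed.

Definition topG : gradedRep F := @GradedRep F topS topA topA_even.
Local Notation X := (gforget topG).

Lemma qval_al (u : X v1) : vsval (Qact X alpha u) = zc1 ** vsval u. Proof. exact: val_al. Qed.
Lemma qval_ze (u : X v1) : vsval (Qact X zeta u) = zc2 ** winv (vsval u). Proof. exact: val_ze. Qed.
Lemma qval_be (u : X v1) : vsval (Qact X beta u) = winv (dn2 ** (dn1 ** vsval u)). Proof. exact: val_be. Qed.
Lemma qval_ga (u : X v2) : vsval (Qact X gamma u) = zc1 ** vsval u. Proof. exact: val_ga. Qed.
Lemma qval_et (u : X v2) : vsval (Qact X eta u) = zc2 ** winv (vsval u). Proof. exact: val_et. Qed.
Lemma qval_de (u : X v2) : vsval (Qact X delta u) = up1 ** (up2 ** vsval u). Proof. exact: val_de. Qed.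

(** The loops are restrictions of operators commuting with all of [gh]. *)
Lemma top_relations : Qrelations X.
Proof.
split; split; apply/lfunP=> u; rewrite !comp_lfunE; apply: subvs_inj.
- by rewrite qval_be qval_al qval_ga qval_be -!(ca _ _ c1) winv_act.
- by rewrite qval_be qval_ze qval_et qval_be -!winv_act -!(ca _ _ c2) !winv_act.
- by rewrite qval_ze qval_de qval_de qval_et !winv_act -!(ca _ _ c2).
- by rewrite qval_al qval_de qval_de qval_ga -!(ca _ _ c1).
- by rewrite qval_al qval_ze qval_ze qval_al winv_act (ca zc1 _ c2).
- by rewrite qval_ga qval_et qval_et qval_ga winv_act (ca zc1 _ c2).
Qed.

Definition tval (i : Qvert) : X i -> N :=
  match i return X i -> N with
  | v1 => fun u : subvs_of (Utop 2) => vsval u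
  | v2 => fun u : subvs_of (Utop 0) => vsval u end.

Lemma tvalP i k u v : @tval i (k *: u + v) = k *: tval u + tval v.
Proof. by case: i u v. Qed.

Lemma tvalD i u v : @tval i (u + v) = tval u + tval v.
Proof. by case: i u v. Qed.

Lemma tvalN i u : @tval i (- u) = - tval u.
Proof. by case: i u. Qed.

Lemma tvalZ i k u : @tval i (k *: u) = k *: tval u.
Proof. by case: i u. Qed.

Lemma tval_inj i (u v : X i) : tval u = tval v -> u = v.
Proof. by case: i u v => u v; exact: subvs_inj. Qed.

Lemma val_diag i u : tval (Qdiag X i u) = zc1 ** tval u.
Proof. by case: i u => u; [exact: val_al | exact: val_ga]. Qed.
Lemma val_diag' i u : tval (Qdiag' X i u) = zc2 ** winv (tval u).
Proof. by case: i u => u; [exact: val_ze | exact: val_et]. Qed.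

Lemma vtop2 (u : X v1) : top 2 (tval u). Proof. by apply/UtopP; exact: subvsP. Qed.
Lemma vtop0 (u : X v2) : top 0 (tval u). Proof. by apply/UtopP; exact: subvsP. Qed.

Lemma tval_be (u : X v1) : tval (Qact X beta u) = winv (dn2 ** (dn1 ** tval u)).
Proof. exact: val_be. Qed.
Lemma tval_de (u : X v2) : tval (Qact X delta u) = up1 ** (up2 ** tval u).
Proof. exact: val_de. Qed.

Lemma val_turn i u : tval (Qturn X i u) =
  2 *: tval u + zc1 ** (zc2 ** winv (tval u)) - wop (tval u).
Proof.
case: i u => u.
  transitivity (tval (Qact X delta (Qact X beta u))); first by rewrite -comp_lfunE.
  by rewrite tval_de tval_be (turn_top2 (vtop2 u)).
transitivity (tval (Qact X beta (Qact X delta u))); first by rewrite -comp_lfunE.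
by rewrite tval_be tval_de (turn_top0 (vtop0 u)).
Qed.

Lemma nilp_restrict i (T : 'End(N)) (S : 'End(X i)) :
  (forall u, tval (S u) = T (tval u)) -> nilp T -> nilp S.
Proof.
move=> E [n H]; exists n => u; apply: tval_inj.
have -> : tval (0 : X i) = 0 by case: (i).
by rewrite -[RHS](H (tval u)); elim: n {H} => //= n <-; rewrite E.
Qed.

Lemma zc1_nilp : nilp (act N zc1).
Proof.
have [_ e _] := chi_zc; apply: (nilp_ext _ (chi_nilp NX c1)) => v.
by rewrite zshiftE e scale0r subr0.
Qed.
Lemma zc2_nilp : nilp (act N zc2).
Proof.
have [_ _ e] := chi_zc; apply: (nilp_ext _ (chi_nilp NX c2)) => v.
by rewrite zshiftE e scale0r subr0.
Qed.

Definition turnT : 'End(N) :=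
  (act N zc1 \o (act N zc2 \o winv))%VF + (-1) *: zshift chi N zc0.

Lemma turnTE v : turnT v = 2 *: v + zc1 ** (zc2 ** winv v) - wop v.
Proof.
have [e0 _ _] := chi_zc.
by rewrite add_lfunE scale_lfunE 2!comp_lfunE zshiftE e0 wopE; vect_ring.
Qed.

Lemma turn_nilp i : nilp (Qturn X i).
Proof.
have [e0 _ _] := chi_zc.
apply: (@nilp_restrict i turnT) => [u|]; first by rewrite turnTE val_turn.
apply: nilp_add; last by apply: nilpZ; exact: (chi_nilp NX c0).
  move=> v; rewrite scale_lfunE 4!comp_lfunE scale_lfunE !zshiftE e0 !lfunZ !lfunD !lfunN !lfunZ.
  by rewrite winv_act !(ca _ _ c0).
by apply: nilp_comp zc1_nilp => v; rewrite !comp_lfunE winv_act (ca zc1 _ c2).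
Qed.

Lemma top_nilpotent : Qnilpotent X.
Proof.
apply: (Qnilpotent_of top_relations) => i; split; last exact: turn_nilp.
  by apply: nilp_restrict zc1_nilp => u; exact: val_diag.
have H : nilp (act N zc2 \o winv)%VF by apply: nilp_comp zc2_nilp => v; rewrite winv_act.
by apply: nilp_restrict H => u; rewrite comp_lfunE; exact: val_diag'.
Qed.

Lemma val_Qu i u : tval (Qu topG i u + Qturn X i u) = wop (tval u).
Proof.
have := congr1 (@tval i) (QuE (G := topG) u); rewrite val_diag val_diag'.
rewrite !(tvalD, tvalN, tvalZ) val_turn.
set v := tval u; set w := wop v; set q := tval (Qu topG i u); set s := zc1 ** _ => H.
have -> : q = s + 2 *: v - 2 *: (2 *: v + s - w) by rewrite {1}H; vect_ring.
by vect_ring.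
Qed.

(** On D the inverse of (d1, d2) -> dn2 w^-1 d1 + up1 d2 is d -> (up1 d, w^-1 dn2 d), since up1 dn2
    + dn2 up1 = w on N[1] and both squares vanish. *)
Definition topPhi (m : (X v1 * (X v1 * X v2) * X v2)%type) : N :=
  tval m.1.1 + (dn2 ** winv (tval m.1.2.1) + up1 ** tval m.1.2.2) + tval m.2.

Fact topPhi_linear : linear topPhi.
Proof.
move=> k [[b [d1 d2]] c] [[b' [d1' d2']] c'].
have -> : k *: ((b, (d1, d2), c) : (X v1 * (X v1 * X v2) * X v2)%type) + (b', (d1', d2'), c')
  = (k *: b + b', (k *: d1 + d1', k *: d2 + d2'), k *: c + c') by [].
by rewrite /topPhi [_.1]/= [_.2]/= !tvalP; vect_ring.
Qed.

Definition topPhiL : 'Hom((X v1 * (X v1 * X v2) * X v2)%type, N) :=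
  linfun (HB.pack topPhi (GRing.isLinear.Build F _ N *:%R topPhi topPhi_linear)
   : {linear (X v1 * (X v1 * X v2) * X v2)%type -> N}).

Lemma topPhiE m : topPhiL m = topPhi m. Proof. exact: lfunE. Qed.
Local Notation RO1 := (omaps_comb l1 r1 (QO1 topG) (QO2 topG)).
Local Notation RO2 := (omaps_comb l2 r2 (QO1 topG) (QO2 topG)).
Definition topM : act_space (M11 F) := jordan_space F2 RO1 RO2.

Let x02E : x j0 j2 = l1 *: up1 + r1 *: up2.
Proof.
rewrite up1_def up2_def; move: (x j0 j2) (x j3 j1) => u v.
transitivity ((l1 * r2 - r1 * l2) *: u); first by rewrite det1 scale1r.
by vect_ring.
Qed.
Let x31E : x j3 j1 = l2 *: up1 + r2 *: up2.
Proof.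
rewrite up1_def up2_def; move: (x j0 j2) (x j3 j1) => u v.
transitivity ((l1 * r2 - r1 * l2) *: v); first by rewrite det1 scale1r.
by vect_ring.
Qed.
Let x13E : x j1 j3 = l1 *: dn1 + r1 *: dn2.
Proof.
rewrite dn1_def dn2_def; move: (x j1 j3) (x j2 j0) => u v.
transitivity ((l1 * r2 - r1 * l2) *: u); first by rewrite det1 scale1r.
by vect_ring.
Qed.
Let x20E : x j2 j0 = l2 *: dn1 + r2 *: dn2.
Proof.
rewrite dn1_def dn2_def; move: (x j1 j3) (x j2 j0) => u v.
transitivity ((l1 * r2 - r1 * l2) *: v); first by rewrite det1 scale1r.
by vect_ring.
Qed.

Lemma h2_top k n : top k n -> hh2 p pi ** n = (2 - k) *: n.
Proof.
move=> [wn hn]; have e : hs ** n = 2^-1 *: (h1 ** n + hh2 p pi ** n).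
  by rewrite (short_hE psl_g uce char0) lfunZ lfunD scale_lfunE add_lfunE.
have -> : hh2 p pi ** n = 2 *: (hs ** n) - h1 ** n by rewrite e; vect_field F2.
by rewrite hn wn; vect_ring.
Qed.

Definition dvec (d : (X v1 * X v2)%type) : N := dn2 ** winv (tval d.1) + up1 ** tval d.2.

Lemma wt_top k n : top k n -> wgt 1 n. Proof. by case. Qed.

Lemma top_dvec d : top 1 (dvec d).
Proof.
apply: topD.
  rewrite (_ : 1 = 2 - 1 :> F); last by ring.
  by apply: (top_dn k2); apply: top_winv; exact: vtop2.
by rewrite -[1]add0r; apply: (top_up i1); exact: vtop0.
Qed.

Lemma up1_dvec d : up1 ** dvec d = tval d.1.
Proof.
have t1 := top_winv (vtop2 d.1).
by rewrite /dvec lfunD (up1_dn2 (wt_top t1)) (up1_top2 t1) lfun0 subr0 wopK up1_up1 addr0.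
Qed.
Lemma up2_dvec d : up2 ** dvec d = zc2 ** winv (tval d.1) - up1 ** (up2 ** tval d.2).
Proof.
have t1 := top_winv (vtop2 d.1).
by rewrite /dvec lfunD up2_dn2 (up2_top2 t1) lfun0 subr0 up2_up1.
Qed.
Lemma dn1_dvec d : dn1 ** dvec d = zc1 ** tval d.2 - winv (dn2 ** (dn1 ** tval d.1)).
Proof.
rewrite /dvec lfunD dn1_dn2 !winv_act; have := up1_dn1 (tval d.2); rewrite (dn1_top0 (vtop0 d.2)) lfun0.
move/esym/subr0_eq=> <-; by vect_ring.
Qed.
Lemma dn2_dvec d : dn2 ** dvec d = wop (tval d.2).
Proof.
rewrite /dvec lfunD dn2_dn2 add0r; have := up1_dn2 (wt_top (vtop0 d.2)).
by rewrite (dn2_top0 (vtop0 d.2)) lfun0 => /esym/subr0_eq ->.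
Qed.

(** Apply w = up1 dn2 + dn2 up1 to dn1 b and use that [up1] kills b; [up2_c] is the mirror image. *)
Lemma dn1_b (b : X v1) : dn1 ** tval b = dn2 ** winv (zc1 ** tval b) + up1 ** winv (dn2 ** (dn1 ** tval b)).
Proof.
have tb := vtop2 b; have t1 := top_dn k1 tb.
rewrite -!winv_act -lfunD -[LHS]winvK; congr (winv _).
rewrite (up1_dn2 (wt_top t1)) up1_dn1 (up1_top2 tb) lfun0 subr0; vect_ring.
Qed.
Lemma up2_c (c : X v2) : up2 ** tval c = dn2 ** winv (up1 ** (up2 ** tval c)) + up1 ** (zc2 ** winv (tval c)).
Proof.
have tc := vtop0 c; have t1 := top_up i2 tc.
rewrite -winv_act -[zc2 ** winv _]winv_act -[up1 ** winv _]winv_act -lfunD -[LHS]winvK; congr (winv _).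
have := up1_dn2 (wt_top t1); have := up2_dn2 (tval c); rewrite (dn2_top0 tc) lfun0 => /esym/subr0_eq -> H.
by rewrite H; vect_ring.
Qed.

Lemma dvecP k d d' : dvec (k *: d + d') = k *: dvec d + dvec d'.
Proof. by rewrite /dvec [_.1]/= [_.2]/= !tvalP; vect_ring. Qed.
Lemma dvec0 : dvec 0 = 0.
Proof. by have := dvecP (-1) 0 0; rewrite scaler0 addr0 scaleN1r addNr. Qed.
Lemma dvecZ k d : dvec (k *: d) = k *: dvec d.
Proof. by rewrite -[k *: d]addr0 dvecP dvec0 addr0. Qed.
Lemma dvecD d d' : dvec (d + d') = dvec d + dvec d'.
Proof. by have := dvecP 1 d d'; rewrite !scale1r. Qed.
Lemma dvecN d : dvec (- d) = - dvec d.
Proof. by rewrite -scaleN1r dvecZ scaleN1r. Qed.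

Local Notation comb l r := (omaps_comb l r (QO1 topG) (QO2 topG)).

Lemma act_comb l r (u v : gh) (n : N) : (l *: u + r *: v) ** n = l *: (u ** n) + r *: (v ** n).
Proof. by rewrite [act N (_ + _)]lfunD ![act N (_ *: _)]lfunZ add_lfunE !scale_lfunE. Qed.

Lemma tval_oB l r d : tval (oB (comb l r) d : X v1) = (l *: up1 + r *: up2) ** dvec d.
Proof.
rewrite [oB _ _]add_lfunE !scale_lfunE oB_QO1 oB_QO2 !(tvalD, tvalZ, tvalN).
by rewrite (val_diag' (i := v1)) tval_de act_comb up1_dvec up2_dvec.
Qed.
Lemma tval_oC l r d : tval (oC (comb l r) d : X v2) = (l *: dn1 + r *: dn2) ** dvec d.
Proof.
rewrite [oC _ _]add_lfunE !scale_lfunE oC_QO1 oC_QO2 tvalD !tvalZ val_Qu [tval (- _ + _)]tvalD tvalN (val_diag (i := v2)) tval_be.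
by rewrite act_comb dn1_dvec dn2_dvec; congr (_ *: _ + _); rewrite addrC.
Qed.
Lemma dvec_uB l r (b : X v1) : dvec (uB (comb l r) b) = (l *: dn1 + r *: dn2) ** tval b.
Proof.
rewrite [uB _ _]add_lfunE !scale_lfunE dvecD !dvecZ uB_QO1 uB_QO2 /dvec [_.1]/= [_.2]/= [X in _ + X *: _]/=.
rewrite (val_diag (i := v1)) tval_be val_Qu winvK (_ : tval (0 : X v2) = 0) // lfun0 addr0.
by rewrite act_comb -dn1_b.
Qed.
Lemma dvec_uC l r (c : X v2) : dvec (uC (comb l r) c) = (l *: up1 + r *: up2) ** tval c.
Proof.
rewrite [uC _ _]add_lfunE !scale_lfunE dvecD !dvecZ uC_QO1 uC_QO2 /dvec [_.1]/= [_.2]/=.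
rewrite (val_diag' (i := v2)) tval_de (_ : tval (0 : X v1) = 0) // !lfun0 add0r.
by rewrite act_comb -up2_c.
Qed.
Lemma up_b l r (b : X v1) : (l *: up1 + r *: up2) ** tval b = 0.
Proof.
by rewrite act_comb (up1_top2 (vtop2 b)) (up2_top2 (vtop2 b)) !scaler0 addr0.
Qed.
Lemma dn_c l r (c : X v2) : (l *: dn1 + r *: dn2) ** tval c = 0.
Proof.
by rewrite act_comb (dn1_top0 (vtop0 c)) (dn2_top0 (vtop0 c)) !scaler0 addr0.
Qed.

Lemma tval_comb i s (b : X i) s1 s2 u v U V : tval u = U -> tval v = V ->
  tval (s *: b + 2^-1 *: (s1 *: u - s2 *: v)) = s *: tval b + 2^-1 *: (s1 *: U - s2 *: V).
Proof. by move=> <- <-; rewrite tvalD !tvalZ tvalD tvalN !tvalZ. Qed.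
Lemma dvec_comb s d s1 s2 u v u' v' U V U' V' :
  dvec u = U -> dvec v = V -> dvec u' = U' -> dvec v' = V' ->
  dvec (2^-1 *: (s *: d + s1 *: (u - v) + s2 *: (u' - v'))) =
  2^-1 *: (s *: dvec d + s1 *: (U - V) + s2 *: (U' - V')).
Proof. by move=> <- <- <- <-; rewrite dvecZ 2!dvecD 3!dvecZ 2!dvecD 2!dvecN. Qed.

Lemma topPhi_jop (a : M11 F) m :
  topPhi (jop RO1 RO2 a m) = br_lift p pi (M11_emb a) (short_f F) ** topPhi m.
Proof.
move: m => [[b d] c]; rewrite (jordan_brE psl_g uce char0) x02E x31E x13E x20E.
have -> : topPhi (b, d, c) = tval b + dvec d + tval c by [].
have tb := vtop2 b; have td := top_dvec d; have tc := vtop0 c.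
have [_ hb] := tb; have [_ hd] := td; have [_ hc] := tc.
have b0 := up_b _ _ b; have c0' := dn_c _ _ c.
have EB l r := tval_oB l r d; have EC l r := tval_oC l r d; have UB l r := dvec_uB l r b; have UC l r := dvec_uC l r c.
transitivity (tval ((a : 'M_2) 0 0 *: b + 2^-1 *: ((a : 'M_2) 0 1 *: oB RO1 d - (a : 'M_2) 1 0 *: oB RO2 d) : X v1)
  + dvec (2^-1 *: (((a : 'M_2) 0 0 + (a : 'M_2) 1 1) *: d + (a : 'M_2) 0 1 *: (uC RO1 c - uB RO1 b)
            + (a : 'M_2) 1 0 *: (uB RO2 b - uC RO2 c)))
  + tval ((a : 'M_2) 1 1 *: c + 2^-1 *: ((a : 'M_2) 1 0 *: oC RO2 d - (a : 'M_2) 0 1 *: oC RO1 d) : X v2)); first by [].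
have E1 := tval_comb (i := v1) ((a : 'M_2) 0 0) b ((a : 'M_2) 0 1) ((a : 'M_2) 1 0) (EB l1 r1) (EB l2 r2).
have E2 := dvec_comb ((a : 'M_2) 0 0 + (a : 'M_2) 1 1) d ((a : 'M_2) 0 1) ((a : 'M_2) 1 0)
  (UC l1 r1) (UB l1 r1) (UB l2 r2) (UC l2 r2).
have E3 := tval_comb (i := v2) ((a : 'M_2) 1 1) c ((a : 'M_2) 1 0) ((a : 'M_2) 0 1) (EC l2 r2) (EC l1 r1).
apply: (etrans (congr2 +%R (congr2 +%R E1 E2) E3)); clear E1 E2 E3 EB EC UB UC.
move: ((a : 'M_2) 0 0) ((a : 'M_2) 0 1) ((a : 'M_2) 1 0) ((a : 'M_2) 1 1) => s00 s01 s10 s11.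
move: (l1 *: up1 + r1 *: up2) (l2 *: up1 + r2 *: up2) (b0 l1 r1) (b0 l2 r2) => P1 P2 p1 p2.
move: (l1 *: dn1 + r1 *: dn2) (l2 *: dn1 + r2 *: dn2) (c0' l1 r1) (c0' l2 r2) => M1 M2 m1 m2.
have h2b := h2_top tb; have h2d := h2_top td; have h2c := h2_top tc.
rewrite ![act N (_ + _)]lfunD ![act N (_ *: _)]lfunZ ![act N (_ - _)]lfunD ![act N (- _)]lfunN.
rewrite !(add_lfunE, scale_lfunE, opp_lfunE).
have eD z : z ** (tval b + dvec d + tval c) = z ** tval b + z ** dvec d + z ** tval c by rewrite !lfunD.
rewrite !eD hb hd hc h2b h2d h2c p1 p2 m1 m2; by vect_field F2.
Qed.

Lemma top_val2 n : top 2 n -> exists u : X v1, tval u = n.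
Proof. by move=> /UtopP nU; exists (vsproj (Utop 2) n); rewrite /tval vsprojK. Qed.
Lemma top_val0 n : top 0 n -> exists u : X v2, tval u = n.
Proof. by move=> /UtopP nU; exists (vsproj (Utop 0) n); rewrite /tval vsprojK. Qed.

Lemma tval_part q i (u : X i) : u \in part (topS i) q -> tval u \in part N q.
Proof. by case: i u => u; rewrite sub_partE. Qed.

Lemma topPhi_Jor : is_Jor p pi N topM.
Proof.
have Od z q n : z \in part gh true -> n \in part N (~~ q) -> z ** n \in part N q.
  by move=> zo nq; case: NL => H _; have := H _ _ _ _ zo nq; rewrite addTb negbK.
exists topPhiL; split.
- move=> q [[b [d1 d2]] c]; rewrite topPhiE !prod_spaceE => /andP[/andP[bq dq] cq].
  have /andP[dq1 dq2] : (d1 \in part (topS v1) (~~ q)) && (d2 \in part (topS v2) (~~ q)).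
    exact: dq.
  rewrite /topPhi; apply: rpredD; [apply: rpredD; [exact: (tval_part bq) | apply: rpredD] | exact: (tval_part cq)].
    by apply: Od; [exact: dn2_odd | apply: winv_even; exact: (tval_part dq1)].
  by apply: Od; [exact: up1_odd | exact: (tval_part dq2)].
- apply/eqP; rewrite -subv0; apply/subvP=> -[[b d] c]; rewrite memv_ker memv0 topPhiE.
  move=> /eqP H0; have H : tval b + dvec d + tval c = 0 by [].
  have [_ hb] := vtop2 b; have [_ hd] := top_dvec d; have [_ hc] := vtop0 c.
  (* Applying [h1] twice separates the eigenvalues 2, 1 and 0. *)
  have H1 := congr1 (act N h1) H; rewrite lfun0 2!lfunD hb hd hc scale0r addr0 scale1r in H1.
  have H2 := congr1 (act N h1) H1; rewrite lfun0 lfunD lfunZ hb hd scale1r in H2.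
  have b0 : tval b = 0.
    apply: (scalerI F2); rewrite scaler0 -[RHS](subrr 0) -{1}H2 -H1; vect_ring.
  have d0 : dvec d = 0 by move: H1; rewrite b0 scaler0 add0r.
  have c0' : tval c = 0 by move: H; rewrite b0 d0 !add0r.
  have d1 : tval d.1 = 0 by rewrite -up1_dvec d0 lfun0.
  have d2 : tval d.2 = 0 by rewrite -[tval d.2]winvK -dn2_dvec d0 !lfun0.
  apply/eqP; have z i (u : X i) : tval u = 0 -> u = 0.
    by move=> u0; apply: tval_inj; rewrite u0; case: (i).
  by rewrite (z _ _ b0) (z _ _ c0') [d]surjective_pairing (z _ _ d1) (z _ _ d2).
- apply/vspaceP=> n; rewrite leigen_in scale1r; apply/memv_imgP/eqP=> [[[[b d] c] _ ->]|wn].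
    rewrite topPhiE -[RHS]scale1r; apply: wgtD; [apply: wgtD|];
      [exact: (wt_top (vtop2 b)) | exact: (wt_top (top_dvec d)) | exact: (wt_top (vtop0 c))].
  have wn1 : wgt 1 n by apply: (etrans wn); rewrite scale1r.
  have [b [d [c [en tb td tc]]]] := top_split wn1.
  have [ub eb] := top_val2 tb; have [uc ec] := top_val0 tc.
  have t2 : top 2 (up1 ** d) by rewrite (_ : 2 = 1 + 1) //; exact: top_up.
  have t0 : top 0 (winv (dn2 ** d)) by apply: top_winv; rewrite -[0](subrr 1); exact: top_dn.
  have [u1 e1] := top_val2 t2; have [u2 e2] := top_val0 t0.
  (* The D-coordinates of d are up1 d and w^-1 dn2 d. *)
  exists (ub, (u1, u2), uc); first exact: memvf.
  rewrite topPhiE -[topPhi _]/(tval ub + (dn2 ** winv (tval u1) + up1 ** tval u2) + tval uc) eb ec e1 e2 en; congr (_ + _ + _).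
  rewrite -winv_act -[up1 ** winv _]winv_act -lfunD (up1_dn2 (wt_top td)) addrC subrK winvK //.
- by move=> a m; rewrite [act topM a m](jactE F2) !topPhiE topPhi_jop.
Qed.

Lemma Jor_exists : exists (G : gradedRep F), [/\ Qrelations (gforget G), Qnilpotent (gforget G)
  & is_Jor p pi N (jordan_space F2 (omaps_comb l1 r1 (QO1 G) (QO2 G)) (omaps_comb l2 r2 (QO1 G) (QO2 G)))].
Proof.
by exists topG; split; [exact: top_relations | exact: top_nilpotent | exact: topPhi_Jor].
Qed.
End OnModule.
End RotatedElements.

(** * Reduction of the central character *)

Section AtypicalParameters.
Variables (F : fieldType) (F2 : 2 != 0 :> F).

(** The binary form with coefficients cp, c, cn has discriminant 4 and equals 2 (l1 X + l2 Y)(r1 X +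
    r2 Y); the discriminant of the product is 4 times the square of the determinant. An explicit
    choice avoids square roots. *)
Lemma atypical_factor (c cp cn : F) : c ^+ 2 - 4 * cp * cn = 4 ->
  exists l1 r1 l2 r2, [/\ l1 * r2 - r1 * l2 = 1, c = 2 * (l1 * r2 + r1 * l2),
    cp = 2 * (l1 * r1) & cn = 2 * (l2 * r2)].
Proof.
have F4 : 4 != 0 :> F by rewrite (_ : 4 = 2 * 2) ?mulf_neq0 //; ring.
have [cE|cn0] := eqVneq (c + 2) 0 => H.
  have {}cE : c = - 2 by apply/eqP; rewrite -addr_eq0 cE.
  have pn : cp * cn = 0.
    have E : 4 * (cp * cn) = c ^+ 2 - (c ^+ 2 - 4 * cp * cn) by ring.
  by apply: (mulfI F4); rewrite E H cE; ring.
  (* For c = -2 the discriminant forces cp cn = 0, so l1 r2 = 0 and r1 l2 = -1. *)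
  exists (cp / 2), 1, (-1), (- (cn / 2)); split; try by field.
    transitivity (1 - cp * cn / 4); first by field; rewrite F2 F4.
    by rewrite pn mul0r subr0.
  transitivity (- 2 - cp * cn / 2); last by field.
  by rewrite pn mul0r subr0.
(* Normalise l1 = 1; then r2 = (c + 2) / 4 is nonzero, r1 = cp / 2 and l2 = cn / (2 r2) = 2 t. *)
set t := cn / (c + 2); have tE : cn = t * (c + 2) by rewrite /t divfK.
have cE : c = 2 + 4 * cp * t.
  apply: (mulIf cn0); have -> : c * (c + 2) = (c ^+ 2 - 4 * cp * cn) + 4 * cp * cn + 2 * c by ring.
  by rewrite H {1}tE; ring.
exists 1, (cp / 2), (2 * t), (1 + cp * t); split; try by field.
  by rewrite {1}cE; field.
by rewrite tE cE; ring.
Qed.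
End AtypicalParameters.

Section NilpotentModel.
Variables (F : fieldType) (F2 : 2 != 0 :> F) (G : gradedRep F).
Local Notation X := (gforget G).
Hypothesis rel : Qrelations X.
Hypothesis nil : Qnilpotent X.

Lemma nilp_block (V W : vectType F) (f : 'End(V)) (h : 'End(W)) (T : 'End((V * W)%type)) :
  (forall x, T x = (f x.1, h x.2)) -> nilp f -> nilp h -> nilp T.
Proof.
move=> TE [n fn] [m hm]; exists (n + m)%N => x.
have -> : iter (n + m) T x = (iter (n + m) f x.1, iter (n + m) h x.2).
  by elim: (n + m)%N => [|k IH]; [case: x | rewrite !iterS IH TE].
by rewrite (iter_ge (leq_addr m n) (fn _)) (iter_ge (leq_addl n m) (hm _)).
Qed.

(** The nilpotent part of [Qu + Qturn], which is thereby invertible. *)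
Definition wshift i : 'End(X i) := Qu G i + Qturn X i - 2 *: \1%VF.

Lemma wshift_nilp i : nilp (wshift i).
Proof.
have H : nilp ((Qdiag X i \o Qdiag' X i)%VF + (-1) *: Qturn X i).
  apply: nilp_add; first exact: prod_turn_comm.
    exact: diag_prod_nilp.
  by apply: nilpZ; exact: Qturn_nilp.
apply: nilp_ext H => x; rewrite !add_lfunE opp_lfunE !scale_lfunE id_lfunE.
by vect_ring.
Qed.

Lemma wdiag_comm i : lcomm (Qdiag' X i) (Qu G i + Qturn X i).
Proof.
move=> x; rewrite !add_lfunE !scale_lfunE !id_lfunE !comp_lfunE !lfunD !lfunZ.
by rewrite (Qturn_diag' rel) (Qdiag_comm rel).
Qed.

Lemma wdiag_nilp i : nilp ((Qu G i + Qturn X i) \o Qdiag' X i)%VF.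
Proof.
have H := nilp_comp (@wdiag_comm i) (Qdiag'_nilp nil i).
by apply: nilp_ext H => x; rewrite !comp_lfunE wdiag_comm.
Qed.

Lemma zmaps_nil_scalar (f1 : 'End(X v1)) (f2 : 'End(X v2)) c :
  nilp (f1 - c *: \1%VF) -> nilp (f2 - c *: \1%VF) ->
  @zmaps_nil F (QA G) (G v1) (G v2) (QD G) (scalar_zmaps f1 f2) c.
Proof.
move=> n1 n2.
have nb : nilp (block_lfun f1 0 0 f2 - c *: \1%VF).
  apply: (nilp_block _ n1 n2) => -[x y].
  rewrite !add_lfunE !opp_lfunE !scale_lfunE !id_lfunE block_lfunE !zero_lfunE.
  by apply: prod_eq; rewrite /= ?addr0 ?add0r.
by split.
Qed.

Lemma nil0 (V : vectType F) (f : 'End(V)) : nilp f -> nilp (f - 0 *: \1%VF).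
Proof. by rewrite scale0r subr0. Qed.

Lemma Qone_nil : zmaps_nil (Qone G) 2.
Proof.
apply: zmaps_nil_scalar; [have H := nilpZ 2 (wshift_nilp v1) | have H := nilpZ 2 (wshift_nilp v2)];
  apply: nilp_ext H => x; rewrite !(add_lfunE, opp_lfunE, scale_lfunE, id_lfunE, comp_lfunE);
  by vect_ring.
Qed.

Lemma Qz1_nil : zmaps_nil (Qz1 G) 0.
Proof.
apply: zmaps_nil_scalar; apply: nil0; [exact: (Qdiag_nilp nil v1) | exact: (Qdiag_nilp nil v2)].
Qed.

Lemma Qz2_nil : zmaps_nil (Qz2 G) 0.
Proof. by apply: zmaps_nil_scalar; apply: nil0; [exact: (wdiag_nilp v1) | exact: (wdiag_nilp v2)]. Qed.
End NilpotentModel.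

Section NilpotentCombination.
Variables (F : fieldType) (F2 : 2 != 0 :> F) (A B C D : superspace F).

Lemma nilp_comb (V : vectType F) (f1 f f2 : 'End(V)) a b c :
  lcomm f f1 -> lcomm f f2 -> lcomm f1 f2 ->
  nilp (f1 - 0 *: \1%VF) -> nilp (f - 2 *: \1%VF) -> nilp (f2 - 0 *: \1%VF) ->
  nilp (a *: f1 + b *: (2^-1 *: f + 0 *: f + 0 *: f) + c *: f2 - b *: \1%VF).
Proof.
move=> c1 c2 c12; rewrite !scale0r !subr0 => n1 n n2.
have H : nilp (a *: f1 + (b / 2) *: (f - 2 *: \1%VF) + c *: f2).
  apply: nilp_add; [|apply: nilp_add|exact: nilpZ]; last exact: nilpZ; last exact: nilpZ.
    move=> x; rewrite !add_lfunE !scale_lfunE !add_lfunE !opp_lfunE !scale_lfunE !id_lfunE.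
    by rewrite lfunD !lfunZ lfunD lfunN !lfunZ c2 c12; vect_ring.
  move=> x; rewrite !scale_lfunE !add_lfunE !opp_lfunE !scale_lfunE !id_lfunE.
  by rewrite !lfunZ lfunD lfunN !lfunZ c1; vect_ring.
apply: nilp_ext H => x; rewrite !(add_lfunE, opp_lfunE, scale_lfunE, id_lfunE, zero_lfunE).
by vect_field F2.
Qed.

Variables (O1 O2 : omaps A B C D) (one z1 z2 : zmaps A B C D).
Hypothesis R : model_rel O1 O2 one z1 z2.

Lemma rot_z_nil l r l' r' k : zmaps_nil one 2 -> zmaps_nil z1 0 -> zmaps_nil z2 0 ->
  zmaps_nil (rot_z one z1 z2 l r l' r' k) (k * (l * r' + r * l')).
Proof.
move=> [nA nB nC nD] [pA pB pC pD] [mA mB mC mD].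
have [a1 b1 c1 d1] := relo1 R; have [a2 b2 c2 d2] := relo2 R; have [a b c d] := relz12 R.
by split; apply: nilp_comb.
Qed.
End NilpotentCombination.

(** * Morphisms of models and of quiver representations *)

Section JordanNaturality.
Variables (F : fieldType) (F2 : 2 != 0 :> F) (A B C D A' B' C' D' : superspace F).
Variables (O1 O2 : omaps A B C D) (O1' O2' : omaps A' B' C' D').
Variables (fB : 'Hom(B, B')) (fC : 'Hom(C, C')) (fD : 'Hom(D, D')).

Definition omaps_natural (O : omaps A B C D) (O' : omaps A' B' C' D') : Prop :=
  [/\ forall d, fB (oB O d) = oB O' (fD d), forall d, fC (oC O d) = oC O' (fD d),
      forall b, fD (uB O b) = uB O' (fB b) & forall c, fD (uC O c) = uC O' (fC c)].

Lemma omaps_natural_comb l r : omaps_natural O1 O1' -> omaps_natural O2 O2' ->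
  omaps_natural (omaps_comb l r O1 O2) (omaps_comb l r O1' O2').
Proof.
by move=> [B1 C1 u1 v1] [B2 C2 u2 v2]; split=> x /=;
  rewrite !add_lfunE !scale_lfunE lfunD !lfunZ ?B1 ?B2 ?C1 ?C2 ?u1 ?u2 ?v1 ?v2.
Qed.

Lemma jop_natural a b d c : omaps_natural O1 O1' -> omaps_natural O2 O2' ->
  let m := jop O1 O2 a (b, d, c) in
  (fB m.1.1, fD m.1.2, fC m.2) = jop O1' O2' a (fB b, fD d, fC c).
Proof.
move=> [B1 C1 u1 v1] [B2 C2 u2 v2] m; rewrite /m /jop.
move: (B1 d) (B2 d) (C1 d) (C2 d) (u1 b) (u2 b) (v1 c) (v2 c) => <- <- <- <- <- <- <- <-.
move: (oB O1 d) (oB O2 d) (oC O1 d) (oC O2 d) (uB O1 b) (uB O2 b) (uC O1 c) (uC O2 c).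
move=> x1 x2 x3 x4 x5 x6 x7 x8.
do 2?apply: prod_eq; rewrite [LHS]/= [RHS]/=.
- by rewrite lfunD !lfunZ lfunD lfunN !lfunZ.
- by rewrite lfunZ 2!lfunD 3!lfunZ 2!lfunD 2!lfunN.
- by rewrite lfunD !lfunZ lfunD lfunN !lfunZ.
Qed.
End JordanNaturality.

Section QuiverMaps.
Variables (F : fieldType) (F2 : 2 != 0 :> F) (l1 r1 l2 r2 : F).
Hypothesis det1 : l1 * r2 - r1 * l2 = 1.

Definition Qjor (G : gradedRep F) : act_space (M11 F) :=
  jordan_space F2 (omaps_comb l1 r1 (QO1 G) (QO2 G)) (omaps_comb l2 r2 (QO1 G) (QO2 G)).

Definition qpair (G G' : gradedRep F) (f : 'Hom(G v1, G' v1) * 'Hom(G v2, G' v2)) :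
  'Hom((G v1 * G v2)%type, (G' v1 * G' v2)%type) := locked (block_lfun f.1 0 0 f.2).

Lemma qpairE G G' f d : @qpair G G' f d = (f.1 d.1, f.2 d.2).
Proof. by rewrite /qpair -lock block_lfunE !zero_lfunE addr0 add0r. Qed.

Definition qmap (G G' : gradedRep F) (f : 'Hom(G v1, G' v1) * 'Hom(G v2, G' v2)) :
  'Hom((G v1 * (G v1 * G v2) * G v2)%type, (G' v1 * (G' v1 * G' v2) * G' v2)%type) :=
  locked (block_lfun (block_lfun f.1 0 0 (qpair f)) 0 0 f.2).

Lemma qmapE G G' f m : @qmap G G' f m = (f.1 m.1.1, (f.1 m.1.2.1, f.2 m.1.2.2), f.2 m.2).
Proof. by rewrite /qmap -lock !block_lfunE !zero_lfunE qpairE !addr0 !add0r. Qed.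

Lemma qmapP G G' k f f' : @qmap G G' (k *: f + f') = k *: qmap f + qmap f'.
Proof.
apply/lfunP=> m; rewrite add_lfunE scale_lfunE !qmapE.
by do 2?apply: prod_eq; rewrite [LHS]/= [RHS]/=; do ?apply: prod_eq; rewrite [LHS]/= [RHS]/=
  add_lfunE scale_lfunE.
Qed.

Lemma qmap_id G : @qmap G G (\1%VF, \1%VF) = \1%VF.
Proof. by apply/lfunP=> -[[b [d1 d2]] c]; rewrite qmapE !id_lfunE. Qed.

Lemma qmap_inj0 G G' f : (forall m, @qmap G G' f m = 0) -> f = 0.
Proof.
move=> H; apply: prod_eq; apply/lfunP=> x; rewrite zero_lfunE.
  by have := H (x, (0, 0), 0); rewrite qmapE => -[].
by have := H (0, (0, 0), x); rewrite qmapE => -[].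
Qed.

Section Morphism.
Variables (G G' : gradedRep F) (f : 'Hom(G v1, G' v1) * 'Hom(G v2, G' v2)).
Local Notation X := (gforget G).
Local Notation X' := (gforget G').
Hypothesis fM : @Qmorphism F X X' f.

Lemma qm_al x : f.1 (Qact X alpha x) = Qact X' alpha (f.1 x).
Proof. by have /lfunP/(_ x) := fM alpha; rewrite !comp_lfunE. Qed.
Lemma qm_ze x : f.1 (Qact X zeta x) = Qact X' zeta (f.1 x).
Proof. by have /lfunP/(_ x) := fM zeta; rewrite !comp_lfunE. Qed.
Lemma qm_be x : f.2 (Qact X beta x) = Qact X' beta (f.1 x).
Proof. by have /lfunP/(_ x) := fM beta; rewrite !comp_lfunE. Qed.
Lemma qm_ga x : f.2 (Qact X gamma x) = Qact X' gamma (f.2 x).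
Proof. by have /lfunP/(_ x) := fM gamma; rewrite !comp_lfunE. Qed.
Lemma qm_et x : f.2 (Qact X eta x) = Qact X' eta (f.2 x).
Proof. by have /lfunP/(_ x) := fM eta; rewrite !comp_lfunE. Qed.
Lemma qm_de x : f.1 (Qact X delta x) = Qact X' delta (f.2 x).
Proof. by have /lfunP/(_ x) := fM delta; rewrite !comp_lfunE. Qed.

Lemma qm_w1 x : f.1 (Qu G v1 x + Qturn X v1 x) = Qu G' v1 (f.1 x) + Qturn X' v1 (f.1 x).
Proof.
rewrite !(add_lfunE, scale_lfunE, id_lfunE, comp_lfunE) !(lfunD, lfunZ) !(qm_al, qm_ze, qm_de, qm_be).
by [].
Qed.
Lemma qm_w2 x : f.2 (Qu G v2 x + Qturn X v2 x) = Qu G' v2 (f.2 x) + Qturn X' v2 (f.2 x).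
Proof.
rewrite !(add_lfunE, scale_lfunE, id_lfunE, comp_lfunE) !(lfunD, lfunZ) !(qm_ga, qm_et, qm_de, qm_be).
by [].
Qed.

Lemma natural_QO1 : @omaps_natural F (QA G) (G v1) (G v2) (QD G) (QA G') (G' v1) (G' v2) (QD G')
  f.1 f.2 (qpair f) (QO1 G) (QO1 G').
Proof.
split=> x; rewrite ?oB_QO1 ?oC_QO1 ?uB_QO1 ?uC_QO1 qpairE ?[_.1]/= ?[_.2]/=.
- by [].
- by rewrite lfunD lfunN qm_be qm_ga.
- by rewrite qm_al qm_be.
- by rewrite lfun0.
Qed.

Lemma natural_QO2 : @omaps_natural F (QA G) (G v1) (G v2) (QD G) (QA G') (G' v1) (G' v2) (QD G')
  f.1 f.2 (qpair f) (QO2 G) (QO2 G').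
Proof.
split=> x; rewrite ?oB_QO2 ?oC_QO2 ?uB_QO2 ?uC_QO2 qpairE ?[_.1]/= ?[_.2]/=.
- by rewrite lfunD lfunN qm_ze qm_de.
- exact: qm_w2.
- by rewrite qm_w1 lfun0.
- by rewrite qm_de qm_et.
Qed.

Lemma qmap_morphism : @even_map F (G v1) (G' v1) f.1 -> @even_map F (G v2) (G' v2) f.2 ->
  @act_morphism F _ (Qjor G) (Qjor G') (qmap f).
Proof.
move=> e1 e2; split=> [q [[b [d1 d2]] c]|a [[b d] c]].
  rewrite qmapE !prod_spaceE => /andP[/andP[bq /andP[d1q d2q]] cq].
  apply/andP; split; last exact: e2.
  by apply/andP; split; [exact: e1 | apply/andP; split; [exact: e1 | exact: e2]].
rewrite [act (Qjor G) _ _](jactE F2) [act (Qjor G') _ _](jactE F2).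
have E (b0 : G v1) d0 (c0 : G v2) : qmap f (b0, d0, c0) = (f.1 b0, qpair f d0, f.2 c0).
  by rewrite qmapE qpairE.
rewrite (E b d c) -(jop_natural a b d c (omaps_natural_comb l1 r1 natural_QO1 natural_QO2)
  (omaps_natural_comb l2 r2 natural_QO1 natural_QO2)).
by move: (jop _ _ a (b, d, c)) => [[b' d'] c']; exact: E.
Qed.
End Morphism.

Section Full.
Variables (G G' : gradedRep F).
Local Notation X := (gforget G).
Local Notation X' := (gforget G').
Hypothesis rel : Qrelations X.
Hypothesis nil : Qnilpotent X.
Variable h : 'Hom((G v1 * (G v1 * G v2) * G v2)%type, (G' v1 * (G' v1 * G' v2) * G' v2)%type).
Local Notation R1 := (omaps_comb l1 r1 (QO1 G) (QO2 G)).
Local Notation R2 := (omaps_comb l2 r2 (QO1 G) (QO2 G)).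
Local Notation R1' := (omaps_comb l1 r1 (QO1 G') (QO2 G')).
Local Notation R2' := (omaps_comb l2 r2 (QO1 G') (QO2 G')).
Hypothesis hJ : forall a m, h (jop R1 R2 a m) = jop R1' R2' a (h m).
Local Notation M := (G v1 * (G v1 * G v2) * G v2)%type.

Definition hB : 'Hom(G v1, G' v1) :=
  locked (row_lfun (row_lfun \1 0) 0 \o h \o col_lfun (col_lfun \1 0) 0)%VF.
Definition hC : 'Hom(G v2, G' v2) := locked (row_lfun 0 \1 \o h \o col_lfun 0 \1)%VF.
Definition hD : 'Hom((G v1 * G v2)%type, (G' v1 * G' v2)%type) :=
  locked (row_lfun (row_lfun 0 \1) 0 \o h \o col_lfun (col_lfun 0 \1) 0)%VF.

Lemma hBE b : hB b = (h (b, 0, 0)).1.1.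
Proof. by rewrite /hB -lock !comp_lfunE !col_lfunE !row_lfunE !id_lfunE !zero_lfunE !addr0. Qed.
Lemma hCE c : hC c = (h (0, 0, c)).2.
Proof. by rewrite /hC -lock !comp_lfunE !col_lfunE !row_lfunE !id_lfunE !zero_lfunE !add0r. Qed.
Lemma hDE d : hD d = (h (0, d, 0)).1.2.
Proof. by rewrite /hD -lock !comp_lfunE !col_lfunE !row_lfunE !id_lfunE !zero_lfunE !addr0 !add0r. Qed.

Definition unit2 i j : 'M[F]_2 := delta_mx i j.

Lemma jop00 (H : gradedRep F) O O' (b : H v1) (d : (H v1 * H v2)%type) (c : H v2) :
  @jop F (QA H) (H v1) (H v2) (QD H) O O' (unit2 0 0) (b, d, c) = (b, 2^-1 *: d, 0).
Proof. by rewrite /jop !mxE /= !scale0r !scale1r !subrr !scaler0 !addr0 scale1r. Qed.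
Lemma jop11 (H : gradedRep F) O O' (b : H v1) (d : (H v1 * H v2)%type) (c : H v2) :
  @jop F (QA H) (H v1) (H v2) (QD H) O O' (unit2 1 1) (b, d, c) = (0, 2^-1 *: d, c).
Proof. by rewrite /jop !mxE /= add0r !scale0r !scale1r !subrr !scaler0 !addr0. Qed.
Lemma jop01 (H : gradedRep F) O O' (b : H v1) (d : (H v1 * H v2)%type) (c : H v2) :
  @jop F (QA H) (H v1) (H v2) (QD H) O O' (unit2 0 1) (b, d, c) =
  (2^-1 *: oB O d, 2^-1 *: (uC O c - uB O b), - (2^-1 *: oC O d)).
Proof. by rewrite /jop !mxE /= !addr0 !scale0r !scale1r !addr0 !add0r !subr0 scalerN. Qed.
Lemma jop10 (H : gradedRep F) O O' (b : H v1) (d : (H v1 * H v2)%type) (c : H v2) :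
  @jop F (QA H) (H v1) (H v2) (QD H) O O' (unit2 1 0) (b, d, c) =
  (- (2^-1 *: oB O' d), 2^-1 *: (uB O' b - uC O' c), 2^-1 *: oC O' d).
Proof. by rewrite /jop !mxE /= !addr0 !scale0r !scale1r !add0r !subr0 scalerN. Qed.

Lemma half_fix (V : vectType F) (v : V) : 2^-1 *: v = v -> v = 0.
Proof.
move=> H; have : v = 2 *: v by rewrite -{2}H scalerA mulfV ?scale1r.
by move=> E; have := subrr v; rewrite {1}E; have -> : 2 *: v - v = v by vect_ring.
Qed.

(** A bimodule map commutes with the idempotent E11, which acts by 1, 1/2 and 0 on B, D and C; hence
    it respects the Peirce decomposition. *)
Lemma h_B b : h (b, 0, 0) = (hB b, 0, 0).
Proof.
have := hJ (unit2 0 0) (b, 0, 0); rewrite jop00 scaler0 hBE.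
move: (h (b, 0, 0)) => [[b' d'] c']; rewrite jop00 => -[/esym/half_fix d0 c0].
by rewrite -c0 d0.
Qed.
Lemma half_inj (V : vectType F) (u v : V) : 2^-1 *: u = 2^-1 *: v -> u = v.
Proof. by apply: scalerI; rewrite invr_eq0. Qed.

Lemma h_C c : h (0, 0, c) = (0, 0, hC c).
Proof.
have := hJ (unit2 1 1) (0, 0, c); rewrite jop11 scaler0 hCE.
move: (h (0, 0, c)) => [[b' d'] c']; rewrite jop11 => -[b0 /esym/half_fix d0].
by rewrite b0 d0.
Qed.
Lemma h_D d : h (0, d, 0) = (0, hD d, 0).
Proof.
have := hJ (unit2 0 0) (0, d, 0); rewrite jop00 hDE.
have -> : ((0, 2^-1 *: d, 0) : M) = 2^-1 *: ((0, d, 0) : M).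
  by do 2?apply: prod_eq; rewrite //= scaler0.
rewrite lfunZ; move: (h (0, d, 0)) => [[b' d'] c']; rewrite jop00 => -[/half_fix b0 c0].
have c0' : c' = 0 by apply: half_inj; rewrite c0 scaler0.
by rewrite b0 c0'.
Qed.

Lemma h_all b d c : h (b, d, c) = (hB b, hD d, hC c).
Proof.
have -> : ((b, d, c) : M) = (b, 0, 0) + (0, d, 0) + (0, 0, c).
  by do 2?apply: prod_eq; rewrite /= ?addr0 ?add0r.
by rewrite !lfunD h_B h_C h_D; do 2?apply: prod_eq; rewrite /= ?addr0 ?add0r.
Qed.

(** The matrix unit at (0, 1) acts through the first family alone, and its components in B, D and C
    separate the four maps; [full_R2] uses the unit at (1, 0). *)
Lemma full_R1 : @omaps_natural F (QA G) (G v1) (G v2) (QD G) (QA G') (G' v1) (G' v2) (QD G') hB hC hD R1 R1'.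
Proof.
have E b d c : h (jop R1 R2 (unit2 0 1) (b, d, c)) = jop R1' R2' (unit2 0 1) (hB b, hD d, hC c).
  by rewrite hJ h_all.
split=> x.
- have := E 0 x 0; rewrite jop01 h_all jop01 => -[H _ _].
  by move: H; rewrite lfunZ; exact: half_inj.
- have := E 0 x 0; rewrite jop01 h_all jop01 => -[_ _ H].
  by move: H; rewrite lfunN lfunZ => /oppr_inj; exact: half_inj.
- have := E x 0 0; rewrite jop01 h_all jop01 => -[_ H _].
  by move: H; rewrite lfunZ => /half_inj; rewrite !lfun0 !sub0r lfunN => /oppr_inj.
- have := E 0 0 x; rewrite jop01 h_all jop01 => -[_ H _].
  by move: H; rewrite lfunZ => /half_inj; rewrite !lfun0 !subr0.
Qed.

Lemma full_R2 : @omaps_natural F (QA G) (G v1) (G v2) (QD G) (QA G') (G' v1) (G' v2) (QD G') hB hC hD R2 R2'.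
Proof.
have E b d c : h (jop R1 R2 (unit2 1 0) (b, d, c)) = jop R1' R2' (unit2 1 0) (hB b, hD d, hC c).
  by rewrite hJ h_all.
split=> x.
- have := E 0 x 0; rewrite jop10 h_all jop10 => -[H _ _].
  by move: H; rewrite lfunN lfunZ => /oppr_inj; exact: half_inj.
- have := E 0 x 0; rewrite jop10 h_all jop10 => -[_ _ H].
  by move: H; rewrite lfunZ; exact: half_inj.
- have := E x 0 0; rewrite jop10 h_all jop10 => -[_ H _].
  by move: H; rewrite lfunZ => /half_inj; rewrite !lfun0 !subr0.
- have := E 0 0 x; rewrite jop10 h_all jop10 => -[_ H _].
  by move: H; rewrite lfunZ => /half_inj; rewrite !lfun0 !sub0r lfunN => /oppr_inj.
Qed.

(** The rotation has determinant 1, so its inverse has entries r2, -r1, -l2, l1. *)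
Lemma unrotate_lfun (V W : vectType F) (f1 f2 : 'Hom(V, W)) x :
  f1 x = (r2 *: (l1 *: f1 + r1 *: f2) + (- r1) *: (l2 *: f1 + r2 *: f2)) x /\
  f2 x = ((- l2) *: (l1 *: f1 + r1 *: f2) + l1 *: (l2 *: f1 + r2 *: f2)) x.
Proof.
rewrite !(add_lfunE, scale_lfunE); move: (f1 x) (f2 x) => u v; split.
  transitivity ((l1 * r2 - r1 * l2) *: u); first by rewrite det1 scale1r.
  by vect_ring.
transitivity ((l1 * r2 - r1 * l2) *: v); first by rewrite det1 scale1r.
by vect_ring.
Qed.

Lemma full_QO : @omaps_natural F (QA G) (G v1) (G v2) (QD G) (QA G') (G' v1) (G' v2) (QD G') hB hC hD (QO1 G) (QO1 G') /\
  @omaps_natural F (QA G) (G v1) (G v2) (QD G) (QA G') (G' v1) (G' v2) (QD G') hB hC hD (QO2 G) (QO2 G').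
Proof.
have [n1 n2 n3 n4] := omaps_natural_comb r2 (- r1) full_R1 full_R2.
have [m1 m2 m3 m4] := omaps_natural_comb (- l2) l1 full_R1 full_R2.
split; split=> x.
- rewrite (unrotate_lfun (oB (QO1 G)) (oB (QO2 G)) x).1 (unrotate_lfun (oB (QO1 G')) (oB (QO2 G')) (hD x)).1; exact: n1.
- rewrite (unrotate_lfun (oC (QO1 G)) (oC (QO2 G)) x).1 (unrotate_lfun (oC (QO1 G')) (oC (QO2 G')) (hD x)).1; exact: n2.
- rewrite (unrotate_lfun (uB (QO1 G)) (uB (QO2 G)) x).1 (unrotate_lfun (uB (QO1 G')) (uB (QO2 G')) (hB x)).1; exact: n3.
- rewrite (unrotate_lfun (uC (QO1 G)) (uC (QO2 G)) x).1 (unrotate_lfun (uC (QO1 G')) (uC (QO2 G')) (hC x)).1; exact: n4.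
- rewrite (unrotate_lfun (oB (QO1 G)) (oB (QO2 G)) x).2 (unrotate_lfun (oB (QO1 G')) (oB (QO2 G')) (hD x)).2; exact: m1.
- rewrite (unrotate_lfun (oC (QO1 G)) (oC (QO2 G)) x).2 (unrotate_lfun (oC (QO1 G')) (oC (QO2 G')) (hD x)).2; exact: m2.
- rewrite (unrotate_lfun (uB (QO1 G)) (uB (QO2 G)) x).2 (unrotate_lfun (uB (QO1 G')) (uB (QO2 G')) (hB x)).2; exact: m3.
- rewrite (unrotate_lfun (uC (QO1 G)) (uC (QO2 G)) x).2 (unrotate_lfun (uC (QO1 G')) (uC (QO2 G')) (hC x)).2; exact: m4.
Qed.

Lemma w_surj (x : X v1) : exists y, Qu G v1 y + Qturn X v1 y = x.
Proof.
have [k [_ K]] := nilp_unit F2 (wshift_nilp rel nil v1); exists (k x).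
by rewrite -[RHS](K x) !add_lfunE opp_lfunE scale_lfunE id_lfunE; vect_ring.
Qed.

(** The component on D is determined by those on B and C: the second summand of D is the image of
    [uC] in the first family, the first that of [uB] in the second family, because w is onto. *)
Lemma hD_pair d : hD d = (hB d.1, hC d.2).
Proof.
have [[oB1 _ _ uC1] [_ _ uB2 _]] := full_QO.
have -> : d = (d.1, 0) + (0, d.2) by apply: prod_eq; rewrite /= ?addr0 ?add0r.
have [y ey] := w_surj d.1.
have H1 : hD (0, d.2) = (0, hC d.2) by have := uC1 d.2; rewrite !uC_QO1.
have := uB2 y; rewrite !uB_QO2 ey => H2.
have E : (hD (d.1, 0)).1 = hB d.1 by have := oB1 (d.1, 0); rewrite !oB_QO1 => <-.
rewrite lfunD H1; apply: prod_eq; rewrite [RHS]/= [LHS]/=.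
  by rewrite E !addr0.
by rewrite H2 /= !add0r.
Qed.

Lemma full_morphism : @Qmorphism F X X' (hB, hC).
Proof.
have [[oB1 oC1 uB1 uC1] [oB2 oC2 uB2 uC2]] := full_QO.
case; apply/lfunP=> x; rewrite !comp_lfunE.
- by have := uB1 x; rewrite !uB_QO1 hD_pair => -[].
- by have := oB2 (x, 0); rewrite hD_pair !oB_QO2 /= !lfun0 !subr0.
- by have := uB1 x; rewrite !uB_QO1 hD_pair => -[].
- by have := oC1 (0, x); rewrite hD_pair !oC_QO1 /= !lfun0 !oppr0 !add0r.
- by have := uC2 x; rewrite !uC_QO2 hD_pair => -[].
- by have := uC2 x; rewrite !uC_QO2 hD_pair => -[].
Qed.

Lemma full_qmap : h = qmap (hB, hC).
Proof. by apply/lfunP=> -[[b d] c]; rewrite h_all hD_pair qmapE. Qed.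
End Full.
End QuiverMaps.

Section FunctorOf.
Variables (F : fieldType) (A B : lincat F) (fo : A -> B).
Variable hm : forall X Y, hom A X Y -> hom B (fo X) (fo Y).
Hypothesis hm_linear : forall X Y, linear (@hm X Y).
Hypothesis hm_id : forall X, hm (idm X) = idm (fo X).
Hypothesis hm_cmp : forall X Y Z (h : hom A Y Z) (f : hom A X Y), hm (cmp h f) = cmp (hm h) (hm f).

Definition functor_of : functor A B :=
  @Functor F A B fo (fun X Y => HB.pack (@hm X Y)
    (GRing.isLinear.Build F (hom A X Y) (hom B (fo X) (fo Y)) *:%R (@hm X Y) (@hm_linear X Y)))
    hm_id hm_cmp.
End FunctorOf.

Section ActHom.
Variables (F : fieldType) (L : vectType F) (P : act_space L -> Prop).
Local Notation C := (full (A := act_cat L) P).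

Definition Aob (X : C) : act_space L := sval X.

Definition Aval (X Y : C) (f : hom C X Y) : 'Hom(Aob X, Aob Y) :=
  @lin_val F _ (act_hom (Aob X) (Aob Y)) f.

Definition Amk (X Y : C) (f : 'Hom(Aob X, Aob Y)) (fP : act_morphism f) : hom C X Y :=
  @lin_in F _ (act_hom (Aob X) (Aob Y)) f fP.

Lemma Aval_mk X Y f (fP : act_morphism f) : Aval (@Amk X Y f fP) = f.
Proof. by []. Qed.

Lemma Aval_inj X Y : injective (@Aval X Y).
Proof. exact: (@val_inj _ _ (lin_sub (act_hom (Aob X) (Aob Y)))). Qed.

Lemma Aval_linear X Y : linear (@Aval X Y).
Proof.
move=> a u v.
exact_no_check (@lin_val_linear F _ (act_hom (Aob X) (Aob Y)) a u v).
Qed.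

Lemma Aval0 X Y : @Aval X Y 0 = 0.
Proof. exact: (lin_val0 (act_hom (Aob X) (Aob Y))). Qed.

Lemma AvalD X Y f f' : @Aval X Y (f + f') = Aval f + Aval f'.
Proof. by have := Aval_linear 1 f f'; rewrite !scale1r. Qed.

Lemma AvalP X Y f : act_morphism (@Aval X Y f).
Proof. exact: (@lin_subP F _ (act_hom (Aob X) (Aob Y)) f). Qed.

Lemma Aval_id X : Aval (idm X) = \1%VF.
Proof. by []. Qed.

Lemma Aval_cmp X Y Z (h : hom C Y Z) (f : hom C X Y) : Aval (cmp h f) = (Aval h \o Aval f)%VF.
Proof. by []. Qed.
End ActHom.

(** * Separation of the two parities *)

Section PureRep.
Variables (F : fieldType) (r : bool).

(** Both vertices are put in parity [r], which labels the block. *)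
Definition pure_rep (X : Qrep F) : gradedRep F :=
  @GradedRep F (fun i => pure_space r (X i)) (fun a => Qact X a)
   (fun a => @concentrated_even F r (pure_space r (X (Qsrc a))) (pure_space r (X (Qtgt a))) (Qact X a)
     (pure_concentrated r _) (pure_concentrated r _)).

Lemma pure_rep_rel X : Qrelations X -> Qrelations (gforget (pure_rep X)).
Proof. exact. Qed.

Lemma pure_rep_path (X : Qrep F) i j (w : Qpath i j) u :
  Qpath_act (gforget (pure_rep X)) w u = Qpath_act X w u :> X j.
Proof.
elim: w u => [|a w IH] u; first by rewrite /= !id_lfunE.
rewrite [Qpath_act (gforget _) _]/= [Qpath_act X _]/= !comp_lfunE.
by congr (Qact X a _); exact: IH.
Qed.

Lemma pure_rep_nil X : Qnilpotent X -> Qnilpotent (gforget (pure_rep X)).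
Proof.
move=> [n H]; exists n => i j q le; apply/lfunP=> u; rewrite zero_lfunE.
by apply: (etrans (pure_rep_path q u)); rewrite H // zero_lfunE.
Qed.

Lemma pure_other (V : vectType F) s v : v \in part (pure_space r V) s -> s != r -> v = 0.
Proof. by rewrite /= /pure_part => + /negbTE sr; rewrite sr memv0 => /eqP. Qed.
End PureRep.

Section PartRep.
Variables (F : fieldType) (G : gradedRep F) (q : bool).
Local Notation X := (gforget G).

Definition part_rep : Qrep F := @QRep F (fun i => subvs_of (part (G i) q))
  (fun a => restrict (Qact X a) (part (G (Qsrc a)) q) (part (G (Qtgt a)) q)).

Definition pval i (u : part_rep i) : G i := vsval (u : subvs_of (part (G i) q)).

Lemma pval_inj i : injective (@pval i).
Proof. exact: subvs_inj. Qed.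

Lemma pval_part i u : @pval i u \in part (G i) q.
Proof. exact: subvsP. Qed.

Lemma pval0 i : @pval i 0 = 0. Proof. by []. Qed.

Lemma pvalE a u : @pval (Qtgt a) (Qact part_rep a u) = Qact X a (@pval (Qsrc a) u).
Proof. by apply: restrictE => v; exact: (gact_even (a := a)). Qed.

Hypothesis rel : Qrelations X.
Hypothesis nil : Qnilpotent X.

Lemma part_rep_rel : Qrelations part_rep.
Proof.
split; split; apply/lfunP=> u; rewrite !comp_lfunE; apply: pval_inj.
- by rewrite (pvalE (a := beta)) (pvalE (a := alpha)) (pvalE (a := gamma)) (pvalE (a := beta)) (be_al rel).
- by rewrite (pvalE (a := beta)) (pvalE (a := zeta)) (pvalE (a := eta)) (pvalE (a := beta)) (be_ze rel).
- by rewrite (pvalE (a := zeta)) (pvalE (a := delta)) (pvalE (a := delta)) (pvalE (a := eta)) (ze_de rel).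
- by rewrite (pvalE (a := alpha)) (pvalE (a := delta)) (pvalE (a := delta)) (pvalE (a := gamma)) (al_de rel).
- by rewrite (pvalE (a := alpha)) (pvalE (a := zeta)) (pvalE (a := zeta)) (pvalE (a := alpha)) (al_ze rel).
- by rewrite (pvalE (a := gamma)) (pvalE (a := eta)) (pvalE (a := eta)) (pvalE (a := gamma)) (ga_et rel).
Qed.

Lemma part_rep_path i j (w : Qpath i j) u :
  pval (Qpath_act part_rep w u) = Qpath_act X w (pval u).
Proof.
elim: w u => [|a w IH] u; first by rewrite /= !id_lfunE.
by rewrite [Qpath_act part_rep _]/= [Qpath_act X _]/= !comp_lfunE (pvalE (a := a)) IH.
Qed.

Lemma part_rep_nil : Qnilpotent part_rep.
Proof.
case: nil => n H; exists n => i j w le; apply/lfunP=> u; apply: pval_inj.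
by rewrite part_rep_path H // !zero_lfunE.
Qed.

Definition pincl i : 'Hom(part_rep i, G i) := locked (linfun (@vsval F (G i) (part (G i) q))).
Definition pproj i : 'Hom(G i, part_rep i) :=
  locked (linfun (vsproj (part (G i) q)) \o daddv_pi (part (G i) q) (part (G i) (~~ q)))%VF.

Lemma pinclE i u : pincl i u = pval u.
Proof. by rewrite /pincl -lock; exact: lfunE. Qed.

Lemma pval_proj i v : pval (pproj i v) = scomp q v.
Proof.
rewrite /pproj -lock /pval comp_lfunE lfunE; apply: vsprojK; exact: scomp_part.
Qed.

Local Notation P := (pure_rep q part_rep).

Lemma pincl_even i : @even_map F (P i) (G i) (pincl i).
Proof.
move=> s u us; rewrite pinclE; have [->|sq] := eqVneq s q; first exact: pval_part.
by rewrite (pure_other us sq) pval0 mem0v.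
Qed.

Lemma pproj_even i : @even_map F (G i) (P i) (pproj i).
Proof.
move=> s v vs; have [->|sq] := eqVneq s q; first exact: pure_self.
have -> : pproj i v = 0; last exact: mem0v.
apply: pval_inj; rewrite pval_proj pval0 scomp_other //.
by suff <- : s = ~~ q by []; move: sq; case: (s); case: (q).
Qed.

Lemma pincl_morphism : @Qmorphism F (gforget P) X (pincl v1, pincl v2).
Proof.
have E i w : @Qat F (gforget P) X (pincl v1, pincl v2) i w = @pval i w by case: i w => w; exact: pinclE.
by move=> a; apply/lfunP=> u; rewrite !comp_lfunE !E; exact: pvalE.
Qed.

Lemma pproj_morphism : @Qmorphism F X (gforget P) (pproj v1, pproj v2).
Proof.
have E i w : @pval i (@Qat F X (gforget P) (pproj v1, pproj v2) i w) = scomp q w.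
  by case: i w => w; exact: pval_proj.
move=> a; apply/lfunP=> u; rewrite !comp_lfunE; apply: pval_inj.
rewrite E; apply: esym; apply: (etrans (pvalE _)); rewrite E.
by rewrite (even_map_scomp _ _ (@gact_even F G a)).
Qed.
End PartRep.

Section QuiverBimodule.
Variables (F : closedFieldType) (g : lieSuper F) (p : 'Hom(sl22 F, g)).
Variables (gh : lieSuper F) (pi : 'Hom(gh, g)).
Hypothesis psl_g : is_psl22 p.
Hypothesis uce : universal_central_extension pi.
Hypothesis char0 : forall n, n.+1%:R != 0 :> F.
Variable chi : {scalar subvs_of (center gh)}.
Variables l1 r1 l2 r2 : F.
Hypothesis det1 : l1 * r2 - r1 * l2 = 1.
Hypothesis chi_one : chiv chi (z_one p pi) = 2 * (l1 * r2 + r1 * l2).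
Hypothesis chi_pos : chiv chi (z_pos p pi) = 2 * (l1 * r1).
Hypothesis chi_neg : chiv chi (z_neg p pi) = 2 * (l2 * r2).

Lemma Qjor_chi G : Qrelations (gforget G) -> Qnilpotent (gforget G) ->
  jordan1_chi p pi chi (Qjor (char0 1) l1 r1 l2 r2 G).
Proof.
move=> rel nil; have R := Qmodel (char0 1) rel nil.
have [f [f_lie fE]] := uce_to_ext psl_g uce.
have nn l r l' r' k := rot_z_nil (char0 1) R l r l' r' k (Qone_nil rel nil) (Qz1_nil nil) (Qz2_nil rel nil).
apply: (jordan_space_chi char0 (model_rotate (char0 1) R det1) psl_g uce f_lie fE).
- by rewrite chi_one; exact: nn.
- by have := nn l1 r1 l1 r1 1; rewrite mul1r [r1 * l1]mulrC -mulr2n -mulr_natl -chi_pos.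
- by have := nn l2 r2 l2 r2 1; rewrite mul1r [r2 * l2]mulrC -mulr2n -mulr_natl -chi_neg.
Qed.

Let F2 := char0 1.
Local Notation J := (jordan_mod1_chi p pi chi).
Local Notation Qjor := (Qjor F2 l1 r1 l2 r2).

Definition Jg (G : gradedRep F) (rel : Qrelations (gforget G)) (nil : Qnilpotent (gforget G)) : J :=
  exist _ (Qjor G) (Qjor_chi rel nil).

Definition Tob (r : bool) (X : Qnil_cat F) : J :=
  Jg (pure_rep_rel r (proj2_sig X).1) (pure_rep_nil r (proj2_sig X).2).

Lemma Tmap_morphism r (X Y : Qnil_cat F) (f : hom _ X Y) :
  @act_morphism F _ (Aob (Tob r X)) (Aob (Tob r Y))
    (@qmap F (pure_rep r (sval X)) (pure_rep r (sval Y)) (Qval f)).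
Proof.
apply: (@qmap_morphism F F2 l1 r1 l2 r2 (pure_rep r (sval X)) (pure_rep r (sval Y)) (Qval f)).
- exact: (QvalP f).
- exact: (concentrated_even _ (pure_concentrated r _) (pure_concentrated r _)).
- exact: (concentrated_even _ (pure_concentrated r _) (pure_concentrated r _)).
Qed.

Definition Tmap r X Y (f : hom (Qnil_cat F) X Y) : hom J (Tob r X) (Tob r Y) :=
  Amk (Tmap_morphism r f).

Lemma TmapE r X Y (f : hom (Qnil_cat F) X Y) m :
  Aval (Tmap r f) m = @qmap F (pure_rep r (sval X)) (pure_rep r (sval Y)) (Qval f) m.
Proof. by []. Qed.

Lemma Tmap_linear r X Y : linear (@Tmap r X Y).
Proof.
move=> a f f'; apply: Aval_inj; rewrite Aval_linear !Aval_mk Qval_linear; exact: qmapP.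
Qed.

Lemma Tmap_id r X : Tmap r (idm X) = idm (Tob r X).
Proof. by apply: Aval_inj; rewrite Aval_mk Aval_id Qval_id; exact: qmap_id. Qed.

Lemma Tmap_cmp r X Y Z (h : hom (Qnil_cat F) Y Z) (f : hom _ X Y) :
  Tmap r (cmp h f) = cmp (Tmap r h) (Tmap r f).
Proof.
apply: Aval_inj; apply/lfunP=> m; rewrite (Aval_cmp (Tmap r h) (Tmap r f)) comp_lfunE !TmapE.
by case: m => -[b [d1 d2]] c; rewrite !qmapE Qval_cmp /= !comp_lfunE.
Qed.

Definition Tfun (r : bool) : functor (Qnil_cat F) J :=
  functor_of (@Tmap_linear r) (@Tmap_id r) (@Tmap_cmp r).

Lemma Jhom_jop (G G' : gradedRep F) rel nil rel' nil' (f : hom J (@Jg G rel nil) (@Jg G' rel' nil')) a m :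
  Aval f (jop (omaps_comb l1 r1 (QO1 G) (QO2 G)) (omaps_comb l2 r2 (QO1 G) (QO2 G)) a m) =
  jop (omaps_comb l1 r1 (QO1 G') (QO2 G')) (omaps_comb l2 r2 (QO1 G') (QO2 G')) a (Aval f m).
Proof.
have [_ H] := AvalP f; have := H a m.
by rewrite [act (Aob (Jg rel nil)) _ _](jactE F2) [act (Aob (Jg rel' nil')) _ _](jactE F2).
Qed.

Lemma Tfun_faithful r : functor_faithful (Tfun r).
Proof.
move=> X Y f f0; have E : Tmap r f = 0 by exact: f0.
apply: Qval_inj; rewrite Qval0; apply: (@qmap_inj0 F (pure_rep r (sval X)) (pure_rep r (sval Y))).
move=> m; have /lfunP/(_ m) := congr1 (@Aval F _ _ (Tob r X) (Tob r Y)) E.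
by rewrite Aval0 zero_lfunE.
Qed.

Lemma Tfun_full r : functor_full (Tfun r).
Proof.
move=> X Y h0; pose h : hom J (Tob r X) (Tob r Y) := h0.
have rel := pure_rep_rel r (proj2_sig X).1; have nil := pure_rep_nil r (proj2_sig X).2.
have H a m := @Jhom_jop (pure_rep r (sval X)) (pure_rep r (sval Y)) (pure_rep_rel r (proj2_sig X).1)
  (pure_rep_nil r (proj2_sig X).2) (pure_rep_rel r (proj2_sig Y).1) (pure_rep_nil r (proj2_sig Y).2) h a m.
have fM := full_morphism F2 det1 rel nil H; have fE := full_qmap F2 det1 rel nil H.
exists (@Qmk F X Y _ fM); apply: (@Aval_inj F _ _ (Tob r X) (Tob r Y) (Tmap r (@Qmk F X Y _ fM)) h).
exact: esym fE.
Qed.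

(** The map is determined by its components on B and C, which are even maps between spaces of
    opposite parity. *)
Lemma Tfun_orthogonal r s X Y (h : hom J (Tob r X) (Tob s Y)) : r != s -> h = 0.
Proof.
move=> rs; apply: Aval_inj; rewrite Aval0.
have rel := pure_rep_rel r (proj2_sig X).1; have nil := pure_rep_nil r (proj2_sig X).2.
have H a m := @Jhom_jop (pure_rep r (sval X)) (pure_rep s (sval Y)) (pure_rep_rel r (proj2_sig X).1)
  (pure_rep_nil r (proj2_sig X).2) (pure_rep_rel s (proj2_sig Y).1) (pure_rep_nil s (proj2_sig Y).2) h a m.
have [he _] := AvalP h.
apply: (etrans (full_qmap F2 det1 rel nil H)).
have z i q : (0 : pure_rep r (sval X) i) \in part (pure_rep r (sval X) i) q by exact: mem0v.
have b0 b : hB (Aval h) b = 0.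
  rewrite hBE; apply: (@pure_other F s _ r) => //.
  have : Aval h (b, 0, 0) \in part (Aob (Tob s Y)) r.
    by apply: he; rewrite !prod_spaceE; apply/andP; split; [apply/andP; split|];
      first [exact: pure_self | exact: z | exact: mem0v | apply/andP; split; exact: z].
  by rewrite !prod_spaceE => /andP[/andP[]].
have c0 c : hC (Aval h) c = 0.
  rewrite hCE; apply: (@pure_other F s _ r) => //.
  have : Aval h (0, 0, c) \in part (Aob (Tob s Y)) r.
    by apply: he; rewrite !prod_spaceE; apply/andP; split; [apply/andP; split|];
      first [exact: pure_self | exact: z | exact: mem0v | apply/andP; split; exact: z].
  by rewrite !prod_spaceE => /andP[].
by apply/lfunP=> -[[b [d1 d2]] c]; rewrite qmapE /= !b0 !c0 zero_lfunE.
Qed.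

(** The arrows are even, so the components of each parity at the two vertices form a
    subrepresentation, and the two subrepresentations add up to G. *)
Lemma Jg_splits (G : gradedRep F) rel nil :
  exists Y : 'I_2 -> Qnil_cat F, direct_sum (fun i => Tob (i == 1) (Y i)) (@Jg G rel nil).
Proof.
pose Y q : Qnil_cat F := exist _ (part_rep G q) (conj (part_rep_rel q rel) (part_rep_nil q nil)).
have iM q : @act_morphism F _ (Aob (Tob q (Y q))) (Aob (Jg rel nil))
    (@qmap F (pure_rep q (part_rep G q)) G (pincl G q v1, pincl G q v2)).
  by apply: (@qmap_morphism F F2 l1 r1 l2 r2 (pure_rep q (part_rep G q)) G);
    [exact: pincl_morphism | exact: pincl_even | exact: pincl_even].
have pM q : @act_morphism F _ (Aob (Jg rel nil)) (Aob (Tob q (Y q)))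
    (@qmap F G (pure_rep q (part_rep G q)) (pproj G q v1, pproj G q v2)).
  by apply: (@qmap_morphism F F2 l1 r1 l2 r2 G (pure_rep q (part_rep G q)));
    [exact: pproj_morphism | exact: pproj_even | exact: pproj_even].
have pi1 q i u : pproj G q i (pincl G q i u) = u.
  by apply: pval_inj; rewrite pval_proj pinclE scomp_id // pval_part.
have pi0 q s i u : q != s -> pproj G s i (pincl G q i u) = 0.
  move=> qs; apply: pval_inj; rewrite pval_proj pinclE pval0 scomp_other //.
  by suff <- : q = ~~ s by [exact: pval_part]; move: qs; case: (q); case: (s).
have ip i v : pincl G false i (pproj G false i v) + pincl G true i (pproj G true i v) = v.
  by rewrite !pinclE !pval_proj scomp_sum.
pose inj q : hom J (Tob q (Y q)) (Jg rel nil) := @Amk F _ _ (Tob q (Y q)) (Jg rel nil) _ (iM q).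
pose prj q : hom J (Jg rel nil) (Tob q (Y q)) := @Amk F _ _ (Jg rel nil) (Tob q (Y q)) _ (pM q).
have injE q m : Aval (inj q) m = @qmap F (pure_rep q (part_rep G q)) G (pincl G q v1, pincl G q v2) m by [].
have prjE q m : Aval (prj q) m = @qmap F G (pure_rep q (part_rep G q)) (pproj G q v1, pproj G q v2) m by [].
have E1 q : cmp (prj q) (inj q) = idm (Tob q (Y q)).
  apply: Aval_inj; apply: (etrans (Aval_cmp (prj q) (inj q))); rewrite Aval_id.
  apply/lfunP=> m; rewrite comp_lfunE id_lfunE injE prjE.
  by case: m => -[b [d1 d2]] c; rewrite !qmapE /= !pi1.
have E0 q s : q != s -> cmp (prj s) (inj q) = 0.
  move=> qs; apply: Aval_inj; apply: (etrans (Aval_cmp (prj s) (inj q))); rewrite Aval0.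
  apply/lfunP=> m; rewrite comp_lfunE zero_lfunE injE prjE.
  by case: m => -[b [d1 d2]] c; rewrite !qmapE /= !pi0.
have E2 : cmp (inj false) (prj false) + cmp (inj true) (prj true) = idm (Jg rel nil).
  apply: Aval_inj; rewrite AvalD (Aval_cmp (inj false) (prj false)) (Aval_cmp (inj true) (prj true)) Aval_id.
  apply/lfunP=> m; rewrite add_lfunE !comp_lfunE id_lfunE !injE !prjE.
  case: m => -[b [d1 d2]] c; rewrite !qmapE.
  by do 2?apply: prod_eq; rewrite [LHS]/= [RHS]/=; do ?apply: prod_eq; exact: ip.
exists (fun i => Y (i == 1)), (fun i => inj (i == 1)), (fun i => prj (i == 1)).
split=> [i|i j ij|]; first exact: E1.
  apply: E0; move: ij.
  by have [->|->] := ord2E i; have [->|->] := ord2E j; rewrite ?eqxx.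
by rewrite sum2; exact: E2.
Qed.
End QuiverBimodule.

(** * The two blocks *)

Section JordanRestriction.
Variables (F : fieldType) (g : lieSuper F) (p : 'Hom(sl22 F, g)).
Variables (gh : lieSuper F) (pi : 'Hom(gh, g)).
Variables (N N' : act_space gh) (M M' : act_space (M11 F)).
Variables (phi : 'Hom(M, N)) (phi' : 'Hom(M', N')).
Hypothesis Jphi : [/\ even_map phi, lker phi = 0%VS,
    limg phi = passmx.leigenspace (act N (short_h p pi)) 1
  & forall a m, phi (act M a m) = act N (br_lift p pi (M11_emb a) (short_f F)) (phi m)].
Hypothesis Jphi' : [/\ even_map phi', lker phi' = 0%VS,
    limg phi' = passmx.leigenspace (act N' (short_h p pi)) 1
  & forall a m, phi' (act M' a m) = act N' (br_lift p pi (M11_emb a) (short_f F)) (phi' m)].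

(** Jor on morphisms: G commutes with h and thus preserves the eigenspace of 1, on which [phi'] is
    inverted. *)
Lemma Jor_restrict (G : 'Hom(N, N')) : act_morphism G ->
  exists gm : 'Hom(M, M'), act_morphism gm /\ forall m, phi' (gm m) = G (phi m).
Proof.
case: Jphi Jphi' => [pe pk pim pa] [pe' pk' pim' pa'] [Ge Ga].
have inj m m' : phi' m = phi' m' -> m = m'.
  by move=> E; have k0 := introT eqP pk'; rewrite -[m](lker0_lfunK k0) E lker0_lfunK.
have E m : phi' ((phi'^-1 \o G \o phi)%VF m) = G (phi m).
  rewrite 2!comp_lfunE limg_lfunVK // pim' leigen_in -Ga.
  have : phi m \in limg phi by rewrite memv_img // memvf.
  by rewrite pim leigen_in => /eqP->; rewrite lfunZ.
exists (phi'^-1 \o G \o phi)%VF; split=> //; split=> [q v vq|a m]; last first.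
  by apply: inj; rewrite E pa Ga -E pa'.
rewrite -[X in X \in _](@scomp_id F M' q); last first.
  have other : scomp (~~ q) ((phi'^-1 \o G \o phi)%VF v) = 0.
    apply: inj; rewrite (even_map_scomp _ _ pe') E lfun0 scomp_other // negbK.
    by apply: (Ge); exact: pe.
  rewrite -[X in X \in _]scomp_sum.
  by case: q vq other => _ /= ->; rewrite ?addr0 ?add0r; exact: scomp_part.
exact: scomp_part.
Qed.
End JordanRestriction.

Section BlockDecomposition.
Variables (F : closedFieldType) (g : lieSuper F) (p : 'Hom(sl22 F, g)).
Variables (gh : lieSuper F) (pi : 'Hom(gh, g)).
Hypothesis psl_g : is_psl22 p.
Hypothesis uce : universal_central_extension pi.
Hypothesis char0 : forall n, n.+1%:R != 0 :> F.
Variable chi : {scalar subvs_of (center gh)}.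
Hypothesis chi_atyp : semisimple_atypical p pi chi.
Variables l1 r1 l2 r2 : F.
Hypothesis det1 : l1 * r2 - r1 * l2 = 1.
Hypothesis chi_one : chiv chi (z_one p pi) = 2 * (l1 * r2 + r1 * l2).
Hypothesis chi_pos : chiv chi (z_pos p pi) = 2 * (l1 * r1).
Hypothesis chi_neg : chiv chi (z_neg p pi) = 2 * (l2 * r2).
Local Notation J := (jordan_mod1_chi p pi chi).
Local Notation LM := (lie_mod1_chi p pi chi).
Local Notation JG := (Jg psl_g uce char0 det1 chi_one chi_pos chi_neg).
Local Notation T := (Tfun psl_g uce char0 det1 chi_one chi_pos chi_neg).

Lemma Jor_isomorphic (X Y : J) N : is_Jor p pi N (Aob X) -> is_Jor p pi N (Aob Y) -> isomorphic X Y.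
Proof.
move=> [phi JX] [phi' JY].
have [f [fM fE]] := Jor_restrict JX JY (act_morphism_id N).
have [f' [fM' fE']] := Jor_restrict JY JX (act_morphism_id N).
exists (Amk fM), (Amk fM'); split; apply: Aval_inj; apply/lfunP=> m;
  rewrite Aval_cmp comp_lfunE Aval_id id_lfunE.
  by apply: (Jor_inj JX); apply: (etrans (fE' (f m))); rewrite id_lfunE fE id_lfunE.
by apply: (Jor_inj JY); apply: (etrans (fE (f' m))); rewrite id_lfunE fE' id_lfunE.
Qed.

Lemma jordan_splits : splits_into J (Qnil_cat F).
Proof.
exists (fun i => T (i == 1)); split=> [i|i j X Y ij f|X].
- split; [exact: Tfun_faithful | exact: Tfun_full].
- have O r s A B := @Tfun_orthogonal F g p gh pi psl_g uce char0 chi l1 r1 l2 r2 det1 chi_one chi_pos chi_neg r s A B.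
  apply: (O _ _ X Y f); move: ij.
  by have [->|->] := ord2E i; have [->|->] := ord2E j; rewrite ?eqxx.
have [_ [N [NX NJ]]] := proj2_sig X.
have [G [rel nil GJ]] := Jor_exists psl_g uce char0 det1 chi_one chi_pos chi_neg NX.
have [Y Ysum] := Jg_splits psl_g uce char0 det1 chi_one chi_pos chi_neg rel nil.
have {}Ysum : direct_sum (fun i => T (i == 1) (Y i)) (JG rel nil) := Ysum.
exists Y; apply: direct_sum_isor Ysum.
exact: (@Jor_isomorphic (JG rel nil) X N).
Qed.

(** A chosen module with Jor(N) isomorphic to X. Together with [extend_morphism] and uniqueness of
    extensions it yields a quasi-inverse of Jor. *)
Definition KN (X : J) : act_space gh := projT1 (cid (proj2_sig X).2).
Lemma KNP X : module1_chi p pi chi (KN X) /\ is_Jor p pi (KN X) (Aob X).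
Proof. exact: (projT2 (cid (proj2_sig X).2)). Qed.

Definition Kphi (X : J) : 'Hom(Aob X, KN X) := projT1 (cid (KNP X).2).
Lemma KphiP X : Jor_map p pi (Kphi X).
Proof. exact: (projT2 (cid (KNP X).2)). Qed.

Definition Kob (X : J) : LM := exist _ (KN X) (KNP X).1.

Lemma Kext (X Y : J) (f : hom J X Y) : exists G : 'Hom(KN X, KN Y),
  act_morphism G /\ forall m, G (Kphi X m) = Kphi Y (Aval f m).
Proof.
have [G GM GE] := extend_morphism psl_g uce char0 chi_atyp (KNP X).1 (KNP Y).1 (KphiP X) (KphiP Y) (AvalP f).
by exists G.
Qed.

Definition Kmap (X Y : J) (f : hom J X Y) : hom LM (Kob X) (Kob Y) :=
  @Amk F gh _ (Kob X) (Kob Y) _ (projT2 (cid (Kext f))).1.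

Lemma KmapE X Y (f : hom J X Y) m : Aval (Kmap f) (Kphi X m) = Kphi Y (Aval f m).
Proof. exact: (projT2 (cid (Kext f))).2. Qed.

Lemma morphism_ext (N N' : act_space gh) (M : act_space (M11 F)) (phi : 'Hom(M, N)) (G G' : 'Hom(N, N')) :
  module1_chi p pi chi N -> Jor_map p pi phi -> act_morphism G -> act_morphism G' ->
  (forall m, G (phi m) = G' (phi m)) -> G = G'.
Proof.
move=> NX Jphi [_ Ga] [_ Ga'] E; apply/eqP; rewrite -subr_eq0; apply/eqP.
apply: (morphism_zero psl_g uce char0 chi_atyp NX Jphi) => [x n|m].
  by rewrite !add_lfunE !opp_lfunE Ga Ga' lfunD lfunN.
by rewrite add_lfunE opp_lfunE E subrr.
Qed.

Lemma Kuniq (X : J) (Y : LM) (G G' : hom LM (Kob X) Y) :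
  (forall m, Aval G (Kphi X m) = Aval G' (Kphi X m)) -> G = G'.
Proof.
by move=> E; apply: Aval_inj; apply: (morphism_ext (KNP X).1 (KphiP X) (AvalP G) (AvalP G') E).
Qed.

Lemma Kmap_linear X Y : linear (@Kmap X Y).
Proof.
move=> a f f'; apply: Kuniq => m.
rewrite KmapE !Aval_linear !add_lfunE !scale_lfunE !KmapE.
by rewrite lfunD lfunZ.
Qed.

Lemma Kmap_id X : Kmap (idm X) = idm (Kob X).
Proof. by apply: Kuniq => m; rewrite KmapE !Aval_id !id_lfunE. Qed.

Lemma Kmap_cmp X Y Z (h : hom J Y Z) (f : hom J X Y) : Kmap (cmp h f) = cmp (Kmap h) (Kmap f).
Proof. by apply: Kuniq => m; rewrite KmapE !Aval_cmp !comp_lfunE (KmapE f) KmapE. Qed.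

Definition Kfun : functor J LM := functor_of Kmap_linear Kmap_id Kmap_cmp.

Lemma Kfun_faithful : functor_faithful Kfun.
Proof.
move=> X Y f f0; apply: Aval_inj; rewrite Aval0; apply/lfunP=> m; rewrite zero_lfunE.
apply: (Jor_inj (KphiP Y)); rewrite -KmapE lfun0.
have -> : Kmap f = 0 by exact: f0.
by rewrite Aval0 zero_lfunE.
Qed.

Lemma Kfun_full : functor_full Kfun.
Proof.
move=> X Y G; have [gm [gmM gmE]] := Jor_restrict (KphiP X) (KphiP Y) (AvalP G).
exists (Amk gmM); apply: (@Kuniq X (Kob Y) (Kmap (Amk gmM)) G) => m.
by rewrite KmapE Aval_mk gmE.
Qed.

Lemma Kob_isomorphic (X : J) (Y : LM) : is_Jor p pi (Aob Y) (Aob X) -> isomorphic (Kob X) Y.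
Proof.
move=> [phi GJ]; have NX : module1_chi p pi chi (Aob Y) := proj2_sig Y.
have idM := act_morphism_id (Aob X).
have [f fM fE] := extend_morphism psl_g uce char0 chi_atyp (KNP X).1 NX (KphiP X) GJ idM.
have [f' fM' fE'] := extend_morphism psl_g uce char0 chi_atyp NX (KNP X).1 GJ (KphiP X) idM.
exists (@Amk F gh _ (Kob X) Y f fM), (@Amk F gh _ Y (Kob X) f' fM').
split; apply: Aval_inj.
  apply: (morphism_ext (KNP X).1 (KphiP X) (act_morphism_comp fM' fM) (act_morphism_id _)) => m.
  by rewrite comp_lfunE fE fE' !id_lfunE.
apply: (morphism_ext NX GJ (act_morphism_comp fM fM') (act_morphism_id _)) => m.
by rewrite comp_lfunE fE' fE !id_lfunE.
Qed.

(** That N[1] is a unital Jordan bimodule is obtained from its description by a quiver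
    representation, for which the Jordan identity has been verified. *)
Lemma Kfun_dense : functor_dense Kfun.
Proof.
move=> Y; have NX : module1_chi p pi chi (Aob Y) := proj2_sig Y.
have [G [rel nil GJ]] := Jor_exists psl_g uce char0 det1 chi_one chi_pos chi_neg NX.
exists (JG rel nil); exact: (@Kob_isomorphic (JG rel nil) Y GJ).
Qed.

Lemma blocks_of_factor : two_blocks_equivalent_to LM (Qnil_cat F) /\
  two_blocks_equivalent_to J (Qnil_cat F).
Proof.
split; apply: (splits_two_blocks (@Qnil_indecomposable F)); last exact: jordan_splits.
apply: splits_equivalent jordan_splits.
exact: (ff_dense_equivalent Kfun_faithful Kfun_full Kfun_dense).
Qed.
End BlockDecomposition.

Lemma atypical_blocks (F : closedFieldType) (g : lieSuper F) (p : 'Hom(sl22 F, g))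
    (gh : lieSuper F) (pi : 'Hom(gh, g)) (chi : {scalar subvs_of (center gh)}) :
  is_psl22 p -> universal_central_extension pi -> (forall n, n.+1%:R != 0 :> F) ->
  semisimple_atypical p pi chi ->
  two_blocks_equivalent_to (lie_mod1_chi p pi chi) (Qnil_cat F) /\
  two_blocks_equivalent_to (jordan_mod1_chi p pi chi) (Qnil_cat F).
Proof.
move=> psl_g uce char0 chi_atyp.
have [l1 [r1 [l2 [r2 [d1 e1 e2 e3]]]]] := atypical_factor (char0 1) chi_atyp.
exact: (blocks_of_factor psl_g uce char0 chi_atyp d1 e1 e2 e3).
Qed.

Theorem theorem6p15 (R : realType)
    (g : lieSuper R[i]) (p : 'Hom(sl22 R[i], g)) (psl_g : is_psl22 p)
    (gh : lieSuper R[i]) (pi : 'Hom(gh, g))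
    (uce_gh : universal_central_extension pi)
    (chi : {scalar subvs_of (center gh)})
    (chi_atyp : semisimple_atypical p pi chi) :
  two_blocks_equivalent_to (lie_mod1_chi p pi chi) (Qnil_cat R[i]) /\
  two_blocks_equivalent_to (jordan_mod1_chi p pi chi) (Qnil_cat R[i]).
Proof.
have char0 n : n.+1%:R != 0 :> R[i] by rewrite Num.Theory.pnatr_eq0.
exact: (atypical_blocks psl_g uce_gh char0 chi_atyp).
Qed.
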